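(* Let $\tau\in[0,\frac{\pi}{2}]$, $C_0\in\mathbb R$, let $\Omega\subset\mathbb R^2$ be a bounded domain, and let $u\in C^2(\mathbb R^2\setminus\overline\Omega)$ be a classical solution of $$F_\tau(\lambda(D^2u))=C_0\quad\text{in }\mathbb R^2\setminus\overline\Omega$$ satisfying the following condition in $\mathbb R^2\setminus\overline\Omega$: $D^2u>0$ if $\tau=0$; $D^2u>(-a+b)I$ if $\tau\in(0,\frac{\pi}{4})$; $D^2u>-I$ if $\tau=\frac{\pi}{4}$; $D^2u>-(a+b)I$ if $\tau\in(\frac{\pi}{4},\frac{\pi}{2})$; $C_0\neq 0$ if $\tau=\frac{\pi}{2}$. Then there exist $\gamma,d,d_1,d_2\in\mathbb R$, $\beta\in\mathbb R^2$ and a real symmetric $2\times2$ matrix $A$ with $F_\tau(\lambda(A))=C_0$ such that, for all $k\in\mathbb N$, $$u(x)-\Big(\tfrac12x^TAx+\beta\cdot x+\gamma\Big)-d\ln(x^TQx)=(x^TQx)^{-\frac12}\big(d_1\cos\theta+d_2\sin\theta\big)+O_k\big(|x|^{-2}\ln|x|\big)$$ as $|x|\to\infty$, where $$Q=\sin\tau\,A^2+2\cos\tau\,A+\sin\tau\,I$$ (which is the inverse of the matrix $\big[\partial F/\partial M_{ij}(A)\big]$ for $F(M):=F_\tau(\lambda(M))$), and $\theta=\theta(x)$ is the angle of the unit vector $\frac{Q^{1/2}x}{(x^TQx)^{1/2}}$, that is, $(\cos\theta,\sin\theta)=\frac{Q^{1/2}x}{(x^TQx)^{1/2}}$.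
   Context: For a real symmetric $2\times 2$ matrix $M$, $\lambda(M)=(\lambda_1,\lambda_2)$ denotes the vector of its eigenvalues, and $I$ is the $2\times2$ identity matrix. Matrix inequalities are in the sense of symmetric matrices ($M>N$ means $M-N$ is positive definite). For $\tau\in(0,\frac{\pi}{2}]$ let $a=\cot\tau$ and $b=\sqrt{|\cot^2\tau-1|}$. The function $F_\tau$ is defined by - $\tau=0$: $F_\tau(\lambda)=\frac12\sum_{i=1}^2\ln\lambda_i$; - $0<\tau<\frac{\pi}{4}$: $F_\tau(\lambda)=\frac{\sqrt{a^2+1}}{2b}\sum_{i=1}^2\ln\frac{\lambda_i+a-b}{\lambda_i+a+b}$; - $\tau=\frac{\pi}{4}$: $F_\tau(\lambda)=-\sqrt2\sum_{i=1}^2\frac{1}{1+\lambda_i}$; - $\frac{\pi}{4}<\tau<\frac{\pi}{2}$: $F_\tau(\lambda)=\frac{\sqrt{a^2+1}}{b}\sum_{i=1}^2\arctan\frac{\lambda_i+a-b}{\lambda_i+a+b}$; - $\tau=\frac{\pi}{2}$: $F_\tau(\lambda)=\sum_{i=1}^2\arctan\lambda_i$. The domain of $F_\tau$ consists of those $\lambda$ for which the formula makes sense: $\lambda_i>0$ if $\tau=0$; $\frac{\lambda_i+a-b}{\lambda_i+a+b}>0$ if $\tau\in(0,\frac{\pi}{4})$; $\lambda_i\ne-1$ if $\tau=\frac{\pi}{4}$; $\lambda_i+a+b\neq0$ if $\tau\in(\frac{\pi}{4},\frac{\pi}{2})$; all $\lambda$ if $\tau=\frac{\pi}{2}$. For a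 function $f$ defined near infinity, $k\in\mathbb N$ and real $p,q$, $f=O_k(|x|^{p}(\ln|x|)^{q})$ as $|x|\to\infty$ means $|D^jf(x)|=O(|x|^{p-j}(\ln|x|)^{q})$ as $|x|\to\infty$ for every $0\le j\le k$. *)

(* Defs.v *)
From HB Require Import structures.
From mathcomp Require Import all_boot all_order all_algebra.
From mathcomp Require Import all_classical all_reals all_analysis.
Set Implicit Arguments.
Unset Strict Implicit.
Unset Printing Implicit Defensive.
Import Order.TTheory GRing.Theory Num.Theory.
Import numFieldNormedType.Exports.
Local Open Scope classical_set_scope.
Local Open Scope ring_scope.

Definition dot (R : realType) (x y : 'cV[R]_2) : R := (x^T *m y) 0 0.

(* The norm that MathComp-Analysis puts on matrices is the sup norm. *)
Definition enorm (R : realType) (x : 'cV[R]_2) : R := Num.sqrt (dot x x).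

Definition qform (R : realType) (M : 'M[R]_2) (x : 'cV[R]_2) : R :=
  dot x (M *m x).

Definition bounded_domain (R : realType) (Omega : set 'cV[R]_2) : Prop :=
  [/\ open Omega, connected Omega, Omega !=set0 & bounded_set Omega].

Definition posdef (R : realType) (M : 'M[R]_2) : Prop :=
  M^T = M /\ forall x : 'cV[R]_2, x != 0 -> 0 < qform M x.

Definition mxgt (R : realType) (M N : 'M[R]_2) : Prop := posdef (M - N).

(* The eigenvalues are counted with multiplicity and their order is left
   unspecified; all functions and conditions applied to this vector below are
   symmetric.  A real matrix with no real eigenvalues is sent to 0; this never
   concerns a symmetric matrix. *)
Definition eigenvalues (R : realType) (M : 'M[R]_2) : 'rV[R]_2 :=
  xget 0 [set l : 'rV[R]_2 | char_poly M = \prod_(i < 2) ('X - (l 0 i)%:P)].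

Definition sqrtmx (R : realType) (Q : 'M[R]_2) : 'M[R]_2 :=
  xget 0 [set S : 'M[R]_2 | posdef S /\ S *m S = Q].

Definition acoef (R : realType) (tau : R) : R := cos tau / sin tau.

Definition bcoef (R : realType) (tau : R) : R :=
  Num.sqrt `|acoef tau ^+ 2 - 1|.

Definition Ftau (R : realType) (tau : R) (l : 'rV[R]_2) : R :=
  let a := acoef tau in
  let b := bcoef tau in
  if tau == 0 then 2^-1 * \sum_(i < 2) ln (l 0 i)
  else if tau < pi / 4 then
    Num.sqrt (a ^+ 2 + 1) / (2 * b) *
      \sum_(i < 2) ln ((l 0 i + a - b) / (l 0 i + a + b))
  else if tau == pi / 4 then
    - Num.sqrt 2 * \sum_(i < 2) (1 + l 0 i)^-1
  else if tau < pi / 2 then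
    Num.sqrt (a ^+ 2 + 1) / b *
      \sum_(i < 2) atan ((l 0 i + a - b) / (l 0 i + a + b))
  else \sum_(i < 2) atan (l 0 i).

(* Since x / 0 = 0 in MathComp, positivity of the quotient in the second case
   already excludes a zero denominator. *)
Definition Ftau_dom (R : realType) (tau : R) (l : 'rV[R]_2) : Prop :=
  let a := acoef tau in
  let b := bcoef tau in
  forall i : 'I_2,
    if tau == 0 then 0 < l 0 i
    else if tau < pi / 4 then 0 < (l 0 i + a - b) / (l 0 i + a + b)
    else if tau == pi / 4 then l 0 i != -1
    else if tau < pi / 2 then l 0 i + a + b != 0
    else true.

(* [ln] and division being total, an equation F_tau(lambda(M)) = C is only
   meaningful together with the membership of lambda(M) in the domain. *)
Definition Ftau_eq (R : realType) (tau : R) (M : 'M[R]_2) (C : R) : Prop :=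
  Ftau_dom tau (eigenvalues M) /\ Ftau tau (eigenvalues M) = C.

Definition partial (R : realType) (i : 'I_2) (f : 'cV[R]_2 -> R) :
    'cV[R]_2 -> R :=
  fun x => 'D_(delta_mx i 0) f x.

Fixpoint Ck (R : realType) (k : nat) (U : set 'cV[R]_2) (f : 'cV[R]_2 -> R) :
    Prop :=
  (forall x, U x -> {for x, continuous f}) /\
  match k with
  | 0 => True
  | k'.+1 => forall i : 'I_2,
      (forall x, U x -> derivable f x (delta_mx i 0)) /\ Ck k' U (partial i f)
  end.

Definition hessian (R : realType) (f : 'cV[R]_2 -> R) (x : 'cV[R]_2) :
    'M[R]_2 :=
  \matrix_(i, j) partial i (partial j f) x.

Definition Dnorm (R : realType) (j : nat) (f : 'cV[R]_2 -> R) (x : 'cV[R]_2) :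
    R :=
  Num.sqrt (\sum_(s : j.-tuple 'I_2) (foldr (@partial R) f s x) ^+ 2).

(* f = O_k(|x|^p (ln |x|)^q) as |x| -> oo. *)
Definition bigO_k (R : realType) (k : nat) (p q : R) (f : 'cV[R]_2 -> R) :
    Prop :=
  exists r C : R,
    Ck k [set x | r < enorm x] f /\
    forall (j : nat) (x : 'cV[R]_2), (j <= k)%N -> r < enorm x ->
      Dnorm j f x <= C * (enorm x `^ (p - j%:R) * ln (enorm x) `^ q).

(* G is the matrix [dF/dM_ij (A)] of F(M) := F_tau(lambda(M)), a function on
   symmetric matrices: the symmetric G with DF(A)[N] = \sum_ij G_ij N_ij. *)
Definition is_Ftau_gradient (R : realType) (tau : R) (A G : 'M[R]_2) : Prop :=
  G^T = G /\
  forall N : 'M[R]_2, N^T = N ->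
    is_derive A N (fun M : 'M[R]_2 => Ftau tau (eigenvalues M))
      (\sum_(i < 2) \sum_(j < 2) G i j * N i j).

Definition Qmx (R : realType) (tau : R) (A : 'M[R]_2) : 'M[R]_2 :=
  sin tau *: (A *m A) + (2 * cos tau) *: A + (sin tau)%:M.

(* theta(x) is an angle of the unit vector Q^(1/2) x / (x^T Q x)^(1/2). *)
Definition is_angle (R : realType) (Q : 'M[R]_2) (theta : 'cV[R]_2 -> R) :
    Prop :=
  forall x : 'cV[R]_2, x != 0 ->
    let e := (Num.sqrt (qform Q x))^-1 *: (sqrtmx Q *m x) in
    cos (theta x) = e 0 0 /\ sin (theta x) = e 1 0.

(* Main.v *)
Require Import Defs.
From HB Require Import structures.
From mathcomp Require Import all_boot all_order all_algebra.
From mathcomp Require Import all_classical all_reals all_analysis.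
From mathcomp Require Import ring lra.
From mathcomp Require Import complex.
Import Order.TTheory GRing.Theory Num.Theory.
Import numFieldNormedType.Exports.
Local Open Scope classical_set_scope.
Local Open Scope ring_scope.
Set Implicit Arguments.
Unset Strict Implicit.
Unset Printing Implicit Defensive.

(** In dimension two, clearing the logarithms or arctangents turns F_tau(lambda) = C0 into an
    algebraic relation between the trace and the determinant of D^2 u. Either (lambda_1 +
    c)(lambda_2 + c) = s^2 with both factors of a fixed sign sg, or, in one exceptional case with
    pi/4 < tau < pi/2, lambda_1 + lambda_2 = -2a. In the first case v = (sg/s)(u + c|x|^2/2) is
    convex with det D^2 v = 1 near infinity ([monge_ampere_case]); in the second u + a|x|^2/2 is
    harmonic ([harmonic_case]).

    Harmonic functions ([harmonic_expansion]). If D^2 h is bounded near infinity, then h_x - i h_y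
    is holomorphic with bounded derivative and so grows at most linearly. Cauchy's formula after the
    inversion z -> 1/z gives its Laurent expansion k z + l + 2d/z - w/z^2 + O(|z|^-3), with control
    of all derivatives. The number d is real because h is single-valued. Integration gives the
    quadratic, linear, logarithmic and dipole terms of h up to O(|x|^-2). Moreover k is a mean of
    the second derivatives over a circle, so strict bounds on D^2 h pass to the limit.

    The equation det D^2 v = 1 ([monge_ampere_expansion]). The Lewy map T(x) = x + Dv(x) is
    expanding because D^2 v > 0, and it is one-to-one near infinity with image covering a
    neighbourhood of infinity ([lewy_geometry], [lewy_onto]). Its inverse is the gradient of the
    Legendre transform psi of v + |x|^2/2, and D^2 psi = (I + D^2 v)^-1 has trace (2 + tr)/(1 + tr +
    det) = 1, where tr and det are those of D^2 v. So psi - |z|^2/4 is harmonic with bounded second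
    derivatives, and its expansion is known. Undoing the Legendre transform ([legendre_expansion])
    expands v in the variable y = P x, where P is the limit of I + D^2 v; errors in the gradient
    enter only through their squares.

    Back to u: by Cayley-Hamilton Q is a combination of A and I, and for the limit A it equals kappa
    P^2 with kappa > 0. Hence ln|Px|^2 and the dipole in P x are ln(x^T Q x), up to a constant, and
    the cos theta, sin theta terms ([angle_expansion]). Remainders are carried in the classes [Sym]
    of symbols at infinity. The gradient of F is computed from trace and determinant ([trdet_rep]),
    which stay smooth where the eigenvalues meet. *)

Section Plane.
Context {R : realType}.
Implicit Types (x y z : 'cV[R]_2) (f g : 'cV[R]_2 -> R).

(** * Euclidean norm on the plane and Fréchet differentiability *)

Lemma I2P (P : 'I_2 -> Prop) : P 0 -> P 1 -> forall i, P i.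
Proof. by move=> P0 P1 [[|[|//]]] Hi; [move: P0|move: P1]; congr P; apply: val_inj. Qed.

Definition vec (a b : R) : 'cV[R]_2 := \col_i (if i == 0 then a else b).

Lemma vec0 a b : vec a b 0 0 = a. Proof. by rewrite mxE. Qed.

Lemma vec1 a b : vec a b 1 0 = b. Proof. by rewrite mxE. Qed.

Lemma cv2P x y : x 0 0 = y 0 0 -> x 1 0 = y 1 0 -> x = y.
Proof. by move=> h0 h1; apply/matrixP => i j; rewrite ord1; elim/I2P: i. Qed.

Lemma dotE x y : dot x y = x 0 0 * y 0 0 + x 1 0 * y 1 0.
Proof.
rewrite /dot mxE big_ord_recl big_ord1 !mxE.
have -> : lift ord0 ord0 = 1 :> 'I_2 by apply: val_inj; reflexivity.
reflexivity.
Qed.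

Lemma enorm_sqr x : enorm x ^+ 2 = x 0 0 ^+ 2 + x 1 0 ^+ 2.
Proof. by rewrite /enorm dotE -!expr2 sqr_sqrtr// addr_ge0// sqr_ge0. Qed.

Lemma enorm_ge0 x : 0 <= enorm x. Proof. exact: sqrtr_ge0. Qed.
Hint Resolve enorm_ge0 : core.

Lemma enorm_le x (c : R) : 0 <= c -> x 0 0 ^+ 2 + x 1 0 ^+ 2 <= c ^+ 2 -> enorm x <= c.
Proof. by move=> c0; rewrite -enorm_sqr ler_pXn2r// ?nnegrE. Qed.

Lemma le_enorm x (c : R) : 0 <= c -> c ^+ 2 <= x 0 0 ^+ 2 + x 1 0 ^+ 2 -> c <= enorm x.
Proof. by move=> c0; rewrite -enorm_sqr ler_pXn2r// ?nnegrE. Qed.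

Lemma enorm0_eq x : enorm x = 0 -> x = 0.
Proof.
move=> h; have := enorm_sqr x; rewrite h => h'.
by apply: cv2P; rewrite !mxE; nra.
Qed.

Lemma enorm0 : enorm (0 : 'cV[R]_2) = 0.
Proof. by rewrite /enorm dotE !mxE !mul0r addr0 sqrtr0. Qed.

Lemma enorm_gt0 x : (0 < enorm x) = (x != 0).
Proof.
rewrite lt0r enorm_ge0 andbT; congr negb; apply/eqP/eqP => [/enorm0_eq//|->].
exact: enorm0.
Qed.

Lemma coord_le x i : `|x i 0| <= enorm x.
Proof.
by elim/I2P: i; apply: le_enorm => //; rewrite real_normK ?num_real// ?lerDl ?lerDr sqr_ge0.
Qed.

Lemma enorm_le_sum x : enorm x <= `|x 0 0| + `|x 1 0|.
Proof.
apply: enorm_le; first by rewrite addr_ge0.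
rewrite -[x 0 0 ^+ 2]real_normK ?num_real// -[x 1 0 ^+ 2]real_normK ?num_real//.
by have := normr_ge0 (x 0 0); have := normr_ge0 (x 1 0); nra.
Qed.

Lemma dot_le x y : `|dot x y| <= enorm x * enorm y.
Proof.
rewrite -(ler_pXn2r (n := 2)) ?nnegrE ?mulr_ge0// exprMn !enorm_sqr dotE real_normK ?num_real//.
set a := x 0 0; set b := x 1 0; set c := y 0 0; set d := y 1 0.
by have := sqr_ge0 (a * d - b * c); nra.
Qed.

Lemma enormZ (a : R) x : enorm (a *: x) = `|a| * enorm x.
Proof.
rewrite /enorm !dotE !mxE.
have -> : a * x 0 0 * (a * x 0 0) + a * x 1 0 * (a * x 1 0) = a ^+ 2 * (x 0 0 * x 0 0 + x 1 0 * x 1 0) by ring.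
by rewrite sqrtrM ?sqr_ge0// sqrtr_sqr.
Qed.

Lemma enormD x y : enorm (x + y) <= enorm x + enorm y.
Proof.
apply: enorm_le; first by rewrite addr_ge0.
have := dot_le x y; rewrite dotE => /(le_trans (ler_norm _)).
have := enorm_sqr x; have := enorm_sqr y; rewrite !mxE; nra.
Qed.

Lemma enormN x : enorm (- x) = enorm x.
Proof. by rewrite -scaleN1r enormZ normrN1 mul1r. Qed.

Lemma enormBC x y : enorm (x - y) = enorm (y - x).
Proof. by rewrite -enormN opprB. Qed.

Lemma enorm_sub x y : enorm x <= enorm (x - y) + enorm y.
Proof. by rewrite -{1}(subrK y x) enormD. Qed.

(** The topology of the matrix space comes from the sup norm. Since |x_i| <= |x| <= |x_0| + |x_1|,
    Euclidean balls generate the same neighbourhoods, and all later epsilon arguments can be run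
    with [enorm]. *)
Lemma nbhs_enorm x (P : set 'cV[R]_2) :
  nbhs x P <-> exists2 d, 0 < d & forall y, enorm (y - x) < d -> P y.
Proof.
rewrite nbhs_ballP; split=> [[d /= d0 Pd]|[d d0 Pd]].
  exists d => // y yx; apply: Pd; split=> // i j; rewrite ord1 /ball /=.
  by apply: le_lt_trans yx; have := coord_le (y - x) i; rewrite !mxE distrC.
exists (d / 2) => /=; first by rewrite divr_gt0.
move=> y xy; apply: Pd; apply: le_lt_trans (enorm_le_sum _) _.
have [_ {}xy] := xy; have := xy 0 0; have := xy 1 0; rewrite /ball /= !mxE ![`|x _ _ - _|]distrC; lra.
Qed.

Lemma enorm_near x (d : R) : 0 < d -> \forall y \near x, enorm (y - x) < d.
Proof. by move=> d0; apply/nbhs_enorm; exists d. Qed.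

Lemma exterior_near (r : R) x : r < enorm x -> \forall y \near x, r < enorm y.
Proof.
move=> rx; have d0 : 0 < enorm x - r by lra.
apply: filterS (enorm_near x d0).
by move=> y; have := enorm_sub x y; rewrite enormBC; lra.
Qed.

Lemma continuous_for_enorm f x :
  {for x, continuous f} <-> forall e, 0 < e -> \forall y \near x, `|f y - f x| < e.
Proof.
split=> [/cvgrPdist_lt h e e0|h].
  by near=> y; rewrite distrC; near: y; exact: h.
apply: (proj2 (@cvgrPdist_lt _ _ _ (nbhs x) _ f (f x))) => e e0.
by near=> y; rewrite distrC; near: y; exact: h.
Unshelve. all: by end_near. Qed.

(* [fd f x a b]: f is Fréchet differentiable at x with gradient (a, b). *)
Definition fd f x (a b : R) := forall e, 0 < e ->
  \forall y \near x, `|f y - f x - (a * (y 0 0 - x 0 0) + b * (y 1 0 - x 1 0))| <= e * enorm (y - x).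

Lemma fd_continuous f x a b : fd f x a b -> {for x, continuous f}.
Proof.
move=> fx; apply/continuous_for_enorm => e e0.
have k0 : 0 < 1 + `|a| + `|b| by have := normr_ge0 a; have := normr_ge0 b; lra.
have d0 : 0 < e / (1 + `|a| + `|b|) by rewrite divr_gt0.
near=> y.
have h1 : `|f y - f x - (a * (y 0 0 - x 0 0) + b * (y 1 0 - x 1 0))| <= 1 * enorm (y - x).
  by near: y; exact: fx.
have h2 : enorm (y - x) < e / (1 + `|a| + `|b|) by near: y; exact: enorm_near.
have h3 := coord_le (y - x) 0; have h4 := coord_le (y - x) 1.
rewrite !mxE in h3 h4.
have {}h3 : `|a * (y 0 0 - x 0 0)| <= `|a| * enorm (y - x) by rewrite normrM ler_wpM2l.
have {}h4 : `|b * (y 1 0 - x 1 0)| <= `|b| * enorm (y - x) by rewrite normrM ler_wpM2l.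
rewrite ltr_pdivlMr// in h2.
have h5 := ler_normD (f y - f x - (a * (y 0 0 - x 0 0) + b * (y 1 0 - x 1 0))) (a * (y 0 0 - x 0 0) + b * (y 1 0 - x 1 0)).
rewrite subrK in h5.
have h6 := ler_normD (a * (y 0 0 - x 0 0)) (b * (y 1 0 - x 1 0)).
by lra.
Unshelve. all: by end_near. Qed.

End Plane.
#[global] Hint Extern 0 (is_true (0 <= enorm _)) => solve [apply: enorm_ge0] : core.

(** * Directional derivatives, mean value theorems and chain rules *)

Section Calculus.
Context {R : realType}.
Implicit Types (x y z : 'cV[R]_2) (f g : 'cV[R]_2 -> R).

(** Multiplying the difference quotient by h removes both the division and the punctured
    neighbourhood, so derivatives can be combined by plain inequalities. *)
Lemma is_deriveP (V : normedModType R) (f : V -> R) (x v : V) (l : R) :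
  is_derive x v f l <-> forall e, 0 < e ->
    \forall h \near (0 : R), `|f (x + h *: v) - f x - h * l| <= e * `|h|.
Proof.
split=> [[dv <-] e e0|h].
  have /cvgrPdist_le/(_ e e0) : h^-1 *: ((f \o shift x) (h *: v) - f x) @[h --> 0^'] --> 'D_v f x by [].
  rewrite near_withinE => h; near=> k.
  have [->|k0] := eqVneq k 0; first by rewrite scale0r addr0 subrr mul0r subr0 normr0 mulr0.
  have : `|'D_v f x - k^-1 *: ((f \o shift x) (k *: v) - f x)| <= e.
    by move: k0; near: k; exact: h.
  rewrite distrC /= (addrC _ x) => hk.
  have -> : f (x + k *: v) - f x - k * 'D_v f x = k * (k^-1 *: (f (x + k *: v) - f x) - 'D_v f x).
    by rewrite -[k^-1 *: _]/(k^-1 * _); field.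
  by rewrite normrM mulrC ler_wpM2r.
have cv : h^-1 *: ((f \o shift x) (h *: v) - f x) @[h --> 0^'] --> l.
  apply/cvgrPdist_le => e e0; rewrite near_withinE; near=> k => k0.
  have hk : `|f (x + k *: v) - f x - k * l| <= e * `|k| by near: k; exact: h.
  have -> : l - k^-1 *: ((f \o shift x) (k *: v) - f x) = - (k^-1 * (f (x + k *: v) - f x - k * l)).
    by rewrite /= (addrC _ x) -[k^-1 *: _]/(k^-1 * _); field.
  by rewrite normrN normrM normfV ler_pdivrMl ?normr_gt0// (mulrC _ e).
split; first by apply/cvg_ex; exists l.
by apply/cvg_lim.
Unshelve. all: by end_near. Qed.

Lemma near0_lt (d : R) : 0 < d -> \forall k \near (0 : R), `|k| < d.
Proof.
move=> d0; apply/nbhs_ballP; exists d => // k.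
by rewrite /ball /= sub0r normrN.
Qed.

Lemma is_derive_line f x v l (t : R) : is_derive (x + t *: v) v f l ->
  is_derive t (1 : R) (fun s : R => f (x + s *: v)) l.
Proof.
move=> /is_deriveP h; apply/is_deriveP => e e0; near=> k.
have -> : x + (t + k *: 1) *: v = x + t *: v + k *: v.
  by rewrite scalerDl addrA -[k *: 1]/(k * 1) mulr1.
by near: k; exact: h.
Unshelve. all: by end_near. Qed.

Lemma is_derive_dirZ f x v l (c : R) : is_derive x v f l -> is_derive x (c *: v) f (c * l).
Proof.
move=> /is_deriveP h; apply/is_deriveP => e e0.
have c0 := normr_ge0 c.
have e1 : 0 < e / (1 + `|c|) by rewrite divr_gt0//; lra.
have /nbhs_ballP[d /= d0 hd] := h _ e1.
have d1 : 0 < d / (1 + `|c|) by rewrite divr_gt0//; lra.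
near=> k; rewrite scalerA mulrA.
have kd : `|k| < d / (1 + `|c|) by near: k; exact: near0_lt.
have k0 := normr_ge0 k.
rewrite ltr_pdivlMr in kd; last by lra.
have := hd (k * c); rewrite /ball /= sub0r normrN normrM => /(_ _) hk.
apply: le_trans (hk _) _; first by lra.
rewrite mulrAC ler_pdivrMr; last by lra.
by nra.
Unshelve. all: by end_near. Qed.

(** Only a derivative along [v] is assumed of the inner function: along that line its increment is
    at most L|h|, so the error of [phi] is o(h) as well. *)
Lemma is_derive_outer (V : normedModType R) (phi : R -> R) (f : V -> R) (x v : V) (l m : R) :
  is_derive (f x) (1:R) phi m -> is_derive x v f l ->
  is_derive x v (fun y : V => phi (f y)) (m * l).
Proof.
move=> /is_deriveP dphi /is_deriveP df; apply/is_deriveP => e e0.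
set L := 1 + `|l|; set M := 1 + `|m|.
have Lp : 0 < L by rewrite /L; have := normr_ge0 l; lra.
have Mp : 0 < M by rewrite /M; have := normr_ge0 m; lra.
have e1 : 0 < e / 2 / L by rewrite !divr_gt0.
have e2 : 0 < e / 2 / M by rewrite !divr_gt0.
have /nbhs_ballP[d /= d0 hd] := dphi _ e1.
have dL : 0 < d / L by rewrite divr_gt0.
near=> h.
have h1 : `|f (x + h *: v) - f x - h * l| <= 1 * `|h| by near: h; exact: df.
have h2 : `|f (x + h *: v) - f x - h * l| <= e / 2 / M * `|h| by near: h; exact: df.
have hL : `|h| < d / L by near: h; exact: near0_lt.
set k := f (x + h *: v) - f x in h1 h2.
have kL : `|k| <= L * `|h|.
  have := ler_normD (k - h * l) (h * l); rewrite subrK normrM /L; lra.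
rewrite ltr_pdivlMr// mulrC in hL.
have := hd k; rewrite /ball /= sub0r normrN => /(_ (le_lt_trans kL hL)).
have kE : f x + k = f (x + h *: v) by rewrite /k; ring.
rewrite -[k *: 1]/(k * 1) mulr1 kE => h3.
have -> : phi (f (x + h *: v)) - phi (f x) - h * (m * l) =
  (phi (f (x + h *: v)) - phi (f x) - k * m) + m * (k - h * l) by ring.
apply: le_trans (ler_normD _ _) _; rewrite normrM.
have h4 : e / 2 / L * `|k| <= e / 2 * `|h|.
  apply: le_trans (ler_wpM2l (ltW e1) kL) _.
  by rewrite mulrA divfK ?gt_eqF.
have h5 : `|m| * `|k - h * l| <= M * `|k - h * l|.
  by apply: ler_wpM2r => //; rewrite /M; lra.
have h6 : M * `|k - h * l| <= e / 2 * `|h|.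
  apply: le_trans (ler_wpM2l (ltW Mp) h2) _.
  by rewrite mulrA (mulrC M) divfK ?gt_eqF.
lra.
Unshelve. all: by end_near. Qed.

Lemma is_derive_inv (V : normedModType R) (f : V -> R) (x v : V) (l : R) : f x != 0 ->
  is_derive x v f l -> is_derive x v (fun y : V => (f y)^-1) (- (l * ((f x)^-1 * (f x)^-1))).
Proof.
move=> fx df.
have di : is_derive (f x) (1:R) (fun y : R => y^-1) (- (f x) ^- 2 *: (1:R)) by exact: is_deriveV.
have := is_derive_outer di df; congr is_derive.
by rewrite -[_ *: _]/(_ * _) mulr1; field.
Qed.

Lemma is_derive_linear (c s : R) : is_derive s (1:R) (fun u : R => c * u) c.
Proof.
apply/is_deriveP => e e0; near=> h; rewrite -[h *: 1]/(h * 1).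
have -> : c * (s + h * 1) - c * s - h * c = 0 by ring.
by rewrite normr0; apply: mulr_ge0; [exact: ltW|exact: normr_ge0].
Unshelve. all: by end_near. Qed.

Lemma MVT_cc (phi dphi : R -> R) (a b : R) : a <= b ->
  (forall s : R, a <= s <= b -> is_derive s (1:R) phi (dphi s)) ->
  exists2 s : R, a <= s <= b & phi b - phi a = dphi s * (b - a).
Proof.
move=> ab h.
have [s hs es] : exists2 c, c \in `[a, b] & phi b - phi a = dphi c * (b - a).
  apply: MVT_segment => //.
    by move=> x /[!in_itv]/= /andP[x0 x1]; apply: h; rewrite !ltW.
  apply: derivable_within_continuous => x /[!in_itv]/= hx.
  by have [] := h _ hx.
by exists s; move: hs; rewrite ?in_itv.
Qed.

Lemma MVT01 (phi dphi : R -> R) :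
  (forall s : R, 0 <= s <= 1 -> is_derive s (1:R) phi (dphi s)) ->
  exists2 s : R, 0 <= s <= 1 & phi 1 - phi 0 = dphi s.
Proof. by move=> h; have [s hs ->] := MVT_cc ler01 h; exists s => //; rewrite subr0 mulr1. Qed.

Lemma MVT_line f x v (df : R -> R) :
  (forall s : R, 0 <= s <= 1 -> is_derive (x + s *: v) v f (df s)) ->
  exists2 s : R, 0 <= s <= 1 & f (x + v) - f x = df s.
Proof.
move=> h; have [s hs] := MVT01 (fun s hs => is_derive_line (h s hs)).
by rewrite scale1r scale0r addr0; exists s.
Qed.

Lemma fd_derive f x a b v : fd f x a b -> is_derive x v f (a * v 0 0 + b * v 1 0).
Proof.
move=> fx; apply/is_deriveP => e e0.
have v0 := enorm_ge0 v.
have e1 : 0 < e / (1 + enorm v) by rewrite divr_gt0//; lra.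
have [d d0 hd] := proj1 (nbhs_enorm _ _) (fx _ e1).
have d1 : 0 < d / (1 + enorm v) by rewrite divr_gt0//; lra.
near=> h.
have hh : `|h| < d / (1 + enorm v) by near: h; exact: near0_lt.
rewrite ltr_pdivlMr in hh; last by lra.
have e2 : x + h *: v - x = h *: v by rewrite addrAC subrr add0r.
have h0 := normr_ge0 h.
have := hd (x + h *: v); rewrite e2 enormZ => /(_ _).
have -> : (x + h *: v) 0 0 - x 0 0 = h * v 0 0 by rewrite !mxE; ring.
have -> : (x + h *: v) 1 0 - x 1 0 = h * v 1 0 by rewrite !mxE; ring.
have -> : a * (h * v 0 0) + b * (h * v 1 0) = h * (a * v 0 0 + b * v 1 0) by ring.
move=> hdd; apply: le_trans (hdd _) _; first by nra.
rewrite -mulrA ler_pM2l// mulrC -ler_pdivlMr ?invr_gt0; last by lra.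
by rewrite invrK ler_wpM2l//; lra.
Unshelve. all: by end_near. Qed.

Lemma fd_partial f x a b : fd f x a b -> partial 0 f x = a /\ partial 1 f x = b.
Proof.
move=> fx; rewrite /partial; split.
  by have [_ ->] := fd_derive (delta_mx 0 0) fx; rewrite !mxE /=; ring.
by have [_ ->] := fd_derive (delta_mx 1 0) fx; rewrite !mxE /=; ring.
Qed.

(** The path from [x] to [y] runs along the first axis, then along the second. None of its points is
    farther from [x] than [y], so it stays in the disc. *)
Lemma MVT_plane f x y (d : R) (p0 p1 : 'cV[R]_2 -> R) :
  (forall z, enorm (z - x) < d -> is_derive z (delta_mx 0 0 : 'cV[R]_2) f (p0 z)) ->
  (forall z, enorm (z - x) < d -> is_derive z (delta_mx 1 0 : 'cV[R]_2) f (p1 z)) ->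
  enorm (y - x) < d ->
  exists z0 z1, [/\ enorm (z0 - x) < d, enorm (z1 - x) < d &
    f y - f x = (y 0 0 - x 0 0) * p0 z0 + (y 1 0 - x 1 0) * p1 z1].
Proof.
move=> d0 d1 yd.
set h := y 0 0 - x 0 0; set k := y 1 0 - x 1 0.
have yx2 : enorm (y - x) ^+ 2 = h ^+ 2 + k ^+ 2 by rewrite enorm_sqr !mxE.
have near1 s : 0 <= s <= 1 -> enorm ((x + s *: (h *: delta_mx 0 0)) - x) < d.
  move=> /andP[s0 s1]; apply: le_lt_trans yd; apply: enorm_le => //.
  rewrite !mxE /= yx2.
  have : s ^+ 2 <= 1 by nra.
  have -> : x 0 0 + s * (h * 1) - x 0 0 = s * h by ring.
  have -> : x 1 0 + s * (h * 0) - x 1 0 = 0 by ring.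
  by have := sqr_ge0 h; have := sqr_ge0 k; nra.
have near2 s : 0 <= s <= 1 -> enorm ((x + h *: delta_mx 0 0 + s *: (k *: delta_mx 1 0)) - x) < d.
  move=> /andP[s0 s1]; apply: le_lt_trans yd; apply: enorm_le => //.
  rewrite !mxE /= yx2.
  have : s ^+ 2 <= 1 by nra.
  have -> : x 0 0 + h * 1 + s * (k * 0) - x 0 0 = h by ring.
  have -> : x 1 0 + h * 0 + s * (k * 1) - x 1 0 = s * k by ring.
  by have := sqr_ge0 h; have := sqr_ge0 k; nra.
have [s hs es] := MVT_line (fun s hs => is_derive_dirZ h (d0 _ (near1 s hs))).
have [t ht et] := MVT_line (fun s hs => is_derive_dirZ k (d1 _ (near2 s hs))).
have yE : y = x + h *: delta_mx 0 0 + k *: delta_mx 1 0.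
  by apply: cv2P; rewrite !mxE /=; rewrite /h /k; ring.
rewrite -yE in et.
eexists; eexists; split; [exact: near1 hs|exact: near2 ht|].
by rewrite -es -et; ring.
Qed.

Lemma C1_fd f x (p0 p1 : 'cV[R]_2 -> R) :
  (\forall y \near x, is_derive y (delta_mx 0 0 : 'cV[R]_2) f (p0 y)) ->
  (\forall y \near x, is_derive y (delta_mx 1 0 : 'cV[R]_2) f (p1 y)) ->
  {for x, continuous p0} -> {for x, continuous p1} -> fd f x (p0 x) (p1 x).
Proof.
move=> d0 d1 /continuous_for_enorm c0 /continuous_for_enorm c1 e e0.
have e2 : 0 < e / 2 by lra.
have /nbhs_enorm[d dp hd] : \forall y \near x,
  [/\ is_derive y (delta_mx 0 0 : 'cV[R]_2) f (p0 y),
  is_derive y (delta_mx 1 0 : 'cV[R]_2) f (p1 y), `|p0 y - p0 x| < e / 2 & `|p1 y - p1 x| < e / 2].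
  near=> y; split; near: y => //; [exact: c0|exact: c1].
apply/nbhs_enorm; exists d => // y yd.
have [z0 [z1 [z0d z1d ->]]] : exists z0 z1, [/\ enorm (z0 - x) < d, enorm (z1 - x) < d &
    f y - f x = (y 0 0 - x 0 0) * p0 z0 + (y 1 0 - x 1 0) * p1 z1].
  by apply: MVT_plane yd => z /hd[].
have [_ _ b0 _] := hd _ z0d; have [_ _ _ b1] := hd _ z1d.
set q0 := p0 z0 in b0 *; set q1 := p1 z1 in b1 *.
set h := y 0 0 - x 0 0; set k := y 1 0 - x 1 0.
have -> : h * q0 + k * q1 - (p0 x * h + p1 x * k) = h * (q0 - p0 x) + k * (q1 - p1 x) by ring.
have h1 := coord_le (y - x) 0; have h2 := coord_le (y - x) 1.
rewrite !mxE -/h -/k in h1 h2.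
apply: le_trans (ler_normD _ _) _; rewrite !normrM.
have := ler_pM (normr_ge0 h) (normr_ge0 (q0 - p0 x)) h1 (ltW b0).
have := ler_pM (normr_ge0 k) (normr_ge0 (q1 - p1 x)) h2 (ltW b1).
lra.
Unshelve. all: by end_near. Qed.

(** Bounded partial derivatives make the function locally Lipschitz. This starts the inductions
    where the derivatives are so far only known to be bounded. *)
Lemma bounded_partials_continuous f x (p0 p1 : 'cV[R]_2 -> R) (A : R) :
  (\forall y \near x, is_derive y (delta_mx 0 0 : 'cV[R]_2) f (p0 y)) ->
  (\forall y \near x, is_derive y (delta_mx 1 0 : 'cV[R]_2) f (p1 y)) ->
  (\forall y \near x, `|p0 y| <= A) -> (\forall y \near x, `|p1 y| <= A) -> {for x, continuous f}.
Proof.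
move=> d0 d1 b0 b1; apply/continuous_for_enorm => e e0.
have /nbhs_enorm[d dp hd] : \forall y \near x,
  [/\ is_derive y (delta_mx 0 0 : 'cV[R]_2) f (p0 y),
  is_derive y (delta_mx 1 0 : 'cV[R]_2) f (p1 y), `|p0 y| <= A & `|p1 y| <= A].
  by near=> y; split; near: y => //.
have A0 : 0 <= A.
  have [_ _ h _] : _ := hd x (eq_ind_r (fun u => enorm u < d) (eq_ind_r (fun u => u < d) dp enorm0) (subrr x)).
  by apply: le_trans h; exact: normr_ge0.
near=> y.
have yd : enorm (y - x) < d by near: y; exact: enorm_near.
have yA : enorm (y - x) < e / (2 * A + 1) by near: y; apply: enorm_near; rewrite divr_gt0//; lra.
have [z0 [z1 [z0d z1d ->]]] : exists z0 z1, [/\ enorm (z0 - x) < d, enorm (z1 - x) < d &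
    f y - f x = (y 0 0 - x 0 0) * p0 z0 + (y 1 0 - x 1 0) * p1 z1].
  by apply: MVT_plane yd => z /hd[].
have [_ _ c0 _] := hd _ z0d; have [_ _ _ c1] := hd _ z1d.
have h1 := coord_le (y - x) 0; have h2 := coord_le (y - x) 1.
rewrite !mxE in h1 h2.
apply: le_lt_trans (ler_normD _ _) _; rewrite !normrM.
have := ler_pM (normr_ge0 _) (normr_ge0 _) h1 c0.
have := ler_pM (normr_ge0 _) (normr_ge0 _) h2 c1.
rewrite ltr_pdivlMr in yA; last by lra.
have := enorm_ge0 (y - x); lra.
Unshelve. all: by end_near. Qed.

Lemma fd_lipschitz f x a b : fd f x a b ->
  \forall y \near x, `|f y - f x| <= (1 + `|a| + `|b|) * enorm (y - x).
Proof.
move=> fx; near=> y.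
have h1 : `|f y - f x - (a * (y 0 0 - x 0 0) + b * (y 1 0 - x 1 0))| <= 1 * enorm (y - x).
  by near: y; exact: fx.
have h3 := coord_le (y - x) 0; have h4 := coord_le (y - x) 1.
rewrite !mxE in h3 h4.
have {}h3 : `|a * (y 0 0 - x 0 0)| <= `|a| * enorm (y - x) by rewrite normrM ler_wpM2l.
have {}h4 : `|b * (y 1 0 - x 1 0)| <= `|b| * enorm (y - x) by rewrite normrM ler_wpM2l.
have h5 := ler_normD (f y - f x - (a * (y 0 0 - x 0 0) + b * (y 1 0 - x 1 0))) (a * (y 0 0 - x 0 0) + b * (y 1 0 - x 1 0)).
rewrite subrK in h5.
have h6 := ler_normD (a * (y 0 0 - x 0 0)) (b * (y 1 0 - x 1 0)).
by lra.
Unshelve. all: by end_near. Qed.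

Lemma fd_comp f (g0 g1 : 'cV[R]_2 -> R) x a b a0 b0 a1 b1 :
  fd f (vec (g0 x) (g1 x)) a b -> fd g0 x a0 b0 -> fd g1 x a1 b1 ->
  fd (fun y => f (vec (g0 y) (g1 y))) x (a * a0 + b * a1) (a * b0 + b * b1).
Proof.
move=> fx gx0 gx1 e e0.
set L0 := 1 + `|a0| + `|b0|; set L1 := 1 + `|a1| + `|b1|; set L := L0 + L1.
have hA := normr_ge0 a; have hB := normr_ge0 b.
have Lp : 0 < L by rewrite /L /L0 /L1; have := normr_ge0 a0; have := normr_ge0 b0; have := normr_ge0 a1; have := normr_ge0 b1; lra.
set A := 1 + `|a| + `|b|.
have Ap : 0 < A by rewrite /A; lra.
have e1 : 0 < e / 2 / L by rewrite !divr_gt0.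
have e2 : 0 < e / 2 / A by rewrite !divr_gt0.
have [d d0 hd] := proj1 (nbhs_enorm _ _) (fx _ e1).
have dL : 0 < d / L by rewrite divr_gt0.
near=> y.
have l0 : `|g0 y - g0 x| <= L0 * enorm (y - x) by near: y; exact: fd_lipschitz.
have l1 : `|g1 y - g1 x| <= L1 * enorm (y - x) by near: y; exact: fd_lipschitz.
have lin0 : `|g0 y - g0 x - (a0 * (y 0 0 - x 0 0) + b0 * (y 1 0 - x 1 0))| <= e / 2 / A * enorm (y - x).
  by near: y; exact: gx0.
have lin1 : `|g1 y - g1 x - (a1 * (y 0 0 - x 0 0) + b1 * (y 1 0 - x 1 0))| <= e / 2 / A * enorm (y - x).
  by near: y; exact: gx1.
have yd : enorm (y - x) < d / L by near: y; exact: enorm_near.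
have n0 := enorm_ge0 (y - x).
have lv : enorm (vec (g0 y) (g1 y) - vec (g0 x) (g1 x)) <= L * enorm (y - x).
  apply: le_trans (enorm_le_sum _) _; rewrite !mxE /= /L; lra.
rewrite ltr_pdivlMr// mulrC in yd.
have := hd _ (le_lt_trans lv yd).
rewrite !vec0 !vec1.
set D0 := g0 y - g0 x in lin0 *; set D1 := g1 y - g1 x in lin1 *.
set m0 := a0 * _ + b0 * _ in lin0; set m1 := a1 * _ + b1 * _ in lin1.
move=> hF.
have hF' : `|f (vec (g0 y) (g1 y)) - f (vec (g0 x) (g1 x)) - (a * D0 + b * D1)| <= e / 2 * enorm (y - x).
  apply: le_trans hF _; apply: le_trans (ler_wpM2l (ltW e1) lv) _.
  by rewrite mulrA divfK ?gt_eqF.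
have -> : (a * a0 + b * a1) * (y 0 0 - x 0 0) + (a * b0 + b * b1) * (y 1 0 - x 1 0) = a * m0 + b * m1.
  by rewrite /m0 /m1; ring.
set F := _ - f _ in hF' *.
have -> : F - (a * m0 + b * m1) = F - (a * D0 + b * D1) + (a * (D0 - m0) + b * (D1 - m1)) by ring.
apply: le_trans (ler_normD _ _) _.
have h7 := ler_normD (a * (D0 - m0)) (b * (D1 - m1)).
rewrite !normrM in h7.
have qA : e / 2 / A * A = e / 2 by rewrite divfK ?gt_eqF.
have h8 : (`|a| + `|b|) * (e / 2 / A) <= e / 2 / A * A.
  by have := e2; set q := e / 2 / _; rewrite /A; lra.
rewrite qA in h8.
have h9 := ler_wpM2r n0 h8.
have := ler_wpM2l hA lin0; have := ler_wpM2l hB lin1.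
set q := e / 2 / A in h9 *.
lra.
Unshelve. all: by end_near. Qed.

Lemma fd_coord0 (phi : R -> R) x l : is_derive (x 0 0) (1:R) phi l -> fd (fun y => phi (y 0 0)) x l 0.
Proof.
move=> /is_deriveP h e e0.
have /nbhs_ballP[d /= d0 hd] := h e e0.
apply/nbhs_enorm; exists d => // y yd.
have yx := coord_le (y - x) 0; rewrite !mxE in yx.
have := hd (y 0 0 - x 0 0); rewrite /ball /= sub0r normrN => /(_ (le_lt_trans yx yd)).
rewrite mul0r addr0 -[(y 0 0 - x 0 0) *: 1]/((y 0 0 - x 0 0) * 1) mulr1 [x 0 0 + _]addrC subrK mulrC => hh; apply: le_trans hh _.
by rewrite ler_wpM2l// ltW.
Qed.

(* Chain rule along a curve, obtained from [fd_comp] by viewing the curve as a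
   function of the first coordinate. *)
Lemma fd_curve f (c0 c1 : R -> R) t a b l0 l1 :
  fd f (vec (c0 t) (c1 t)) a b -> is_derive t (1:R) c0 l0 -> is_derive t (1:R) c1 l1 ->
  is_derive t (1:R) (fun s => f (vec (c0 s) (c1 s))) (a * l0 + b * l1).
Proof.
move=> ft ct0 ct1.
have g0 : fd (fun y : 'cV[R]_2 => c0 (y 0 0)) (vec t 0) l0 0 by apply: fd_coord0; rewrite vec0.
have g1 : fd (fun y : 'cV[R]_2 => c1 (y 0 0)) (vec t 0) l1 0 by apply: fd_coord0; rewrite vec0.
have ft' : fd f (vec (c0 (vec t 0 0 0)) (c1 (vec t 0 0 0))) a b by rewrite vec0.
have := fd_derive (vec 1 0) (fd_comp ft' g0 g1).
have -> : vec t 0 = 0 + t *: vec 1 0 :> 'cV[R]_2 by apply: cv2P; rewrite !mxE /=; ring.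
move=> /is_derive_line.
have -> : (fun s : R => f (vec (c0 ((0 + s *: vec 1 0) 0 0)) (c1 ((0 + s *: vec 1 0 : 'cV[R]_2) 0 0)))) = (fun s => f (vec (c0 s) (c1 s))).
  by apply/funext => s; rewrite !mxE /= add0r mulr1.
by rewrite vec0 vec1; have -> : (a * l0 + b * l1) * 1 + (a * 0 + b * 0) * 0 = a * l0 + b * l1 by ring.
Qed.

End Calculus.

(** * Symbol classes at infinity *)

Section Symbols.
Context {R : realType}.
Implicit Types (x y z : 'cV[R]_2) (f g : 'cV[R]_2 -> R) (p q : int).

Definition at_inf : set_system 'cV[R]_2 := [set P | exists r, forall x, r < enorm x -> P x].

#[global] Instance at_inf_filter : Filter at_inf.
Proof.
split=> [|P Q [r hr] [s hs]|P Q PQ [r hr]]; first by exists 0.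
- by exists (Num.max r s) => x; rewrite gt_max => /andP[? ?]; split; [exact: hr|exact: hs].
- by exists r => x /hr /PQ.
Qed.

Lemma at_inf_gt (r : R) : \forall x \near at_inf, r < enorm x.
Proof. by exists r. Qed.

(** The set {r < |x|} is open; hence identities that hold only near infinity may be
    differentiated. *)
Lemma at_inf_near (P : set 'cV[R]_2) :
  (\forall x \near at_inf, P x) -> \forall x \near at_inf, \forall y \near x, P y.
Proof.
move=> [r hr]; exists r => x rx; near=> y; apply: hr.
by near: y; exact: exterior_near.
Unshelve. all: by end_near. Qed.

(* [Sym k p f]: f is C^k near infinity and |D^j f(x)| = O(|x|^(p-j)) for every j <= k. *)
Fixpoint Sym (k : nat) (p : int) (f : 'cV[R]_2 -> R) : Prop :=
  [/\ \forall x \near at_inf, {for x, continuous f},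
      exists C : R, \forall x \near at_inf, `|f x| <= C * enorm x ^ p &
      match k with
      | 0 => True
      | k'.+1 => forall i, (\forall x \near at_inf, derivable f x (delta_mx i 0)) /\
                   Sym k' (p - 1) (partial i f)
      end].

Lemma Sym_continuous k p f : Sym k p f -> \forall x \near at_inf, {for x, continuous f}.
Proof. by case: k => [|k] []. Qed.

Lemma Sym_bound k p f : Sym k p f -> exists C : R, \forall x \near at_inf, `|f x| <= C * enorm x ^ p.
Proof. by case: k => [|k] []. Qed.

Lemma Sym_bound_gt0 k p f : Sym k p f ->
  exists2 C : R, 0 < C & \forall x \near at_inf, `|f x| <= C * enorm x ^ p.
Proof.
move=> /Sym_bound[C hC]; exists (`|C| + 1); first by have := normr_ge0 C; lra.
near=> x; have h1 : `|f x| <= C * enorm x ^ p by near: x.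
apply: le_trans h1 _; apply: ler_wpM2r; first exact: exprz_ge0.
by have := ler_norm C; lra.
Unshelve. all: by end_near. Qed.

Lemma Sym_eq k p f g : (\forall x \near at_inf, f x = g x) -> Sym k p f -> Sym k p g.
Proof.
elim: k p f g => [|k IH] p f g fg [cf [C bf] df]; split => //.
- near=> x; have fgx : \forall y \near x, f y = g y by near: x; exact: at_inf_near.
  have cfx : {for x, continuous f} by near: x.
  apply/continuous_for_enorm => e e0; near=> y.
  have <- : f y = g y by near: y.
  have <- : f x = g x by exact: (nbhs_singleton fgx).
  by near: y; exact: (proj1 (continuous_for_enorm _ _)).
- exists C; near=> x; have <- : f x = g x by near: x.
  by near: x.
- near=> x; have fgx : \forall y \near x, f y = g y by near: x; exact: at_inf_near.
  have cfx : {for x, continuous f} by near: x.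
  apply/continuous_for_enorm => e e0; near=> y.
  have <- : f y = g y by near: y.
  have <- : f x = g x by exact: (nbhs_singleton fgx).
  by near: y; exact: (proj1 (continuous_for_enorm _ _)).
- exists C; near=> x; have <- : f x = g x by near: x.
  by near: x.
- move=> i; have [dfi sfi] := df i; split.
    near=> x; have fgx : \forall y \near x, f y = g y by near: x; exact: at_inf_near.
    have dx : derivable f x (delta_mx i 0) by near: x.
    by apply: near_eq_derivable dx.
  apply: IH sfi; near=> x.
  have fgx : \forall y \near x, f y = g y by near: x; exact: at_inf_near.
  exact: near_eq_derive.
Unshelve. all: by end_near. Qed.

Lemma Sym_derive k p f i : Sym k.+1 p f -> Sym k (p - 1) (partial i f).
Proof. by case=> _ _ /(_ i)[]. Qed.

Lemma Sym_is_derive k p f i : Sym k.+1 p f ->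
  \forall x \near at_inf, is_derive x (delta_mx i 0 : 'cV[R]_2) f (partial i f x).
Proof.
case=> _ _ /(_ i)[h _]; near=> x; have dx : derivable f x (delta_mx i 0) by near: x.
exact: derivableP.
Unshelve. all: by end_near. Qed.

Lemma near_fd (f p0 p1 : 'cV[R]_2 -> R) :
  (\forall x \near at_inf, is_derive x (delta_mx 0 0 : 'cV[R]_2) f (p0 x)) ->
  (\forall x \near at_inf, is_derive x (delta_mx 1 0 : 'cV[R]_2) f (p1 x)) ->
  (\forall x \near at_inf, {for x, continuous p0}) ->
  (\forall x \near at_inf, {for x, continuous p1}) ->
  \forall x \near at_inf, fd f x (p0 x) (p1 x).
Proof.
move=> d0 d1 c0 c1; near=> x; apply: C1_fd.
- by near: x; exact: at_inf_near.
- by near: x; exact: at_inf_near.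
- by near: x.
- by near: x.
Unshelve. all: by end_near. Qed.

Lemma Sym_fd k p f : Sym k.+1 p f ->
  \forall x \near at_inf, fd f x (partial 0 f x) (partial 1 f x).
Proof.
move=> sf; apply: near_fd; try exact: Sym_is_derive sf.
- exact: Sym_continuous (Sym_derive 0 sf).
- exact: Sym_continuous (Sym_derive 1 sf).
Qed.

(** The usual way into the class: continuity of [f] follows from [C1_fd], because the candidate
    derivatives [d], being symbols, are continuous. *)
Lemma Sym_intro k p f (d : 'I_2 -> 'cV[R]_2 -> R) :
  (exists C : R, \forall x \near at_inf, `|f x| <= C * enorm x ^ p) ->
  (forall i, \forall x \near at_inf, is_derive x (delta_mx i 0 : 'cV[R]_2) f (d i x)) ->
  (forall i, Sym k (p - 1) (d i)) -> Sym k.+1 p f.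
Proof.
move=> bf df sd; split => //.
- have h := near_fd (df 0) (df 1) (Sym_continuous (sd 0)) (Sym_continuous (sd 1)).
  near=> x; have fx : fd f x (d 0 x) (d 1 x) by near: x.
  exact: fd_continuous fx.
- move=> i; split.
    near=> x; have dx : is_derive x (delta_mx i 0 : 'cV[R]_2) f (d i x) by near: x; exact: df.
    by case: dx.
  apply: Sym_eq (sd i); near=> x.
  have dx : is_derive x (delta_mx i 0 : 'cV[R]_2) f (d i x) by near: x; exact: df.
  by case: dx => _ <-.
Unshelve. all: by end_near. Qed.

Lemma SymS k p f : Sym k.+1 p f -> Sym k p f.
Proof.
elim: k p f => [|k IH] p f; first by case.
move=> [cf bf df]; split=> // i; have [di si] := df i; split=> //; exact: IH.
Qed.

Lemma Sym_le k p q f : p <= q -> Sym k p f -> Sym k q f.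
Proof.
elim: k p q f => [|k IH] p q f pq sf.
  have [cf _ _] := sf; have [C C0 hC] := Sym_bound_gt0 sf.
  split=> //; exists C; near=> x; have fx : `|f x| <= C * enorm x ^ p by near: x.
  apply: le_trans fx _; rewrite ler_pM2l//; apply: ler_weXz2l => //.
  by apply: ltW; near: x; exact: at_inf_gt.
apply: (@Sym_intro _ _ _ (fun i => partial i f)).
- have [C C0 hC] := Sym_bound_gt0 sf.
  exists C; near=> x; have fx : `|f x| <= C * enorm x ^ p by near: x.
  apply: le_trans fx _; rewrite ler_pM2l//; apply: ler_weXz2l => //.
  by apply: ltW; near: x; exact: at_inf_gt.
- by move=> i; exact: Sym_is_derive sf.
- by move=> i; apply: IH (Sym_derive i sf); rewrite lerD2r.
Unshelve. all: by end_near. Qed.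

Lemma SymD k p f g : Sym k p f -> Sym k p g -> Sym k p (fun x => f x + g x).
Proof.
have bD k' p' f' g' : Sym k' p' f' -> Sym k' p' g' ->
  exists C : R, \forall x \near at_inf, `|f' x + g' x| <= C * enorm x ^ p'.
  move=> /Sym_bound[C hC] /Sym_bound[D hD]; exists (C + D); near=> x.
  apply: le_trans (ler_normD _ _) _; rewrite mulrDl lerD//; near: x => //.
elim: k p f g => [|k IH] p f g sf sg.
  split=> //; last exact: bD sf sg.
  near=> x.
  have cf : {for x, continuous f} by near: x; exact: Sym_continuous sf.
  have cg : {for x, continuous g} by near: x; exact: Sym_continuous sg.
  exact: (@continuousD _ _ _ f g).
apply: (@Sym_intro _ _ _ (fun i x => partial i f x + partial i g x)).
- exact: bD sf sg.
- move=> i; near=> x.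
  have : is_derive x (delta_mx i 0 : 'cV[R]_2) f (partial i f x) by near: x; exact: Sym_is_derive sf.
  have : is_derive x (delta_mx i 0 : 'cV[R]_2) g (partial i g x) by near: x; exact: Sym_is_derive sg.
  by move=> ? ?; apply: is_deriveD.
- by move=> i; apply: IH; exact: Sym_derive.
Unshelve. all: by end_near. Qed.

Lemma Sym_cst0 k p : Sym k p (fun _ => 0).
Proof.
elim: k p => [|k IH] p.
  split=> //; last by exists 0; near=> x; rewrite normr0 mul0r.
  by near=> x; exact: cst_continuous.
apply: (@Sym_intro _ _ _ (fun _ _ => 0)) => //.
- by exists 0; near=> x; rewrite normr0 mul0r.
- by move=> i; near=> x; exact: is_derive_cst.
Unshelve. all: by end_near. Qed.

Lemma Sym_cst k (c : R) : Sym k 0 (fun _ => c).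
Proof.
case: k => [|k].
  split=> //; last by exists `|c|; near=> x; rewrite expr0z mulr1.
  by near=> x; exact: cst_continuous.
apply: (@Sym_intro _ _ _ (fun _ _ => 0)) => //.
- by exists `|c|; near=> x; rewrite expr0z mulr1.
- by move=> i; near=> x; exact: is_derive_cst.
- by move=> i; exact: Sym_cst0.
Unshelve. all: by end_near. Qed.

Lemma is_derive_coord x v i : is_derive x v (fun y : 'cV[R]_2 => y i 0) (v i 0).
Proof.
apply/is_deriveP => e e0; near=> h.
rewrite !mxE (_ : x i 0 + h * v i 0 - x i 0 - h * v i 0 = 0); last by ring.
rewrite normr0; apply: mulr_ge0; [exact: ltW|exact: normr_ge0].
Unshelve. all: by end_near. Qed.

Lemma Sym_coord k i : Sym k 1 (fun x => x i 0).
Proof.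
case: k => [|k].
  split=> //; last by exists 1; near=> x; rewrite expr1z mul1r coord_le.
  near=> x; apply/continuous_for_enorm => e e0; near=> y.
  have := coord_le (y - x) i; rewrite !mxE => /le_lt_trans; apply.
  by near: y; exact: enorm_near.
apply: (@Sym_intro _ _ _ (fun j _ => (delta_mx j 0 : 'cV[R]_2) i 0)) => //.
- by exists 1; near=> x; rewrite expr1z mul1r coord_le.
- by move=> j; near=> x; exact: is_derive_coord.
- by move=> j; rewrite subrr; exact: Sym_cst.
Unshelve. all: by end_near. Qed.

Lemma SymM k p q f g : Sym k p f -> Sym k q g -> Sym k (p + q) (fun x => f x * g x).
Proof.
have bM k' p' q' f' g' : Sym k' p' f' -> Sym k' q' g' ->
  exists C : R, \forall x \near at_inf, `|f' x * g' x| <= C * enorm x ^ (p' + q').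
  move=> /Sym_bound[C hC] /Sym_bound[D hD]; exists (C * D); near=> x.
  have x0 : 0 < enorm x by near: x; exact: at_inf_gt.
  rewrite normrM expfzDr ?gt_eqF// mulrACA; apply: ler_pM => //; near: x => //.
elim: k p q f g => [|k IH] p q f g sf sg.
  split=> //; last exact: bM sf sg.
  near=> x.
  have cf : {for x, continuous f} by near: x; exact: Sym_continuous sf.
  have cg : {for x, continuous g} by near: x; exact: Sym_continuous sg.
  exact: (@continuousM _ _ f g).
apply: (@Sym_intro _ _ _ (fun i x => f x * partial i g x + g x * partial i f x)).
- exact: bM sf sg.
- move=> i; near=> x.
  have : is_derive x (delta_mx i 0 : 'cV[R]_2) f (partial i f x) by near: x; exact: Sym_is_derive sf.
  have : is_derive x (delta_mx i 0 : 'cV[R]_2) g (partial i g x) by near: x; exact: Sym_is_derive sg.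
  by move=> ? ?; apply: is_deriveM.
- move=> i; apply: SymD.
    by rewrite -addrA; apply: IH; [exact: SymS|exact: Sym_derive].
  by rewrite (_ : p + q - 1 = q + (p - 1)); [apply: IH; [exact: SymS|exact: Sym_derive]|ring].
Unshelve. all: by end_near. Qed.

Lemma SymZ k p (c : R) f : Sym k p f -> Sym k p (fun x => c * f x).
Proof. by move=> sf; rewrite -(add0r p); apply: SymM => //; exact: Sym_cst. Qed.

Lemma SymN k p f : Sym k p f -> Sym k p (fun x => - f x).
Proof. by move=> /(SymZ (-1)); apply: Sym_eq; near=> x; rewrite mulN1r. Unshelve. all: by end_near. Qed.

Lemma SymB k p f g : Sym k p f -> Sym k p g -> Sym k p (fun x => f x - g x).
Proof. by move=> sf sg; apply: SymD => //; exact: SymN. Qed.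

(** The derivative of 1/f is -f' (1/f)^2, of order (p - 1) - 2p = -p - 1; the factors 1/f are
    covered by the induction hypothesis. *)
Lemma SymV k p f (c : R) : 0 < c -> (\forall x \near at_inf, c * enorm x ^ p <= `|f x|) ->
  Sym k p f -> Sym k (- p) (fun x => (f x)^-1).
Proof.
move=> c0 fc.
have f0 : \forall x \near at_inf, f x != 0.
  near=> x; have x0 : 0 < enorm x by near: x; exact: at_inf_gt.
  rewrite -normr_gt0; apply: lt_le_trans (_ : c * enorm x ^ p <= _); last by near: x.
  by rewrite mulr_gt0// exprz_gt0.
have bV : exists C : R, \forall x \near at_inf, `|(f x)^-1| <= C * enorm x ^ (- p).
  exists c^-1; near=> x; have x0 : 0 < enorm x by near: x; exact: at_inf_gt.
  have fx : f x != 0 by near: x.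
  rewrite normfV -invr_expz -invfM lef_pV2 ?posrE ?normr_gt0 ?mulr_gt0 ?exprz_gt0//.
  by near: x.
elim: k => [|k IH] sf.
  split=> //; near=> x; apply: continuousV; near: x => //; exact: (Sym_continuous sf).
apply: (@Sym_intro _ _ _ (fun i x => - (partial i f x * ((f x)^-1 * (f x)^-1)))) => //.
- move=> i; near=> x.
  have d : is_derive x (delta_mx i 0 : 'cV[R]_2) f (partial i f x) by near: x; exact: Sym_is_derive sf.
  have fx : f x != 0 by near: x.
  exact: is_derive_inv.
- move=> i; apply: SymN; rewrite (_ : - p - 1 = (p - 1) + (- p - p)); last by ring.
  by apply: SymM; [exact: Sym_derive|apply: SymM; apply: IH; exact: SymS].
Unshelve. all: by end_near. Qed.

End Symbols.

(** * Integrals over [0, 2 pi] *)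

Section CircleIntegral.
Context {R : realType}.
Implicit Types (f g : R -> R).

Local Notation mu := (@lebesgue_measure R).
Local Notation B := (`[0, 2 * pi]%classic : set R).

Definition J f : R := (\int[mu]_(t in B) f t)%R.

Lemma twopi_gt0 : 0 < 2 * pi :> R.
Proof. by rewrite mulr_gt0// pi_gt0. Qed.

Lemma J_integrable f : continuous f -> mu.-integrable B (EFin \o f).
Proof.
move=> cf; apply: continuous_compact_integrable; first exact: segment_compact.
by apply: continuous_subspaceT.
Qed.

Lemma J_cst (c : R) : J (fun _ => c) = 2 * pi * c.
Proof.
rewrite /J Rintegral_cst//= lebesgue_measure_itv/= lte_fin twopi_gt0/= subr0 mulrC.
by [].
Qed.

Lemma JD f g : continuous f -> continuous g -> J (fun t => f t + g t) = J f + J g.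
Proof. by move=> cf cg; rewrite /J RintegralD//; exact: J_integrable. Qed.

Lemma JZ (c : R) f : continuous f -> J (fun t => c * f t) = c * J f.
Proof. by move=> cf; rewrite /J RintegralZl//; exact: J_integrable. Qed.

Lemma J_le f g : continuous f -> continuous g -> (forall t, 0 <= t <= 2 * pi -> f t <= g t) -> J f <= J g.
Proof.
move=> cf cg fg; apply: le_Rintegral => //; exact: J_integrable.
Qed.

Lemma J_norm_le f (M : R) : continuous f -> (forall t, 0 <= t <= 2 * pi -> `|f t| <= M) ->
  `|J f| <= 2 * pi * M.
Proof.
move=> cf fM; rewrite ler_norml -mulrN -!J_cst; apply/andP; split; apply: J_le => //.
- exact: cst_continuous.
- by move=> t /fM; rewrite ler_norml => /andP[].
- exact: cst_continuous.
- by move=> t /fM; rewrite ler_norml => /andP[].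
Qed.

Lemma J_derive f F : continuous f -> (forall t, is_derive t (1:R) F (f t)) ->
  J f = F (2 * pi) - F 0.
Proof.
move=> cf dF; rewrite /J /Rintegral (@continuous_FTC2 _ f F)//.
- exact: twopi_gt0.
- exact: continuous_subspaceT.
- have dF' t : derivable F t 1 by case: (dF t).
  have cF t : {for t, continuous F} by apply: differentiable_continuous; apply/derivable1_diffP.
  split.
  + by move=> t _.
  + exact: cvg_at_right_filter (cF 0).
  + exact: cvg_at_left_filter (cF (2 * pi)).
- by move=> t _; rewrite derive1E; case: (dF t).
Qed.

(** Differentiation under the integral sign, dominated by the constant [M]; this is why the bound is
    asked for on an open interval around [l]. *)
Lemma J_param (F F1 : R -> R -> R) (a b l M : R) : a < l < b ->
  (forall k, a < k < b -> continuous (F k)) ->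
  (forall k t, a < k < b -> is_derive k (1:R) (F ^~ t) (F1 k t)) ->
  (forall k t, a < k < b -> 0 <= t <= 2 * pi -> `|F1 k t| <= M) ->
  is_derive l (1:R) (fun k => J (F k)) (J (F1 l)).
Proof.
move=> hl cF dF bF.
have d1 x y : a < x < b -> partial1of2 F x y = F1 x y.
  by move=> hx; rewrite partial1of2E; case: (dF x y hx).
have Il : `]a, b[%classic l by rewrite /= in_itv.
have h1 k : `]a, b[%classic k -> mu.-integrable B (EFin \o F k).
  by rewrite /= in_itv /= => hk; apply: J_integrable; exact: cF.
have h2 k t : `]a, b[%classic k -> B t -> derivable (F ^~ t) k 1.
  by rewrite /= in_itv /= => hk _; case: (dF k t hk).
have h3 : mu.-integrable B (EFin \o (fun _ : R => `|M|)).
  by apply: J_integrable; exact: cst_continuous.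
have h4 k t : `]a, b[%classic k -> B t -> `|partial1of2 F k t| <= `|M|.
  rewrite /= !in_itv /= => hk ht; rewrite d1//; apply: le_trans (bF _ _ hk ht) _.
  exact: ler_norm.
have mB : measurable (B : set (measurableTypeR R)) by [].
split.
  exact: (derivable_under_integral mB Il h1 h2 (fun _ => normr_ge0 M) h3 h4).
have := differentiation_under_integral mB Il h1 h2 (fun _ => normr_ge0 M) h3 h4.
rewrite derive1E => ->; apply: eq_Rintegral => t _.
exact: d1.
Qed.

End CircleIntegral.

(** * Complex numbers as points of the plane, and curves of complex numbers *)

Section ComplexCurves.
Context {R : realType}.
Local Open Scope complex_scope.
Local Notation C := R[i].
Implicit Types (z w : C) (f g : R -> C).
Local Notation re := (@complex.Re R).
Local Notation im := (@complex.Im R).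

Definition toC (x : 'cV[R]_2) : C := x 0 0 +i* x 1 0.
Definition ofC (z : C) : 'cV[R]_2 := vec (re z) (im z).
Definition cabs (z : C) : R := enorm (ofC z).

Lemma ofCK z : toC (ofC z) = z.
Proof. by case: z => a b; rewrite /toC vec0 vec1. Qed.

Lemma toCK x : ofC (toC x) = x.
Proof. by apply: cv2P; rewrite /ofC ?vec0 ?vec1. Qed.

Lemma cabs_toC x : cabs (toC x) = enorm x.
Proof. by rewrite /cabs toCK. Qed.

Lemma eqC z w : re z = re w -> im z = im w -> z = w.
Proof. by case: z => a b; case: w => c d /= -> ->. Qed.

Lemma reD z w : re (z + w) = re z + re w. Proof. by case: z; case: w. Qed.
Lemma imD z w : im (z + w) = im z + im w. Proof. by case: z; case: w. Qed.
Lemma reN z : re (- z) = - re z. Proof. by case: z. Qed.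
Lemma imN z : im (- z) = - im z. Proof. by case: z. Qed.
Lemma reM z w : re (z * w) = re z * re w - im z * im w. Proof. by case: z; case: w. Qed.
Lemma imM z w : im (z * w) = re z * im w + im z * re w.
Proof. by case: z => a b; case: w => c d /=; rewrite addrC. Qed.
Lemma reV z : re (z^-1) = re z / (re z ^+ 2 + im z ^+ 2). Proof. by case: z. Qed.
Lemma imV z : im (z^-1) = - im z / (re z ^+ 2 + im z ^+ 2). Proof. by case: z => a b /=; rewrite mulNr. Qed.
Definition reimE := (reD, imD, reN, imN, reM, imM).

Lemma cabs_sqr z : cabs z ^+ 2 = re z ^+ 2 + im z ^+ 2.
Proof. by rewrite /cabs enorm_sqr vec0 vec1. Qed.

Lemma cabs_ge0 z : 0 <= cabs z. Proof. exact: enorm_ge0. Qed.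

Lemma cabsM z w : cabs (z * w) = cabs z * cabs w.
Proof.
apply/eqP; rewrite -(eqrXn2 (n := 2)) ?mulr_ge0 ?cabs_ge0//.
by rewrite exprMn !cabs_sqr reM imM; apply/eqP; ring.
Qed.

Lemma cabsD z w : cabs (z + w) <= cabs z + cabs w.
Proof.
rewrite /cabs (_ : ofC (z + w) = ofC z + ofC w) ?enormD//.
by apply: cv2P; rewrite !mxE /= ?reD ?imD.
Qed.

Lemma cabsN z : cabs (- z) = cabs z.
Proof.
rewrite /cabs (_ : ofC (- z) = - ofC z) ?enormN//.
by apply: cv2P; rewrite !mxE /= ?reN ?imN.
Qed.

Lemma cabs_real (a : R) : cabs (a%:C) = `|a|.
Proof. by rewrite /cabs /enorm dotE /ofC !vec0 !vec1 /= mul0r addr0 -expr2 sqrtr_sqr. Qed.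

Lemma cabs_gt0 z : (0 < cabs z) = (z != 0).
Proof.
rewrite /cabs enorm_gt0; congr negb; apply/eqP/eqP => [h|->].
  by rewrite -(ofCK z) h /toC !mxE.
by apply: cv2P; rewrite !mxE.
Qed.

Lemma cabsV z : cabs (z^-1) = (cabs z)^-1.
Proof.
have [->|z0] := eqVneq z 0.
  have c0 : cabs 0 = 0 by rewrite (cabs_real 0) normr0.
  by rewrite invr0 c0 invr0.
have h : cabs z != 0 by rewrite gt_eqF ?cabs_gt0.
by apply: (mulfI h); rewrite -cabsM !mulfV// (cabs_real 1) normr1.
Qed.

Lemma re_le z : `|re z| <= cabs z.
Proof. by have := coord_le (ofC z) 0; rewrite vec0. Qed.

Lemma im_le z : `|im z| <= cabs z.
Proof. by have := coord_le (ofC z) 1; rewrite vec1. Qed.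

Lemma cabs_le_sum z : cabs z <= `|re z| + `|im z|.
Proof. by have := enorm_le_sum (ofC z); rewrite vec0 vec1. Qed.

Lemma cabs_sub z w : cabs z - cabs w <= cabs (z - w).
Proof. by have := cabsD (z - w) w; rewrite subrK; lra. Qed.

(** Derivative of a curve R -> C, taken componentwise. Contour deformations are carried out by
    differentiating along such curves only. *)
Definition cder f (t : R) (l : C) :=
  is_derive t (1:R) (fun s => re (f s)) (re l) /\ is_derive t (1:R) (fun s => im (f s)) (im l).

Definition ccont f (t : R) :=
  {for t, continuous (fun s => re (f s))} /\ {for t, continuous (fun s => im (f s))}.

Lemma is_derive1_continuous (h : R -> R) (t l : R) : is_derive t (1:R) h l -> {for t, continuous h}.
Proof. by case=> dh _; apply: differentiable_continuous; apply/derivable1_diffP. Qed.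

Lemma cder_ccont f t l : cder f t l -> ccont f t.
Proof. by case=> ? ?; split; apply: is_derive1_continuous; eassumption. Qed.

Lemma cder_eq f t l l' : cder f t l -> l = l' -> cder f t l'.
Proof. by move=> h <-. Qed.

Lemma cder_cst (c : C) t : cder (fun _ => c) t 0.
Proof. by split; apply: is_derive_cst. Qed.

Lemma cderD f g t l m : cder f t l -> cder g t m -> cder (fun s => f s + g s) t (l + m).
Proof.
move=> [f1 f2] [g1 g2]; split; rewrite ?reD ?imD.
  have := is_deriveD f1 g1; congr is_derive; by apply/funext => s; rewrite reD.
by have := is_deriveD f2 g2; congr is_derive; by apply/funext => s; rewrite imD.
Qed.

Lemma cderM f g t l m : cder f t l -> cder g t m ->
  cder (fun s => f s * g s) t (l * g t + f t * m).
Proof.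
move=> [f1 f2] [g1 g2]; split; rewrite !reimE.
  have := is_deriveB (is_deriveM f1 g1) (is_deriveM f2 g2); congr is_derive.
    by apply/funext => s; rewrite reM.
  by rewrite -![_ *: _]/(_ * _); ring.
have := is_deriveD (is_deriveM f1 g2) (is_deriveM f2 g1); congr is_derive.
  by apply/funext => s; rewrite imM.
by rewrite -![_ *: _]/(_ * _); ring.
Qed.

Lemma cderZ (c : C) f t l : cder f t l -> cder (fun s => c * f s) t (c * l).
Proof. by move=> h; apply: cder_eq (cderM (cder_cst c t) h) _; rewrite mul0r add0r. Qed.

Lemma re2im2_neq0 z : z != 0 -> re z ^+ 2 + im z ^+ 2 != 0.
Proof. by rewrite -cabs_gt0 -cabs_sqr => h; rewrite expf_neq0// gt_eqF. Qed.

Lemma cderV f t l : f t != 0 -> cder f t l -> cder (fun s => (f s)^-1) t (- (l * ((f t)^-1 * (f t)^-1))).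
Proof.
move=> ft [f1 f2]; have nz := re2im2_neq0 ft.
pose N s := re (f s) * re (f s) + im (f s) * im (f s).
have dN : is_derive t (1:R) N _ := is_deriveD (is_deriveM f1 f1) (is_deriveM f2 f2).
have nz' : N t != 0 by rewrite /N -!expr2.
have dI := is_derive_inv nz' dN.
split.
  have := is_deriveM f1 dI; congr is_derive; first by apply/funext => s; rewrite reV !expr2.
  rewrite !reimE reV imV -![_ *: _]/(_ * _) /N; move: nz.
  move: (re (f t)) (im (f t)) (re l) (im l) => a b c d nz; field.
  by rewrite !expr2 in nz *; rewrite nz.
have := is_deriveM (is_deriveN f2) dI; congr is_derive; first by apply/funext => s; rewrite imV !expr2.
rewrite !reimE reV imV -![_ *: _]/(_ * _) /N; move: nz.
rewrite ?fctE; move: (re (f t)) (im (f t)) (re l) (im l) => a b c d nz; field.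
by rewrite !expr2 in nz *; rewrite nz.
Qed.

End ComplexCurves.

(** * Circle integrals of complex functions and the winding number *)

Section Cauchy.
Context {R : realType}.
Local Open Scope complex_scope.
Local Notation C := R[i].
Implicit Types (z w c : C) (f g : R -> C).
Local Notation re := (@complex.Re R).
Local Notation im := (@complex.Im R).

Lemma ccont_cst c (t : R) : ccont (fun _ => c) t.
Proof. by split; apply: cst_continuous. Qed.

Lemma ccontM f g (t : R) : ccont f t -> ccont g t -> ccont (fun s => f s * g s) t.
Proof.
move=> [f1 f2] [g1 g2]; split.
  rewrite (_ : (fun s => _) = (fun s => re (f s) * re (g s) - im (f s) * im (g s))).
    by apply: continuousB; apply: continuousM.
  by apply/funext => s; rewrite reM.
rewrite (_ : (fun s => _) = (fun s => re (f s) * im (g s) + im (f s) * re (g s))).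
  by apply: continuousD; apply: continuousM.
by apply/funext => s; rewrite imM.
Qed.

Definition CJ f : C := J (fun t => re (f t)) +i* J (fun t => im (f t)).

Lemma eq_CJ f g : f =1 g -> CJ f = CJ g.
Proof. by move=> fg; congr CJ; apply/funext. Qed.

Lemma CJ_cst c : CJ (fun _ => c) = (2 * pi)%:C * c.
Proof. by rewrite /CJ !J_cst; apply: eqC; rewrite ?reM ?imM /= !mul0r ?subr0 ?addr0. Qed.

Lemma CJD f g : (forall t, ccont f t) -> (forall t, ccont g t) ->
  CJ (fun t => f t + g t) = CJ f + CJ g.
Proof.
move=> cf cg; apply: eqC; rewrite ?reD ?imD /= -JD; try by move=> t; case: (cf t); case: (cg t).
  by congr J; apply/funext => t; rewrite reD.
by congr J; apply/funext => t; rewrite imD.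
Qed.

Lemma CJZ c f : (forall t, ccont f t) -> CJ (fun t => c * f t) = c * CJ f.
Proof.
move=> cf.
have c1 : continuous (fun t => re (f t)) by move=> t; case: (cf t).
have c2 : continuous (fun t => im (f t)) by move=> t; case: (cf t).
have cZ (a : R) (h : R -> R) : continuous h -> continuous (fun t => a * h t).
  by move=> ch t; apply: continuousM; [exact: cst_continuous|exact: ch].
apply: eqC; rewrite ?reM ?imM /= -?mulNr -!JZ// -JD; try exact: cZ.
  by congr J; apply/funext => t; rewrite reM mulNr.
by congr J; apply/funext => t; rewrite imM.
Qed.

Lemma CJ_le f (M : R) : (forall t, ccont f t) -> (forall t, cabs (f t) <= M) ->
  cabs (CJ f) <= 4 * pi * M.
Proof.
move=> cf fM; apply: le_trans (cabs_le_sum _) _ => /=.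
have h1 : `|J (fun t => re (f t))| <= 2 * pi * M.
  by apply: J_norm_le => [t|t _]; [case: (cf t)|exact: le_trans (re_le _) (fM t)].
have h2 : `|J (fun t => im (f t))| <= 2 * pi * M.
  by apply: J_norm_le => [t|t _]; [case: (cf t)|exact: le_trans (im_le _) (fM t)].
lra.
Qed.

Lemma CJ_derive f (F : R -> C) : (forall t, ccont f t) -> (forall t, cder F t (f t)) ->
  F (2 * pi) = F 0 -> CJ f = 0.
Proof.
move=> cf dF F0; rewrite /CJ.
have -> : J (fun t => re (f t)) = re (F (2 * pi)) - re (F 0).
  by apply: (@J_derive _ _ (fun t => re (F t))) => t; [case: (cf t)|case: (dF t)].
have -> : J (fun t => im (f t)) = im (F (2 * pi)) - im (F 0).
  by apply: (@J_derive _ _ (fun t => im (F t))) => t; [case: (cf t)|case: (dF t)].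
by rewrite F0 !subrr.
Qed.

Lemma CJ_param (F F1 : R -> R -> C) (a b l M : R) : a < l < b ->
  (forall k t, a < k < b -> ccont (F k) t) ->
  (forall k t, a < k < b -> cder (F ^~ t) k (F1 k t)) ->
  (forall k t, a < k < b -> cabs (F1 k t) <= M) ->
  cder (fun k => CJ (F k)) l (CJ (F1 l)).
Proof.
move=> hl cF dF bF; split => /=.
  apply: (@J_param _ (fun k t => re (F k t)) (fun k t => re (F1 k t)) a b l M) => //.
  - by move=> k hk t; case: (cF k t hk).
  - by move=> k t hk; case: (dF k t hk).
  - by move=> k t hk _; apply: le_trans (re_le _) (bF _ _ hk).
apply: (@J_param _ (fun k t => im (F k t)) (fun k t => im (F1 k t)) a b l M) => //.
- by move=> k hk t; case: (cF k t hk).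
- by move=> k t hk; case: (dF k t hk).
- by move=> k t hk _; apply: le_trans (im_le _) (bF _ _ hk).
Qed.

Definition circ (r t : R) : C := (r * cos t) +i* (r * sin t).

Lemma circ_2pi r : circ r (2 * pi) = circ r 0.
Proof. by rewrite /circ mulr_natl cos2pi sin2pi cos0 sin0. Qed.

Lemma cabs_circ r t : 0 <= r -> cabs (circ r t) = r.
Proof.
move=> r0; apply/eqP; rewrite -(eqrXn2 (n := 2)) ?cabs_ge0//; apply/eqP.
rewrite cabs_sqr /= !exprMn -mulrDr.
by rewrite cos2Dsin2 mulr1.
Qed.

Lemma cder_circ r t : cder (circ r) t ('i * circ r t).
Proof.
split => /=; rewrite ?mul0r ?mul1r ?add0r ?sub0r.
  have := is_deriveM (is_derive_cst r t (1:R)) (is_derive_cos t).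
  by congr is_derive; rewrite -![_ *: _]/(_ * _) /cst; ring.
have := is_deriveM (is_derive_cst r t (1:R)) (is_derive_sin t).
by congr is_derive; rewrite -![_ *: _]/(_ * _) /cst; ring.
Qed.

Lemma circ_neq0 r t : 0 < r -> circ r t != 0.
Proof. by move=> r0; rewrite -cabs_gt0 cabs_circ// ltW. Qed.

Lemma cder_real (t : R) : cder (fun s => s%:C) t 1.
Proof. by split => /=; [exact: is_derive_id|exact: is_derive_cst]. Qed.

Lemma cconst01 f : (forall s : R, 0 <= s <= 1 -> cder f s 0) -> f 0 = f 1.
Proof.
move=> df.
have [s _ h1] := MVT01 (fun s hs => proj1 (df s hs)).
have [t _ h2] := MVT01 (fun s hs => proj2 (df s hs)).
by apply: eqC; [move: h1|move: h2] => /= /eqP; rewrite subr_eq0 => /eqP.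
Qed.

Lemma circ_sub_ge (r l : R) (t : R) z : 0 <= r -> r - `|l| * cabs z <= cabs (circ r t - l%:C * z).
Proof.
by move=> r0; apply: le_trans (cabs_sub _ _); rewrite cabs_circ// cabsM cabs_real.
Qed.

Lemma i_neq0 : 'i != 0 :> C.
Proof. by rewrite eq_complex /= oner_eq0 andbF. Qed.

Lemma CJ_circ r : CJ (circ r) = 0.
Proof.
apply: (@CJ_derive _ (fun t => (- 'i) * circ r t)).
- by move=> t; apply: cder_ccont (cder_circ r t).
- move=> t; apply: cder_eq (cderZ (- 'i) (cder_circ r t)) _.
  by rewrite mulrA mulNr -expr2 sqr_i opprK mul1r.
- by rewrite circ_2pi.
Qed.

(** Replacing [z] by k z gives an integral that is constant in k on [0, 1]: its k-derivative
    integrates a total derivative over the closed circle. At k = 0 the integrand is 1. *)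
Lemma winding (r : R) z : cabs z < r -> CJ (fun t => circ r t / (circ r t - z)) = (2 * pi)%:C.
Proof.
move=> zr.
have z0 := cabs_ge0 z; have r0 : 0 < r by lra.
(* With e r = d = (r - |z|)/2, every k in (-e, 1 + e) keeps |circ r t - k z| >= d. This open
   interval contains [0, 1] and is where the domination is uniform. *)
set e := (r - cabs z) / (2 * r).
have e0 : 0 < e by rewrite divr_gt0//; lra.
set d := (r - cabs z) / 2.
have d0 : 0 < d by rewrite /d; lra.
have er : e * r = d by rewrite /e /d; field; lra.
have ez : e * cabs z <= d by rewrite -er ler_wpM2l ?ltW.
have low k t : - e < k < 1 + e -> d <= cabs (circ r t - k%:C * z).
  move=> /andP[k1 k2]; apply: le_trans (circ_sub_ge _ _ _ (ltW r0)).
  have : `|k| <= 1 + e by rewrite ler_norml; apply/andP; split; lra.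
  by move=> /(ler_wpM2r z0); rewrite /d in ez *; lra.
have nz k t : - e < k < 1 + e -> circ r t - k%:C * z != 0.
  by move=> /low-/(_ t) h; rewrite -cabs_gt0; lra.
pose F (k t : R) : C := circ r t * (circ r t - k%:C * z)^-1.
pose F1 (k t : R) : C := circ r t * (z * ((circ r t - k%:C * z)^-1 * (circ r t - k%:C * z)^-1)).
have dt k t : cder (fun s => circ r s - k%:C * z) t ('i * circ r t).
  by apply: cder_eq (cderD (cder_circ r t) (cder_cst _ _)) _; rewrite addr0.
have dk k t : cder (fun s => circ r t - s%:C * z) k (- z).
  apply: cder_eq (cderD (cder_cst _ _) _) _; last exact: add0r.
  have := cderZ (- z) (cder_real k); rewrite mulr1; congr cder.
  by apply/funext => s; rewrite mulNr mulrC.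
have h : CJ (F 0) = CJ (F 1).
  apply: (@cconst01 (fun k => CJ (F k))) => k /andP[k0 k1].
  have hk : - e < k < 1 + e by apply/andP; split; lra.
  rewrite (_ : 0 = CJ (F1 k)).
    apply: (@CJ_param F F1 (- e) (1 + e) k (r * (cabs z * (d^-1 * d^-1)))) => //.
    - move=> j t hj; apply: ccontM; first exact: cder_ccont (cder_circ r t).
      by apply: cder_ccont; apply: cderV (dt j t); exact: nz.
    - move=> j t hj; apply: cder_eq (cderZ _ (cderV (nz j t hj) (dk j t))) _.
      by rewrite mulNr opprK.
    - move=> j t hj; rewrite /F1 !cabsM cabs_circ; last exact: ltW.
      rewrite !cabsV.
      have := low j t hj => lj.
      have hi : (cabs (circ r t - j%:C * z))^-1 <= d^-1 by rewrite lef_pV2 ?posrE//; lra.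
      apply: ler_wpM2l; first exact: ltW.
      apply: ler_wpM2l => //; apply: ler_pM => //; rewrite invr_ge0; exact: cabs_ge0.
  (* The k-derivative s z/(s - k z)^2 of the integrand, with s = circ r t, is the t-derivative of i
     z/(s - k z), because ds/dt = i s. *)
  symmetry; apply: (@CJ_derive _ (fun t => ('i * z) * (circ r t - k%:C * z)^-1)).
  - move=> t; apply: ccontM; first exact: cder_ccont (cder_circ r t).
    apply: ccontM; first exact: ccont_cst.
    by apply: ccontM; apply: cder_ccont; apply: cderV (dt k t); exact: nz.
  - move=> t; apply: cder_eq (cderZ _ (cderV (nz k t hk) (dt k t))) _.
    rewrite /F1; set q := (_^-1 * _).
    have i2 := @sqr_i R.
    have -> : 'i * z * - ('i * circ r t * q) = - ('i ^+ 2) * (circ r t * (z * q)) by ring.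
    by rewrite i2 opprK mul1r.
  - by rewrite circ_2pi.
have -> : CJ (fun t => circ r t / (circ r t - z)) = CJ (F 1).
  by apply: eq_CJ => t; rewrite /F mul1r.
rewrite -h (@eq_CJ _ (fun _ => 1)) ?CJ_cst ?mulr1// => t.
by rewrite /F mul0r subr0 mulfV// circ_neq0.
Qed.

End Cauchy.

(** * Cauchy's formula, and complex-valued symbols *)

Section CauchyFormula.
Context {R : realType}.
Local Open Scope complex_scope.
Local Notation C := R[i].
Implicit Types (z w c : C) (f g : R -> C).
Local Notation re := (@complex.Re R).
Local Notation im := (@complex.Im R).

(* The functions K of interest are only known to be differentiable along curves,
   K' being given by D.  The contour is contracted to the point t, along which
   the integral is constant. *)
Lemma cauchy_formula (K D : C -> C) (rho M r : R) t :
  (forall (c : R -> C) s l, cder c s l -> cabs (c s) < rho -> cder (fun u => K (c u)) s (D (c s) * l)) ->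
  (forall (c : R -> C) s, ccont c s -> cabs (c s) < rho -> ccont (fun u => D (c u)) s) ->
  (forall w, cabs w < rho -> cabs (D w) <= M) ->
  r < rho -> cabs t < r ->
  CJ (fun a => K (circ r a) * (circ r a / (circ r a - t))) = (2 * pi)%:C * K t.
Proof.
move=> dK cD bD rrho tr.
have t0 := cabs_ge0 t; have r0 : 0 < r by lra.
have M0 : 0 <= M.
  have /bD : cabs t < rho by lra.
  by have := cabs_ge0 (D t); lra.
(* For k in (-e, 1 + e) the contracted contour has modulus at most (1 + 2e) r = r + (rho - r)/2,
   still below rho. *)
have [e e0 er] : exists2 e : R, 0 < e & e * r = (rho - r) / 4.
  exists ((rho - r) / (4 * r)); first by rewrite divr_gt0//; lra.
  by field; lra.
pose gam (k a : R) : C := t + k%:C * (circ r a - t).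
have gamb (k a : R) : - e < k < 1 + e -> cabs (gam k a) < rho.
  move=> /andP[k1 k2].
  have -> : gam k a = (1 - k)%:C * t + k%:C * circ r a.
    by rewrite /gam; apply: eqC; rewrite !reimE /=; ring.
  apply: le_lt_trans (cabsD _ _) _; rewrite !cabsM !cabs_real cabs_circ; last exact: ltW.
  have h1 : `|1 - k| * cabs t <= `|1 - k| * r by apply: ler_wpM2l => //; exact: ltW.
  have h2 : (`|1 - k| + `|k|) * r <= (1 + 2 * e) * r.
    apply: ler_wpM2r; first exact: ltW.
    by have [k3|k3] := ger0P k; have [k4|k4] := ger0P (1 - k); lra.
  lra.
have nz a : circ r a - t != 0.
  rewrite -cabs_gt0; have := cabs_sub (circ r a) t; rewrite (cabs_circ _ (ltW r0)); lra.
have dk k a : cder (fun s => gam s a) k (circ r a - t).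
  apply: cder_eq (cderD (cder_cst _ _) _) _; last exact: add0r.
  have := cderZ (circ r a - t) (cder_real k); rewrite mulr1; congr cder.
  by apply/funext => s; rewrite mulrC.
have da0 a : cder (fun b => circ r b - t) a ('i * circ r a).
  by apply: cder_eq (cderD (cder_circ r a) (cder_cst _ _)) _; rewrite addr0.
have da k a : cder (gam k) a (k%:C * ('i * circ r a)).
  by apply: cder_eq (cderD (cder_cst _ _) (cderZ _ (da0 a))) _; rewrite add0r.
pose F (k a : R) : C := K (gam k a) * (circ r a * (circ r a - t)^-1).
pose F1 (k a : R) : C := D (gam k a) * circ r a.
have cq a : ccont (fun a => circ r a * (circ r a - t)^-1) a.
  apply: ccontM; first exact: cder_ccont (cder_circ r a).
  by apply: cder_ccont; apply: cderV (da0 a).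
have cF1 k : - e < k < 1 + e -> forall a, ccont (F1 k) a.
  move=> hk a; apply: ccontM; last exact: cder_ccont (cder_circ r a).
  by apply: cD; [exact: cder_ccont (da k a)|exact: gamb].
have h : CJ (F 0) = CJ (F 1).
  apply: (@cconst01 _ (fun k => CJ (F k))) => k /andP[k0 k1].
  have hk : - e < k < 1 + e by apply/andP; split; lra.
  rewrite (_ : 0 = CJ (F1 k)).
    apply: (@CJ_param _ F F1 (- e) (1 + e) k (M * r)) => //.
    - move=> j a hj; apply: ccontM; last exact: cq.
      by apply: cder_ccont; apply: dK (da j a) _; exact: gamb.
    - move=> j a hj.
      apply: cder_eq (cderM (dK _ _ _ (dk j a) (gamb j a hj)) (cder_cst _ _)) _.
      by rewrite mulr0 addr0 /F1; have := nz a; move=> hz; field.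
    - move=> j a hj; rewrite /F1 cabsM cabs_circ; last exact: ltW.
      by apply: ler_wpM2r; [exact: ltW|apply: bD; exact: gamb].
  (* For k != 0 the integrand has the primitive (k i)^-1 K(gam k a). At k = 0 it is a constant times
     [circ r a], which has integral zero. *)
  symmetry; have [kz|kz] := eqVneq k 0.
    rewrite (_ : CJ (F1 k) = CJ (fun a => D t * circ r a)).
      rewrite CJZ ?CJ_circ ?mulr0// => a; exact: cder_ccont (cder_circ r a).
    by apply: eq_CJ => a; rewrite /F1 /gam kz mul0r addr0.
  have kz' : k%:C != 0 :> C by rewrite -cabs_gt0 cabs_real normr_gt0.
  have i2 := @i_neq0 R.
  apply: (@CJ_derive _ _ (fun a => (k%:C * 'i)^-1 * K (gam k a))).
  - exact: cF1.
  - move=> a; apply: cder_eq (cderZ _ (dK _ _ _ (da k a) (gamb k a hk))) _.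
    by rewrite /F1; field; rewrite kz' i2.
  - by rewrite /gam circ_2pi.
have -> : CJ (fun a => K (circ r a) * (circ r a / (circ r a - t))) = CJ (F 1).
  by apply: eq_CJ => a; rewrite /F /gam mul1r [t + _]addrC subrK.
rewrite -h -(winding tr) mulrC -CJZ//.
by apply: eq_CJ => a; rewrite /F /gam mul0r addr0.
Qed.

Lemma is_derive_line0 (f : 'cV[R]_2 -> R) x v l :
  is_derive (0 : R) (1:R) (fun s : R => f (x + s *: v)) l -> is_derive x v f l.
Proof.
move=> /is_deriveP h; apply/is_deriveP => e e0; near=> k.
have hk : `|f (x + (0 + k *: 1) *: v) - f (x + 0 *: v) - k * l| <= e * `|k| by near: k; exact: h.
by move: hk; rewrite scale0r addr0 add0r -[k *: 1]/(k * 1) mulr1.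
Unshelve. all: by end_near. Qed.

Definition CSym k p (F : 'cV[R]_2 -> C) := Sym k p (fun x => re (F x)) /\ Sym k p (fun x => im (F x)).

(** The complex increment produced by the i-th coordinate vector. *)
Definition cunit (i : 'I_2) : C := if i == 0 then 1 else 'i.

Lemma toC_line x (s : R) i : toC (x + s *: delta_mx i 0) = toC x + s%:C * cunit i.
Proof.
by apply: eqC; elim/I2P: i; rewrite ?reD ?imD ?reM ?imM /toC /cunit !mxE /=; ring.
Qed.

Lemma CSym_intro k p (F : 'cV[R]_2 -> C) (d : 'I_2 -> 'cV[R]_2 -> C) :
  (exists A : R, \forall x \near at_inf, cabs (F x) <= A * enorm x ^ p) ->
  (forall i, \forall x \near at_inf, cder (fun s => F (x + s *: delta_mx i 0)) 0 (d i x)) ->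
  (forall i, CSym k (p - 1) (d i)) -> CSym k.+1 p F.
Proof.
move=> [A hA] dF sd; split.
  apply: (@Sym_intro _ _ _ _ (fun i x => re (d i x))).
  - by exists A; near=> x; apply: le_trans (re_le _) _; near: x.
  - move=> i; near=> x; apply: is_derive_line0.
    have : cder (fun s => F (x + s *: delta_mx i 0)) 0 (d i x) by near: x; exact: dF.
    by case.
  - by move=> i; case: (sd i).
apply: (@Sym_intro _ _ _ _ (fun i x => im (d i x))).
- by exists A; near=> x; apply: le_trans (im_le _) _; near: x.
- move=> i; near=> x; apply: is_derive_line0.
  have : cder (fun s => F (x + s *: delta_mx i 0)) 0 (d i x) by near: x; exact: dF.
  by case.
- by move=> i; case: (sd i).
Unshelve. all: by end_near. Qed.

Lemma CSymM k p q (F G : 'cV[R]_2 -> C) : CSym k p F -> CSym k q G ->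
  CSym k (p + q) (fun x => F x * G x).
Proof.
move=> [f1 f2] [g1 g2]; split.
  apply: (@Sym_eq _ _ _ (fun x => re (F x) * re (G x) - im (F x) * im (G x))).
    by near=> x; rewrite reM.
  by apply: SymB; apply: SymM.
apply: (@Sym_eq _ _ _ (fun x => re (F x) * im (G x) + im (F x) * re (G x))).
  by near=> x; rewrite imM.
by apply: SymD; apply: SymM.
Unshelve. all: by end_near. Qed.

Lemma CSym_cst k c : CSym k 0 (fun _ => c).
Proof. by split; apply: Sym_cst. Qed.

Lemma CSymZ k p c (F : 'cV[R]_2 -> C) : CSym k p F -> CSym k p (fun x => c * F x).
Proof. by move=> h; rewrite -(add0r p); apply: CSymM => //; exact: CSym_cst. Qed.

Lemma CSym_toC k : CSym k 1 (@toC R).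
Proof. by split => /=; exact: Sym_coord. Qed.

Lemma CSym_eq k p (F G : 'cV[R]_2 -> C) : (\forall x \near at_inf, F x = G x) ->
  CSym k p F -> CSym k p G.
Proof.
by move=> FG [h1 h2]; split; [apply: Sym_eq h1|apply: Sym_eq h2]; near=> x;
  have -> : F x = G x by near: x.
Unshelve. all: by end_near. Qed.

Lemma Sym_enorm2 k : Sym k 2 (fun x : 'cV[R]_2 => x 0 0 ^+ 2 + x 1 0 ^+ 2).
Proof.
apply: (@Sym_eq _ _ _ (fun x => x 0 0 * x 0 0 + x 1 0 * x 1 0)).
  by near=> x; rewrite !expr2.
by apply: SymD; rewrite -[2]/(1 + 1 : int); apply: SymM; exact: Sym_coord.
Unshelve. all: by end_near. Qed.

Lemma Sym_enorm2V k : Sym k (- 2) (fun x : 'cV[R]_2 => (x 0 0 ^+ 2 + x 1 0 ^+ 2)^-1).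
Proof.
apply: (SymV (c := 1)) => //; last exact: Sym_enorm2.
near=> x; rewrite mul1r -enorm_sqr ger0_norm//; exact: exprn_ge0.
Unshelve. all: by end_near. Qed.

Lemma CSym_inv k : CSym k (- 1) (fun x => (toC x)^-1 : C).
Proof.
split.
  apply: (@Sym_eq _ _ _ (fun x => x 0 0 * (x 0 0 ^+ 2 + x 1 0 ^+ 2)^-1)).
    by near=> x; rewrite reV.
  by rewrite -[- 1]/(1 - 2 : int); apply: SymM; [exact: Sym_coord|exact: Sym_enorm2V].
apply: (@Sym_eq _ _ _ (fun x => - x 1 0 * (x 0 0 ^+ 2 + x 1 0 ^+ 2)^-1)).
  by near=> x; rewrite imV.
rewrite -[- 1]/(1 - 2 : int); apply: SymM; last exact: Sym_enorm2V.
by apply: SymN; exact: Sym_coord.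
Unshelve. all: by end_near. Qed.

Lemma cderX f (t : R) l n : cder f t l -> cder (fun s => f s ^+ n) t (n%:R * f t ^+ n.-1 * l).
Proof.
move=> df; elim: n => [|n IH].
  by rewrite !mul0r; have := cder_cst 1 t; congr cder; apply/funext => s; rewrite expr0.
have := cderM df IH.
rewrite (_ : (fun s => f s * f s ^+ n) = (fun s => f s ^+ n.+1)); last by apply/funext => s; rewrite exprS.
move/cder_eq; apply; rewrite /= -natr1; case: n {IH} => [|n] /=.
  by rewrite expr0; ring.
by rewrite exprS; ring.
Qed.

End CauchyFormula.

(** * Decay at infinity of integrals of the Cauchy kernel *)

Section Laurent.
Context {R : realType}.
Local Open Scope complex_scope.
Local Notation C := R[i].
Implicit Types (z w c : C) (f g : R -> C).
Local Notation re := (@complex.Re R).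
Local Notation im := (@complex.Im R).

Lemma cabs_cunit (i : 'I_2) : cabs (cunit i : C) = 1.
Proof.
elim/I2P: i; rewrite /cunit /=; first by rewrite (cabs_real 1) normr1.
by apply/eqP; rewrite -(eqrXn2 (n := 2)) ?cabs_ge0// cabs_sqr /= expr0n /= add0r.
Qed.

Lemma cabsX z n : cabs (z ^+ n) = cabs z ^+ n.
Proof.
elim: n => [|n IH]; first by rewrite !expr0 (cabs_real 1) normr1.
by rewrite !exprS cabsM IH.
Qed.

Lemma CSym0_intro p (F : 'cV[R]_2 -> C) (d : 'I_2 -> 'cV[R]_2 -> C) :
  (exists A : R, \forall x \near at_inf, cabs (F x) <= A * enorm x ^ p) ->
  (forall i, \forall x \near at_inf, cder (fun s => F (x + s *: delta_mx i 0)) 0 (d i x)) ->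
  (exists A : R, forall i, \forall x \near at_inf, cabs (d i x) <= A) -> CSym 0 p F.
Proof.
move=> [A hA] dF [B hB].
have dre i : \forall x \near at_inf, is_derive x (delta_mx i 0 : 'cV[R]_2) (fun x => re (F x)) (re (d i x)).
  near=> x; apply: is_derive_line0.
  have : cder (fun s => F (x + s *: delta_mx i 0)) 0 (d i x) by near: x; exact: dF.
  by case.
have dim i : \forall x \near at_inf, is_derive x (delta_mx i 0 : 'cV[R]_2) (fun x => im (F x)) (im (d i x)).
  near=> x; apply: is_derive_line0.
  have : cder (fun s => F (x + s *: delta_mx i 0)) 0 (d i x) by near: x; exact: dF.
  by case.
have bre i : \forall x \near at_inf, `|re (d i x)| <= B.
  by near=> x; apply: le_trans (re_le _) _; near: x; exact: hB.
have bim i : \forall x \near at_inf, `|im (d i x)| <= B.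
  by near=> x; apply: le_trans (im_le _) _; near: x; exact: hB.
split; split => //.
- near=> x; apply: (@bounded_partials_continuous _ _ _ (fun x => re (d 0 x)) (fun x => re (d 1 x)) B);
  by near: x; exact: at_inf_near.
- by exists A; near=> x; apply: le_trans (re_le _) _; near: x.
- near=> x; apply: (@bounded_partials_continuous _ _ _ (fun x => im (d 0 x)) (fun x => im (d 1 x)) B);
  by near: x; exact: at_inf_near.
- by exists A; near=> x; apply: le_trans (im_le _) _; near: x.
Unshelve. all: by end_near. Qed.

(** A derivative raises the power of the kernel by one and multiplies the density by [circ r a], so
    integrals of this shape are closed under differentiation. *)
Lemma kernel_cder (r M : R) n f i : 0 < r -> (forall a, ccont f a) -> (forall a, cabs (f a) <= M) ->
  \forall x \near at_inf,
    cder (fun s : R => CJ (fun a => f a * ((circ r a * toC (x + s *: delta_mx i 0) - 1)^-1) ^+ n)) 0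
      (- n%:R * cunit i * CJ (fun a => (f a * circ r a) * ((circ r a * toC x - 1)^-1) ^+ n.+1)).
Proof.
move=> r0 cf bf; near=> x.
have M0 : 0 <= M by apply: le_trans (bf 0); exact: cabs_ge0.
(* For |s| < 1 the moved point still has modulus at least 2/r, which keeps |circ r a * x - 1| >= 1
   on the whole interval of differentiation. *)
have xr : 2 / r + 1 < enorm x by near: x; exact: at_inf_gt.
pose b (s a : R) : C := circ r a * toC (x + s *: delta_mx i 0) - 1.
have low s a : -1 < s < 1 -> 1 <= cabs (b s a).
  move=> /andP[s1 s2]; have h := cabs_sub (circ r a * toC (x + s *: delta_mx i 0)) 1.
  rewrite (cabs_real 1) normr1 cabsM (cabs_circ _ (ltW r0)) cabs_toC in h.
  have h2 : enorm x - 1 <= enorm (x + s *: delta_mx i 0).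
    have := enorm_sub x (x + s *: delta_mx i 0).
    rewrite opprD addrA subrr add0r enormN enormZ.
    have -> : enorm (delta_mx i 0 : 'cV[R]_2) = 1.
      rewrite -cabs_toC -(cabs_cunit i); congr cabs.
      have := toC_line (0 : 'cV[R]_2) 1 i; rewrite scale1r add0r mul1r => ->.
      by rewrite (_ : toC 0 = 0) ?add0r// /toC !mxE.
    rewrite mulr1 => h3; have h4 : `|s| <= 1 by rewrite ler_norml; apply/andP; split; exact: ltW.
    by apply: le_trans (lerB (lexx _) h4) _; rewrite lerBlDl; exact: h3.
  have h3 : 2 / r <= enorm (x + s *: delta_mx i 0) by lra.
  have := ler_wpM2l (ltW r0) h3; rewrite mulrCA mulfV ?gt_eqF// mulr1 /b; lra.
have nz s a : -1 < s < 1 -> b s a != 0 by move=> /low-/(_ a) h; rewrite -cabs_gt0; lra.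
have db s a : cder (b ^~ a) s (circ r a * cunit i).
  have -> : b ^~ a = (fun s => circ r a * (toC x + cunit i * s%:C) + -1).
    by apply/funext => u; rewrite /b toC_line (mulrC (cunit i)).
  have d1 := cderZ (circ r a) (cderD (cder_cst (toC x) s) (cderZ (cunit i) (cder_real s))).
  by apply: cder_eq (cderD d1 (cder_cst _ _)) _; rewrite add0r addr0 mulr1.
have dba s a : cder (b s) a ('i * circ r a * toC (x + s *: delta_mx i 0)).
  have d1 := cderD (cderM (cder_circ r a) (cder_cst (toC (x + s *: delta_mx i 0)) a)) (cder_cst (-1) a).
  apply: cder_eq d1 _.
  by rewrite mulr0 !addr0.
pose F (s a : R) : C := f a * ((b s a)^-1) ^+ n.
pose F1 (s a : R) : C := f a * (n%:R * ((b s a)^-1) ^+ n.-1 * (- (circ r a * cunit i * ((b s a)^-1 * (b s a)^-1)))).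
have cb s a m : -1 < s < 1 -> ccont (fun a => ((b s a)^-1) ^+ m) a.
  by move=> hs; exact: cder_ccont (cderX m (cderV (nz s a hs) (dba s a))).
have h : cder (fun s => CJ (F s)) 0 (CJ (F1 0)).
  apply: (@CJ_param _ F F1 (-1) 1 0 (M * (cabs (n%:R : C) * r))).
  - by apply/andP; split; lra.
  - by move=> s a hs; apply: ccontM => //; exact: cb.
  - move=> s a hs; have d1 := cderM (cder_cst (f a) s) (cderX n (cderV (f := b ^~ a) (nz s a hs) (db s a))).
    apply: cder_eq d1 _.
    by rewrite mul0r add0r.
  - move=> s a hs; rewrite /F1 !cabsM cabsN !cabsM cabs_cunit (cabs_circ _ (ltW r0)) cabsX.
    have v1 : cabs (b s a)^-1 <= 1.
      by rewrite cabsV invf_le1//; [exact: low|have := low s a hs; lra].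
    have v0 := cabs_ge0 (b s a)^-1.
    apply: ler_pM => //; first exact: cabs_ge0.
      by rewrite !mulr_ge0 ?cabs_ge0 ?exprn_ge0//; exact: ltW.
    rewrite -mulrA; apply: ler_wpM2l; first exact: cabs_ge0.
    have h1 : cabs (b s a)^-1 ^+ n.-1 <= 1 by rewrite exprn_ile1.
    have h2 : cabs (b s a)^-1 * cabs (b s a)^-1 <= 1 by rewrite mulr_ile1.
    rewrite mulr1 mulrCA -[leRHS]mulr1; apply: ler_wpM2l; first exact: ltW.
    by rewrite mulr_ile1// ?exprn_ge0 ?mulr_ge0.
have h01 : -1 < (0 : R) < 1 by apply/andP; split; lra.
apply: cder_eq h _; rewrite -CJZ.
  apply: eq_CJ => a; rewrite /F1 /b scale0r addr0.
  case: n {F F1 cb} => [|n] /=; first by rewrite !mul0r oppr0 mulr0 !mul0r.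
  by rewrite 2![in RHS]exprS; ring.
move=> a; apply: ccontM; first by apply: ccontM => //; exact: cder_ccont (cder_circ r a).
by have := cb 0 a n.+1 h01; rewrite /b scale0r addr0.
Unshelve. all: by end_near. Qed.

(** The size comes from |circ r a * x - 1| >= (r/2)|x| for large |x|; the derivatives come from
    [kernel_cder], each one turning n into n + 1. *)
Lemma kernel_sym (r M : R) k n f : 0 < r -> (forall a, ccont f a) -> (forall a, cabs (f a) <= M) ->
  CSym k (- n%:Z) (fun x => CJ (fun a => f a * ((circ r a * toC x - 1)^-1) ^+ n)).
Proof.
move=> r0.
have bd m N g : (forall a, ccont g a) -> (forall a, cabs (g a) <= N) ->
  exists A : R, \forall x \near at_inf,
    cabs (CJ (fun a => g a * ((circ r a * toC x - 1)^-1) ^+ m)) <= A * enorm x ^ (- m%:Z).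
  move=> cg bg; exists (4 * pi * (N * (2 / r) ^+ m)); near=> x.
  have N0 : 0 <= N by apply: le_trans (bg 0); exact: cabs_ge0.
  have xr : 2 / r < enorm x by near: x; exact: at_inf_gt.
  have xr2 : 2 < r * enorm x by move: xr; rewrite ltr_pdivrMr// mulrC.
  have low a : r / 2 * enorm x <= cabs (circ r a * toC x - 1).
    have h := cabs_sub (circ r a * toC x) 1.
    by rewrite (cabs_real 1) normr1 cabsM (cabs_circ _ (ltW r0)) cabs_toC in h; lra.
  have nz a : circ r a * toC x - 1 != 0 by rewrite -cabs_gt0; have := low a; lra.
  rewrite -mulrA; apply: CJ_le => a.
    apply: ccontM => //; apply: cder_ccont; apply: cderX; apply: cderV; first exact: nz.
    exact: (cderD (cderM (cder_circ r a) (cder_cst (toC x) a)) (cder_cst (-1) a)).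
  rewrite cabsM -mulrA; apply: ler_pM => //; [exact: cabs_ge0|exact: cabs_ge0|].
  have x0 : 0 < enorm x by nra.
  rewrite cabsX -exprnN -exprVn -exprMn.
  apply: lerXn2r; rewrite ?nnegrE ?cabs_ge0//.
    by rewrite mulr_ge0 ?divr_ge0 ?invr_ge0//; exact: ltW.
  rewrite cabsV (_ : 2 / r / enorm x = (r / 2 * enorm x)^-1); last by field; apply/andP; split; lra.
  by rewrite lef_pV2 ?posrE//; [rewrite cabs_gt0|nra].
elim: k n M f => [|k IH] n M f cf bf.
  apply: (@CSym0_intro _ _ (fun i x => - n%:R * cunit i * CJ (fun a => (f a * circ r a) * ((circ r a * toC x - 1)^-1) ^+ n.+1))).
  - exact: bd cf bf.
  - by move=> i; exact: kernel_cder cf bf.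
  - have cf' a : ccont (fun a => f a * circ r a) a by apply: ccontM => //; exact: cder_ccont (cder_circ r a).
    have bf' a : cabs (f a * circ r a) <= M * r.
      by rewrite cabsM (cabs_circ _ (ltW r0)) ler_wpM2r// ltW.
    have [A hA] := bd n.+1 (M * r) _ cf' bf'.
    exists (cabs (- n%:R : C) * `|A|) => i; near=> x.
    rewrite !cabsM cabs_cunit mulr1; apply: ler_wpM2l; first exact: cabs_ge0.
    have hx : cabs (CJ (fun a => f a * circ r a * (circ r a * toC x - 1)^-1 ^+ n.+1)) <= A * enorm x ^ (- n.+1%:Z).
      by near: x.
    apply: le_trans hx _; apply: le_trans (ler_norm _) _; rewrite normrM -[leRHS]mulr1.
    apply: ler_wpM2l => //; rewrite ger0_norm ?exprz_ge0// -exprnN invf_le1.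
      by apply: exprn_ege1; apply: ltW; near: x; exact: at_inf_gt.
    by apply: exprn_gt0; near: x; exact: at_inf_gt.
apply: (@CSym_intro _ _ _ _ (fun i x => - n%:R * cunit i * CJ (fun a => (f a * circ r a) * ((circ r a * toC x - 1)^-1) ^+ n.+1))).
- exact: bd cf bf.
- by move=> i; exact: kernel_cder cf bf.
- move=> i; apply: CSymZ; rewrite (_ : - n%:Z - 1 = - n.+1%:Z); last by rewrite intS; ring.
  apply: (IH _ (M * r)).
    by move=> a; apply: ccontM => //; exact: cder_ccont (cder_circ r a).
  by move=> a; rewrite cabsM (cabs_circ _ (ltW r0)) ler_wpM2r// ltW.
Unshelve. all: by end_near. Qed.

End Laurent.

(** * Laurent expansion of a holomorphic function near infinity *)

Section LaurentExpansion.
Context {R : realType}.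
Local Open Scope complex_scope.
Local Notation C := R[i].
Implicit Types (z w c : C) (f g : R -> C).
Local Notation re := (@complex.Re R).
Local Notation im := (@complex.Im R).

(** Complex differentiability with derivative [l]: the Cauchy-Riemann equations are built into the
    shape of the two gradients. *)
Definition cdiff (G : 'cV[R]_2 -> C) x (l : C) :=
  fd (fun y => re (G y)) x (re l) (- im l) /\ fd (fun y => im (G y)) x (im l) (re l).

Lemma cder_comp (G : 'cV[R]_2 -> C) (c : R -> C) (s : R) l m :
  cdiff G (ofC (c s)) m -> cder c s l -> cder (fun u => G (ofC (c u))) s (m * l).
Proof.
move=> [G1 G2] [c1 c2]; split.
  have := fd_curve G1 c1 c2; congr is_derive; rewrite reM; ring.
by have := fd_curve G2 c1 c2; congr is_derive; rewrite imM; ring.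
Qed.

Lemma ccont_near (c : R -> C) (s e : R) : ccont c s -> 0 < e ->
  \forall u \near s, cabs (c u - c s) < e.
Proof.
move=> [c1 c2] e0; have e2 : 0 < e / 2 by lra.
have h1 := proj1 (@cvgrPdist_lt _ _ _ (nbhs s) _ (fun u => re (c u)) (re (c s))) c1 _ e2.
have h2 := proj1 (@cvgrPdist_lt _ _ _ (nbhs s) _ (fun u => im (c u)) (im (c s))) c2 _ e2.
near=> u; apply: le_lt_trans (cabs_le_sum _) _; rewrite !reimE.
have k1 : `|re (c u) - re (c s)| < e / 2 by rewrite distrC; near: u; exact: h1.
have k2 : `|im (c u) - im (c s)| < e / 2 by rewrite distrC; near: u; exact: h2.
lra.
Unshelve. all: by end_near. Qed.

Lemma ccont_of_near f (s : R) : (forall e, 0 < e -> \forall u \near s, cabs (f u - f s) < e) -> ccont f s.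
Proof.
move=> h; split.
  apply: (proj2 (@cvgrPdist_lt _ _ _ (nbhs s) _ (fun u => re (f u)) (re (f s)))) => e e0.
  near=> u; rewrite distrC; apply: le_lt_trans (_ : cabs (f u - f s) < e); last by near: u; exact: h.
  by have := re_le (f u - f s); rewrite !reimE.
apply: (proj2 (@cvgrPdist_lt _ _ _ (nbhs s) _ (fun u => im (f u)) (im (f s)))) => e e0.
near=> u; rewrite distrC; apply: le_lt_trans (_ : cabs (f u - f s) < e); last by near: u; exact: h.
by have := im_le (f u - f s); rewrite !reimE.
Unshelve. all: by end_near. Qed.

Lemma continuous_curve (H : 'cV[R]_2 -> R) (c : R -> C) (s : R) :
  {for ofC (c s), continuous H} -> ccont c s -> {for s, continuous (fun u => H (ofC (c u)))}.
Proof.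
move=> /continuous_for_enorm cH cc.
apply: (proj2 (@cvgrPdist_lt _ _ _ (nbhs s) _ (fun u => H (ofC (c u))) (H (ofC (c s))))) => e e0.
have /nbhs_enorm[d d0 hd] := cH e e0.
near=> u; rewrite distrC; apply: hd.
rewrite (_ : ofC (c u) - ofC (c s) = ofC (c u - c s)); last first.
  by apply: cv2P; rewrite !mxE /= ?reimE.
by rewrite -/(cabs _); near: u; exact: ccont_near.
Unshelve. all: by end_near. Qed.

Lemma ccontV (c : R -> C) (s : R) : c s != 0 -> ccont c s -> ccont (fun u => (c u)^-1) s.
Proof.
move=> cs cc; apply: ccont_of_near => e e0.
have c0 : 0 < cabs (c s) by rewrite cabs_gt0.
set m := cabs (c s).
have m2 : 0 < m / 2 by rewrite divr_gt0.
have em : 0 < e * (m * m / 2) by rewrite !mulr_gt0// invr_gt0.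
near=> u.
have h1 : cabs (c u - c s) < m / 2 by near: u; exact: ccont_near.
have h2 : cabs (c u - c s) < e * (m * m / 2) by near: u; exact: ccont_near.
have h3 : m / 2 < cabs (c u).
  by have := cabs_sub (c s) (c u); rewrite -cabsN opprB in h1; rewrite -/m; lra.
have cu : c u != 0 by rewrite -cabs_gt0; lra.
have -> : (c u)^-1 - (c s)^-1 = - (c u - c s) * ((c u)^-1 * (c s)^-1).
  by field; rewrite cu cs.
rewrite !cabsM cabsN !cabsV -/m -invfM ltr_pdivrMr; last by rewrite mulr_gt0//; lra.
apply: lt_le_trans h2 _; rewrite ler_pM2l//; nra.
Unshelve. all: by end_near. Qed.

Lemma cder_lipschitz (c : R -> C) (s : R) l : cder c s l ->
  exists2 L : R, 0 < L & \forall h \near (0 : R), cabs (c (s + h) - c s) <= L * `|h|.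
Proof.
move=> [/is_deriveP/(_ 1 ltr01) c1 /is_deriveP/(_ 1 ltr01) c2].
exists (2 + `|re l| + `|im l|); first by have := normr_ge0 (re l); have := normr_ge0 (im l); lra.
near=> h; apply: le_trans (cabs_le_sum _) _; rewrite !reimE.
have h1 : `|re (c (s + h *: 1)) - re (c s) - h * re l| <= 1 * `|h| by near: h.
have h2 : `|im (c (s + h *: 1)) - im (c s) - h * im l| <= 1 * `|h| by near: h.
rewrite -[h *: 1]/(h * 1) mulr1 in h1 h2.
have := ler_normD (re (c (s + h)) - re (c s) - h * re l) (h * re l).
have := ler_normD (im (c (s + h)) - im (c s) - h * im l) (h * im l).
rewrite !subrK !normrM; lra.
Unshelve. all: by end_near. Qed.

Lemma kernel_expansion (x : C) : x != 0 -> x != 1 ->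
  x / (x - 1) = 1 + x^-1 + x^-1 ^+ 2 + x^-1 ^+ 3 + x^-1 ^+ 4 + x^-1 ^+ 5 + x^-1 ^+ 5 * (x - 1)^-1.
Proof. by move=> x0 x1; field; rewrite x0 subr_eq0 x1. Qed.

Lemma ccontD f g (t : R) : ccont f t -> ccont g t -> ccont (fun s => f s + g s) t.
Proof.
move=> [f1 f2] [g1 g2]; split.
  rewrite (_ : (fun s => _) = (fun s => re (f s) + re (g s))); first exact: continuousD.
  by apply/funext => s; rewrite reD.
rewrite (_ : (fun s => _) = (fun s => im (f s) + im (g s))); first exact: continuousD.
by apply/funext => s; rewrite imD.
Qed.

Lemma cabsD6 (a b c d e f : C) :
  cabs (a + b + c + d + e + f) <= cabs a + cabs b + cabs c + cabs d + cabs e + cabs f.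
Proof.
have := cabsD (a + b + c + d + e) f; have := cabsD (a + b + c + d) e.
have := cabsD (a + b + c) d; have := cabsD (a + b) c; have := cabsD a b; lra.
Qed.

Section Exterior.
Context (G G' : 'cV[R]_2 -> C) (rho A : R).
Context (rho0 : 0 < rho) (dG : forall x, rho < enorm x -> cdiff G x (G' x)).
Context (cG1 : forall x, rho < enorm x -> {for x, continuous (fun y => re (G' y))}).
Context (cG2 : forall x, rho < enorm x -> {for x, continuous (fun y => im (G' y))}).
Context (bG : forall x, rho < enorm x -> cabs (G x) <= A * enorm x).
Context (bG' : forall x, rho < enorm x -> cabs (G' x) <= A).

(** The inversion of G. The factor z^3 outweighs the linear growth of G, so that K = O(|z|^2) is
    differentiable at 0 with derivative 0. [D] is K', it is O(|z|) and hence continuous at 0. Since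
    0^-1 = 0, both vanish at 0 by computation. *)
Let K z : C := z ^+ 3 * G (ofC z^-1).
Let D z : C := 3 * z ^+ 2 * G (ofC z^-1) - z * G' (ofC z^-1).

Let exterior_inv z : z != 0 -> cabs z < rho^-1 -> rho < enorm (ofC z^-1).
Proof.
move=> z0 zr; rewrite -/(cabs _) cabsV -[ltLHS]invrK ltf_pV2 ?posrE ?invr_gt0//.
by rewrite cabs_gt0.
Qed.

Let A0 : 0 <= A.
Proof.
have /bG' : rho < enorm (vec (rho + 1) 0).
  apply: lt_le_trans (_ : rho + 1 <= _); first by lra.
  by have := coord_le (vec (rho + 1) 0) 0; rewrite vec0; apply: le_trans; exact: ler_norm.
by apply: le_trans; exact: cabs_ge0.
Qed.

Let bK z : cabs z < rho^-1 -> cabs (K z) <= A * cabs z ^+ 2.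
Proof.
have [->|z0] := eqVneq z 0.
  by rewrite /K expr0n mul0r (cabs_real 0) normr0 expr0n /= mulr0.
move=> zr; rewrite /K cabsM cabsX.
have := bG (exterior_inv z0 zr); rewrite -/(cabs _) cabsV => h.
have z1 : 0 < cabs z by rewrite cabs_gt0.
have h3 : 0 <= cabs z ^+ 3 by rewrite exprn_ge0 ?ltW.
apply: le_trans (ler_wpM2l h3 h) _.
by rewrite (_ : cabs z ^+ 3 * (A / cabs z) = A * cabs z ^+ 2)//; field; rewrite gt_eqF.
Qed.

Let bD z : cabs z < rho^-1 -> cabs (D z) <= 4 * A * cabs z.
Proof.
have [->|z0] := eqVneq z 0.
  by rewrite /D expr0n mulr0 !mul0r subr0 (cabs_real 0) normr0 mulr0.
move=> zr; apply: le_trans (cabsD _ _) _; rewrite cabsN !cabsM.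
have z1 : 0 < cabs z by rewrite cabs_gt0.
have h1 := bG (exterior_inv z0 zr); rewrite -/(cabs _) cabsV in h1.
have h2 := bG' (exterior_inv z0 zr).
have c3 : cabs (3 : C) = 3.
  by rewrite (_ : 3 = (3 : R)%:C) ?cabs_real ?ger0_norm//; apply: eqC; rewrite /= ?addr0.
have h3 : 0 <= cabs 3 * (cabs z * cabs z) by rewrite !mulr_ge0 ?cabs_ge0.
have := ler_wpM2l h3 h1; have := ler_wpM2l (ltW z1) h2.
rewrite c3 (_ : 3 * (cabs z * cabs z) * (A / cabs z) = 3 * A * cabs z); last by field; rewrite gt_eqF.
by move=> ? ?; lra.
Qed.

Let dK (c : R -> C) s l : cder c s l -> cabs (c s) < rho^-1 ->
  cder (fun u => K (c u)) s (D (c s) * l).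
Proof.
move=> dc cr; have [cs|cs] := eqVneq (c s) 0; last first.
  have d1 := cder_comp (c := fun u => (c u)^-1) (dG (exterior_inv cs cr)) (cderV cs dc).
  by apply: cder_eq (cderM (cderX 3 dc) d1) _; rewrite /D; field.
rewrite cs /D expr0n mulr0 !mul0r subr0 mul0r.
have K0 : K 0 = 0 by rewrite /K expr0n mul0r.
have [L L0 hL] := cder_lipschitz dc.
have key e : 0 < e -> \forall h \near (0 : R), cabs (K (c (s + h)) - K (c s)) <= e * `|h|.
  move=> e0; have r0 : 0 < rho^-1 by rewrite invr_gt0.
  have q0 : 0 < e / (A * L ^+ 2 + 1) by rewrite divr_gt0//; have := mulr_ge0 A0 (sqr_ge0 L); lra.
  have q1 : 0 < rho^-1 / L by rewrite divr_gt0.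
  near=> h; rewrite cs K0 subr0.
  have ch : cabs (c (s + h)) <= L * `|h|.
    have : cabs (c (s + h) - c s) <= L * `|h| by near: h.
    by rewrite cs subr0.
  have h1 : `|h| < rho^-1 / L by near: h; exact: near0_lt.
  have h2 : `|h| < e / (A * L ^+ 2 + 1) by near: h; exact: near0_lt.
  rewrite ltr_pdivlMr// mulrC in h1.
  apply: le_trans (bK (le_lt_trans ch h1)) _.
  have h3 : cabs (c (s + h)) ^+ 2 <= (L * `|h|) ^+ 2 
    by apply: lerXn2r ch; rewrite nnegrE; [exact: cabs_ge0|apply: mulr_ge0 => //; exact: ltW].
  apply: le_trans (ler_wpM2l A0 h3) _.
  rewrite exprMn mulrA expr2 mulrA; apply: ler_wpM2r => //.
  rewrite ltr_pdivlMr in h2; last by have := mulr_ge0 A0 (sqr_ge0 L); lra.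
  by have := normr_ge0 h; lra.
split; apply/is_deriveP => e e0; near=> h; rewrite -[h *: 1]/(h * 1) mulr1 mulr0 subr0.
  have : cabs (K (c (s + h)) - K (c s)) <= e * `|h| by near: h; exact: key.
  by apply: le_trans; have := re_le (K (c (s + h)) - K (c s)); rewrite !reimE.
have : cabs (K (c (s + h)) - K (c s)) <= e * `|h| by near: h; exact: key.
by apply: le_trans; have := im_le (K (c (s + h)) - K (c s)); rewrite !reimE.
Unshelve. all: by end_near. Qed.

Let cD (c : R -> C) s : ccont c s -> cabs (c s) < rho^-1 -> ccont (fun u => D (c u)) s.
Proof.
move=> cc cr; have [cs|cs] := eqVneq (c s) 0; last first.
  have ci := ccontV cs cc; have hx := exterior_inv cs cr.
  have [G1 G2] := dG hx.
  have c1 : ccont (fun u => G (ofC (c u)^-1)) s.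
    split; [apply: (continuous_curve (H := fun y => re (G y)) _ ci)|apply: (continuous_curve (H := fun y => im (G y)) _ ci)].
      exact: fd_continuous G1.
    exact: fd_continuous G2.
  have c2 : ccont (fun u => -1 * G' (ofC (c u)^-1)) s.
    apply: ccontM; first exact: ccont_cst.
    split; [apply: (continuous_curve (H := fun y => re (G' y)) _ ci)|apply: (continuous_curve (H := fun y => im (G' y)) _ ci)].
      exact: cG1.
    exact: cG2.
  have c3 : ccont (fun u => 3 * (c u * c u)) s.
    by apply: ccontM; [exact: ccont_cst|exact: ccontM].
  have [p1 p2] := ccontM c3 c1; have [q1 q2] := ccontM cc c2.
  split.
    rewrite (_ : (fun s0 => _) = (fun u => re (3 * (c u * c u) * G (ofC (c u)^-1)) + re (c u * (-1 * G' (ofC (c u)^-1))))).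
      exact: continuousD.
    by apply/funext => u; rewrite -reD /D expr2 mulN1r mulrN.
  rewrite (_ : (fun s0 => _) = (fun u => im (3 * (c u * c u) * G (ofC (c u)^-1)) + im (c u * (-1 * G' (ofC (c u)^-1))))).
    exact: continuousD.
  by apply/funext => u; rewrite -imD /D expr2 mulN1r mulrN.
apply: ccont_of_near => e e0.
have A0' := A0.
have q0 : 0 < e / (4 * A + 1) by rewrite divr_gt0//; lra.
have r0 : 0 < rho^-1 by rewrite invr_gt0.
near=> u.
have D0 : D (c s) = 0 by rewrite /D cs expr0n mulr0 !mul0r subr0.
have h1 : cabs (c u) < rho^-1.
  have : cabs (c u - c s) < rho^-1 by near: u; exact: ccont_near.
  by rewrite cs subr0.
have h2 : cabs (c u) < e / (4 * A + 1).
  have : cabs (c u - c s) < e / (4 * A + 1) by near: u; exact: ccont_near.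
  by rewrite cs subr0.
rewrite D0 subr0; apply: le_lt_trans (bD h1) _.
rewrite ltr_pdivlMr in h2; last by lra.
by have := cabs_ge0 (c u); lra.
Unshelve. all: by end_near. Qed.

Let r := (2 * rho)^-1.
Let r0 : 0 < r. Proof. by rewrite invr_gt0 mulr_gt0. Qed.
Let rr : r < rho^-1.
Proof. by have h := rho0; rewrite ltf_pV2 ?posrE; lra. Qed.

(** The j-th Taylor coefficient of K at 0, hence the coefficient of x^(3 - j) in G. The circle |z| =
    r corresponds to |x| = 2 rho. *)
Definition laurent_coef (j : nat) : C :=
  (2 * pi)%:C^-1 * CJ (fun a => K (circ r a) * (circ r a)^-1 ^+ j).

Let cr a : cabs (circ r a) < rho^-1. Proof. by rewrite cabs_circ// ltW. Qed.

Let cKj j a : ccont (fun a => K (circ r a) * (circ r a)^-1 ^+ j) a.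
Proof.
apply: ccontM; first exact: cder_ccont (dK (cder_circ r a) (cr a)).
by apply: cder_ccont; apply: cderX; apply: cderV (cder_circ r a); exact: circ_neq0.
Qed.

Let ker x a : C := K (circ r a) * (circ r a)^-1 ^+ 5 * ((circ r a * toC x - 1)^-1) ^+ 1.

Let rest x : C := (2 * pi)%:C^-1 * ((toC x)^-1 * (toC x)^-1 * CJ (ker x)).

Let nz x a : 2 * rho < enorm x -> circ r a * toC x != 1.
Proof.
move=> hx; apply/eqP => h.
have := cabsM (circ r a) (toC x); rewrite h cabs_toC (cabs_circ _ (ltW r0)) (cabs_real 1) normr1 /r => e1.
have : (2 * rho)^-1 * (2 * rho) = 1 by rewrite mulVf//; have := rho0; lra.
have := r0; rewrite /r; nra.
Qed.

Let cker x a : 2 * rho < enorm x -> ccont (ker x) a.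
Proof.
move=> hx; apply: ccontM; first exact: cKj.
apply: cder_ccont; apply: cderX; apply: cderV; first by rewrite subr_eq0; exact: nz.
exact: (cderD (cderM (cder_circ r a) (cder_cst (toC x) a)) (cder_cst (-1) a)).
Qed.

Let twopiC : (2 * pi)%:C != 0 :> C.
Proof. by rewrite -cabs_gt0 cabs_real normr_gt0 gt_eqF// twopi_gt0. Qed.

(** Cauchy's formula for K at 1/x, with the kernel s/(s - 1/x) expanded geometrically in 1/(s x) up
    to the fifth power. The tail (s x)^-5/(s x - 1), multiplied by x^3, gives [rest]. *)
Lemma laurent_exact x : 2 * rho < enorm x ->
  G x = toC x ^+ 3 * laurent_coef 0 + toC x ^+ 2 * laurent_coef 1 + toC x * laurent_coef 2
   + laurent_coef 3 + (toC x)^-1 * laurent_coef 4 + (toC x)^-1 ^+ 2 * laurent_coef 5 + rest x.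
Proof.
move=> hx; set z := toC x; have rp := rho0.
have x0 : 0 < enorm x by lra.
have z0 : z != 0 by rewrite -cabs_gt0 cabs_toC.
have zr : cabs z^-1 < r by rewrite cabsV cabs_toC ltf_pV2 ?posrE; lra.
have bD' w : cabs w < rho^-1 -> cabs (D w) <= 4 * A * rho^-1.
  move=> wr; apply: le_trans (bD wr) _; apply: ler_wpM2l; last exact: ltW.
  by rewrite mulr_ge0//; exact: A0.
have hc := cauchy_formula dK cD bD' rr zr.
have GE : G x = z ^+ 3 * (2 * pi)%:C^-1 * CJ (fun a => K (circ r a) * (circ r a / (circ r a - z^-1))).
  rewrite hc /K invrK toCK; move: twopiC; move: (2 * pi)%:C => p p0.
  by field; rewrite z0 p0.
pose t j a := K (circ r a) * (circ r a)^-1 ^+ j.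
have e1 : CJ (fun a => K (circ r a) * (circ r a / (circ r a - z^-1))) =
   CJ (fun a => t 0%N a + (z^-1 * t 1%N a + (z^-1 ^+ 2 * t 2%N a + (z^-1 ^+ 3 * t 3%N a +
     (z^-1 ^+ 4 * t 4%N a + (z^-1 ^+ 5 * t 5%N a + z^-1 ^+ 5 * ker x a)))))).
  apply: eq_CJ => a; rewrite /t /ker -/z.
  have s0 : circ r a != 0 by exact: circ_neq0.
  have s1 : circ r a * z != 1 by exact: nz.
  have s2 : circ r a * z - 1 != 0 by rewrite subr_eq0.
  have s3 : circ r a - z^-1 != 0.
    by rewrite (_ : circ r a - z^-1 = z^-1 * (circ r a * z - 1)) ?mulf_neq0 ?invr_eq0//; field.
  move: (K (circ r a)) => k; move: (circ r a) s0 s1 s2 s3 => s s0 s1 s2 s3.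
  by field; rewrite z0 s0 s2.
have ct j b : ccont (t j) b by exact: cKj.
have ck b : ccont (ker x) b by exact: cker.
have L c j g : (forall b, ccont g b) ->
    CJ (fun a => c * t j a + g a) = c * CJ (t j) + CJ g /\ forall b, ccont (fun a => c * t j a + g a) b.
  move=> cg.
  have h b : ccont (fun a => c * t j a) b by apply: ccontM; [exact: ccont_cst|exact: ct].
  by split; [rewrite (CJD h cg) CJZ|move=> b; apply: ccontD].
have c6 b : ccont (fun a => z^-1 ^+ 5 * ker x a) b by apply: ccontM; [exact: ccont_cst|exact: ck].
have [e5 c5] := L (z^-1 ^+ 5) 5%N _ c6.
have [e4 c4] := L (z^-1 ^+ 4) 4%N _ c5.
have [e3 c3] := L (z^-1 ^+ 3) 3%N _ c4.
have [e2 c2] := L (z^-1 ^+ 2) 2%N _ c3.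
have [e0 c1] := L z^-1 1%N _ c2.
have lc j : laurent_coef j = (2 * pi)%:C^-1 * CJ (t j) by [].
have rE : rest x = (2 * pi)%:C^-1 * (z^-1 * z^-1 * CJ (ker x)) by [].
rewrite GE e1 (CJD (ct 0%N) c1) e0 e2 e3 e4 e5 (CJZ _ ck) !lc rE.
move: (CJ (ker x)) (CJ (t 0%N)) (CJ (t 1%N)) (CJ (t 2%N)) (CJ (t 3%N)) (CJ (t 4%N)) (CJ (t 5%N)) => q0 q1 q2 q3 q4 q5 q6.
move: twopiC; move: (2 * pi)%:C => p p0.
by field; rewrite z0 p0.
Qed.

Let laurent_coef0 : laurent_coef 0 = 0.
Proof.
have bD' w : cabs w < rho^-1 -> cabs (D w) <= 4 * A * rho^-1.
  move=> wr; apply: le_trans (bD wr) _; apply: ler_wpM2l; last exact: ltW.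
  by rewrite mulr_ge0//; exact: A0.
have c0 : cabs 0 < r by rewrite (cabs_real 0) normr0; exact: r0.
have := cauchy_formula dK cD bD' rr c0.
rewrite /K expr0n mul0r mulr0 => h; rewrite /laurent_coef -[RHS](mulr0 (2 * pi)%:C^-1); congr (_ * _).
rewrite -h; apply: eq_CJ => a; rewrite subr0 expr0; congr (_ * _).
by rewrite mulfV// circ_neq0.
Qed.

(** [rest] is x^-2 times an integral of the first power of the kernel. *)
Let rest_sym k : CSym k (- 3) rest.
Proof.
apply: CSymZ; rewrite -[- 3]/(- 1 - 1 - 1%:Z : int); apply: CSymM.
  by apply: CSymM; exact: CSym_inv.
have bf a : cabs (K (circ r a) * (circ r a)^-1 ^+ 5) <= A * r ^+ 2 * r^-1 ^+ 5; last first.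
  exact: (kernel_sym k 1 r0 (cKj 5%N) bf).
rewrite cabsM cabsX cabsV (cabs_circ _ (ltW r0)); apply: ler_wpM2r.
  by rewrite exprn_ge0// invr_ge0 ltW.
by have := bK (cr a); rewrite (cabs_circ _ (ltW r0)).
Qed.

(** All other terms are O(|x|), so |x|^2 times the modulus of this coefficient is at most M|x|;
    unless the coefficient vanishes, this fails once |x| exceeds M divided by that modulus. *)
Let laurent_coef1 : laurent_coef 1 = 0.
Proof.
have [/Sym_bound_gt0[B B0 hB] /Sym_bound_gt0[B' B'0 hB']] := rest_sym 0.
set L := laurent_coef.
have c0 (w : C) := cabs_ge0 w.
have rho2 : rho < 2 * rho by have := rho0; lra.
pose M := A + cabs (L 2%N) + cabs (L 3%N) + cabs (L 4%N) + cabs (L 5%N) + B + B'.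
apply/eqP; apply: contraT; rewrite -cabs_gt0 => L1.
suff : False by [].
have [x] : \forall x \near at_inf, [/\ 2 * rho < enorm x, 1 < enorm x, M / cabs (L 1%N) < enorm x,
   `|re (rest x)| <= B * enorm x ^ (- 3) & `|im (rest x)| <= B' * enorm x ^ (- 3)].
  by near=> x; split; near: x => //; exact: at_inf_gt.
move=> /(_ (vec (`|x| + 1) 0)) [].
  have hx := coord_le (vec (`|x| + 1) 0) 0; rewrite vec0 in hx; apply: lt_le_trans hx.
  by rewrite ger0_norm ?addr_ge0//; apply: le_lt_trans (ler_norm x) _; rewrite ltrDl ltr01.
move: (vec _ _) => {}x x2 x1 xM h1 h2.
have := laurent_exact x2; rewrite laurent_coef0 mulr0 add0r -/L => h.
have x0 : 0 < enorm x by exact: lt_trans ltr01 x1.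
have e1 : toC x ^+ 2 * L 1%N = G x + - (toC x * L 2%N) + - L 3%N + - ((toC x)^-1 * L 4%N) + - ((toC x)^-1 ^+ 2 * L 5%N) + - rest x.
  by rewrite h; ring.
have v1 : (enorm x)^-1 <= 1 by rewrite invf_le1// ltW.
have v0 : 0 < (enorm x)^-1 by rewrite invr_gt0.
have r3 : enorm x ^ (- 3) <= 1.
  by rewrite -[- 3]/(- 3%:Z) -exprnN invf_le1 ?exprn_gt0// exprn_ege1// ltW.
have e2 : cabs (toC x ^+ 2 * L 1%N) <= M * enorm x.
  move: h1 h2 r3; move: (enorm x ^ (- 3)) => u; rewrite e1 /M.
  move: (rest x) (L 2%N) (L 3%N) (L 4%N) (L 5%N) => q l2 l3 l4 l5 h1 h2 r3; apply: le_trans (cabsD6 _ _ _ _ _ _) _; rewrite !cabsN !cabsM !cabsV !cabs_toC.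
  have uX : u <= enorm x by exact: le_trans r3 (ltW x1).
  have vX : (enorm x)^-1 <= enorm x by exact: le_trans v1 (ltW x1).
  have v2 : (enorm x)^-1 * (enorm x)^-1 <= enorm x by apply: le_trans (ltW x1); rewrite mulr_ile1// ltW.
  rewrite !mulrDl -(addrA _ (B * enorm x)); apply: lerD; last first.
    apply: le_trans (cabs_le_sum _) _; apply: lerD.
      exact: le_trans h1 (ler_wpM2l (ltW B0) uX).
    exact: le_trans h2 (ler_wpM2l (ltW B'0) uX).
  apply: lerD; last by rewrite mulrC; exact: ler_wpM2l.
  apply: lerD; last by rewrite mulrC; exact: ler_wpM2l.
  apply: lerD; last by rewrite -[leLHS]mulr1; apply: ler_wpM2l => //; exact: ltW.
  apply: lerD; last by rewrite mulrC.
  by apply: bG; exact: lt_trans x2.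
move: e2; rewrite cabsM cabsX cabs_toC expr2 -mulrA mulrC ler_pM2r// leNgt => /negP; apply.
by rewrite -ltr_pdivrMr.
Unshelve. all: by end_near. Qed.

Lemma laurent_sym k :
  CSym k (- 3) (fun x => G x - (toC x * laurent_coef 2 + laurent_coef 3 + (toC x)^-1 * laurent_coef 4
     + (toC x)^-1 ^+ 2 * laurent_coef 5)).
Proof.
apply: CSym_eq (rest_sym k); exists (2 * rho) => x /laurent_exact ->.
by rewrite laurent_coef0 laurent_coef1; ring.
Qed.

Lemma laurent_coef4 :
  laurent_coef 4 = (2 * pi)%:C^-1 * CJ (fun a => G (ofC (circ r a)^-1) * (circ r a)^-1).
Proof.
congr (_ * _); apply: eq_CJ => a; rewrite /K.
have := circ_neq0 a r0; move: (G (ofC (circ r a)^-1)) => g; move: (circ r a) => s s0; field.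
by rewrite s0.
Qed.

(** With s = circ r a, the integrands s G(1/s) and G'(1/s) differ by the derivative of -i s G(1/s),
    which integrates to zero. Written as a mean of G', the leading coefficient inherits bounds on
    G'. *)
Lemma laurent_coef2 :
  laurent_coef 2 = (2 * pi)%:C^-1 * CJ (fun a => G' (ofC (circ r a)^-1)).
Proof.
congr (_ * _).
have cG'1 b : ccont (fun a => G' (ofC (circ r a)^-1)) b.
  have ci : ccont (fun a => (circ r a)^-1) b.
    by apply: ccontV; [exact: circ_neq0|exact: cder_ccont (cder_circ r b)].
  have hx := exterior_inv (circ_neq0 b r0) (cr b).
  by split; [apply: (continuous_curve (H := fun y => re (G' y)) _ ci); exact: cG1|
    apply: (continuous_curve (H := fun y => im (G' y)) _ ci); exact: cG2].
pose f a : C := K (circ r a) * (circ r a)^-1 ^+ 2 + -1 * G' (ofC (circ r a)^-1).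
have cf b : ccont f b.
  by apply: ccontD; [exact: cKj|apply: ccontM; [exact: ccont_cst|]].
have f0 : CJ f = 0.
  apply: (CJ_derive (F := fun a => (- 'i) * (circ r a * G (ofC (circ r a)^-1)))) => // [a|]; last by rewrite circ_2pi.
  have s0 := circ_neq0 a r0.
  have d1 := cder_comp (c := fun u => (circ r u)^-1) (dG (exterior_inv s0 (cr a))) (cderV s0 (cder_circ r a)).
  apply: cder_eq (cderZ _ (cderM (cder_circ r a) d1)) _.
  rewrite /f /K; move: (G (ofC (circ r a)^-1)) (G' (ofC (circ r a)^-1)) => g g'; move: (circ r a) s0 => s s0.
  rewrite (_ : - 'i * ('i * s * g + s * (g' * - ('i * s * (s^-1 / s)))) = - ('i ^+ 2) * (s * g - g')).
    by rewrite sqr_i; field.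
  by field.
have := CJD (cKj 2%N) (g := fun a => -1 * G' (ofC (circ r a)^-1)).
rewrite -/f f0 CJZ// => h; have := h (fun b => ccontM (ccont_cst _ b) (cG'1 b)).
by rewrite mulN1r => /esym/eqP; rewrite subr_eq0 => /eqP.
Qed.

End Exterior.
End LaurentExpansion.

(** * Symmetry of second derivatives, and integration of gradient bounds outside a disc *)

Section Exterior.
Context {R : realType}.
Implicit Types (x y z : 'cV[R]_2) (f g : 'cV[R]_2 -> R).

(** The second difference of f over a square of side h equals h times an increment of p0, and also h
    times an increment of p1. Differentiability of p0 and p1 at x evaluates these increments as a10
    h and a01 h up to e h. *)
Lemma Young f x (p0 p1 : 'cV[R]_2 -> R) a00 a10 a01 a11 :
  (\forall y \near x, is_derive y (delta_mx 0 0 : 'cV[R]_2) f (p0 y)) ->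
  (\forall y \near x, is_derive y (delta_mx 1 0 : 'cV[R]_2) f (p1 y)) ->
  fd p0 x a00 a10 -> fd p1 x a01 a11 -> a10 = a01.
Proof.
move=> d0 d1 f0 f1; apply/eqP; rewrite -subr_eq0 -normr_le0.
apply/ler_addgt0Pr => e e0; rewrite add0r.
have e8 : 0 < e / 8 by lra.
have /nbhs_enorm[d dp hd] : \forall y \near x,
  [/\ is_derive y (delta_mx 0 0 : 'cV[R]_2) f (p0 y), is_derive y (delta_mx 1 0 : 'cV[R]_2) f (p1 y),
   `|p0 y - p0 x - (a00 * (y 0 0 - x 0 0) + a10 * (y 1 0 - x 1 0))| <= e / 8 * enorm (y - x) &
   `|p1 y - p1 x - (a01 * (y 0 0 - x 0 0) + a11 * (y 1 0 - x 1 0))| <= e / 8 * enorm (y - x)].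
  by near=> y; split; near: y => //; [exact: f0|exact: f1].
pose h := d / 3.
have h0 : 0 < h by rewrite /h; lra.
pose P (s t : R) := x + vec s t.
have Psub s t : P s t - x = vec s t by rewrite /P addrAC subrr add0r.
have Pe s t : 0 <= s <= h -> 0 <= t <= h -> enorm (P s t - x) <= 2 * h.
  move=> /andP[s0 s1] /andP[t0 t1]; rewrite Psub; apply: le_trans (enorm_le_sum _) _.
  by rewrite vec0 vec1 !ger0_norm//; lra.
have Pd s t : 0 <= s <= h -> 0 <= t <= h -> enorm (P s t - x) < d.
  by move=> hs ht; apply: le_lt_trans (Pe _ _ hs ht) _; rewrite /h; lra.
have L0 (s t : R) : P s t = P 0 t + s *: delta_mx 0 0.
  by apply: cv2P; rewrite !mxE /=; ring.
have L1 (s t : R) : P s t = P s 0 + t *: delta_mx 1 0.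
  by apply: cv2P; rewrite !mxE /=; ring.
have D0 s t : 0 <= s <= h -> 0 <= t <= h -> is_derive s (1:R) (fun s => f (P s t)) (p0 (P s t)).
  move=> hs ht; have [k _ _ _] := hd _ (Pd _ _ hs ht); rewrite L0 in k.
  have := is_derive_line k; rewrite -L0; congr is_derive.
  by apply/funext => u; rewrite -L0.
have D1 s t : 0 <= s <= h -> 0 <= t <= h -> is_derive t (1:R) (fun t => f (P s t)) (p1 (P s t)).
  move=> hs ht; have [_ k _ _] := hd _ (Pd _ _ hs ht); rewrite L1 in k.
  have := is_derive_line k; rewrite -L1; congr is_derive.
  by apply/funext => u; rewrite -L1.
have hh : 0 <= h <= h by rewrite lexx ltW.
have h00 : 0 <= (0 : R) <= h by rewrite lexx ltW.
have scale (phi dphi : R -> R) := @MVT_cc _ phi dphi 0 h (ltW h0).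
pose Del := f (P h h) - f (P h 0) - f (P 0 h) + f (P 0 0).
have [s hs es] : exists2 s, 0 <= s <= h & Del = (p0 (P s h) - p0 (P s 0)) * h.
  have [|s hs es] := scale (fun s => f (P s h) - f (P s 0)) (fun s => p0 (P s h) - p0 (P s 0)).
    by move=> s hs; apply: is_deriveB; exact: D0.
  by exists s => //; move: es; rewrite subr0 => <-; rewrite /Del; ring.
have [t ht et] : exists2 t, 0 <= t <= h & Del = (p1 (P h t) - p1 (P 0 t)) * h.
  have [|t ht et] := scale (fun t => f (P h t) - f (P 0 t)) (fun t => p1 (P h t) - p1 (P 0 t)).
    by move=> t ht; apply: is_deriveB; exact: D1.
  by exists t => //; move: et; rewrite subr0 => <-; rewrite /Del; ring.
have {}est : p0 (P s h) - p0 (P s 0) = p1 (P h t) - p1 (P 0 t).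
  by apply: (mulIf (lt0r_neq0 h0)); rewrite -es -et.
have b1 u v : 0 <= u <= h -> 0 <= v <= h -> `|p0 (P u v) - p0 x - (a00 * u + a10 * v)| <= e / 8 * (2 * h).
  move=> hu hv; have [_ _ k _] := hd _ (Pd _ _ hu hv); move: k.
  have -> : P u v 0 0 - x 0 0 = u by rewrite !mxE /=; ring.
  have -> : P u v 1 0 - x 1 0 = v by rewrite !mxE /=; ring.
  by move=> /le_trans; apply; apply: ler_wpM2l; [exact: ltW|exact: Pe].
have b2 u v : 0 <= u <= h -> 0 <= v <= h -> `|p1 (P u v) - p1 x - (a01 * u + a11 * v)| <= e / 8 * (2 * h).
  move=> hu hv; have [_ _ _ k] := hd _ (Pd _ _ hu hv); move: k.
  have -> : P u v 0 0 - x 0 0 = u by rewrite !mxE /=; ring.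
  have -> : P u v 1 0 - x 1 0 = v by rewrite !mxE /=; ring.
  by move=> /le_trans; apply; apply: ler_wpM2l; [exact: ltW|exact: Pe].
have := b1 s h hs hh; have := b1 s 0 hs h00; have := b2 h t hh ht; have := b2 0 t h00 ht.
rewrite !ler_norml => /andP[? ?] /andP[? ?] /andP[? ?] /andP[? ?].
have hF : `|(a10 - a01) * h| <= e * h by rewrite ler_norml; apply/andP; split; lra.
have nh : `|h| = h by rewrite ger0_norm// ltW.
by rewrite normrM nh (ler_pM2r h0) in hF; rewrite -ler_norml.
Unshelve. all: by end_near. Qed.

Lemma polar x : exists2 t : R, `|t| <= pi & x = ofC (circ (enorm x) t).
Proof.
have [r0|r0] := eqVneq (enorm x) 0.
  exists 0; first by rewrite normr0 pi_ge0.
  by rewrite r0 (enorm0_eq r0); apply: cv2P; rewrite !mxE /= mul0r.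
have rp : 0 < enorm x by rewrite lt0r r0 enorm_ge0.
set a := x 0 0 / enorm x; set b := x 1 0 / enorm x.
have ab : a ^+ 2 + b ^+ 2 = 1.
  by rewrite /a /b !expr_div_n -mulrDl -enorm_sqr mulfV// expf_neq0.
have ha : -1 <= a <= 1 by apply/andP; split; nra.
have c1 : cos (acos a) = a by apply: acosK; rewrite in_itv.
have s1 : sin (acos a) = `|b|.
  by rewrite sin_acos// -sqrtr_sqr; congr Num.sqrt; lra.
have t0 := acos_ge0 ha; have t1 := acos_lepi ha.
have xa : x 0 0 = enorm x * a by rewrite /a; field.
have xb : x 1 0 = enorm x * b by rewrite /b; field.
have [b0|b0] := leP 0 b.
  exists (acos a); first by rewrite ger0_norm.
  by apply: cv2P; rewrite !mxE /= ?c1 ?s1 ?(ger0_norm b0).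
exists (- acos a); first by rewrite normrN ger0_norm.
apply: cv2P; rewrite !mxE /= ?cosN ?sinN ?c1 ?s1//.
by rewrite (ltr0_norm b0) opprK.
Qed.

Lemma enorm_circ (r t : R) : 0 <= r -> enorm (ofC (circ r t)) = r.
Proof. exact: cabs_circ. Qed.

(** Every point of the circle is within angle pi of the point of angle 0. On that arc each gradient
    component contributes at most pi B r, so each value differs from the reference value by at most
    2 pi B r. *)
Lemma arc_osc f (a b : 'cV[R]_2 -> R) (r B : R) : 0 <= r ->
  (forall y, enorm y = r -> [/\ fd f y (a y) (b y), `|a y| <= B & `|b y| <= B]) ->
  forall x y, enorm x = r -> enorm y = r -> `|f x - f y| <= 4 * pi * B * r.
Proof.
move=> r0 hf.
have key t : `|t| <= pi -> `|f (ofC (circ r t)) - f (ofC (circ r 0))| <= 2 * pi * B * r.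
  move=> tpi.
  have dl := @is_derive_linear R t.
  have [|s _] := MVT01 (phi := fun s => f (ofC (circ r (t * s))))
    (dphi := fun s => a (ofC (circ r (t * s))) * (- (r * sin (t * s)) * t) + b (ofC (circ r (t * s))) * ((r * cos (t * s)) * t)).
    move=> s _; have [fy _ _] := hf _ (enorm_circ (t * s) r0).
    apply: (fd_curve (c0 := fun s => r * cos (t * s)) (c1 := fun s => r * sin (t * s)) fy).
      have [h _] := cder_circ r (t * s).
      have := is_derive_outer h (dl s); rewrite /= mul0r mul1r sub0r; exact.
    have [_ h] := cder_circ r (t * s).
    by have := is_derive_outer h (dl s); rewrite /= mul0r mul1r add0r; exact.
  rewrite mulr0 mulr1 => ->; have [_ ha hb] := hf _ (enorm_circ (t * s) r0).
  have B0 : 0 <= B by apply: le_trans ha.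
  have t0 := normr_ge0 t.
  have sc : `|r * sin (t * s)| <= r.
    by rewrite normrM (ger0_norm r0) -[leRHS]mulr1 ler_wpM2l// ler_norml sin_geN1 sin_le1.
  have cc : `|r * cos (t * s)| <= r.
    by rewrite normrM (ger0_norm r0) -[leRHS]mulr1 ler_wpM2l// ler_norml cos_geN1 cos_le1.
  have h1 : `|- (r * sin (t * s)) * t| <= r * pi by rewrite normrM normrN; apply: ler_pM.
  have h2 : `|r * cos (t * s) * t| <= r * pi by rewrite normrM; apply: ler_pM.
  have h3 := ler_pM (normr_ge0 _) (normr_ge0 _) ha h1.
  have h4 := ler_pM (normr_ge0 _) (normr_ge0 _) hb h2.
  rewrite -!normrM in h3 h4.
  by apply: le_trans (ler_normD _ _) _; apply: le_trans (lerD h3 h4) _; lra.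
move=> x y xr yr; have [t /key ht ex] := polar x; have [u /key hu ey] := polar y.
rewrite xr in ex; rewrite yr in ey; rewrite ex ey.
set p := f _ in ht *; set q := f (ofC (circ r u)) in hu *; set o := f _ in ht hu.
rewrite (_ : p - q = (p - o) - (q - o)); last by ring.
apply: le_trans (ler_normB _ _) _; lra.
Qed.

(** Integrating a gradient of size |x|^-3 along rays and circles bounds the oscillation of f beyond
    |x| by a multiple of |x|^-2, so f is Cauchy at infinity. *)
Lemma exterior_limit f (a b : 'cV[R]_2 -> R) (rho B : R) : 0 < rho ->
  (forall y, rho < enorm y -> [/\ fd f y (a y) (b y), `|a y| <= B * (enorm y)^-1 ^+ 3
     & `|b y| <= B * (enorm y)^-1 ^+ 3]) ->
  exists g C : R, forall x, rho < enorm x -> `|f x - g| <= C * (enorm x)^-1 ^+ 2.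
Proof.
move=> rho0 hf.
(* The ray is parametrised as x/s with s in [t, 1]: the speed |x|/s^2 against the gradient bound B
   (s/|x|)^3 leaves B s/|x|^2, which is bounded, so the mean value theorem suffices on an
   arbitrarily long ray. *)
have ray x t : rho < enorm x -> 0 < t <= 1 -> `|f (t^-1 *: x) - f x| <= 2 * B * (enorm x)^-1 ^+ 2.
  move=> hx /andP[t0 t1]; have x0 : 0 < enorm x by exact: lt_trans hx.
  have hs s : t <= s <= 1 -> rho < enorm (s^-1 *: x) /\ (enorm (s^-1 *: x))^-1 = s * (enorm x)^-1.
    move=> /andP[s0 s1]; have sp : 0 < s by exact: lt_le_trans s0.
    rewrite enormZ ger0_norm ?invr_ge0 ?ltW//; split; last by rewrite invfM invrK.
    apply: lt_le_trans hx _; rewrite -[leLHS]mul1r; apply: ler_wpM2r => //.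
    by rewrite invf_ge1.
  have vE s : s^-1 *: x = vec (x 0 0 * s^-1) (x 1 0 * s^-1).
    by apply: cv2P; rewrite !mxE /= mulrC.
  have [|s hst] := MVT_cc t1 (phi := fun s => f (s^-1 *: x)) (dphi := fun s =>
     a (s^-1 *: x) * (x 0 0 * - (1 * (s^-1 * s^-1))) + b (s^-1 *: x) * (x 1 0 * - (1 * (s^-1 * s^-1)))).
    move=> s hst; have [ys _] := hs s hst; have [fy _ _] := hf _ ys.
    have s0 : s != 0 by have /andP[] := hst; lra.
    have di : is_derive s (1:R) (fun u : R => u^-1) (- (1 * (s^-1 * s^-1))).
      exact: (is_derive_inv (f := id) s0 (is_derive_id s (1:R))).
    rewrite vE in fy *.
    have := fd_curve (c0 := fun s => x 0 0 * s^-1) (c1 := fun s => x 1 0 * s^-1) fy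
      (is_derive_outer (is_derive_linear _ _) di) (is_derive_outer (is_derive_linear _ _) di).
    by congr is_derive; apply/funext => u; rewrite vE.
  have [ys yi] := hs s hst; have [_ ha hb] := hf _ ys; rewrite yi in ha hb.
  have /andP[s0 s1] := hst; have sp : 0 < s by exact: lt_le_trans s0.
  rewrite invr1 scale1r distrC => ->.
  have x0' := coord_le x 0; have x1' := coord_le x 1.
  have bnd (q c : R) : `|q| <= B * (s / enorm x) ^+ 3 -> `|c| <= enorm x ->
      `|q * (c * - (1 * (s^-1 * s^-1)))| <= B * (enorm x)^-1 ^+ 2 * s.
    move=> hq hc.
    have sq : 0 <= s^-1 * s^-1 by rewrite mulr_ge0 ?invr_ge0 ?ltW.
    have hcs : `|c * - (1 * (s^-1 * s^-1))| <= enorm x * (s^-1 * s^-1).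
      by rewrite normrM normrN mul1r (ger0_norm sq); apply: ler_wpM2r.
    have := ler_pM (normr_ge0 _) (normr_ge0 _) hq hcs; rewrite -normrM => /le_trans; apply.
    rewrite (_ : B * (s / enorm x) ^+ 3 * (enorm x * (s^-1 * s^-1)) = B * (enorm x)^-1 ^+ 2 * s)//.
    by field; rewrite !gt_eqF.
  have k1 := bnd _ _ ha x0'; have k2 := bnd _ _ hb x1'.
  rewrite normrM; apply: le_trans (_ : 2 * B * (enorm x)^-1 ^+ 2 * s * `|1 - t| <= _).
    by apply: ler_wpM2r => //; apply: le_trans (ler_normD _ _) _; lra.
  have B0 : 0 <= 2 * B * (enorm x)^-1 ^+ 2.
    have e3 : 0 < (enorm x)^-1 ^+ 2 by rewrite exprn_gt0// invr_gt0.
    have : 0 <= B * (enorm x)^-1 ^+ 2 * s by apply: le_trans k1.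
    by rewrite pmulr_lge0//; lra.
  rewrite -mulrA -[leRHS]mulr1; apply: ler_wpM2l => //; rewrite ger0_norm; last by lra.
  by rewrite mulr_ile1//; lra.
have arc x y : rho < enorm x -> enorm x = enorm y -> `|f x - f y| <= 4 * pi * B * (enorm x)^-1 ^+ 2.
  move=> hx xy; have x0 : 0 < enorm x by exact: lt_trans hx.
  have := @arc_osc f a b (enorm x) (B * (enorm x)^-1 ^+ 3) (enorm_ge0 x) _ x y erefl (esym xy).
  rewrite (_ : 4 * pi * (B * (enorm x)^-1 ^+ 3) * enorm x = 4 * pi * B * (enorm x)^-1 ^+ 2).
    by apply => z zx; have := hf z; rewrite zx; exact.
  by field; rewrite gt_eqF.
pose C := 2 * B + 4 * pi * B.
have osc x y : rho < enorm x -> enorm x <= enorm y -> `|f y - f x| <= C * (enorm x)^-1 ^+ 2.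
  move=> hx xy; have x0 : 0 < enorm x by exact: lt_trans hx.
  have y0 : 0 < enorm y by exact: lt_le_trans xy.
  pose t := enorm x / enorm y.
  have ht : 0 < t <= 1 by rewrite divr_gt0//= ler_pdivrMr// mul1r.
  have [t0 _] := andP ht.
  have ty : enorm (t *: y) = enorm x by rewrite enormZ ger0_norm ?ltW// /t divfK ?gt_eqF.
  have := ray (t *: y) t; rewrite ty scalerA mulVf ?gt_eqF// scale1r => /(_ hx ht) h1.
  have h2 := arc x (t *: y) hx (esym ty).
  rewrite (_ : f y - f x = (f y - f (t *: y)) - (f x - f (t *: y))); last by ring.
  by apply: le_trans (ler_normB _ _) _; rewrite /C; lra.
have osc2 x y : rho < enorm x -> rho < enorm y -> `|f y - f x| <= C * (enorm x)^-1 ^+ 2 + C * (enorm y)^-1 ^+ 2.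
  move=> hx hy; have [xy|yx] := leP (enorm x) (enorm y).
    apply: le_trans (osc _ _ hx xy) _; rewrite lerDl.
    apply: le_trans (normr_ge0 (f y - f y)) (osc y y hy (lexx _)).
  rewrite distrC; apply: le_trans (osc _ _ hy (ltW yx)) _; rewrite lerDr.
  apply: le_trans (normr_ge0 (f x - f x)) (osc x x hx (lexx _)).
(* Every number f y - C|y|^-2 lies below every f x + C|x|^-2; the limit is the supremum of the
   former. *)
pose S := [set f y - C * (enorm y)^-1 ^+ 2 | y in [set y | rho < enorm y]].
have Sub x : rho < enorm x -> ubound S (f x + C * (enorm x)^-1 ^+ 2).
  move=> hx _ [y /= hy <-]; have := osc2 x y hx hy; rewrite ler_norml => /andP[_].
  by lra.
have [e he] : exists e : 'cV[R]_2, rho < enorm e.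
  exists (vec (rho + 1) 0); have := coord_le (vec (rho + 1) 0) 0; rewrite vec0.
  by rewrite ger0_norm; lra.
have S0 : S !=set0 by exists (f e - C * (enorm e)^-1 ^+ 2), e.
have hS : has_sup S by split=> //; exists (f e + C * (enorm e)^-1 ^+ 2); exact: Sub.
exists (sup S), C => x hx; rewrite ler_norml; apply/andP; split.
  have : sup S <= f x + C * (enorm x)^-1 ^+ 2 by apply: ge_sup => //; exact: Sub.
  lra.
have : f x - C * (enorm x)^-1 ^+ 2 <= sup S by apply: sup_upper_bound => //; exists x.
lra.
Qed.

(** To stay outside the disc, [x] is moved radially to the circle of radius rho + 1, and from there
    along an arc to a fixed point [e]. *)
Lemma exterior_growth f (a b : 'cV[R]_2 -> R) (rho B : R) : 0 < rho ->
  (forall y, rho < enorm y -> [/\ fd f y (a y) (b y), `|a y| <= B & `|b y| <= B]) ->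
  exists C : R, forall x, rho + 1 < enorm x -> `|f x| <= C * enorm x.
Proof.
move=> rho0 hf; pose r := rho + 1.
have [e he] : exists e : 'cV[R]_2, enorm e = r.
  by exists (ofC (circ r 0)); rewrite enorm_circ// /r; lra.
exists (2 * B + 4 * pi * B + `|f e|) => x hx.
have x0 : 0 < enorm x by lra.
pose y := (r / enorm x) *: x.
have r0 : 0 < r by rewrite /r; lra.
have yr : enorm y = r by rewrite enormZ ger0_norm ?divfK ?gt_eqF// divr_ge0 ?ltW.
have B0 : 0 <= B by have [|_ h _] := hf x; [lra|apply: le_trans h].
have h1 : `|f y - f e| <= 4 * pi * B * r.
  apply: (@arc_osc _ a b) => //; first exact: ltW.
  by move=> z zr; apply: hf; rewrite zr /r; lra.
have seg s : 0 <= s <= 1 -> rho < enorm (y + s *: (x - y)).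
  move=> /andP[s0 s1].
  have -> : y + s *: (x - y) = (r / enorm x + s * (1 - r / enorm x)) *: x.
    rewrite /y; apply: cv2P; rewrite !mxE; ring.
  have rx : r / enorm x <= 1 by rewrite ler_pdivrMr// mul1r ltW.
  have q0 : 0 < r / enorm x by rewrite divr_gt0.
  rewrite enormZ ger0_norm; last by nra.
  apply: lt_le_trans (_ : r / enorm x * enorm x <= _); last by rewrite ler_pM2r//; nra.
  by rewrite divfK ?gt_eqF// /r; lra.
have [s hs] := MVT_line (fun s hs => fd_derive (x - y) (let: And3 h _ _ := hf _ (seg s hs) in h)).
have [_ ha hb] := hf _ (seg s hs).
rewrite (addrC y) subrK => e1.
have xy : enorm (x - y) <= enorm x.
  have -> : x - y = (1 - r / enorm x) *: x by rewrite /y scalerBl scale1r.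
  rewrite enormZ ger0_norm; last by rewrite subr_ge0 ler_pdivrMr// mul1r ltW.
  by rewrite -[leRHS]mul1r ler_pM2r// lerBlDr lerDl divr_ge0 ?ltW.
have c0 := le_trans (coord_le (x - y) 0) xy; have c1 := le_trans (coord_le (x - y) 1) xy.
have h2 : `|f x - f y| <= 2 * B * enorm x.
  rewrite e1; apply: le_trans (ler_normD _ _) _; rewrite !normrM.
  have := ler_pM (normr_ge0 _) (normr_ge0 _) ha c0.
  have := ler_pM (normr_ge0 _) (normr_ge0 _) hb c1; lra.
have x1 : 1 <= enorm x by rewrite -/r in hx; rewrite /r in hx; lra.
have h3 : 4 * pi * B * r <= 4 * pi * B * enorm x.
  by apply: ler_wpM2l; [rewrite !mulr_ge0// pi_ge0|exact: ltW].
have h4 := ler_wpM2l (normr_ge0 (f e)) x1.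
rewrite (_ : f x = (f x - f y) + (f y - f e) + f e); last by ring.
apply: le_trans (ler_normD _ _) _; have := ler_normD (f x - f y) (f y - f e).
lra.
Qed.

End Exterior.

(** * Expansion of harmonic functions near infinity *)

Section HarmonicExpansion.
Context {R : realType}.
Local Open Scope complex_scope.
Local Notation C := R[i].
Implicit Types (x y z : 'cV[R]_2).
Local Notation re := (@complex.Re R).
Local Notation im := (@complex.Im R).

(** The real part of k z^2/2 + l z + 2d log z + w/z, with k = k0 - i k1, l = l0 - i l1 and w = w0 +
    i w1. *)
Definition expansion (k0 k1 l0 l1 d w0 w1 : R) (x : 'cV[R]_2) : R :=
  l0 * x 0 0 + l1 * x 1 0 + (k0 / 2 * (x 0 0 * x 0 0 - x 1 0 * x 1 0) + k1 * (x 0 0 * x 1 0))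
  + d * ln (x 0 0 * x 0 0 + x 1 0 * x 1 0)
  + (w0 * x 0 0 + w1 * x 1 0) * (x 0 0 * x 0 0 + x 1 0 * x 1 0)^-1.

Definition expansion_grad (k0 k1 l0 l1 d w0 w1 : R) (v x : 'cV[R]_2) : R :=
  let N := x 0 0 * x 0 0 + x 1 0 * x 1 0 in
  l0 * v 0 0 + l1 * v 1 0 + k0 * (x 0 0 * v 0 0 - x 1 0 * v 1 0) + k1 * (v 0 0 * x 1 0 + x 0 0 * v 1 0)
  + d * (N^-1 * (2 * (x 0 0 * v 0 0 + x 1 0 * v 1 0))) + (w0 * v 0 0 + w1 * v 1 0) * N^-1
  - (w0 * x 0 0 + w1 * x 1 0) * (2 * (x 0 0 * v 0 0 + x 1 0 * v 1 0) * (N^-1 * N^-1)).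

Lemma enorm2_gt0 x : 0 < enorm x -> 0 < x 0 0 * x 0 0 + x 1 0 * x 1 0.
Proof. by move=> x0; rewrite -!expr2 -enorm_sqr exprn_gt0. Qed.

Lemma is_derive_expansion k0 k1 l0 l1 d w0 w1 x v : 0 < enorm x ->
  is_derive x v (expansion k0 k1 l0 l1 d w0 w1) (expansion_grad k0 k1 l0 l1 d w0 w1 v x).
Proof.
move=> /enorm2_gt0 N0.
have c0 := is_derive_coord x v 0; have c1 := is_derive_coord x v 1.
have cZ (c l : R) (f : 'cV[R]_2 -> R) : is_derive x v f l -> is_derive x v (fun y => c * f y) (c * l).
  by move=> h; exact: is_derive_outer (is_derive_linear c (f x)) h.
pose N (y : 'cV[R]_2) := y 0 0 * y 0 0 + y 1 0 * y 1 0.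
have dN : is_derive x v N _ := is_deriveD (is_deriveM c0 c0) (is_deriveM c1 c1).
have dl := is_derive_outer (f := N) (is_derive1_ln N0) dN.
have di := is_derive_inv (f := N) (lt0r_neq0 N0) dN.
have d1 := is_deriveD (cZ l0 _ _ c0) (cZ l1 _ _ c1).
have d2 := is_deriveD (cZ (k0 / 2) _ _ (is_deriveB (is_deriveM c0 c0) (is_deriveM c1 c1))) (cZ k1 _ _ (is_deriveM c0 c1)).
have d3 := is_deriveM (is_deriveD (cZ w0 _ _ c0) (cZ w1 _ _ c1)) di.
have dE := is_deriveD (is_deriveD (is_deriveD d1 d2) (cZ d _ _ dl)) d3.
apply: is_derive_eq dE _.
rewrite /expansion_grad -![_ *: _]/(_ * _) /N /=.
rewrite ?fctE; move: N0; move: (x 0 0) (x 1 0) (v 0 0) (v 1 0) => a b a' b' N0.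
by field; rewrite gt_eqF.
Qed.

Lemma fdN (f : 'cV[R]_2 -> R) x a b : fd f x a b -> fd (fun y => - f y) x (- a) (- b).
Proof.
move=> fx e e0; near=> y.
have : `|f y - f x - (a * (y 0 0 - x 0 0) + b * (y 1 0 - x 1 0))| <= e * enorm (y - x) by near: y; exact: fx.
by rewrite -normrN; congr (`|_| <= _); ring.
Unshelve. all: by end_near. Qed.

Lemma continuousN_at (f : 'cV[R]_2 -> R) x : {for x, continuous f} -> {for x, continuous (fun y => - f y)}.
Proof.
move=> /continuous_for_enorm h; apply/continuous_for_enorm => e e0; near=> y.
by rewrite -opprD normrN; near: y; exact: h.
Unshelve. all: by end_near. Qed.

(** For q = CJ f != 0, multiplying f by the unit number conj(q)/|q| makes the integral real and
    equal to |q|, so only a real part has to be bounded. The constant 2 pi, in place of 4 pi, makes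
    a mean no larger than the maximum. *)
Lemma CJ_le_sharp (f : R -> C) (M : R) : (forall t, ccont f t) ->
  (forall t, 0 <= t <= 2 * pi -> cabs (f t) <= M) -> cabs (CJ f) <= 2 * pi * M.
Proof.
move=> cf fM; have [q0|q0] := eqVneq (CJ f) 0.
  rewrite q0 (cabs_real 0) normr0; apply: mulr_ge0; first exact: ltW (twopi_gt0).
  apply: le_trans (cabs_ge0 (f 0)) (fM 0 _); rewrite lexx /=; exact: ltW (twopi_gt0).
case qE : (CJ f) q0 => [a b] q0.
have mp : 0 < cabs (a +i* b) by rewrite cabs_gt0.
have mm : cabs (a +i* b) ^+ 2 = a ^+ 2 + b ^+ 2 by rewrite cabs_sqr.
move: (cabs (a +i* b)) mp mm => m mp mm.
pose u : C := (a / m) +i* (- b / m).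
have u1 : cabs u = 1.
  apply/eqP; rewrite -(eqrXn2 (n := 2)) ?cabs_ge0// cabs_sqr /= !expr_div_n sqrrN -mulrDl -mm expr1n.
  by rewrite mulfV// expf_neq0// gt_eqF.
have -> : m = J (fun t => re (u * f t)).
  transitivity (re (CJ (fun t => u * f t))) => //.
  rewrite CJZ// qE /= (_ : a / m * a - - b / m * b = (a ^+ 2 + b ^+ 2) / m); last by field; rewrite gt_eqF.
  by rewrite -mm; field; rewrite gt_eqF.
apply: le_trans (ler_norm _) _; apply: J_norm_le => [t|t ht].
  by have [] := ccontM (ccont_cst u t) (cf t).
by apply: le_trans (re_le _) _; rewrite cabsM u1 mul1r; exact: fM.
Qed.

(** The function p0 - i p1 is holomorphic with derivative h00 - i h01; its Laurent expansion is
    integrated back to h. The last conclusion holds because k0 - i k1 is the mean of that derivative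
    over a circle. *)
Theorem harmonic_expansion (h p0 p1 h00 h01 : 'cV[R]_2 -> R) (rho B : R) : 0 < rho ->
  (forall x, rho < enorm x -> [/\ fd h x (p0 x) (p1 x), fd p0 x (h00 x) (h01 x) & fd p1 x (h01 x) (- h00 x)]) ->
  (forall x, rho < enorm x -> {for x, continuous h00} /\ {for x, continuous h01}) ->
  (forall x, rho < enorm x -> `|h00 x| <= B /\ `|h01 x| <= B) ->
  exists k0 k1 l0 l1 c d w0 w1 : R,
    (forall k, Sym k (- 2) (fun x => h x - (expansion k0 k1 l0 l1 d w0 w1 x + c))) /\
    forall b, 0 <= b -> (forall x, rho < enorm x -> h00 x ^+ 2 + h01 x ^+ 2 < b ^+ 2) ->
      k0 ^+ 2 + k1 ^+ 2 < b ^+ 2.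
Proof.
move=> rho0 dh ch bh.
pose G x : C := p0 x +i* (- p1 x).
pose G' x : C := h00 x +i* (- h01 x).
have rp : 0 < rho + 1 by lra.
have dG x : rho + 1 < enorm x -> cdiff G x (G' x).
  move=> hx; have [|_ f0 f1] := dh x; first by lra.
  split; first by rewrite /= opprK.
  by have := fdN f1; rewrite opprK.
have cG1 x : rho + 1 < enorm x -> {for x, continuous (fun y => re (G' y))}.
  by move=> hx; have [|] := ch x; first by lra.
have cG2 x : rho + 1 < enorm x -> {for x, continuous (fun y => im (G' y))}.
  by move=> hx; have [|_ c] := ch x; [lra|exact: continuousN_at].
have [C0 hC0] : exists C0 : R, forall x, rho + 1 < enorm x -> `|p0 x| <= C0 * enorm x.
  apply: (@exterior_growth _ _ h00 h01 rho B rho0) => y hy.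
  by have [_ ? _] := dh y hy; have [? ?] := bh y hy.
have [C1 hC1] : exists C0 : R, forall x, rho + 1 < enorm x -> `|p1 x| <= C0 * enorm x.
  apply: (@exterior_growth _ _ h01 (fun x => - h00 x) rho B rho0) => y hy.
  by have [_ _ ?] := dh y hy; have [? ?] := bh y hy; rewrite normrN.
pose A := `|C0| + `|C1| + 2 * B.
have bG x : rho + 1 < enorm x -> cabs (G x) <= A * enorm x.
  move=> hx; apply: le_trans (cabs_le_sum _) _; rewrite /= normrN.
  apply: le_trans (lerD (hC0 x hx) (hC1 x hx)) _; rewrite -mulrDl; apply: ler_wpM2r => //.
  have [|b0 _] := bh x; first by lra.
  have := le_trans (normr_ge0 _) b0; have := ler_norm C0; have := ler_norm C1; rewrite /A; lra.
have bG' x : rho + 1 < enorm x -> cabs (G' x) <= A.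
  move=> hx; apply: le_trans (cabs_le_sum _) _; rewrite /= normrN.
  have [|b0 b1] := bh x; first by lra.
  by have := normr_ge0 C0; have := normr_ge0 C1; rewrite /A; lra.
pose s_ a := circ (2 * (rho + 1))^-1 a.
have [L [L4 L2 Lsym]] : exists L : nat -> C,
    [/\ L 4%N = (2 * pi)%:C^-1 * CJ (fun a => G (ofC (s_ a)^-1) * (s_ a)^-1),
        L 2%N = (2 * pi)%:C^-1 * CJ (fun a => G' (ofC (s_ a)^-1)) &
        forall k, CSym k (- 3) (fun x => G x - (toC x * L 2%N + L 3%N + (toC x)^-1 * L 4%N + (toC x)^-1 ^+ 2 * L 5%N))].
  exists (laurent_coef G (rho + 1)); split; first exact: laurent_coef4.
    exact: (laurent_coef2 rp dG cG1 cG2 bG bG').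
  by move=> k; exact: (laurent_sym rp dG cG1 cG2 bG bG').
have rr0 : 0 < (2 * (rho + 1))^-1 by rewrite invr_gt0; lra.
have sn a : circ (2 * (rho + 1))^-1 a != 0 by exact: circ_neq0.
have se a : enorm (ofC (circ (2 * (rho + 1))^-1 a)^-1) = 2 * (rho + 1).
  by rewrite -/(cabs _) cabsV cabs_circ ?invrK//; exact: ltW.
have sx a : rho + 1 < enorm (ofC (circ (2 * (rho + 1))^-1 a)^-1) by rewrite se; lra.
have cs a := cder_circ (2 * (rho + 1))^-1 a.
pose S a := ofC (circ (2 * (rho + 1))^-1 a)^-1.
(* The imaginary part of the residue is, up to 2 pi, the period of dh around a circle, and h is
   single-valued. *)
have imL4 : im (L 4%N) = 0.
  have cf a : ccont (fun a => G (S a) * (circ (2 * (rho + 1))^-1 a)^-1) a.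
    have di := cderV (sn a) (cs a).
    apply: ccontM; last exact: cder_ccont di.
    exact: cder_ccont (cder_comp (c := fun a => (circ (2 * (rho + 1))^-1 a)^-1) (dG _ (sx a)) di).
  have j0 : J (fun a => im (G (S a) * (circ (2 * (rho + 1))^-1 a)^-1)) = 0.
    transitivity (h (S (2 * pi)) - h (S 0)); last by rewrite /S circ_2pi subrr.
    apply: (@J_derive _ _ (fun a => h (S a))) => a; first by case: (cf a).
    have [d0 d1] := cderV (sn a) (cs a).
    have [|fh _ _] := dh (S a); first by have := sx a; rewrite -/(S a); lra.
    have := fd_curve (c0 := fun a => re (circ (2 * (rho + 1))^-1 a)^-1)
      (c1 := fun a => im (circ (2 * (rho + 1))^-1 a)^-1) fh d0 d1; congr is_derive.
    rewrite /S; have := re2im2_neq0 (sn a); move: (circ _ a) => s nz.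
    rewrite imM -[re (G _)]/(p0 _) -[im (G _)]/(- p1 _) -/(ofC s^-1).
    rewrite !reimE !reV !imV; move: (p0 _) (p1 _) nz => u w; move: (re s) (im s) => e f nz /=.
    by field.
  have e : im (CJ (fun a => G (S a) * (circ (2 * (rho + 1))^-1 a)^-1)) = 0 by [].
  by rewrite L4 imM e imV mulr0 add0r -[im (2 * pi)%:C]/0 oppr0 !mul0r.
exists (re (L 2%N)), (- im (L 2%N)), (re (L 3%N)), (- im (L 3%N)).
(* The coefficients are matched with the derivative k z + l + 2d/z - w/z^2 of the complex function
   whose real part is [expansion]. *)
pose k0 := re (L 2%N); pose k1 := - im (L 2%N); pose l0 := re (L 3%N); pose l1 := - im (L 3%N).
pose d := re (L 4%N) / 2; pose w0 := - re (L 5%N); pose w1 := - im (L 5%N).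
pose e_ i : 'cV[R]_2 := delta_mx i 0.
pose D (i : 'I_2) x := (if i == 0 then p0 x else p1 x) - expansion_grad k0 k1 l0 l1 d w0 w1 (e_ i) x.
have D0 x : D 0 x = p0 x - expansion_grad k0 k1 l0 l1 d w0 w1 (e_ 0) x by [].
have D1 x : D 1 x = p1 x - expansion_grad k0 k1 l0 l1 d w0 w1 (e_ 1) x by [].
have e00 : e_ 0 0 0 = 1 by rewrite mxE.
have e01 : e_ 0 1 0 = 0 by rewrite mxE.
have e10 : e_ 1 0 0 = 0 by rewrite mxE.
have e11 : e_ 1 1 0 = 1 by rewrite mxE.
have DS k i : Sym k (- 3) (D i).
  have [S0 S1] := Lsym k.
  elim/I2P: i.
    apply: Sym_eq S0; exists 0 => x x0; rewrite D0 reD reN -[re (G x)]/(p0 x); congr (_ - _).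
    have N0 := enorm2_gt0 x0; rewrite /expansion_grad e00 e01 !expr2 !reimE !reV !imV imL4 !expr2.
    rewrite -[re (toC x)]/(x 0 0) -[im (toC x)]/(x 1 0) /k0 /k1 /l0 /l1 /d /w0 /w1.
    move: (re (L 2%N)) (im (L 2%N)) (re (L 3%N)) (im (L 3%N)) (re (L 4%N)) (re (L 5%N)) (im (L 5%N)).
    move: (x 0 0) (x 1 0) N0 => a b N0 *; field.
    by rewrite gt_eqF.
  apply: Sym_eq (SymN S1); exists 0 => x x0; rewrite D1 imD opprD -[im (G x)]/(- p1 x) opprK imN opprK.
  congr (_ + _).
  have N0 := enorm2_gt0 x0; rewrite /expansion_grad e10 e11 !expr2 !reimE !reV !imV imL4 !expr2.
  rewrite -[re (toC x)]/(x 0 0) -[im (toC x)]/(x 1 0) /k0 /k1 /l0 /l1 /d /w0 /w1.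
  move: (re (L 2%N)) (im (L 2%N)) (re (L 3%N)) (im (L 3%N)) (re (L 4%N)) (re (L 5%N)) (im (L 5%N)).
  move: (x 0 0) (x 1 0) N0 => a b N0 *; field.
  by rewrite gt_eqF.
pose f x := h x - expansion k0 k1 l0 l1 d w0 w1 x.
have df i : \forall x \near at_inf, is_derive x (e_ i) f (D i x).
  exists rho => x hx; have [fh _ _] := dh x hx; have x0 : 0 < enorm x by exact: lt_trans hx.
  have dE := is_derive_expansion k0 k1 l0 l1 d w0 w1 (e_ i) x0.
  have := is_deriveB (fd_derive (e_ i) fh) dE.
  elim/I2P: i {dE}; rewrite ?D0 ?D1 ?e00 ?e01 ?e10 ?e11 mulr0 ?addr0 ?add0r mulr1; exact.
have nf := near_fd (df 0) (df 1) (Sym_continuous (DS 0%N 0)) (Sym_continuous (DS 0%N 1)).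
have [B0 hB0] := Sym_bound (DS 0%N 0); have [B1 hB1] := Sym_bound (DS 0%N 1).
have [r hr] : \forall x \near at_inf, [/\ fd f x (D 0 x) (D 1 x), `|D 0 x| <= (`|B0| + `|B1|) * (enorm x)^-1 ^+ 3
    & `|D 1 x| <= (`|B0| + `|B1|) * (enorm x)^-1 ^+ 3].
  near=> x.
  have E3 : enorm x ^ (- 3) = (enorm x)^-1 ^+ 3 by rewrite exprVn exprnN.
  have h0 : `|D 0 x| <= B0 * enorm x ^ (- 3) by near: x.
  have h1 : `|D 1 x| <= B1 * enorm x ^ (- 3) by near: x.
  have v3 : 0 <= (enorm x)^-1 ^+ 3 by rewrite exprn_ge0// invr_ge0.
  rewrite E3 in h0 h1; split; first by near: x.
    apply: le_trans h0 _; apply: ler_wpM2r => //;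
      by apply: le_trans (ler_norm B0) _; rewrite lerDl.
  apply: le_trans h1 _; apply: ler_wpM2r => //;
      by apply: le_trans (ler_norm B1) _; rewrite lerDr.
pose r' := `|r| + 1.
have r'0 : 0 < r' by rewrite /r' ltr_wpDl.
have [|c [Cc hc]] := @exterior_limit _ f (D 0) (D 1) r' (`|B0| + `|B1|) r'0.
  by move=> y hy; apply: hr; apply: lt_trans hy; rewrite /r'; apply: le_lt_trans (ler_norm r) _; rewrite ltrDl.
exists c, d, w0, w1; split.
  move=> k; apply: SymS; apply: (@Sym_intro _ _ _ _ D) => [|i|i].
  - exists Cc; exists r' => x hx; have := hc x hx; rewrite exprVn exprnN.
    by rewrite /f -addrA -opprD.
  - near=> x.
    have di : is_derive x (e_ i) f (D i x) by near: x; exact: df.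
    have := is_deriveB di (is_derive_cst c x (e_ i)); rewrite subr0; congr is_derive.
    by apply/funext => y; rewrite /f opprD addrA.
  - by rewrite -[- 2 - 1]/(- 3 : int).
(* The bound stays strict because |G'| attains its maximum over the circle at some [c0], and there
   it is below b. *)
move=> b b0 hb; rewrite sqrrN -cabs_sqr.
have cG a : ccont (fun a => G' (S a)) a.
  have ci : ccont (fun a => (circ (2 * (rho + 1))^-1 a)^-1) a.
    exact: cder_ccont (cderV (sn a) (cs a)).
  by split; [apply: (continuous_curve (H := fun y => re (G' y)) _ ci); exact: cG1|
    apply: (continuous_curve (H := fun y => im (G' y)) _ ci); exact: cG2].
pose phi a := re (G' (S a)) * re (G' (S a)) + im (G' (S a)) * im (G' (S a)).
have phiE a : phi a = cabs (G' (S a)) ^+ 2 by rewrite cabs_sqr /phi !expr2.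
have cphi : continuous phi.
  move=> a; have [c1 c2] := cG a.
  have m1 : {for a, continuous (fun a => re (G' (S a)) * re (G' (S a)))} by apply: continuousM.
  have m2 : {for a, continuous (fun a => im (G' (S a)) * im (G' (S a)))} by apply: continuousM.
  exact: (continuousD m1 m2).
have [|c0 _ hc0] := EVT_max (f := phi) (ltW twopi_gt0); first exact: continuous_subspaceT.
have lt_b : cabs (G' (S c0)) ^+ 2 < b ^+ 2.
  by rewrite cabs_sqr /= sqrrN; apply: hb; have := sx c0; rewrite -/(S c0); lra.
apply: le_lt_trans lt_b; apply: lerXn2r; rewrite ?nnegrE ?cabs_ge0//.
have hJ := CJ_le_sharp cG (M := cabs (G' (S c0))) _.
rewrite L2 cabsM cabsV cabs_real ger0_norm ?(ltW twopi_gt0)// mulrC ler_pdivrMr ?twopi_gt0// mulrC.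
apply: hJ => t ht.
have := hc0 t; rewrite in_itv /= => /(_ ht); rewrite !phiE.
by rewrite ler_pXn2r// nnegrE cabs_ge0.
Unshelve. all: by end_near. Qed.

End HarmonicExpansion.

(** * Extreme values on annuli *)

Section AnnulusCompact.
Context {R : realType}.
Implicit Types (x y z : 'cV[R]_2).

(** The annulus is a continuous image of a rectangle of radii and angles, compact as a product of
    two segments. Taking a = 0 gives a disc and a = b a circle. *)
Lemma annulus_EVT (f : 'cV[R]_2 -> R) (c : 'cV[R]_2) (a b : R) : 0 <= a <= b ->
  (forall x, a <= enorm (x - c) <= b -> {for x, continuous f}) ->
  exists2 x, a <= enorm (x - c) <= b & forall y, a <= enorm (y - c) <= b -> f y <= f x.
Proof.
move=> /andP[a0 ab] cf.
pose P (p : R * R) : 'cV[R]_2 := c + ofC (circ p.1 p.2).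
pose A : set (R * R) := `[a, b]%classic `*` `[- pi, pi]%classic.
have PA p : A p -> a <= enorm (P p - c) <= b.
  move=> [/= h1 _]; rewrite in_itv /= in h1; have /andP[h2 h3] := h1.
  by rewrite /P addrAC subrr add0r enorm_circ//; exact: le_trans h2.
have A0 : A !=set0.
  by exists (a, 0); split => /=; rewrite in_itv /= ?lexx ?ab// oppr_le0 pi_ge0.
have cA : compact A by apply: compact_setX; exact: segment_compact.
have cP p i : {for p, continuous (fun p => P p i 0)}.
  have h (g : R -> R) : continuous g -> {for p, continuous (fun p : R * R => p.1 * g p.2)}.
    move=> cg; apply: (@continuousM _ _ (fun p : R * R => p.1) (fun p : R * R => g p.2)).
      exact: cvg_fst.
    by apply: continuous_comp; [exact: cvg_snd|exact: cg].
  elim/I2P: i.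
    rewrite (_ : (fun _ => _) = (fun p => c 0 0 + p.1 * cos p.2)); last by apply/funext => q; rewrite !mxE.
    by apply: continuousD; [exact: cst_continuous|apply: h; exact: continuous_cos].
  rewrite (_ : (fun _ => _) = (fun p => c 1 0 + p.1 * sin p.2)); last by apply/funext => q; rewrite !mxE.
  by apply: continuousD; [exact: cst_continuous|apply: h; exact: continuous_sin].
have cfP : {within A, continuous (fun p => f (P p))}.
  apply: continuous_in_subspaceT => p /set_mem /PA hp.
  have /continuous_for_enorm cfp := cf _ hp.
  apply: (proj2 (@cvgrPdist_lt _ _ _ (nbhs p) _ (fun p => f (P p)) (f (P p)))) => e e0.
  have /nbhs_enorm[d d0 hd] := cfp e e0.
  have d2 : 0 < d / 2 by lra.
  have k0 := proj1 (@cvgrPdist_lt _ _ _ (nbhs p) _ (fun p => P p 0 0) (P p 0 0)) (cP p 0) _ d2.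
  have k1 := proj1 (@cvgrPdist_lt _ _ _ (nbhs p) _ (fun p => P p 1 0) (P p 1 0)) (cP p 1) _ d2.
  near=> q; rewrite distrC; apply: hd; apply: le_lt_trans (enorm_le_sum _) _.
  have l0 : `|P q 0 0 - P p 0 0| < d / 2 by rewrite distrC; near: q; exact: k0.
  have l1 : `|P q 1 0 - P p 1 0| < d / 2 by rewrite distrC; near: q; exact: k1.
  rewrite [(P q - P p) 0 0]mxE [(P q - P p) 1 0]mxE [(- P p) 0 0]mxE [(- P p) 1 0]mxE; lra.
have [p /set_mem pA hp] := compact_EVT_max A0 cA cfP.
exists (P p); first exact: PA.
move=> y hy; have [t ht et] := polar (y - c).
have -> : y = P (enorm (y - c), t) by rewrite /P /= -et addrC subrK.
apply: hp; apply/mem_set; split => /=; rewrite in_itv//=.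
by rewrite -ler_norml.
Unshelve. all: by end_near. Qed.

Lemma annulus_bounded (f : 'cV[R]_2 -> R) (a b : R) : 0 <= a <= b ->
  (forall x, a <= enorm x <= b -> {for x, continuous f}) ->
  exists B : R, forall x, a <= enorm x <= b -> `|f x| <= B.
Proof.
move=> ab cf.
have cf' x : a <= enorm (x - 0) <= b -> {for x, continuous f} by rewrite subr0; exact: cf.
have [x _ hx] := annulus_EVT ab cf'.
have [z _ hz] := annulus_EVT ab (fun x h => continuousN_at (cf' x h)).
exists (Num.max (f x) (- f z)) => y hy; rewrite ler_norml; apply/andP; split.
  by rewrite lerNl; apply: le_trans (hz y _) _; rewrite ?subr0// le_max lexx orbT.
by apply: le_trans (hx y _) _; rewrite ?subr0// le_max lexx.
Qed.

End AnnulusCompact.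

(** * The Lewy map of a solution of det D^2 v = 1 *)

Section Lewy.
Context {R : realType}.
Implicit Types (x y z : 'cV[R]_2).
Context (v q0 q1 a00 a01 a11 : 'cV[R]_2 -> R) (R0 : R).
Context (R0p : 0 < R0).
Context (dv : forall x, R0 < enorm x -> [/\ fd v x (q0 x) (q1 x), fd q0 x (a00 x) (a01 x) & fd q1 x (a01 x) (a11 x)]).
Context (ca : forall x, R0 < enorm x -> [/\ {for x, continuous a00}, {for x, continuous a01} & {for x, continuous a11}]).
Context (MA : forall x, R0 < enorm x -> 0 < a00 x /\ a00 x * a11 x - a01 x ^+ 2 = 1).

(** The gradient of v + |x|^2/2. Its Jacobian I + D^2 v has determinant 1 + tr + det = 2 + tr, with
    tr and det those of D^2 v. *)
Definition lewy x : 'cV[R]_2 := x + vec (q0 x) (q1 x).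

Let pos x (w0 w1 : R) : R0 < enorm x -> 0 <= a00 x * (w0 * w0) + 2 * a01 x * (w0 * w1) + a11 x * (w1 * w1).
Proof.
move=> /MA[p0 p1]; rewrite -(pmulr_rge0 _ p0).
have -> : a00 x * (a00 x * (w0 * w0) + 2 * a01 x * (w0 * w1) + a11 x * (w1 * w1)) =
  (a00 x * w0 + a01 x * w1) ^+ 2 + (a00 x * a11 x - a01 x ^+ 2) * w1 ^+ 2 by ring.
by rewrite p1 mul1r addr_ge0// sqr_ge0.
Qed.

Let mono y w (sa sb : R) : sa <= sb -> (forall s, sa <= s <= sb -> R0 < enorm (y + s *: w)) ->
  w 0 0 * q0 (y + sa *: w) + w 1 0 * q1 (y + sa *: w) <= w 0 0 * q0 (y + sb *: w) + w 1 0 * q1 (y + sb *: w).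
Proof.
move=> sab hs.
have [|s hsab] := MVT_cc sab (phi := fun s => w 0 0 * q0 (y + s *: w) + w 1 0 * q1 (y + s *: w))
  (dphi := fun s => w 0 0 * (a00 (y + s *: w) * w 0 0 + a01 (y + s *: w) * w 1 0)
    + w 1 0 * (a01 (y + s *: w) * w 0 0 + a11 (y + s *: w) * w 1 0)).
  move=> s hsab; have [_ f0 f1] := dv (hs s hsab).
  have d0 := is_derive_outer (is_derive_linear (w 0 0) _) (is_derive_line (fd_derive w f0)).
  have d1 := is_derive_outer (is_derive_linear (w 1 0) _) (is_derive_line (fd_derive w f1)).
  exact: is_deriveD d0 d1.
have := pos (w 0 0) (w 1 0) (hs s hsab).
set p := y + s *: w => h e; rewrite -subr_ge0 e; apply: mulr_ge0; last by rewrite subr_ge0.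
by apply: le_trans h _; rewrite le_eqVlt; apply/orP; left; apply/eqP; ring.
Qed.

Let R1 := R0 + 1.

Let q_bounded : exists2 M : R, 0 <= M & forall x, enorm x = R1 -> `|q0 x| <= M /\ `|q1 x| <= M.
Proof.
have h : 0 <= R1 <= R1 by rewrite lexx andbT /R1; have := R0p; lra.
have big x : R1 <= enorm x <= R1 -> R0 < enorm x.
  by move=> /andP[hx _]; apply: lt_le_trans hx; rewrite /R1 ltrDl.
have [B0 hB0] := annulus_bounded h (fun x hx => let: And3 _ k _ := dv (big x hx) in fd_continuous k).
have [B1 hB1] := annulus_bounded h (fun x hx => let: And3 _ _ k := dv (big x hx) in fd_continuous k).
exists (`|B0| + `|B1|); first by rewrite addr_ge0.
move=> x xr; have hx : R1 <= enorm x <= R1 by rewrite xr lexx.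
have l0 := hB0 x hx; have l1 := hB1 x hx.
have := ler_norm B0; have := ler_norm B1; have := normr_ge0 B0; have := normr_ge0 B1.
by move=> ? ? ? ?; split; lra.
Qed.

(* When the segment from y to y + w meets the ball of radius R1, monotonicity is
   used on the two pieces outside of it; the rest costs a multiple of |w|. *)
Let almost_mono : exists2 M : R, 0 <= M & forall y w, R1 <= enorm y -> R1 <= enorm (y + w) ->
  - (M * enorm w) <= w 0 0 * (q0 (y + w) - q0 y) + w 1 0 * (q1 (y + w) - q1 y).
Proof.
have [M M0 hM] := q_bounded; exists (4 * M); first by rewrite mulr_ge0.
move=> y w hy hyw.
have R01 : R0 < R1 by rewrite /R1 ltrDl.
have R1p : 0 < R1 by exact: lt_trans R01.
have w0 := enorm_ge0 w.
have neg : - (4 * M * enorm w) <= 0 by rewrite oppr_le0 !mulr_ge0.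
pose p s := y + s *: w.
pose phi s := w 0 0 * q0 (p s) + w 1 0 * q1 (p s).
have m sa sb : sa <= sb -> (forall s, sa <= s <= sb -> R1 <= enorm (p s)) -> phi sa <= phi sb.
  by move=> sab hs; apply: mono sab _ => s /hs; exact: lt_le_trans.
have -> : w 0 0 * (q0 (y + w) - q0 y) + w 1 0 * (q1 (y + w) - q1 y) = phi 1 - phi 0.
  by rewrite /phi /p scale0r addr0 scale1r; ring.
have [alpha0|alpha0] := eqVneq (enorm w) 0.
  by rewrite (_ : phi 1 = phi 0) ?subrr// /phi /p (enorm0_eq alpha0) !scaler0.
have ap : 0 < enorm w by rewrite lt0r alpha0.
(* Completing the square: |y + s w|^2 = al (s - st)^2 + ka. If ka < R1^2, the line is inside the
   disc exactly for |s - st| < d, where al d^2 = R1^2 - ka. *)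
pose al := enorm w ^+ 2; have alp : 0 < al by rewrite exprn_gt0.
pose be := y 0 0 * w 0 0 + y 1 0 * w 1 0.
pose st := - be / al; pose ka := enorm y ^+ 2 - be ^+ 2 / al.
have pN s : enorm (p s) ^+ 2 = al * (s - st) ^+ 2 + ka.
  rewrite /ka /st enorm_sqr /p !mxE (enorm_sqr y).
  have -> : (y 0 0 + s * w 0 0) ^+ 2 + (y 1 0 + s * w 1 0) ^+ 2 =
    s ^+ 2 * (w 0 0 ^+ 2 + w 1 0 ^+ 2) + 2 * s * be + (y 0 0 ^+ 2 + y 1 0 ^+ 2) by rewrite /be; ring.
  by rewrite -!enorm_sqr -/al; field; exact: lt0r_neq0.
have ge s : (R1 <= enorm (p s)) = (R1 ^+ 2 <= al * (s - st) ^+ 2 + ka).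
  by rewrite -pN ler_pXn2r// nnegrE// ltW.
have h0 : R1 ^+ 2 <= al * (0 - st) ^+ 2 + ka by rewrite -ge /p scale0r addr0.
have h1 : R1 ^+ 2 <= al * (1 - st) ^+ 2 + ka by rewrite -ge /p scale1r.
have [kR|kR] := leP (R1 ^+ 2) ka.
  apply: le_trans neg _; rewrite subr_ge0; apply: m => // s _; rewrite ge.
  by apply: le_trans kR _; rewrite lerDr mulr_ge0 ?sqr_ge0// ltW.
pose d := Num.sqrt ((R1 ^+ 2 - ka) / al).
have d0 : 0 <= d by exact: sqrtr_ge0.
have d2 : al * d ^+ 2 = R1 ^+ 2 - ka.
  by rewrite sqr_sqrtr ?divr_ge0 ?(ltW alp)// 1?mulrC ?divfK ?gt_eqF//; lra.
have dp : 0 < d by rewrite sqrtr_gt0 divr_gt0// subr_gt0.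
have ge' s : (R1 <= enorm (p s)) = (d ^+ 2 <= (s - st) ^+ 2).
  by rewrite ge -[RHS](ler_pM2l alp) d2 lerBlDr.
have e0 : d ^+ 2 <= (0 - st) ^+ 2 by rewrite -ge' ge.
have e1 : d ^+ 2 <= (1 - st) ^+ 2 by rewrite -ge' ge.
(* Both endpoints lie outside the open disc. If the closest point [st] falls outside (0, 1), the
   distance is monotone on the segment, which therefore never enters the disc. *)
have [stn|stn] := leP st 0.
  apply: le_trans neg _; rewrite subr_ge0; apply: m => // s /andP[s0 s1]; rewrite ge'.
  by apply: le_trans e0 _; nra.
have [stp|stp] := leP 1 st.
  apply: le_trans neg _; rewrite subr_ge0; apply: m => // s /andP[s0 s1]; rewrite ge'.
  by apply: le_trans e1 _; nra.
have dst : d <= st by nra.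
have dst1 : d <= 1 - st by nra.
(* Monotonicity is used before and after the disc. At the crossings st - d and st + d the gradient
   is bounded by M in each component, so the gap costs at most 4 M|w|. *)
have n1 : phi 0 <= phi (st - d).
  by apply: m; [lra|move=> s /andP[s0 s1]; rewrite ge'; nra].
have n2 : phi (st + d) <= phi 1.
  by apply: m; [lra|move=> s /andP[s0 s1]; rewrite ge'; nra].
have on s : (s - st) ^+ 2 = d ^+ 2 -> enorm (p s) = R1.
  by move=> hs; apply/eqP; rewrite -(eqrXn2 (n := 2)) ?(ltW R1p)// pN hs d2 subrK.
have [a0 a1] : `|q0 (p (st - d))| <= M /\ `|q1 (p (st - d))| <= M by apply: hM; apply: on; ring.
have [b0 b1] : `|q0 (p (st + d))| <= M /\ `|q1 (p (st + d))| <= M by apply: hM; apply: on; ring.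
have c0 := coord_le w 0; have c1 := coord_le w 1.
have bd (a b : R) : `|a| <= enorm w -> `|b| <= M -> `|a * b| <= enorm w * M.
  by move=> ha hb; rewrite normrM; apply: ler_pM.
have := bd _ _ c0 a0; have := bd _ _ c1 a1; have := bd _ _ c0 b0; have := bd _ _ c1 b1.
rewrite !ler_norml => /andP[? ?] /andP[? ?] /andP[? ?] /andP[? ?].
by rewrite /phi in n1 n2 *; lra.
Qed.

Lemma lewy0 x : lewy x 0 0 = x 0 0 + q0 x. Proof. by rewrite !mxE. Qed.

Lemma lewy1 x : lewy x 1 0 = x 1 0 + q1 x. Proof. by rewrite !mxE. Qed.

Lemma lewy_dot x y : dot (lewy x - lewy y) (x - y) = enorm (x - y) ^+ 2 +
  ((x - y) 0 0 * (q0 x - q0 y) + (x - y) 1 0 * (q1 x - q1 y)).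
Proof.
rewrite dotE enorm_sqr.
have -> : (lewy x - lewy y) 0 0 = (x - y) 0 0 + (q0 x - q0 y) by rewrite !mxE /=; ring.
have -> : (lewy x - lewy y) 1 0 = (x - y) 1 0 + (q1 x - q1 y) by rewrite !mxE /=; ring.
by ring.
Qed.

(** By [lewy_dot] the scalar product of T x - T y with x - y is |x - y|^2 plus a monotonicity term.
    That term is nonnegative when the segment stays outside the disc, which yields expansion at
    distance up to D = M + 1. In general it is at least -M|x - y|, so |T x - T y| >= |x - y| - M.
    Equal images are then at distance at most M < D, where expansion applies and gives
    injectivity. *)
Lemma lewy_geometry : exists D R2 C : R, [/\ 1 <= D, R0 + 1 + D <= R2,
  (forall x y, R2 < enorm x -> enorm (x - y) <= D -> enorm (x - y) <= enorm (lewy x - lewy y)),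
  (forall x y, R2 < enorm x -> R0 + 1 <= enorm y -> lewy x = lewy y -> x = y) &
  forall x, R2 < enorm x -> enorm x - C <= enorm (lewy x)].
Proof.
have [M M0 hM] := almost_mono.
have expand x y : R1 + (M + 1) < enorm x -> enorm (x - y) <= M + 1 -> enorm (x - y) <= enorm (lewy x - lewy y).
  move=> hx hxy.
  have [->|n0] := eqVneq (enorm (x - y)) 0; first exact: enorm_ge0.
  have np : 0 < enorm (x - y) by rewrite lt0r n0 enorm_ge0.
  have := @mono y (x - y) 0 1 ler01; rewrite scale0r addr0 scale1r (addrC y) subrK => h.
  have {}h : (x - y) 0 0 * q0 y + (x - y) 1 0 * q1 y <= (x - y) 0 0 * q0 x + (x - y) 1 0 * q1 x.
    apply: h => s /andP[s0 s1].
    have e1 : x - (y + s *: (x - y)) = (1 - s) *: (x - y) by rewrite opprD addrA scalerBl scale1r.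
    have := enorm_sub x (y + s *: (x - y)); rewrite e1 enormZ ger0_norm; last by rewrite subr_ge0.
    have : (1 - s) * enorm (x - y) <= 1 * (M + 1) by apply: ler_pM => //; lra.
    by rewrite /R1 in hx; lra.
  rewrite -(ler_pM2r np) -expr2.
  apply: le_trans (le_trans (ler_norm _) (dot_le _ _)); rewrite lewy_dot; lra.
have far x y : R1 <= enorm x -> R1 <= enorm y -> enorm (x - y) - M <= enorm (lewy x - lewy y).
  move=> hx hy.
  have [e0|n0] := eqVneq (enorm (x - y)) 0.
    by apply: le_trans (enorm_ge0 _); rewrite e0; lra.
  have np : 0 < enorm (x - y) by rewrite lt0r n0 enorm_ge0.
  have := hM y (x - y) hy; rewrite (addrC y) subrK => /(_ hx) h.
  rewrite -(ler_pM2r np); apply: le_trans (le_trans (ler_norm _) (dot_le _ _)); rewrite lewy_dot; nra.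
have [e he] : exists e : 'cV[R]_2, enorm e = R1.
  by exists (ofC (circ R1 0)); rewrite enorm_circ// /R1; have := R0p; lra.
exists (M + 1), (R1 + (M + 1)), (M + R1 + enorm (lewy e)); split.
- lra.
- by rewrite /R1; lra.
- exact: expand.
- move=> x y hx hy xy; have hx1 : R1 <= enorm x by lra.
  have := far x y hx1 hy; rewrite xy subrr enorm0 => h1.
  have := expand x y hx _; rewrite xy subrr enorm0 => h2.
  have h3 : enorm (x - y) = 0 by apply/eqP; rewrite eq_le enorm_ge0 andbT; apply: h2; lra.
  by have /eqP := enorm0_eq h3; rewrite subr_eq0 => /eqP.
- move=> x hx; have hx1 : R1 <= enorm x by lra.
  have := far x e hx1; rewrite he lexx => /(_ isT) h.
  have := enorm_sub x e; have := enorm_sub (lewy x - lewy e) (- lewy e).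
  by rewrite opprK subrK enormN he; have := enorm_sub (lewy x) (lewy x - 0); rewrite subr0; have := enormD (lewy x) (- lewy e); rewrite enormN; lra.
Qed.

Context (D R2 : R) (D1 : 1 <= D) (R2D : R0 + 1 + D <= R2).
Context (expand : forall x y, R2 < enorm x -> enorm (x - y) <= D -> enorm (x - y) <= enorm (lewy x - lewy y)).

Let fd_lewy x : R0 < enorm x ->
  fd (fun y => lewy y 0 0) x (1 + a00 x) (a01 x) /\ fd (fun y => lewy y 1 0) x (a01 x) (1 + a11 x).
Proof.
move=> /dv[_ f0 f1]; split=> e e0; near=> y.
  have : `|q0 y - q0 x - (a00 x * (y 0 0 - x 0 0) + a01 x * (y 1 0 - x 1 0))| <= e * enorm (y - x) by near: y; exact: f0.
  by rewrite !lewy0; congr (`|_| <= _); ring.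
have : `|q1 y - q1 x - (a01 x * (y 0 0 - x 0 0) + a11 x * (y 1 0 - x 1 0))| <= e * enorm (y - x) by near: y; exact: f1.
by rewrite !lewy1; congr (`|_| <= _); ring.
Unshelve. all: by end_near. Qed.

(** The squared distance from T y to z attains its minimum over the closed unit disc around x0.
    Expansion keeps the minimiser off the boundary, and at an interior minimiser with T x != z the
    direction -(T x - z) would decrease it, because I + D^2 v >= I. *)
Lemma lewy_open x0 z : R2 + 1 < enorm x0 -> enorm (z - lewy x0) < 1 / 2 ->
  exists2 x, enorm (x - x0) < 1 & lewy x = z.
Proof.
move=> hx0 hz.
pose N y := (lewy y 0 0 - z 0 0) * (lewy y 0 0 - z 0 0) + (lewy y 1 0 - z 1 0) * (lewy y 1 0 - z 1 0).
have NE y : N y = enorm (lewy y - z) ^+ 2 by rewrite enorm_sqr /N !expr2 !mxE.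
have big y : enorm (y - x0) <= 1 -> R2 < enorm y.
  by move=> h; have := enorm_sub x0 y; rewrite enormBC; lra.
have R20 : R0 < R2 by have := D1; have := R2D; lra.
have dN y u : enorm (y - x0) <= 1 -> is_derive y u N
   (2 * ((lewy y 0 0 - z 0 0) * ((1 + a00 y) * u 0 0 + a01 y * u 1 0) + (lewy y 1 0 - z 1 0) * (a01 y * u 0 0 + (1 + a11 y) * u 1 0))).
  move=> hy; have [f0 f1] := fd_lewy (lt_trans R20 (big y hy)).
  have d0 := is_deriveB (fd_derive u f0) (is_derive_cst (z 0 0) y u).
  have d1 := is_deriveB (fd_derive u f1) (is_derive_cst (z 1 0) y u).
  have := is_deriveD (is_deriveM d0 d0) (is_deriveM d1 d1); congr is_derive.
  by rewrite -![_ *: _]/(_ * _) ?fctE /cst /=; ring.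
have cN y : 0 <= enorm (y - x0) <= 1 -> {for y, continuous (fun y => - N y)}.
  move=> /andP[_ hy]; apply: continuousN_at.
  have [f0 f1] := fd_lewy (lt_trans R20 (big y hy)).
  have k0 : {for y, continuous (fun y => lewy y 0 0 - z 0 0)}.
    by apply: continuousB; [exact: fd_continuous f0|exact: cst_continuous].
  have k1 : {for y, continuous (fun y => lewy y 1 0 - z 1 0)}.
    by apply: continuousB; [exact: fd_continuous f1|exact: cst_continuous].
  exact: (continuousD (continuousM k0 k0) (continuousM k1 k1)).
have h01 : 0 <= (0 : R) <= 1 by rewrite lexx ler01.
have [x /andP[_ hx] xmin] := annulus_EVT h01 cN.
have Nx0 : N x <= N x0 by have := xmin x0; rewrite subrr enorm0 lexx ler01 lerN2; exact.
have Nhalf : enorm (lewy x - z) < 1 / 2.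
  apply: le_lt_trans (_ : enorm (lewy x0 - z) < 1 / 2); last by rewrite enormBC.
  by rewrite -(ler_pXn2r (n := 2)) ?nnegrE// -!NE.
have x1 : enorm (x - x0) < 1.
  have : enorm (x0 - x) <= enorm (lewy x0 - lewy x).
    by apply: expand; [lra|rewrite enormBC; have := D1; lra].
  rewrite enormBC => h; apply: le_lt_trans h _.
  have := enormD (lewy x0 - z) (z - lewy x).
  rewrite addrA subrK (enormBC (lewy x0) z) (enormBC z (lewy x)); lra.
exists x => //; apply/eqP; rewrite -subr_eq0; apply: contraT; rewrite -enorm_gt0 => wp; exfalso.
pose u : 'cV[R]_2 := - (lewy x - z).
have u0 : u 0 0 = - (lewy x 0 0 - z 0 0) by rewrite !mxE.
have u1 : u 1 0 = - (lewy x 1 0 - z 1 0) by rewrite !mxE.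
have l0 : 2 * ((lewy x 0 0 - z 0 0) * ((1 + a00 x) * u 0 0 + a01 x * u 1 0) + (lewy x 1 0 - z 1 0) * (a01 x * u 0 0 + (1 + a11 x) * u 1 0)) <= - 2 * N x.
  rewrite u0 u1 /N; set w0 := _ - z 0 0; set w1 := _ - z 1 0.
  have := pos w0 w1 (lt_trans R20 (big x hx)); lra.
have Np : 0 < N x by rewrite NE exprn_gt0.
(* The derivative along u is at most -2 N x. With N x itself as tolerance, a small step h > 0
   changes N by at most -2 N x h + N x h < 0, against minimality. *)
have /is_deriveP/(_ (N x) Np) hd := dN x u hx.
set l := 2 * _ in l0 hd.
have : \forall k \near (0 : R), enorm (k *: u) < 1 - enorm (x - x0).
  have dp : 0 < (1 - enorm (x - x0)) / (1 + enorm u) by rewrite divr_gt0//; have := enorm_ge0 u; lra.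
  near=> k; rewrite enormZ.
  have : `|k| < (1 - enorm (x - x0)) / (1 + enorm u) by near: k; exact: near0_lt.
  rewrite ltr_pdivlMr; last by have := enorm_ge0 u; lra.
  by have := normr_ge0 k; lra.
move=> /nbhs_ballP[ea /= eap hea]; have /nbhs_ballP[eb /= ebp heb] := hd.
pose e := Num.min ea eb; have ep : 0 < e by rewrite lt_min eap.
have e2 : `|e / 2| = e / 2 by rewrite ger0_norm; lra.
have [e2a e2b] : e / 2 < ea /\ e / 2 < eb.
  have : e <= ea by rewrite ge_min lexx.
  have : e <= eb by rewrite ge_min lexx orbT.
  lra.
have h2 : enorm (e / 2 *: u) < 1 - enorm (x - x0) by apply: hea; rewrite /ball /= sub0r normrN e2.
have h1 := heb (e / 2); rewrite /ball /= sub0r normrN e2 in h1; have {}h1 := h1 e2b.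
have := xmin (x + (e / 2) *: u).
rewrite enorm_ge0 lerN2 /= => /(_ _) h3.
have : enorm (x + e / 2 *: u - x0) <= 1.
  by rewrite addrAC; apply: le_trans (enormD _ _) _; lra.
move=> /h3; move: h1; rewrite ler_norml => /andP[_]; nra.
Unshelve. all: by end_near. Qed.


Let R20 : R0 < R2. Proof. by have := D1; have := R2D; lra. Qed.

Context (Cg : R) (growth : forall x, R2 < enorm x -> enorm x - Cg <= enorm (lewy x)).
Context (inj : forall x y, R2 < enorm x -> R0 + 1 <= enorm y -> lewy x = lewy y -> x = y).

Let image z := exists2 x, R2 + 2 < enorm x & lewy x = z.

(** A preimage given by [lewy_open] has modulus above R2 + 1. If it were at most R2 + 2, it would
    lie in a compact annulus, on which T is bounded by a constant below rho. *)
Let image_step : exists2 rho : R, 0 < rho & forall z z',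
  image z -> enorm (z' - z) < 1 / 2 -> rho < enorm z' -> image z'.
Proof.
have R2p : 0 < R2 by have := R20; have := R0p; lra.
have h : 0 <= R2 + 1 <= R2 + 2 by apply/andP; split; lra.
have big x : R2 + 1 <= enorm x <= R2 + 2 -> R0 < enorm x by move=> /andP[hx _]; have := R20; lra.
have [B0 hB0] := annulus_bounded h (fun x hx => fd_continuous (fd_lewy (big x hx)).1).
have [B1 hB1] := annulus_bounded h (fun x hx => fd_continuous (fd_lewy (big x hx)).2).
exists (`|B0| + `|B1| + 1); first by have := normr_ge0 B0; have := normr_ge0 B1; lra.
move=> z z' [x hx <-] hz rz.
have hx1 : R2 + 1 < enorm x by lra.
have [x' xx' xz'] := lewy_open hx1 hz.
exists x' => //; rewrite ltNge; apply/negP => hx'.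
have hx2 : R2 + 1 <= enorm x' by have := enorm_sub x x'; rewrite enormBC; lra.
have hx3 : R2 + 1 <= enorm x' <= R2 + 2 by rewrite hx2.
have := enorm_le_sum (lewy x'); have := hB0 x' hx3; have := hB1 x' hx3.
have := ler_norm B0; have := ler_norm B1; rewrite xz'; lra.
Qed.

Let image_segment (rho : R) z z' : (forall z z', image z -> enorm (z' - z) < 1 / 2 -> rho < enorm z' -> image z') ->
  image z -> (forall s, 0 <= s <= 1 -> rho < enorm (z + s *: (z' - z))) -> image z'.
Proof.
move=> step iz seg.
pose n := (Num.truncn (2 * enorm (z' - z))).+1.
have n0 : 0 < n%:R :> R by rewrite ltr0n.
have nE : enorm (z' - z) < n%:R / 2.
  by have := truncnS_gt (2 * enorm (z' - z)); rewrite -/n; lra.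
have key m : (m <= n)%N -> image (z + (m%:R / n%:R) *: (z' - z)).
  elim: m => [|m IH] mn; first by rewrite mul0r scale0r addr0.
  apply: step (IH (ltnW mn)) _ _.
    rewrite opprD addrACA subrr add0r -scalerBl -mulrBl -natrB// subSnn enormZ.
    rewrite ger0_norm; last by rewrite divr_ge0 ?ler0n// ltW.
    by rewrite mulrAC ltr_pdivrMr// mul1r; lra.
  by apply: seg; rewrite divr_ge0 ?ler0n//= ler_pdivrMr// mul1r ler_nat.
by have := key n (leqnn n); rewrite divff ?gt_eqF// scale1r addrC subrK.
Qed.

(* The complement of the square of half-side rho is the union of four half-planes,
   each convex and each meeting its two neighbours. *)
Lemma lewy_onto : exists2 rho : R, 0 < rho & forall z, rho < enorm z -> image z.
Proof.
have [rho rho0 step] := image_step.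
pose P (i : 'I_2) (s : R) := forall z, rho < s * z i 0 -> image z.
have half (i : 'I_2) (s : R) z : `|s| = 1 -> image z -> rho < s * z i 0 -> P i s.
  move=> s1 iz hz z' hz'; apply: image_segment step iz _ => u /andP[u0 u1].
  apply: lt_le_trans (coord_le _ i).
  have -> : (z + u *: (z' - z)) i 0 = (1 - u) * z i 0 + u * z' i 0 by rewrite !mxE; ring.
  apply: lt_le_trans (_ : s * ((1 - u) * z i 0 + u * z' i 0) <= _).
    have [->|un] := eqVneq u 1; first by rewrite subrr mul0r add0r mul1r.
    have u1' : 0 < 1 - u by rewrite subr_gt0 lt_neqAle un.
    have := ler_wpM2l u0 (ltW hz'); have : (1 - u) * rho < (1 - u) * (s * z i 0) by rewrite ltr_pM2l.
    lra.
  by apply: le_trans (ler_norm _) _; rewrite normrM s1 mul1r.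
have s1 : `|1 : R| = 1 by rewrite normr1.
have sN1 : `|- 1 : R| = 1 by rewrite normrN normr1.
pose sg (b : bool) : R := if b then 1 else -1.
have nsg b : `|sg b| = 1 by case: b.
have ssg b : sg b * sg b = 1 by case: b; rewrite /sg; ring.
pose corner (b c : bool) := vec (sg b * (rho + 1)) (sg c * (rho + 1)).
have H01 b c : P 0 (sg b) -> P 1 (sg c).
  move=> h; apply: (half 1 (sg c) (corner b c)) => //.
    by apply: h; rewrite vec0 mulrA ssg; lra.
  by rewrite vec1 mulrA ssg; lra.
have H10 b c : P 1 (sg b) -> P 0 (sg c).
  move=> h; apply: (half 0 (sg c) (corner c b)) => //.
    by apply: h; rewrite vec1 mulrA ssg; lra.
  by rewrite vec0 mulrA ssg; lra.
have large z : 2 * rho < enorm z -> exists i b, rho < sg b * z i 0.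
  move=> hz; have := enorm_le_sum z.
  have [h0|h0] := ltP rho `|z 0 0|.
    move=> _; exists 0; move: h0; have [z0|z0] := leP 0 (z 0 0).
      by rewrite ger0_norm// => h; exists true; rewrite /sg mul1r.
    by rewrite ltr0_norm// => h; exists false; rewrite /sg mulN1r.
  move=> hs; have h1 : rho < `|z 1 0| by lra.
  exists 1; move: h1; have [z0|z0] := leP 0 (z 1 0).
    by rewrite ger0_norm// => h; exists true; rewrite /sg mul1r.
  by rewrite ltr0_norm// => h; exists false; rewrite /sg mulN1r.
pose r := `|R2| + `|Cg| + 2 * rho + 3.
have r0 : 0 <= r by rewrite /r; have := normr_ge0 R2; have := normr_ge0 Cg; lra.
have [e he] : exists e : 'cV[R]_2, enorm e = r by exists (ofC (circ r 0)); rewrite enorm_circ.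
have eR2 : R2 + 2 < enorm e by rewrite he /r; have := ler_norm R2; have := normr_ge0 Cg; lra.
have ie : image (lewy e) by exists e.
have [|i [b hib]] := large (lewy e).
  have eR : R2 < enorm e by lra.
  have := growth eR; rewrite he /r; have := ler_norm Cg; have := normr_ge0 R2; lra.
have Pib := half i (sg b) _ (nsg b) ie hib.
have all0 c : P 0 (sg c).
  by move: Pib; clear hib; elim/I2P: i => h; [exact: (H10 true c (H01 b true h))|exact: H10 h].
have all1 c : P 1 (sg c) by exact: H01 (all0 true).
exists (2 * rho); first by lra.
by move=> z /large[j [c hz]]; move: hz; elim/I2P: j => hz; [apply: all0 hz|apply: all1 hz].
Qed.

Let S x := 2 + a00 x + a11 x.
Let c00 x := (1 + a11 x) / S x.
Let c01 x := - a01 x / S x.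
Let c11 x := (1 + a00 x) / S x.

Let S_gt0 x : R0 < enorm x -> 0 < a00 x /\ 0 < a11 x.
Proof.
move=> /MA[p0 p1]; split=> //.
by rewrite -(pmulr_rgt0 _ p0); have := sqr_ge0 (a01 x); lra.
Qed.

(** [psi] is the Legendre transform of v + |x|^2/2, its gradient is the inverse of T, and its
    Hessian is (I + D^2 v)^-1, that is, the adjugate divided by S. The trace of that Hessian is
    1. *)
Lemma lewy_potential : exists (rho : R) (X0 X1 psi : 'cV[R]_2 -> R), 0 < rho /\
  forall z, rho < enorm z -> let x := vec (X0 z) (X1 z) in
   [/\ R2 < enorm x /\ lewy x = z,
     psi z = X0 z * z 0 0 + X1 z * z 1 0 - v x - (X0 z ^+ 2 + X1 z ^+ 2) / 2,
     fd psi z (X0 z) (X1 z),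
     fd X0 z (c00 x) (c01 x) /\ fd X1 z (c01 x) (c11 x) &
     {for z, continuous (fun y => c00 (vec (X0 y) (X1 y)))} /\ {for z, continuous (fun y => c01 (vec (X0 y) (X1 y)))}].
Proof.
have [rho rho0 onto] := lewy_onto.
pose X z := xget 0 [set x | R2 + 2 < enorm x /\ lewy x = z].
have XP z : rho < enorm z -> R2 + 2 < enorm (X z) /\ lewy (X z) = z.
  by move=> /onto[x hx xz]; exact: (xgetI 0 (conj hx xz : [set x | R2 + 2 < enorm x /\ lewy x = z] x)).
have vX z : vec (X z 0 0) (X z 1 0) = X z by apply: cv2P; rewrite !mxE.
(* The local preimage provided by [lewy_open] is X y by injectivity, so expansion of T becomes a
   local Lipschitz bound for X with constant 1. *)
have lip z : rho < enorm z -> \forall y \near z, enorm (X y - X z) <= enorm (y - z).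
  move=> hz; have [hx xz] := XP z hz; near=> y.
  have hy : rho < enorm y by near: y; exact: exterior_near.
  have yz : enorm (y - z) < 1 / 2 by near: y; apply: enorm_near; lra.
  have hx1 : R2 + 1 < enorm (X z) by lra.
  rewrite -{1}xz in yz; have [x' x'x ex'] := lewy_open hx1 yz.
  have [hy2 ey] := XP y hy.
  have eX : X y = x'.
    apply: inj; [lra| |by rewrite ey].
    by have := enorm_sub (X z) x'; rewrite enormBC; have := D1; have := R2D; lra.
  have hxR : R2 < enorm (X z) by lra.
  have xD : enorm (X z - x') <= D by rewrite enormBC; have := D1; lra.
  by have := expand hxR xD; rewrite xz ex' eX (enormBC x') (enormBC y).
exists rho, (fun z => X z 0 0), (fun z => X z 1 0),
  (fun z => X z 0 0 * z 0 0 + X z 1 0 * z 1 0 - v (X z) - (X z 0 0 ^+ 2 + X z 1 0 ^+ 2) / 2).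
split=> // z hz; cbn zeta; rewrite vX; have [hx xz] := XP z hz.
have x0 : R0 < enorm (X z) by have := R20; lra.
have [a0 a1] := S_gt0 x0; have [_ det] := MA x0.
have Sp : 0 < S (X z) by rewrite /S; lra.
have cX (H : 'cV[R]_2 -> R) : {for X z, continuous H} -> {for z, continuous (fun y => H (X y))}.
  move=> /continuous_for_enorm cH; apply/continuous_for_enorm => e e0.
  have /nbhs_enorm[d d0 hd] := cH e e0.
  near=> y; apply: hd; apply: le_lt_trans (_ : enorm (y - z) < d); first by near: y; exact: lip.
  by near: y; exact: enorm_near.
have [f0 f1] := fd_lewy x0.
split; first by split; [lra|].
- by [].
(* The first-order variation in X cancels, since z - X z is the gradient of v at X z. What remains
   is the little-o of v and products of increments of X and z. *)
- move=> e e0; have [fv _ _] := dv x0.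
  have e2 : 0 < e / 2 by lra.
  have /nbhs_enorm[d d0 hd] := fv _ e2.
  near=> y.
  have l : enorm (X y - X z) <= enorm (y - z) by near: y; exact: lip.
  have yd : enorm (y - z) < d by near: y; exact: enorm_near.
  have ye : enorm (y - z) < e / 4 by near: y; apply: enorm_near; lra.
  have hv := hd _ (le_lt_trans l yd).
  have zy := dot_le (X y - X z) (y - z).
  have q0E : q0 (X z) = z 0 0 - X z 0 0 by rewrite -{2}xz lewy0; ring.
  have q1E : q1 (X z) = z 1 0 - X z 1 0 by rewrite -{2}xz lewy1; ring.
  rewrite q0E q1E in hv.
  have k2 := enorm_sqr (X y - X z); rewrite dotE in zy.
  set k0 := (X y - X z) 0 0 in zy k2; set k1 := (X y - X z) 1 0 in zy k2.
  set d0' := (y - z) 0 0 in zy; set d1' := (y - z) 1 0 in zy.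
  have X0E : X y 0 0 = X z 0 0 + k0 by rewrite /k0 !mxE; ring.
  have X1E : X y 1 0 = X z 1 0 + k1 by rewrite /k1 !mxE; ring.
  have y0E : y 0 0 = z 0 0 + d0' by rewrite /d0' !mxE; ring.
  have y1E : y 1 0 = z 1 0 + d1' by rewrite /d1' !mxE; ring.
  rewrite X0E X1E in hv *; rewrite y0E y1E.
  set W := v (X y) in hv *; set V := v (X z) in hv *.
  set n := enorm (y - z) in l yd ye zy *; set m := enorm (X y - X z) in l zy k2 hv.
  have m0 : 0 <= m := enorm_ge0 _; have n0 : 0 <= n := enorm_ge0 _.
  have hm : e / 2 * m <= e / 2 * n by apply: ler_wpM2l => //; lra.
  have mn : m * n <= n * n by apply: ler_wpM2r.
  have mm : m ^+ 2 <= n * n by rewrite expr2; apply: ler_pM.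
  have nn : n * n <= e / 4 * n by apply: ler_wpM2r => //; lra.
  rewrite !ler_norml in hv zy *; move: hv zy => /andP[hv1 hv2] /andP[zy1 zy2].
  by apply/andP; split; nra.
(* [r0] and [r1] are the linearisation errors of T between X z and X y, hence o(|y - z|); applying
   the inverse of I + D^2 v turns them into the errors for X. *)
- pose r0 y := y 0 0 - z 0 0 - ((1 + a00 (X z)) * (X y 0 0 - X z 0 0) + a01 (X z) * (X y 1 0 - X z 1 0)).
  pose r1 y := y 1 0 - z 1 0 - (a01 (X z) * (X y 0 0 - X z 0 0) + (1 + a11 (X z)) * (X y 1 0 - X z 1 0)).
  have small (al be e : R) : 0 < e -> \forall y \near z, `|al * r0 y + be * r1 y| <= e * enorm (y - z).
    move=> e0; have K0 : 0 <= `|al| + `|be| by rewrite addr_ge0.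
    have e1 : 0 < e / (`|al| + `|be| + 1) by rewrite divr_gt0//; lra.
    have /nbhs_enorm[da dap hda] := f0 _ e1; have /nbhs_enorm[db dbp hdb] := f1 _ e1.
    near=> y.
    have hy : rho < enorm y by near: y; exact: exterior_near.
    have [_ ey] := XP y hy.
    have l : enorm (X y - X z) <= enorm (y - z) by near: y; exact: lip.
    have ya : enorm (y - z) < da by near: y; exact: enorm_near.
    have yb : enorm (y - z) < db by near: y; exact: enorm_near.
    have := hda _ (le_lt_trans l ya); rewrite ey xz -/(r0 y) => h0.
    have := hdb _ (le_lt_trans l yb); rewrite ey xz -/(r1 y) => h1.
    set e' := e / _ in e1 h0 h1.
    have l' := ler_wpM2l (ltW e1) l.
    have {}h0 := ler_wpM2l (normr_ge0 al) (le_trans h0 l').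
    have {}h1 := ler_wpM2l (normr_ge0 be) (le_trans h1 l').
    apply: le_trans (ler_normD _ _) _; rewrite !normrM.
    have -> : e = e' * (`|al| + `|be| + 1) by rewrite /e' divfK// gt_eqF//; lra.
    by have := mulr_ge0 (ltW e1) (enorm_ge0 (y - z)); lra.
  have SE : S (X z) = (1 + a00 (X z)) * (1 + a11 (X z)) - a01 (X z) ^+ 2 by rewrite /S; lra.
  have Sn : (1 + a00 (X z)) * (1 + a11 (X z)) - a01 (X z) ^+ 2 != 0 by rewrite -SE gt_eqF.
  split=> e e0; near=> y.
    have : `|- c00 (X z) * r0 y + - c01 (X z) * r1 y| <= e * enorm (y - z) by near: y; exact: small.
    by congr (`|_| <= _); rewrite /c00 /c01 SE /r0 /r1; field.
  have : `|- c01 (X z) * r0 y + - c11 (X z) * r1 y| <= e * enorm (y - z) by near: y; exact: small.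
  by congr (`|_| <= _); rewrite /c01 /c11 SE /r0 /r1; field.
- have [k0 k1 k2] := ca x0.
  have vXf : (fun y => vec (X y 0 0) (X y 1 0)) = X by apply/funext => y; exact: vX.
  have cS : {for X z, continuous (fun y => (S y)^-1)}.
    apply: continuousV; first by rewrite gt_eqF.
    by apply: continuousD => //; apply: continuousD => //; exact: cst_continuous.
  split.
    rewrite (_ : (fun y => _) = (fun y => c00 (X y))); last by apply/funext => y; rewrite vX.
    apply: (cX c00); apply: continuousM => //; apply: continuousD => //; exact: cst_continuous.
  rewrite (_ : (fun y => _) = (fun y => c01 (X y))); last by apply/funext => y; rewrite vX.
  by apply: (cX c01); apply: continuousM => //; exact: continuousN_at.
Unshelve. all: by end_near. Qed.


End Lewy.

(** * Symbols under a change of variables *)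

Section SymbolComposition.
Context {R : realType}.
Implicit Types (x y z : 'cV[R]_2) (p : int).

Lemma lerXn2r_pos (a b : R) n : 0 < a -> a <= b -> a ^+ n <= b ^+ n.
Proof.
move=> a0 ab; apply: (lerXn2r n _ _ ab); rewrite nnegrE; first exact: ltW.
by apply: ltW; exact: lt_le_trans ab.
Qed.

Lemma exprz_equiv (c K : R) p : 0 < c -> 0 < K -> exists2 L : R, 0 < L &
  forall a b, 0 < a -> c * a <= b -> b <= K * a -> b ^ p <= L * a ^ p.
Proof.
move=> c0 K0; exists (c ^ p + K ^ p); first by rewrite addr_gt0// exprz_gt0.
move=> a b a0 h1 h2; have b0 : 0 < b by apply: lt_le_trans h1; rewrite mulr_gt0.
have ap : 0 < a ^ p by rewrite exprz_gt0.
have [p0|p0] := leP 0 p.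
  apply: le_trans (_ : K ^ p * a ^ p <= _).
    rewrite -expfzMl; case: p p0 {ap} => // n _; rewrite /exprz.
    exact: lerXn2r_pos.
  by rewrite ler_pM2r// lerDr exprz_ge0// ltW.
apply: le_trans (_ : c ^ p * a ^ p <= _); last by rewrite ler_pM2r// lerDl exprz_ge0// ltW.
rewrite -expfzMl; have -> : p = - `|p|%N%:Z by rewrite ltz0_abs// opprK.
rewrite -!exprnN lef_pV2 ?posrE ?exprn_gt0 ?mulr_gt0//.
by apply: lerXn2r_pos h1; exact: mulr_gt0.
Qed.

Section Comp.
Context (T0 T1 M00 M01 M10 M11 : 'cV[R]_2 -> R) (c K : R) (c0 : 0 < c) (K0 : 0 < K).
Let T x := vec (T0 x) (T1 x).
Context (Tb : \forall x \near at_inf, c * enorm x <= enorm (T x) <= K * enorm x).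
Context (dT : \forall x \near at_inf, fd T0 x (M00 (T x)) (M01 (T x)) /\ fd T1 x (M10 (T x)) (M11 (T x))).
Context (S00 : forall k, Sym k 0 M00) (S01 : forall k, Sym k 0 M01)
  (S10 : forall k, Sym k 0 M10) (S11 : forall k, Sym k 0 M11).

Lemma at_inf_comp (P : set 'cV[R]_2) : (\forall x \near at_inf, P x) -> \forall x \near at_inf, P (T x).
Proof.
move=> [r hr]; near=> x; apply: hr.
have /andP[h _] : c * enorm x <= enorm (T x) <= K * enorm x by near: x.
apply: lt_le_trans h; rewrite mulrC -ltr_pdivrMr//.
by near: x; exact: at_inf_gt.
Unshelve. all: by end_near. Qed.

(** The Jacobian of T is given as a function of T x. After one differentiation every factor is again
    a symbol composed with T, and the induction on k applies to all of them. *)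
Lemma Sym_comp k p f : (forall k, Sym k p f) -> Sym k p (fun x => f (T x)).
Proof.
have [chain bnd] : (forall p f, (forall k, Sym k p f) -> \forall x \near at_inf,
    fd (fun x => f (T x)) x (partial 0 f (T x) * M00 (T x) + partial 1 f (T x) * M10 (T x))
      (partial 0 f (T x) * M01 (T x) + partial 1 f (T x) * M11 (T x))) /\
  (forall p f, (forall k, Sym k p f) -> exists A : R, \forall x \near at_inf, `|f (T x)| <= A * enorm x ^ p).
  split=> {}p {}f sf.
    near=> x.
    have fx : fd f (T x) (partial 0 f (T x)) (partial 1 f (T x)).
      by near: x; exact: (at_inf_comp (Sym_fd (sf 1%N))).
    have [t0 t1] : fd T0 x (M00 (T x)) (M01 (T x)) /\ fd T1 x (M10 (T x)) (M11 (T x)) by near: x.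
    exact: fd_comp fx t0 t1.
  have [A A0 hA] := Sym_bound_gt0 (sf 0%N).
  have [L L0 hL] := exprz_equiv p c0 K0.
  exists (A * L); near=> x.
  have h1 : `|f (T x)| <= A * enorm (T x) ^ p by near: x; exact: (at_inf_comp hA).
  apply: le_trans h1 _; rewrite -mulrA ler_pM2l//.
  have /andP[h2 h3] : c * enorm x <= enorm (T x) <= K * enorm x by near: x.
  by apply: hL => //; near: x; exact: at_inf_gt.
elim: k p f => [|k IH] p f sf.
  split=> //; last exact: bnd.
  have ch := chain p f sf; near=> x.
  have /fd_continuous // : fd (fun x => f (T x)) x (partial 0 f (T x) * M00 (T x) + partial 1 f (T x) * M10 (T x))
      (partial 0 f (T x) * M01 (T x) + partial 1 f (T x) * M11 (T x)) by near: x.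
apply: (@Sym_intro _ _ _ _ (fun i x => if i == 0 then partial 0 f (T x) * M00 (T x) + partial 1 f (T x) * M10 (T x)
   else partial 0 f (T x) * M01 (T x) + partial 1 f (T x) * M11 (T x))).
- exact: bnd.
- move=> i; have ch := chain p f sf; near=> x.
  have /(fd_derive (delta_mx i 0)) : fd (fun x => f (T x)) x (partial 0 f (T x) * M00 (T x) + partial 1 f (T x) * M10 (T x))
      (partial 0 f (T x) * M01 (T x) + partial 1 f (T x) * M11 (T x)) by near: x.
  by congr is_derive; rewrite !mxE; elim/I2P: (i) => /=; rewrite ?mulr1 ?mulr0 ?addr0 ?add0r.
- have cp i M : (forall k, Sym k 0 M) -> Sym k (p - 1) (fun x => partial i f (T x) * M (T x)).
    move=> sM; rewrite -[p - 1]addr0; apply: SymM; apply: IH => // j.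
    exact: Sym_derive (sf j.+1).
  by elim/I2P => /=; apply: SymD; exact: cp.
Unshelve. all: by end_near. Qed.

End Comp.

(** The size follows from s/(1 + s) <= ln(1 + s) <= s, and the derivatives from the formula -s s'/(1
    + s). *)
Lemma Sym_ln1p k s : (forall k, Sym k (- 1) s) -> Sym k (- 2) (fun x : 'cV[R]_2 => ln (1 + s x) - s x).
Proof.
move=> ss; apply: SymS.
have [C C0 hC] := Sym_bound_gt0 (ss 0%N).
have half : \forall x \near at_inf, `|s x| <= 1 / 2.
  near=> x; have h2 : 2 * C < enorm x by near: x; exact: at_inf_gt.
  have h3 : C <= 1 / 2 * enorm x by lra.
  have x0 : 0 < enorm x by lra.
  apply: le_trans (_ : C * enorm x ^ (- 1) <= _); first by near: x.
  by rewrite -invr_expz expr1z ler_pdivrMr.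
have s1 : forall k, Sym k 0 (fun x => (1 + s x)^-1).
  move=> j; rewrite -oppr0; apply: (SymV (c := 1 / 2)); first by lra.
    near=> x; rewrite expr0z mulr1.
    have : `|s x| <= 1 / 2 by near: x.
    by rewrite ler_norml => /andP[? ?]; rewrite ger0_norm; lra.
  by apply: SymD; [exact: Sym_cst|exact: Sym_le (ss j)].
apply: (@Sym_intro _ _ _ _ (fun i x => - (s x * partial i s x * (1 + s x)^-1))).
- exists (2 * (C * C)); near=> x.
  have h1 : `|s x| <= C * enorm x ^ (- 1) by near: x.
  have h2 : `|s x| <= 1 / 2 by near: x.
  have x0 : 0 < enorm x by near: x; exact: at_inf_gt.
  have E : enorm x ^ (- 2) = enorm x ^ (- 1) * enorm x ^ (- 1) by rewrite -expfzDr ?gt_eqF.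
  rewrite {}E; move: h1; move: (enorm x ^ (- 1)) => u h1.
  have h3 : s x ^+ 2 <= C * u * (C * u).
    by rewrite -real_normK ?num_real// expr2; apply: ler_pM.
  have : `|ln (1 + s x) - s x| <= 2 * s x ^+ 2.
    move: h2; rewrite ler_norml => /andP[a b].
    have up : ln (1 + s x) <= s x by apply: le_ln1Dx; lra.
    have p1 : 0 < 1 + s x by lra.
    have lo : s x - 2 * s x ^+ 2 <= ln (1 + s x).
      have h4 : ln (1 + - (s x / (1 + s x))) <= - (s x / (1 + s x)).
        by apply: le_ln1Dx; rewrite ltrN2 ltr_pdivrMr//; lra.
      have e1 : 1 + - (s x / (1 + s x)) = (1 + s x)^-1 by field; rewrite gt_eqF.
      rewrite e1 lnV ?posrE// lerNl in h4.
      apply: le_trans h4; rewrite opprK ler_pdivlMr//; nra.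
    by have := sqr_ge0 (s x); rewrite ler_norml => ?; apply/andP; split; lra.
  by move=> /le_trans; apply; lra.
- move=> i; near=> x.
  have ds : is_derive x (delta_mx i 0 : 'cV[R]_2) s (partial i s x) by near: x; exact: Sym_is_derive (ss 1%N).
  have : `|s x| <= 1 / 2 by near: x.
  rewrite ler_norml => /andP[a b]; have p1 : 0 < 1 + s x by lra.
  have d1 := is_deriveD (is_derive_cst (1 : R) x (delta_mx i 0 : 'cV[R]_2)) ds.
  have d2 := is_derive_outer (f := fun y => 1 + s y) (is_derive1_ln p1) d1.
  have := is_deriveB d2 ds; congr is_derive.
  by rewrite add0r; field; rewrite gt_eqF.
- move=> i; apply: SymN; rewrite -[- 2 - 1]/(- 1 + (- 1 - 1) + 0 : int); apply: SymM => //.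
  by apply: SymM => //; exact: Sym_derive (ss k.+1).
Unshelve. all: by end_near. Qed.

End SymbolComposition.

(** * Linear maps, quadratic forms, and shifts of the logarithm and dipole terms *)

Section MongeAmpere.
Context {R : realType}.
Implicit Types (x y z : 'cV[R]_2).

Definition nsq (x : 'cV[R]_2) : R := x 0 0 * x 0 0 + x 1 0 * x 1 0.

Definition lin (m00 m01 m11 : R) (x : 'cV[R]_2) : 'cV[R]_2 :=
  vec (m00 * x 0 0 + m01 * x 1 0) (m01 * x 0 0 + m11 * x 1 0).

Definition quad (m00 m01 m11 : R) (x : 'cV[R]_2) : R :=
  m00 * x 0 0 ^+ 2 + 2 * m01 * x 0 0 * x 1 0 + m11 * x 1 0 ^+ 2.

Lemma fd_lin_form (a b : R) x : fd (fun y => a * y 0 0 + b * y 1 0) x a b.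
Proof.
move=> e e0; near=> y.
have -> : a * y 0 0 + b * y 1 0 - (a * x 0 0 + b * x 1 0) - (a * (y 0 0 - x 0 0) + b * (y 1 0 - x 1 0)) = 0 by ring.
by rewrite normr0; apply: mulr_ge0; [exact: ltW|].
Unshelve. all: by end_near. Qed.

Lemma SymM_eq (k : nat) (p q r : int) (f g : 'cV[R]_2 -> R) : p + q = r ->
  Sym k p f -> Sym k q g -> Sym k r (fun x => f x * g x).
Proof. by move=> <-; exact: SymM. Qed.

Lemma Sym_nsqV k : Sym k (- 2) (fun x => (nsq x)^-1).
Proof.
by apply: Sym_eq (Sym_enorm2V k); near=> x; rewrite /nsq !expr2.
Unshelve. all: by end_near. Qed.

(** The lower bound is the upper bound applied to the inverse matrix. *)
Lemma lin_bounds (m00 m01 m11 : R) : m00 * m11 - m01 ^+ 2 != 0 ->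
  exists c K : R, [/\ 0 < c, 0 < K & forall x, c * enorm x <= enorm (lin m00 m01 m11 x) <= K * enorm x].
Proof.
have up (a b e : R) x : enorm (lin a b e x) <= (`|a| + 2 * `|b| + `|e| + 1) * enorm x.
  apply: le_trans (enorm_le_sum _) _; rewrite vec0 vec1.
  have h0 := coord_le x 0; have h1 := coord_le x 1.
  have := ler_normD (a * x 0 0) (b * x 1 0); have := ler_normD (b * x 0 0) (e * x 1 0).
  rewrite !normrM; have := ler_wpM2l (normr_ge0 a) h0; have := ler_wpM2l (normr_ge0 b) h0.
  have := ler_wpM2l (normr_ge0 b) h1; have := ler_wpM2l (normr_ge0 e) h1; have := enorm_ge0 x; lra.
move=> det; pose t := m00 * m11 - m01 ^+ 2.
pose L := `|m11 / t| + 2 * `|- m01 / t| + `|m00 / t| + 1.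
have Lp : 0 < L by rewrite /L; have := normr_ge0 (m11 / t); have := normr_ge0 (- m01 / t); have := normr_ge0 (m00 / t); lra.
exists L^-1, (`|m00| + 2 * `|m01| + `|m11| + 1); split; first by rewrite invr_gt0.
  by have := normr_ge0 m00; have := normr_ge0 m01; have := normr_ge0 m11; lra.
move=> x; rewrite up andbT ler_pdivrMl//.
have {1}-> : x = lin (m11 / t) (- m01 / t) (m00 / t) (lin m00 m01 m11 x).
  by apply: cv2P; rewrite /lin !(vec0, vec1) /t; field.
exact: up.
Qed.

Lemma Sym_lin_nsqV (m00 m01 m11 : R) k : m00 * m11 - m01 ^+ 2 != 0 ->
  Sym k (- 2) (fun x => (nsq (lin m00 m01 m11 x))^-1).
Proof.
move=> /lin_bounds[c [K [c0 K0 hb]]].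
apply: (@Sym_comp _ (fun x => m00 * x 0 0 + m01 * x 1 0) (fun x => m01 * x 0 0 + m11 * x 1 0)
  (fun _ => m00) (fun _ => m01) (fun _ => m01) (fun _ => m11) c K c0 K0 _ _ _ _ _ _ k (- 2) (fun x => (nsq x)^-1)).
- by exists 0 => x _; exact: hb.
- by exists 0 => x _; split; exact: fd_lin_form.
- by move=> j; exact: Sym_cst.
- by move=> j; exact: Sym_cst.
- by move=> j; exact: Sym_cst.
- by move=> j; exact: Sym_cst.
- by move=> j; exact: Sym_nsqV.
Qed.

Lemma Sym_coordZ k (a b : R) : Sym k 1 (fun x : 'cV[R]_2 => a * x 0 0 + b * x 1 0).
Proof. by apply: SymD; apply: SymZ; exact: Sym_coord. Qed.

(* The leading terms at infinity do not see a bounded perturbation of the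
   argument beyond the first order in the logarithm. *)
Lemma log_dipole_shift (m00 m01 m11 d w0 w1 e0 e1 : R) (T0 T1 : 'cV[R]_2 -> R) k :
  m00 * m11 - m01 ^+ 2 != 0 ->
  (\forall x \near at_inf, 0 < nsq (vec (T0 x) (T1 x))) ->
  (forall k, Sym k (- 2) (fun x => (nsq (vec (T0 x) (T1 x)))^-1)) ->
  (forall k, Sym k (- 1) (fun x => T0 x - (lin m00 m01 m11 x 0 0 + e0))) ->
  (forall k, Sym k (- 1) (fun x => T1 x - (lin m00 m01 m11 x 1 0 + e1))) ->
  Sym k (- 2) (fun x => d * ln (nsq (vec (T0 x) (T1 x))) + (w0 * T0 x + w1 * T1 x) * (nsq (vec (T0 x) (T1 x)))^-1
    - (d * ln (nsq (lin m00 m01 m11 x)) + ((w0 + 2 * d * e0) * lin m00 m01 m11 x 0 0 + (w1 + 2 * d * e1) * lin m00 m01 m11 x 1 0)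
         * (nsq (lin m00 m01 m11 x))^-1)).
Proof.
move=> det Tp TV D0 D1.
pose y := lin m00 m01 m11; pose N x := nsq (vec (T0 x) (T1 x)).
pose r0 x := T0 x - (y x 0 0 + e0); pose r1 x := T1 x - (y x 1 0 + e1).
have yV j : Sym j (- 2) (fun x => (nsq (y x))^-1) by exact: Sym_lin_nsqV.
have y0 j : Sym j 1 (fun x => y x 0 0).
  by apply: Sym_eq (Sym_coordZ j m00 m01); near=> x; rewrite vec0.
have y1 j : Sym j 1 (fun x => y x 1 0).
  by apply: Sym_eq (Sym_coordZ j m01 m11); near=> x; rewrite vec1.
have yp : \forall x \near at_inf, 0 < nsq (y x).
  have [c [K [c0 _ hb]]] := lin_bounds det; near=> x.
  apply: enorm2_gt0; have /andP[h _] := hb x; apply: lt_le_trans h; apply: mulr_gt0 => //.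
  by near: x; exact: at_inf_gt.
have d0 j : Sym j 0 (fun x => e0 + r0 x) by apply: SymD; [exact: Sym_cst|exact: Sym_le (D0 j)].
have d1 j : Sym j 0 (fun x => e1 + r1 x) by apply: SymD; [exact: Sym_cst|exact: Sym_le (D1 j)].
(* Here |T x|^2 = |y|^2 (1 + s) with s of order -1. The part 2 y.e/|y|^2 of s turns d ln into a
   dipole of weight 2 d e, and the rest has order -2. *)
pose s x := (2 * (y x 0 0 * (e0 + r0 x) + y x 1 0 * (e1 + r1 x)) + ((e0 + r0 x) * (e0 + r0 x) + (e1 + r1 x) * (e1 + r1 x))) * (nsq (y x))^-1.
have ss j : Sym j (- 1) s.
  apply: (SymM_eq (p := 1) (q := - 2)) => //; apply: SymD.
    by apply: SymZ; apply: SymD; apply: (SymM_eq (p := 1) (q := 0)).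
  by apply: (@Sym_le _ _ 0) => //; apply: SymD; apply: (SymM_eq (p := 0) (q := 0)).
have N1 : \forall x \near at_inf, N x = nsq (y x) * (1 + s x).
  near=> x; have yx : 0 < nsq (y x) by near: x.
  rewrite /N /s {1}/nsq vec0 vec1.
  have -> : T0 x = y x 0 0 + (e0 + r0 x) by rewrite /r0; ring.
  have -> : T1 x = y x 1 0 + (e1 + r1 x) by rewrite /r1; ring.
  have qE (q B : R) : 0 < q -> q * (1 + B * q^-1) = q + B by move=> q0; field; rewrite gt_eqF.
  by rewrite qE// /nsq; ring.
apply: (@Sym_eq _ _ _ (fun x => d * (ln (1 + s x) - s x)
  + d * ((2 * (y x 0 0 * r0 x + y x 1 0 * r1 x) + ((e0 + r0 x) * (e0 + r0 x) + (e1 + r1 x) * (e1 + r1 x))) * (nsq (y x))^-1)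
  + (w0 * (e0 + r0 x) + w1 * (e1 + r1 x)) * (N x)^-1 - (w0 * y x 0 0 + w1 * y x 1 0) * (s x * (N x)^-1))).
  near=> x; have yx : 0 < nsq (y x) by near: x.
  have Nx : N x = nsq (y x) * (1 + s x) by near: x.
  have Np : 0 < N x by near: x.
  have sp : 0 < 1 + s x by rewrite Nx pmulr_rgt0 in Np.
  rewrite -/(N x) -/(y x) {1 3 4}Nx lnM ?posrE//.
  have -> : T0 x = y x 0 0 + (e0 + r0 x) by rewrite /r0; ring.
  have -> : T1 x = y x 1 0 + (e1 + r1 x) by rewrite /r1; ring.
  have sE : s x * nsq (y x) = 2 * (y x 0 0 * (e0 + r0 x) + y x 1 0 * (e1 + r1 x)) + ((e0 + r0 x) * (e0 + r0 x) + (e1 + r1 x) * (e1 + r1 x)).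
    by rewrite /s divfK// gt_eqF.
  set q := nsq (y x) in yx sE *.
  have -> : 2 * (y x 0 0 * r0 x + y x 1 0 * r1 x) + ((e0 + r0 x) * (e0 + r0 x) + (e1 + r1 x) * (e1 + r1 x))
    = s x * q - 2 * (y x 0 0 * e0 + y x 1 0 * e1) by rewrite sE; ring.
  rewrite Nx -/q; move: (s x) sp => u sp.
  by field; rewrite !gt_eqF.
apply: SymB; first apply: SymD; first apply: SymD.
- by apply: SymZ; exact: Sym_ln1p.
- apply: SymZ; apply: (SymM_eq (p := 0) (q := - 2)) => //; apply: SymD.
    by apply: SymZ; apply: SymD; apply: (SymM_eq (p := 1) (q := - 1)).
  by apply: SymD; apply: (SymM_eq (p := 0) (q := 0)).
- apply: (SymM_eq (p := 0) (q := - 2)) => //.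
  by apply: SymD; apply: SymZ.
- apply: (SymM_eq (p := 1) (q := - 3)) => //; last by apply: (SymM_eq (p := - 1) (q := - 2)).
  by apply: SymD; apply: SymZ.
Unshelve. all: by end_near. Qed.

End MongeAmpere.

(** * Expansion of solutions of det D^2 v = 1 *)

Section MongeAmpereExpansion.
Context {R : realType}.
Implicit Types (x y z : 'cV[R]_2).

Definition log_dipole (p00 p01 p11 d w0 w1 : R) (x : 'cV[R]_2) : R :=
  let y := lin p00 p01 p11 x in
  d * ln (nsq y) + (w0 * y 0 0 + w1 * y 1 0) * (nsq y)^-1.

Lemma Sym_expansion_grad (d w0 w1 : R) k (i : 'I_2) :
  Sym k (- 1) (expansion_grad 0 0 0 0 d w0 w1 (delta_mx i 0)).
Proof.
have c j : Sym k 0 (fun _ : 'cV[R]_2 => (delta_mx i 0 : 'cV[R]_2) j 0) by exact: Sym_cst.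
have n := @Sym_nsqV R k.
have xv : Sym k 1 (fun x : 'cV[R]_2 => 2 * (x 0 0 * (delta_mx i 0 : 'cV[R]_2) 0 0 + x 1 0 * (delta_mx i 0 : 'cV[R]_2) 1 0)).
  by apply: SymZ; apply: SymD; apply: (SymM_eq (p := 1) (q := 0)) => //; exact: Sym_coord.
apply: (@Sym_eq _ _ _ (fun x => d * ((nsq x)^-1 * (2 * (x 0 0 * (delta_mx i 0 : 'cV[R]_2) 0 0 + x 1 0 * (delta_mx i 0 : 'cV[R]_2) 1 0)))
   + (w0 * (delta_mx i 0 : 'cV[R]_2) 0 0 + w1 * (delta_mx i 0 : 'cV[R]_2) 1 0) * (nsq x)^-1
   - (w0 * x 0 0 + w1 * x 1 0) * (2 * (x 0 0 * (delta_mx i 0 : 'cV[R]_2) 0 0 + x 1 0 * (delta_mx i 0 : 'cV[R]_2) 1 0) * ((nsq x)^-1 * (nsq x)^-1)))).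
  by near=> x; rewrite /expansion_grad /nsq; ring.
apply: SymB; first apply: SymD.
- by apply: SymZ; apply: (SymM_eq (p := - 2) (q := 1)).
- by apply: (@Sym_le _ _ (- 2)) => //; apply: (SymM_eq (p := 0) (q := - 2)) => //; exact: Sym_cst.
- apply: (@Sym_le _ _ (- 2)) => //; apply: (SymM_eq (p := 1) (q := - 3)) => //; first exact: Sym_coordZ.
  apply: (SymM_eq (p := 1) (q := - 4)) => //; exact: (SymM_eq (p := - 2) (q := - 2)).
Unshelve. all: by end_near. Qed.

Lemma Sym_small k (s : 'cV[R]_2 -> R) (e : R) : 0 < e -> Sym k (- 1) s -> \forall x \near at_inf, `|s x| <= e.
Proof.
move=> e0 /Sym_bound_gt0[C C0 hC]; near=> x.
have h2 : C / e < enorm x by near: x; exact: at_inf_gt.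
have x0 : 0 < enorm x by apply: lt_trans h2; exact: divr_gt0.
apply: le_trans (_ : C * enorm x ^ (- 1) <= _); first by near: x.
by rewrite -invr_expz expr1z ler_pdivrMr// mulrC -ler_pdivrMr// ltW.
Unshelve. all: by end_near. Qed.

(* In terms of the Legendre variable z = T x one has x = B z + l + O(1/|z|) with
   B = [1/2 + k0, k1; k1, 1/2 - k0], and P = B^-1 turns the expansion of the
   Legendre transform into the expansion of v. *)
Lemma legendre_expansion (v T0 T1 h p0 p1 h00 h01 : 'cV[R]_2 -> R) (k0 k1 l0 l1 c d w0 w1 Cg : R) :
  let T x := vec (T0 x) (T1 x) in
  let det z := 1 / 4 - h00 z * h00 z - h01 z * h01 z in
  k0 ^+ 2 + k1 ^+ 2 < (1 / 2) ^+ 2 ->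
  (\forall z \near at_inf, [/\ fd h z (p0 z) (p1 z), fd p0 z (h00 z) (h01 z) & fd p1 z (h01 z) (- h00 z)]) ->
  (forall k, Sym k (- 2) (fun z => h z - (expansion k0 k1 l0 l1 d w0 w1 z + c))) ->
  (\forall x \near at_inf, enorm x - Cg <= enorm (T x)) ->
  (\forall x \near at_inf, T0 x / 2 + p0 (T x) = x 0 0 /\ T1 x / 2 + p1 (T x) = x 1 0) ->
  (\forall x \near at_inf,
     fd T0 x ((1 / 2 - h00 (T x)) * (det (T x))^-1) (- h01 (T x) * (det (T x))^-1) /\
     fd T1 x (- h01 (T x) * (det (T x))^-1) ((1 / 2 + h00 (T x)) * (det (T x))^-1)) ->
  (\forall x \near at_inf, v x = x 0 0 * T0 x + x 1 0 * T1 x - nsq x / 2 - h (T x) - nsq (T x) / 4) ->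
  exists m00 m01 m11 b0 b1 g d w0 w1 : R, [/\ 0 < m00, m00 * m11 - m01 ^+ 2 = 1, m00 + m11 = (1 / 4 - k0 ^+ 2 - k1 ^+ 2)^-1 - 2 &
    forall k, Sym k (- 2) (fun x => v x - (2^-1 * quad m00 m01 m11 x + (b0 * x 0 0 + b1 * x 1 0) + g
      + log_dipole (1 + m00) m01 (1 + m11) d w0 w1 x))].
Proof.
move=> T det hK dh hE growth XT dT vE.
have halfsq : (1 / 2) ^+ 2 = 1 / 4 :> R by field.
rewrite halfsq in hK.
(* [Delta] is the determinant of B and the limit of det D^2 psi at infinity. *)
pose Delta := 1 / 4 - k0 ^+ 2 - k1 ^+ 2.
have Dp : 0 < Delta by rewrite /Delta; lra.
(* [e0] and [e1] are the errors of the affine approximation of the gradient of h; they are symbols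
   of order -1. *)
pose e0 z := p0 z - (l0 + k0 * z 0 0 + k1 * z 1 0).
pose e1 z := p1 z - (l1 + k1 * z 0 0 - k0 * z 1 0).
have small (p : 'cV[R]_2 -> R) (g : 'cV[R]_2 -> R) (i : 'I_2) :
    (\forall z \near at_inf, is_derive z (delta_mx i 0 : 'cV[R]_2) h (p z)) ->
    (\forall z \near at_inf, g z = p z - expansion_grad k0 k1 l0 l1 0 0 0 (delta_mx i 0) z) ->
    forall k, Sym k (- 1) g.
  move=> dp gE k.
  have s1 : Sym k (- 1) (partial i (fun z => h z - (expansion k0 k1 l0 l1 d w0 w1 z + c))).
    exact: (@Sym_le _ _ (- 2 - 1)) (Sym_derive i (hE k.+1)).
  apply: Sym_eq (SymD s1 (Sym_expansion_grad d w0 w1 k i)); near=> z.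
  have z0 : 0 < enorm z by near: z; exact: at_inf_gt.
  have D1 : is_derive z (delta_mx i 0 : 'cV[R]_2) h (p z) by near: z.
  have D2 := is_deriveB D1 (is_deriveD (is_derive_expansion k0 k1 l0 l1 d w0 w1 (delta_mx i 0) z0) (is_derive_cst c z (delta_mx i 0 : 'cV[R]_2))).
  have -> : g z = p z - expansion_grad k0 k1 l0 l1 0 0 0 (delta_mx i 0) z by near: z.
  have -> : partial i (fun z => h z - (expansion k0 k1 l0 l1 d w0 w1 z + c)) z = p z - (expansion_grad k0 k1 l0 l1 d w0 w1 (delta_mx i 0) z + 0).
    by rewrite /partial; case: D2.
  by rewrite /expansion_grad; ring.
have s0 k : Sym k (- 1) e0.
  apply: (small p0 _ 0).
    near=> z; have [f _ _] : [/\ fd h z (p0 z) (p1 z), fd p0 z (h00 z) (h01 z) & fd p1 z (h01 z) (- h00 z)] by near: z.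
    by have := fd_derive (delta_mx 0 0) f; rewrite !mxE /= mulr1 mulr0 addr0.
  by near=> z; rewrite /e0 /expansion_grad !mxE /=; ring.
have s1 k : Sym k (- 1) e1.
  apply: (small p1 _ 1).
    near=> z; have [f _ _] : [/\ fd h z (p0 z) (p1 z), fd p0 z (h00 z) (h01 z) & fd p1 z (h01 z) (- h00 z)] by near: z.
    by have := fd_derive (delta_mx 1 0) f; rewrite !mxE /= mulr1 mulr0 add0r.
  by near=> z; rewrite /e1 /expansion_grad !mxE /=; ring.
have part : \forall z \near at_inf, partial 0 e0 z = h00 z - k0 /\ partial 1 e0 z = h01 z - k1.
  near=> z; have [_ f _] : [/\ fd h z (p0 z) (p1 z), fd p0 z (h00 z) (h01 z) & fd p1 z (h01 z) (- h00 z)] by near: z.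
  apply: fd_partial => e ep; near=> y.
  have : `|p0 y - p0 z - (h00 z * (y 0 0 - z 0 0) + h01 z * (y 1 0 - z 1 0))| <= e * enorm (y - z) by near: y; exact: f.
  by congr (`|_| <= _); rewrite /e0; ring.
have g0 k : Sym k (- 1) (fun z => h00 z - k0).
  apply: (@Sym_le _ _ (- 1 - 1)) => //; apply: Sym_eq (Sym_derive 0 (s0 k.+1)); near=> z.
  by have [-> _] : partial 0 e0 z = h00 z - k0 /\ partial 1 e0 z = h01 z - k1 by near: z.
have g1 k : Sym k (- 1) (fun z => h01 z - k1).
  apply: (@Sym_le _ _ (- 1 - 1)) => //; apply: Sym_eq (Sym_derive 1 (s0 k.+1)); near=> z.
  by have [_ ->] : partial 0 e0 z = h00 z - k0 /\ partial 1 e0 z = h01 z - k1 by near: z.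
have H00 k : Sym k 0 h00.
  by apply: Sym_eq (SymD (Sym_le _ (g0 k)) (Sym_cst k k0)) => //; near=> z; rewrite subrK.
have H01 k : Sym k 0 h01.
  by apply: Sym_eq (SymD (Sym_le _ (g1 k)) (Sym_cst k k1)) => //; near=> z; rewrite subrK.
have sdet k : Sym k 0 det.
  by apply: SymB; [apply: SymB; [exact: Sym_cst|]|]; apply: (SymM_eq (p := 0) (q := 0)).
have detD k : Sym k (- 1) (fun z => det z - Delta).
  apply: (@Sym_eq _ _ _ (fun z => - ((h00 z - k0) * (h00 z + k0) + (h01 z - k1) * (h01 z + k1)))).
    by near=> z; rewrite /det /Delta; ring.
  apply: SymN; apply: SymD; apply: (SymM_eq (p := - 1) (q := 0)) => //; apply: SymD => //; exact: Sym_cst.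
have Vdet k : Sym k 0 (fun z => (det z)^-1).
  rewrite -oppr0; apply: (SymV (c := Delta / 2)) => //; first lra.
  have D2 : 0 < Delta / 2 by lra.
  have hh := Sym_small D2 (detD 0%N); near=> z; rewrite expr0z mulr1.
  have : `|det z - Delta| <= Delta / 2 by near: z.
  by rewrite ler_norml => /andP[? ?]; rewrite ger0_norm; lra.
have SM00 k : Sym k 0 (fun z => (1 / 2 - h00 z) * (det z)^-1).
  by apply: (SymM_eq (p := 0) (q := 0)) => //; apply: SymB => //; exact: Sym_cst.
have SM01 k : Sym k 0 (fun z => - h01 z * (det z)^-1).
  by apply: (SymM_eq (p := 0) (q := 0)) => //; exact: SymN.
have SM11 k : Sym k 0 (fun z => (1 / 2 + h00 z) * (det z)^-1).
  by apply: (SymM_eq (p := 0) (q := 0)) => //; apply: SymD => //; exact: Sym_cst.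
have Tinf (Q : set 'cV[R]_2) : (\forall z \near at_inf, Q z) -> \forall x \near at_inf, Q (T x).
  move=> [r hr]; near=> x; apply: hr.
  have : enorm x - Cg <= enorm (T x) by near: x.
  have : Cg + r < enorm x by near: x; exact: at_inf_gt.
  lra.
pose P00 := (1 / 2 - k0) / Delta; pose P01 := - k1 / Delta; pose P11 := (1 / 2 + k0) / Delta.
have BT : \forall x \near at_inf,
    (1 / 2 + k0) * T0 x + k1 * T1 x + l0 + e0 (T x) = x 0 0 /\ k1 * T0 x + (1 / 2 - k0) * T1 x + l1 + e1 (T x) = x 1 0.
  near=> x; have [E0 E1] : T0 x / 2 + p0 (T x) = x 0 0 /\ T1 x / 2 + p1 (T x) = x 1 0 by near: x.
  by rewrite -{1}E0 -{1}E1 /e0 /e1 vec0 vec1; split; field.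
have TP : \forall x \near at_inf,
    T0 x = P00 * (x 0 0 - l0 - e0 (T x)) + P01 * (x 1 0 - l1 - e1 (T x)) /\
    T1 x = P01 * (x 0 0 - l0 - e0 (T x)) + P11 * (x 1 0 - l1 - e1 (T x)).
  near=> x; have [<- <-] : (1 / 2 + k0) * T0 x + k1 * T1 x + l0 + e0 (T x) = x 0 0 /\ k1 * T0 x + (1 / 2 - k0) * T1 x + l1 + e1 (T x) = x 1 0 by near: x.
  by rewrite /P00 /P01 /P11; move: Dp; rewrite /Delta => Dp; split; field; apply: lt0r_neq0; lra.
have [c' [K [c'0 K0 Tb]]] : exists c' K : R, [/\ 0 < c', 0 < K & \forall x \near at_inf, c' * enorm x <= enorm (T x) <= K * enorm x].
  have [cB [KB [cB0 KB0 hB]]] := @lin_bounds R (1 / 2 + k0) k1 (1 / 2 - k0) ltac:(move: Dp; rewrite /Delta => Dp; apply/lt0r_neq0; lra).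
  have b0 := Tinf _ (Sym_small ltr01 (s0 0%N)); have b1 := Tinf _ (Sym_small ltr01 (s1 0%N)).
  pose L := `|l0| + `|l1| + 2.
  exists (1 / 2), (2 / cB); split; [lra|exact: divr_gt0|near=> x; apply/andP; split].
    have : enorm x - Cg <= enorm (T x) by near: x.
    have : 2 * Cg < enorm x by near: x; exact: at_inf_gt.
    lra.
  have /andP[h1 _] := hB (T x).
  rewrite mulrAC ler_pdivlMr// mulrC; apply: le_trans h1 _.
  have -> : lin (1 / 2 + k0) k1 (1 / 2 - k0) (T x) = x - vec (l0 + e0 (T x)) (l1 + e1 (T x)).
    have [E0 E1] : (1 / 2 + k0) * T0 x + k1 * T1 x + l0 + e0 (T x) = x 0 0 /\ k1 * T0 x + (1 / 2 - k0) * T1 x + l1 + e1 (T x) = x 1 0 by near: x.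
    have subE (y y' : 'cV[R]_2) i : (y - y') i 0 = y i 0 - y' i 0 by rewrite !mxE.
    apply: cv2P; rewrite subE /lin !(vec0, vec1).
      by rewrite -E0; ring.
    by rewrite -E1; ring.
  apply: le_trans (enormD _ _) _; rewrite enormN.
  have : enorm (vec (l0 + e0 (T x)) (l1 + e1 (T x))) <= L.
    apply: le_trans (enorm_le_sum _) _; rewrite vec0 vec1 /L.
    have : `|e0 (T x)| <= 1 by near: x.
    have : `|e1 (T x)| <= 1 by near: x.
    have := ler_normD l0 (e0 (T x)); have := ler_normD l1 (e1 (T x)); lra.
  have : L < enorm x by near: x; exact: at_inf_gt.
  lra.
have comp p f : (forall k, Sym k p f) -> forall k, Sym k p (fun x => f (T x)).
  by move=> sf k; apply: (@Sym_comp _ T0 T1 (fun z => (1 / 2 - h00 z) * (det z)^-1) (fun z => - h01 z * (det z)^-1)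
    (fun z => - h01 z * (det z)^-1) (fun z => (1 / 2 + h00 z) * (det z)^-1) c' K c'0 K0 Tb dT SM00 SM01 SM01 SM11 k p f).
pose d0 := - (P00 * l0 + P01 * l1); pose d1 := - (P01 * l0 + P11 * l1).
have Pdet : P00 * P11 - P01 ^+ 2 = 1 / Delta.
  by move: Dp; rewrite /P00 /P01 /P11 /Delta => Dp; field; apply: lt0r_neq0; lra.
have Pn0 : P00 * P11 - P01 ^+ 2 != 0 by rewrite Pdet gt_eqF// divr_gt0.
have se0 := comp _ _ s0; have se1 := comp _ _ s1.
have Tpos : \forall x \near at_inf, 0 < nsq (T x).
  apply: (Tinf (fun z => 0 < nsq z)); near=> z; apply: enorm2_gt0.
  by near: z; exact: at_inf_gt.
have shift k := @log_dipole_shift R P00 P01 P11 d w0 w1 d0 d1 T0 T1 k Pn0 Tpos (comp _ _ (@Sym_nsqV R)).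
(* The limit of D^2 v is P - I. Both the trace and the determinant of P are 1/Delta, whence det(P -
   I) = 1. *)
exists (P00 - 1), P01, (P11 - 1), d0, d1, ((P00 * l0 ^+ 2 + 2 * P01 * l0 * l1 + P11 * l1 ^+ 2) / 2 - c), (- d), (- (w0 + 2 * d * d0)), (- (w1 + 2 * d * d1)).
split.
- rewrite subr_gt0 /P00 ltr_pdivlMr// mul1r /Delta; nra.
- have -> : (P00 - 1) * (P11 - 1) - P01 ^+ 2 = 1 / Delta - P00 - P11 + 1 by rewrite -Pdet; ring.
  by rewrite /P00 /P11; field; rewrite gt_eqF.
- by rewrite /P00 /P11 -/Delta; field; rewrite gt_eqF.
- move=> k; rewrite !(addrC 1) !subrK.
  have {}shift := shift k _ _.
  apply: (@Sym_eq _ _ _ (fun x => - (d * ln (nsq (T x)) + (w0 * T0 x + w1 * T1 x) * (nsq (T x))^-1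
      - (d * ln (nsq (lin P00 P01 P11 x)) + ((w0 + 2 * d * d0) * lin P00 P01 P11 x 0 0 + (w1 + 2 * d * d1) * lin P00 P01 P11 x 1 0)
         * (nsq (lin P00 P01 P11 x))^-1))
    - (h (T x) - (expansion k0 k1 l0 l1 d w0 w1 (T x) + c))
    - 2^-1 * (P00 * (e0 (T x) * e0 (T x)) + 2 * P01 * (e0 (T x) * e1 (T x)) + P11 * (e1 (T x) * e1 (T x))))).
    near=> x; rewrite /log_dipole.
    have [E0 E1] : (1 / 2 + k0) * T0 x + k1 * T1 x + l0 + e0 (T x) = x 0 0 /\ k1 * T0 x + (1 / 2 - k0) * T1 x + l1 + e1 (T x) = x 1 0 by near: x.
    have [F0 F1] : T0 x = P00 * (x 0 0 - l0 - e0 (T x)) + P01 * (x 1 0 - l1 - e1 (T x)) /\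
      T1 x = P01 * (x 0 0 - l0 - e0 (T x)) + P11 * (x 1 0 - l1 - e1 (T x)) by near: x.
    have -> : v x = x 0 0 * T0 x + x 1 0 * T1 x - nsq x / 2 - h (T x) - nsq (T x) / 4 by near: x.
    (* T x is a critical point in the Legendre formula for v, so the terms linear in the gradient
       errors cancel. Errors of order -1 contribute only through their squares, at order -2. *)
    have key : x 0 0 * T0 x + x 1 0 * T1 x - nsq x / 2 - nsq (T x) / 4
        - (l0 * T0 x + l1 * T1 x + (k0 / 2 * (T0 x * T0 x - T1 x * T1 x) + k1 * (T0 x * T1 x)))
      = 2^-1 * quad (P00 - 1) P01 (P11 - 1) x + (d0 * x 0 0 + d1 * x 1 0) + (P00 * l0 ^+ 2 + 2 * P01 * l0 * l1 + P11 * l1 ^+ 2) / 2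
        - 2^-1 * (P00 * (e0 (T x) * e0 (T x)) + 2 * P01 * (e0 (T x) * e1 (T x)) + P11 * (e1 (T x) * e1 (T x))).
      rewrite /quad /nsq /d0 /d1 !(vec0, vec1) -E0 -E1 /P00 /P01 /P11.
      move: (T0 x) (T1 x) (e0 (T x)) (e1 (T x)) => t0 t1 f0 f1.
      by move: Dp; rewrite /Delta => Dp; field; apply: lt0r_neq0; lra.
    move: key; rewrite /expansion [T x 0 0]vec0 [T x 1 0]vec1.
    have -> : T0 x * T0 x + T1 x * T1 x = nsq (T x) by rewrite /nsq vec0 vec1 -!expr2.
    move: (ln (nsq (lin _ _ _ _))) (ln (nsq (T x))) ((nsq (lin _ _ _ _))^-1) ((nsq (T x))^-1) => L1 L2 L3 L4.
    move: (lin _ _ _ _ 0 0) (lin _ _ _ _ 1 0) (nsq (T x) / 4) (quad _ _ _ _) (P00 * _ + _ + _) => y0 y1 nT qx pe.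
    move: (P00 * _ + _ + _) => pl key.
    lra.
  apply: SymB; first apply: SymB.
  - apply: SymN; apply: shift => j.
      apply: (@Sym_eq _ _ _ (fun x => - (P00 * e0 (T x) + P01 * e1 (T x)))).
        near=> x; rewrite vec0 /d0.
        have [-> _] : T0 x = P00 * (x 0 0 - l0 - e0 (T x)) + P01 * (x 1 0 - l1 - e1 (T x)) /\
          T1 x = P01 * (x 0 0 - l0 - e0 (T x)) + P11 * (x 1 0 - l1 - e1 (T x)) by near: x.
        by ring.
      by apply: SymN; apply: SymD; exact: SymZ.
    apply: (@Sym_eq _ _ _ (fun x => - (P01 * e0 (T x) + P11 * e1 (T x)))).
      near=> x; rewrite vec1 /d1.
      have [_ ->] : T0 x = P00 * (x 0 0 - l0 - e0 (T x)) + P01 * (x 1 0 - l1 - e1 (T x)) /\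
        T1 x = P01 * (x 0 0 - l0 - e0 (T x)) + P11 * (x 1 0 - l1 - e1 (T x)) by near: x.
      by ring.
    by apply: SymN; apply: SymD; exact: SymZ.
  - exact: (comp (- 2) (fun z => h z - (expansion k0 k1 l0 l1 d w0 w1 z + c))).
  - by apply: SymZ; apply: SymD; [apply: SymD|]; apply: SymZ; apply: (SymM_eq (p := - 1) (q := - 1)).
Unshelve. all: by end_near. Qed.

(** The Legendre transform of v + |x|^2/2 becomes harmonic after subtracting |z|^2/4, and its
    expansion is transformed back. The clause on [B] carries strict trace bounds to the limit
    matrix; it is what keeps the limit in the range of the arctangent formula. *)
Theorem monge_ampere_expansion (v q0 q1 a00 a01 a11 : 'cV[R]_2 -> R) (R0 : R) : 0 < R0 ->
  (forall x, R0 < enorm x -> [/\ fd v x (q0 x) (q1 x), fd q0 x (a00 x) (a01 x) & fd q1 x (a01 x) (a11 x)]) ->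
  (forall x, R0 < enorm x -> [/\ {for x, continuous a00}, {for x, continuous a01} & {for x, continuous a11}]) ->
  (forall x, R0 < enorm x -> 0 < a00 x /\ a00 x * a11 x - a01 x ^+ 2 = 1) ->
  exists m00 m01 m11 b0 b1 g d w0 w1 : R, [/\ 0 < m00, m00 * m11 - m01 ^+ 2 = 1,
    forall B, (forall x, R0 < enorm x -> a00 x + a11 x < B) -> m00 + m11 < B &
    forall k, Sym k (- 2) (fun x => v x - (2^-1 * quad m00 m01 m11 x + (b0 * x 0 0 + b1 * x 1 0) + g
      + log_dipole (1 + m00) m01 (1 + m11) d w0 w1 x))].
Proof.
move=> R0p dv ca MA.
have [D [R2 [Cg [D1 R2D expand inj growth]]]] := lewy_geometry R0p dv MA.
have [rho [X0 [X1 [psi [rho0 hX]]]]] := lewy_potential R0p dv ca MA D1 R2D expand growth inj.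
pose T := lewy q0 q1.
pose S x := 2 + a00 x + a11 x.
pose X z := vec (X0 z) (X1 z).
have Xbig z : rho < enorm z -> R0 < enorm (X z).
  by move=> hz; have [[h _] _ _ _ _] := hX z hz; apply: lt_trans h; lra.
have apos x : R0 < enorm x -> 0 < a00 x /\ 0 < a11 x.
  move=> /MA[p0 p1]; split=> //.
  by rewrite -(pmulr_rgt0 _ p0); have := sqr_ge0 (a01 x); lra.
have Spos x : R0 < enorm x -> 0 < S x by move=> /apos[? ?]; rewrite /S; lra.
pose c00 z := (1 + a11 (X z)) / S (X z).
pose c01 z := - a01 (X z) / S (X z).
pose c11 z := (1 + a00 (X z)) / S (X z).
pose h z := psi z - (z 0 0 ^+ 2 + z 1 0 ^+ 2) / 4.
pose p0 z := X0 z - z 0 0 / 2; pose p1 z := X1 z - z 1 0 / 2.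
pose h00 z := c00 z - 1 / 2; pose h01 z := c01 z.
have shift f z a b (b0 b1 : R) : fd f z a b -> fd (fun y => f y - (b0 * y 0 0 + b1 * y 1 0)) z (a - b0) (b - b1).
  move=> fz e e0; near=> y.
  have : `|f y - f z - (a * (y 0 0 - z 0 0) + b * (y 1 0 - z 1 0))| <= e * enorm (y - z) by near: y; exact: fz.
  by congr (`|_| <= _); ring.
have half0 z : p0 z = X0 z - (1 / 2 * z 0 0 + 0 * z 1 0) by rewrite /p0; lra.
have half1 z : p1 z = X1 z - (0 * z 0 0 + 1 / 2 * z 1 0) by rewrite /p1; lra.
have dh z : rho < enorm z -> [/\ fd h z (p0 z) (p1 z), fd p0 z (h00 z) (h01 z) & fd p1 z (h01 z) (- h00 z)].
  move=> hz; have [_ _ fp [f0 f1] _] := hX z hz; split.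
  - move=> e e0; have e2 : 0 < e / 2 by lra.
    near=> y.
    have h1 : `|psi y - psi z - (X0 z * (y 0 0 - z 0 0) + X1 z * (y 1 0 - z 1 0))| <= e / 2 * enorm (y - z) by near: y; exact: fp.
    have h2 : enorm (y - z) < e by near: y; exact: enorm_near.
    have n0 := enorm_ge0 (y - z); have n2 := enorm_sqr (y - z); rewrite !mxE in n2.
    have -> : h y - h z - (p0 z * (y 0 0 - z 0 0) + p1 z * (y 1 0 - z 1 0)) =
      (psi y - psi z - (X0 z * (y 0 0 - z 0 0) + X1 z * (y 1 0 - z 1 0))) - enorm (y - z) ^+ 2 / 4.
      by rewrite n2 /h /p0 /p1; field.
    apply: le_trans (ler_normB _ _) _; rewrite [`|enorm _ ^+ 2 / 4|]ger0_norm ?divr_ge0 ?exprn_ge0//.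
    have : enorm (y - z) ^+ 2 <= e * enorm (y - z) by rewrite expr2; apply: ler_wpM2r => //; exact: ltW.
    have : 0 <= e * enorm (y - z) by rewrite mulr_ge0// ltW.
    by lra.
  - by have := shift _ _ _ _ (1 / 2) 0 f0; rewrite subr0 (_ : (fun y => _) = p0)//; apply/funext => y; rewrite half0.
  - have := shift _ _ _ _ 0 (1 / 2) f1; rewrite subr0 (_ : (fun y => _) = p1); last by apply/funext => y; rewrite half1.
    have Sp := Spos _ (Xbig z hz).
    suff -> : (1 + a00 (X z)) / S (X z) - 1 / 2 = - h00 z by [].
    by rewrite /h00 /c00; move: Sp; rewrite /S => Sp; field; rewrite gt_eqF.
have ch z : rho < enorm z -> {for z, continuous h00} /\ {for z, continuous h01}.
  move=> hz; have [_ _ _ _ [k0 k1]] := hX z hz; split => //.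
  by apply: continuousB; [exact: k0|exact: cst_continuous].
(* With tr = a00 + a11 and det D^2 v = 1, one has (h00^2 + h01^2) S^2 = tr^2/4 - 1, less than S^2/4
   = (tr + 2)^2/4. *)
have hlt z : rho < enorm z -> h00 z ^+ 2 + h01 z ^+ 2 < (1 / 2) ^+ 2.
  move=> hz; have hx := Xbig z hz; have Sp := Spos _ hx; have [_ det] := MA _ hx.
  have [p q] := apos _ hx.
  rewrite -(ltr_pM2r (exprn_gt0 2 Sp)).
  have -> : (h00 z ^+ 2 + h01 z ^+ 2) * S (X z) ^+ 2 = (1 + a11 (X z) - S (X z) / 2) ^+ 2 + a01 (X z) ^+ 2.
    by rewrite /h00 /h01 /c00 /c01; field; rewrite gt_eqF.
  by rewrite /S; nra.
have detE z : rho < enorm z -> 1 / 4 - h00 z * h00 z - h01 z * h01 z = (S (X z))^-1.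
  move=> hz; have Sp := Spos _ (Xbig z hz); have [_ dt] := MA _ (Xbig z hz).
  rewrite /h00 /h01 /c00 /c01.
  have SE : (S (X z))^-1 = (1 + a00 (X z) + a11 (X z) + (a00 (X z) * a11 (X z) - a01 (X z) ^+ 2)) / (S (X z) * S (X z)).
    by rewrite dt /S; field; rewrite gt_eqF.
  by rewrite [RHS]SE; move: Sp; rewrite /S => Sp; field; rewrite gt_eqF.
have bh z : rho < enorm z -> `|h00 z| <= 1 /\ `|h01 z| <= 1.
  move=> /hlt hz; have s0 := sqr_ge0 (h00 z); have s1 := sqr_ge0 (h01 z).
  by rewrite !ler_norml; split; apply/andP; split; nra.
have [k0 [k1 [l0 [l1 [c [d [w0 [w1 [hE hK]]]]]]]]] := harmonic_expansion rho0 dh ch bh.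
have hK1 : k0 ^+ 2 + k1 ^+ 2 < (1 / 2) ^+ 2 by apply: hK => //; lra.
have T0E x : lewy q0 q1 x 0 0 = x 0 0 + q0 x by rewrite mxE vec0.
have T1E x : lewy q0 q1 x 1 0 = x 1 0 + q1 x by rewrite mxE vec1.
have vT x : vec (x 0 0 + q0 x) (x 1 0 + q1 x) = lewy q0 q1 x by apply: cv2P; rewrite !(vec0, vec1, T0E, T1E).
have XT : \forall x \near at_inf, [/\ rho < enorm (lewy q0 q1 x), R0 < enorm x & X (lewy q0 q1 x) = x].
  near=> x; have x1 : R2 < enorm x by near: x; exact: at_inf_gt.
  have x2 : Cg + rho < enorm x by near: x; exact: at_inf_gt.
  have x3 : R0 + 1 < enorm x by near: x; exact: at_inf_gt.
  have hz : rho < enorm (lewy q0 q1 x) by have := growth x x1; lra.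
  split => //; first lra.
  have [[h1 h2] _ _ _ _] := hX _ hz.
  by apply: inj => //; exact: ltW.
have XE x : X (lewy q0 q1 x) = x -> X0 (lewy q0 q1 x) = x 0 0 /\ X1 (lewy q0 q1 x) = x 1 0.
  by move=> e; split; [have := congr1 (fun y => y 0 0) e; rewrite vec0|have := congr1 (fun y => y 1 0) e; rewrite vec1].
(* Since h00^2 + h01^2 = 1/4 - 1/(2 + tr), a bound tr < B amounts to a strict bound by 1/4 - 1/(2 +
   B), which [harmonic_expansion] preserves. *)
have hB (B : R) : (forall x, R0 < enorm x -> a00 x + a11 x < B) -> (1 / 4 - k0 ^+ 2 - k1 ^+ 2)^-1 - 2 < B.
  move=> trB; have D0 : 0 < 1 / 4 - k0 ^+ 2 - k1 ^+ 2 by rewrite expr2 in hK1; lra.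
  have lt z : rho < enorm z -> h00 z ^+ 2 + h01 z ^+ 2 < 1 / 4 - (2 + B)^-1.
    move=> hz; have := detE z hz; have := trB _ (Xbig z hz); have Sp := Spos _ (Xbig z hz).
    rewrite !expr2 => h1 h2; have : (2 + B)^-1 < (S (X z))^-1 by rewrite ltf_pV2 ?posrE// /S; move: Sp; rewrite /S; lra.
    by rewrite -h2; lra.
  have [z hz] : exists z : 'cV[R]_2, rho < enorm z.
    by exists (ofC (circ (rho + 1) 0)); rewrite enorm_circ; lra.
  have b0 : 0 <= 1 / 4 - (2 + B)^-1.
    by have := lt z hz; have := sqr_ge0 (h00 z); have := sqr_ge0 (h01 z); lra.
  have B2 : 0 < 2 + B.
    by have := trB _ (Xbig z hz); have := Spos _ (Xbig z hz); rewrite /S; lra.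
  have := hK (Num.sqrt (1 / 4 - (2 + B)^-1)) (sqrtr_ge0 _); rewrite sqr_sqrtr// => /(_ lt) kB.
  have : (1 / 4 - k0 ^+ 2 - k1 ^+ 2)^-1 < 2 + B by rewrite invf_plt ?posrE//; lra.
  lra.
have [|||||||m00 [m01 [m11 [b0 [b1 [g [d' [w0' [w1' [m0 dm tm sm]]]]]]]]]] :=
  @legendre_expansion v (fun x => x 0 0 + q0 x) (fun x => x 1 0 + q1 x) h p0 p1 h00 h01 k0 k1 l0 l1 c d w0 w1 Cg.
- exact: hK1.
- by near=> z; apply: dh; near: z; exact: at_inf_gt.
- exact: hE.
- near=> x; rewrite vT; apply: growth; near: x; exact: at_inf_gt.
- near=> x; rewrite vT.
  have [hz _ e] : [/\ rho < enorm (lewy q0 q1 x), R0 < enorm x & X (lewy q0 q1 x) = x] by near: x.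
  by have [X0E X1E] := XE _ e; rewrite /p0 /p1 X0E X1E T0E T1E; split; ring.
- near=> x; rewrite vT.
  have [hz hx e] : [/\ rho < enorm (lewy q0 q1 x), R0 < enorm x & X (lewy q0 q1 x) = x] by near: x.
  have [_ f0 f1] := dv _ hx; have [_ dt] := MA _ hx; have Sp := Spos _ hx.
  have dE := detE _ hz; rewrite e in dE.
  rewrite dE invrK /h00 /h01 /c00 /c01 e.
  have E0 : (1 / 2 - ((1 + a11 x) / S x - 1 / 2)) * S x = 1 + a00 x.
    by move: Sp; rewrite /S => Sp; field; rewrite gt_eqF.
  have E1 : (1 / 2 + ((1 + a11 x) / S x - 1 / 2)) * S x = 1 + a11 x.
    by field; rewrite gt_eqF.
  have E2 : - (- a01 x / S x) * S x = a01 x by field; rewrite gt_eqF.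
  rewrite E0 E1 E2; split=> ep ep0; near=> y.
    have : `|q0 y - q0 x - (a00 x * (y 0 0 - x 0 0) + a01 x * (y 1 0 - x 1 0))| <= ep * enorm (y - x) by near: y; exact: f0.
    by congr (`|_| <= _); ring.
  have : `|q1 y - q1 x - (a01 x * (y 0 0 - x 0 0) + a11 x * (y 1 0 - x 1 0))| <= ep * enorm (y - x) by near: y; exact: f1.
  by congr (`|_| <= _); ring.
- near=> x; rewrite vT.
  have [hz hx e] : [/\ rho < enorm (lewy q0 q1 x), R0 < enorm x & X (lewy q0 q1 x) = x] by near: x.
  have [_ psiE _ _ _] := hX _ hz; rewrite -/(X _) e in psiE.
  have [X0E X1E] := XE _ e.
  by rewrite /h psiE X0E X1E /nsq T0E T1E; field.
exists m00, m01, m11, b0, b1, g, d', w0', w1'; split => // B /hB; rewrite tm.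
Unshelve. all: by end_near. Qed.

End MongeAmpereExpansion.

(** * From symbols to the O_k notation *)

Section SymBigO.
Context {R : realType}.
Implicit Types (f : 'cV[R]_2 -> R) (U V : set 'cV[R]_2).

Lemma Ck_sub k U V f : U `<=` V -> Ck k V f -> Ck k U f.
Proof.
move=> UV; elim: k f => [|k IH] f [cf df]; first by split=> // x /UV /cf.
split=> [x /UV /cf//|i]; have [h1 h2] := df i.
by split; [move=> x /UV /h1|exact: IH].
Qed.

Lemma Sym_Ck k p f : Sym k p f -> exists r, Ck k [set x | r < enorm x] f.
Proof.
elim: k p f => [|k IH] p f; first by move=> [[r hr] _ _]; exists r; split.
move=> [[r hr] _ df].
have [[[r0 h0] /IH[s0 k0]] [[r1 h1] /IH[s1 k1]]] := (df 0, df 1).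
exists (`|r| + `|r0| + `|r1| + `|s0| + `|s1|).
have big (t : R) (x : 'cV[R]_2) : t <= `|r| + `|r0| + `|r1| + `|s0| + `|s1| ->
    `|r| + `|r0| + `|r1| + `|s0| + `|s1| < enorm x -> t < enorm x by exact: le_lt_trans.
have L (t : R) : t <= `|t| := ler_norm t.
have N (t : R) : 0 <= `|t| := normr_ge0 t.
have := (L r, L r0, L r1, L s0, L s1); have := (N r, N r0, N r1, N s0, N s1).
move=> [[[[n n0] n1] m0] m1] [[[[l l0] l1] k0'] k1'].
split=> [x /big hx|i]; first by apply: hr; apply: hx; lra.
have [->|->] : i = 0 \/ i = 1 by case: i => -[|[|//]] lt; [left|right]; exact: val_inj.
  split=> [x /big hx|]; first by apply: h0; apply: hx; lra.
  by apply: Ck_sub k0 => x /big hx /=; apply: hx; lra.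
split=> [x /big hx|]; first by apply: h1; apply: hx; lra.
by apply: Ck_sub k1 => x /big hx /=; apply: hx; lra.
Qed.

Lemma Sym_foldr k p f (s : seq 'I_2) : Sym (k + size s) p f -> Sym k (p - (size s)%:Z) (foldr (@partial R) f s).
Proof.
elim: s k => [|i s IH] k /=; first by rewrite addn0 subr0.
rewrite addnS -addSn => /IH /(Sym_derive i).
have -> // : p - (size s)%:Z - 1 = p - (size s).+1%:Z by rewrite -[(size s).+1]addn1 PoszD opprD addrA.
Qed.

Lemma Sym_Dnorm p f j : (forall k, Sym k p f) ->
  exists C : R, \forall x \near at_inf, Dnorm j f x <= C * enorm x ^ (p - j%:Z).
Proof.
move=> sf.
have /choice[C hC] : forall s : j.-tuple 'I_2,
    exists C : R, \forall x \near at_inf, `|foldr (@partial R) f s x| <= C * enorm x ^ (p - j%:Z).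
  move=> s; have := Sym_foldr (sf (0 + size s)%N); rewrite size_tuple.
  exact: Sym_bound.
exists (\sum_s C s); have {}hC : \forall x \near at_inf, forall s : j.-tuple 'I_2, `|foldr (@partial R) f s x| <= C s * enorm x ^ (p - j%:Z).
  exact: filter_forall hC.
near=> x; have hx : forall s : j.-tuple 'I_2, `|foldr (@partial R) f s x| <= C s * enorm x ^ (p - j%:Z) by near: x.
have n0 (s : j.-tuple 'I_2) : 0 <= `|foldr (@partial R) f s x| by [].
apply: le_trans (_ : \sum_(s : j.-tuple 'I_2) `|foldr (@partial R) f s x| <= _); last by rewrite mulr_suml; apply: ler_sum.
rewrite /Dnorm -[leRHS]ger0_norm ?sumr_ge0// -sqrtr_sqr.
apply: ler_wsqrtr; rewrite expr2 mulr_suml; apply: ler_sum => s _.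
rewrite -real_normK ?num_real// expr2 ler_wpM2l// (bigD1 s)//= lerDl.
exact: sumr_ge0.
Unshelve. all: by end_near. Qed.

Lemma Sym_bigO k f : (forall k, Sym k (- 2) f) -> bigO_k k (- 2) 1 f.
Proof.
move=> sf; have [r hr] := Sym_Ck (sf k).
have [C0 hC] : exists C : R, \forall x \near at_inf, forall j, (j <= k)%N -> Dnorm j f x <= C * enorm x ^ (- 2 - j%:Z).
  elim: k {hr} => [|k [C hC]].
    have [C hC] := Sym_Dnorm 0%N sf; exists C; near=> x => j; rewrite leqn0 => /eqP ->.
    by near: x.
  have [D hD] := Sym_Dnorm k.+1 sf; exists (`|C| + `|D|).
  near=> x => j; have x0 : 0 < enorm x by near: x; exact: at_inf_gt.
  have xp (q : int) : 0 <= enorm x ^ q by exact: exprz_ge0.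
  rewrite leq_eqVlt => /predU1P[->|jk].
    have h : Dnorm k.+1 f x <= D * enorm x ^ (- 2 - k.+1%:Z) by near: x.
    by apply: le_trans h _; rewrite ler_wpM2r// (le_trans (ler_norm D))// lerDr.
  have h : forall j, (j <= k)%N -> Dnorm j f x <= C * enorm x ^ (- 2 - j%:Z) by near: x.
  by apply: le_trans (h j jk) _; rewrite ler_wpM2r// (le_trans (ler_norm C))// lerDl.
(* Beyond |x| = e the logarithm is at least 1, so a bound by |x|^(-2-j) implies the one multiplied
   by ln |x|. *)
move: hC => [r1 hC]; exists (`|r| + `|r1| + expR 1), `|C0|.
have big x : `|r| + `|r1| + expR 1 < enorm x -> [/\ r < enorm x, r1 < enorm x & expR 1 < enorm x].
  have := ler_norm r; have := ler_norm r1; have := normr_ge0 r; have := normr_ge0 r1; have := expR_gt0 (1 : R).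
  by move=> ? ? ? ? ? ?; split; lra.
split; first by apply: Ck_sub hr => x /= /big[].
move=> j x jk /big[_ x1 xe].
have x0 : 0 < enorm x by apply: lt_trans xe; exact: expR_gt0.
apply: le_trans (hC x x1 j jk) _.
have ln1 : 1 <= ln (enorm x).
  by rewrite -[X in X <= _](@expRK R) ler_ln ?posrE ?expR_gt0// ltW.
have -> : enorm x `^ (- 2 - j%:R) = enorm x ^ (- 2 - j%:Z).
  by rewrite -opprD -natrD powRN powR_mulrn// -(opprD 2) -PoszD -exprnN.
rewrite powRr1; last by lra.
have xp : 0 <= enorm x ^ (- 2 - j%:Z) by apply: exprz_ge0; exact: ltW.
move: (enorm x ^ _) xp => u u0.
apply: le_trans (_ : `|C0| * u <= _); first by rewrite ler_wpM2r// ler_norm.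
by rewrite ler_wpM2l// ler_peMr.
Unshelve. all: by end_near. Qed.

End SymBigO.

(** * Symmetric 2 x 2 matrices: eigenvalues, positivity, square roots *)

Section SymMatrix.
Context {R : realType}.
Implicit Types (x y : 'cV[R]_2) (M N : 'M[R]_2).

Definition sym2 (a b c : R) : 'M[R]_2 := \matrix_(i, j) if i != j then b else if i == 0 then a else c.

Lemma sym2E a b c : [/\ sym2 a b c 0 0 = a, sym2 a b c 0 1 = b, sym2 a b c 1 0 = b & sym2 a b c 1 1 = c].
Proof. by rewrite !mxE. Qed.

Lemma mx2P M N : M 0 0 = N 0 0 -> M 0 1 = N 0 1 -> M 1 0 = N 1 0 -> M 1 1 = N 1 1 -> M = N.
Proof.
have I2 (i : 'I_2) : i = 0 \/ i = 1 by case: i => -[|[|//]] lt; [left|right]; exact: val_inj.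
by move=> *; apply/matrixP => i j; case: (I2 i) (I2 j) => -> [] ->.
Qed.

Lemma sym2_tr a b c : (sym2 a b c)^T = sym2 a b c.
Proof. by apply: mx2P; rewrite !mxE. Qed.

Lemma sym2_of M : M^T = M -> M = sym2 (M 0 0) (M 0 1) (M 1 1).
Proof.
move=> MT; apply: mx2P; rewrite ?mxE//=.
by rewrite -{1}MT mxE.
Qed.

Lemma mul2E M N i j : (M *m N) i j = M i 0 * N 0 j + M i 1 * N 1 j.
Proof.
rewrite mxE big_ord_recl big_ord1; congr (_ + M i _ * N _ j); exact: val_inj.
Qed.

Lemma mulv2E M x i : (M *m x) i 0 = M i 0 * x 0 0 + M i 1 * x 1 0.
Proof.
rewrite mxE big_ord_recl big_ord1; congr (_ + M i _ * x _ 0); exact: val_inj.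
Qed.

Lemma sym2_mulv a b c x : sym2 a b c *m x = lin a b c x.
Proof. by have [e0 e1 e2 e3] := sym2E a b c; apply: cv2P; rewrite mulv2E (vec0, vec1) (e0, e2) (e1, e3). Qed.

Lemma qform_sym2 a b c x : qform (sym2 a b c) x = quad a b c x.
Proof. by rewrite /qform sym2_mulv dotE vec0 vec1 /quad; ring. Qed.

Lemma posdef_sym2 a b c : posdef (sym2 a b c) <-> 0 < a /\ b ^+ 2 < a * c.
Proof.
split=> [[_ h]|[a0 h]].
  have q0 : 0 < a.
    have := h (vec 1 0); rewrite qform_sym2 /quad vec0 vec1 => /(_ _).
    have v0 : vec 1 0 != 0 :> 'cV[R]_2.
      by apply/eqP => /(congr1 (fun y : 'cV[R]_2 => y 0 0)); rewrite vec0 mxE => /eqP; rewrite oner_eq0.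
    by move=> /(_ v0); lra.
  split=> //; have := h (vec (- b) a); rewrite qform_sym2 /quad vec0 vec1 => /(_ _).
  have v0 : vec (- b) a != 0 :> 'cV[R]_2.
    by apply/eqP => /(congr1 (fun y : 'cV[R]_2 => y 1 0)); rewrite vec1 mxE => /eqP; rewrite gt_eqF.
  move=> /(_ v0).
  have -> : a * (- b) ^+ 2 + 2 * b * - b * a + c * a ^+ 2 = a * (a * c - b ^+ 2) by ring.
  by rewrite pmulr_rgt0// subr_gt0.
split=> [|x x0]; first exact: sym2_tr.
rewrite qform_sym2 -(pmulr_rgt0 _ a0).
have -> : a * quad a b c x = (a * x 0 0 + b * x 1 0) ^+ 2 + (a * c - b ^+ 2) * x 1 0 ^+ 2 by rewrite /quad; ring.
have d0 : 0 < a * c - b ^+ 2 by rewrite subr_gt0.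
have [z1|z1] := eqVneq (x 1 0) 0.
  have x00 : x 0 0 != 0 by apply/eqP => z0; move/eqP: x0; apply; apply: cv2P; rewrite ?z0 ?z1 mxE.
  by rewrite z1 mulr0 addr0 expr0n mulr0 addr0 exprn_even_gt0//= mulf_neq0// gt_eqF.
by apply: ltr_wpDl; [exact: sqr_ge0|rewrite mulr_gt0// exprn_even_gt0].
Qed.

Lemma det2 (K : comNzRingType) (M : 'M[K]_2) : \det M = M 0 0 * M 1 1 - M 0 1 * M 1 0.
Proof.
rewrite (expand_det_row _ 0) big_ord_recl big_ord1 /cofactor !det_mx11 !mxE /= expr0 mul1r expr1 mulN1r mulrN.
by congr (M _ _ * M _ _ - M _ _ * M _ _); exact: val_inj.
Qed.

(** The discriminant (a - c)^2 + 4 b^2 is nonnegative, so explicit real roots exist and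
    [eigenvalues] is not the default value. Whichever ordering is chosen, the values of the
    characteristic polynomial at 0 and 1 determine sum and product. *)
Lemma eigenvalues_tr_det M (l := eigenvalues M) : M^T = M ->
  l 0 0 + l 0 1 = M 0 0 + M 1 1 /\ l 0 0 * l 0 1 = M 0 0 * M 1 1 - M 0 1 ^+ 2.
Proof.
move=> MT; have M10 : M 1 0 = M 0 1 by rewrite -{1}MT mxE.
set a := M 0 0; set c := M 1 1; set b := M 0 1.
have cE : char_poly M = ('X - a%:P) * ('X - c%:P) - b%:P * b%:P.
  by rewrite /char_poly det2 !mxE /= M10 -/a -/b -/c !mulr1n !mulr0n !sub0r mulrNN.
have prodE (l' : 'rV[R]_2) : \prod_(i < 2) ('X - (l' 0 i)%:P) = ('X - (l' 0 0)%:P) * ('X - (l' 0 1)%:P).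
  by rewrite big_ord_recl big_ord1; congr (_ * ('X - (l' 0 _)%:P)); exact: val_inj.
pose r := Num.sqrt ((a - c) ^+ 2 + 4 * b ^+ 2).
have rE : r ^+ 2 = (a - c) ^+ 2 + 4 * b ^+ 2 by rewrite sqr_sqrtr// addr_ge0 ?sqr_ge0// mulr_ge0 ?sqr_ge0.
pose l0 : 'rV[R]_2 := \row_i if i == 0 then (a + c + r) / 2 else (a + c - r) / 2.
have h : char_poly M = \prod_(i < 2) ('X - (l0 0 i)%:P).
  rewrite cE prodE !mxE /=.
  have s : (a + c + r) / 2 + (a + c - r) / 2 = a + c by field.
  have p : (a + c + r) / 2 * ((a + c - r) / 2) = a * c - b * b.
    have -> : (a + c + r) / 2 * ((a + c - r) / 2) = ((a + c) ^+ 2 - r ^+ 2) / 4 by field.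
    by rewrite rE; field.
  move: ((a + c + r) / 2) ((a + c - r) / 2) s p => u w s p.
  have := congr1 (@polyC R) s; have := congr1 (@polyC R) p; rewrite !polyCM !polyCD polyCN !polyCM.
  move=> p' s'.
  have -> : ('X - u%:P) * ('X - w%:P) = 'X * 'X - (u%:P + w%:P) * 'X + u%:P * w%:P :> {poly R} by ring.
  by rewrite s' p'; ring.
have := @xgetI _ 0 [set l : 'rV[R]_2 | char_poly M = \prod_(i < 2) ('X - (l 0 i)%:P)] _ h.
rewrite /= -/(eigenvalues M) -/l prodE cE => e.
have := congr1 (horner^~ 0) e; have := congr1 (horner^~ 1) e; rewrite !hornerE /= => e1 e0.
by split; lra.
Qed.

(** Uniqueness of the positive square root S of N: det S is the positive root of det N, and (tr S)^2
    = tr N + 2 det S fixes the trace. The off-diagonal entry of N is that of S times tr S, and the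
    diagonal follows. *)
Lemma sqrtmx_sym2 a b c : 0 < a -> b ^+ 2 < a * c -> sqrtmx (sym2 a b c *m sym2 a b c) = sym2 a b c.
Proof.
move=> a0 h; have c0 : 0 < c by rewrite -(pmulr_rgt0 _ a0); apply: le_lt_trans h; exact: sqr_ge0.
apply: xget_unique => [|S [Sp SE]]; first by split=> //; apply/posdef_sym2.
have ST := Sp.1; move: Sp SE; rewrite (sym2_of ST).
move: (S 0 0) (S 0 1) (S 1 1) => s t w /posdef_sym2[s0 hs] SE.
have w0 : 0 < w by rewrite -(pmulr_rgt0 _ s0); apply: le_lt_trans hs; exact: sqr_ge0.
have [e0 e1 e2 e3] := sym2E a b c; have [f0 f1 f2 f3] := sym2E s t w.
have := congr1 (fun M : 'M[R]_2 => M 0 0) SE; have := congr1 (fun M : 'M[R]_2 => M 0 1) SE.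
have := congr1 (fun M : 'M[R]_2 => M 1 1) SE.
rewrite !mul2E e0 e1 e2 e3 f0 f1 f2 f3 => h11 h01 h00.
have dd : s * w - t ^+ 2 = a * c - b ^+ 2.
  apply/eqP; rewrite -(@eqrXn2 _ 2)//; [|by rewrite subr_ge0 ltW|by rewrite subr_ge0 ltW].
  apply/eqP.
  have -> : (s * w - t ^+ 2) ^+ 2 = (s * s + t * t) * (t * t + w * w) - (s * t + t * w) * (s * t + t * w) by ring.
  by rewrite h00 h01 h11; ring.
have tt : s + w = a + c.
  apply/eqP; rewrite -(@eqrXn2 _ 2)//; [|by rewrite addr_ge0// ltW|by rewrite addr_ge0// ltW].
  apply/eqP.
  have -> : (s + w) ^+ 2 = (s * s + t * t) + (t * t + w * w) + 2 * (s * w - t ^+ 2) by ring.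
  by rewrite h00 h11 dd; ring.
have tb : t = b.
  have : (t - b) * (a + c) = 0 by rewrite mulrBl -{1}tt; lra.
  by move=> /eqP; rewrite mulf_eq0 [a + c == 0]gt_eqF ?addr_gt0// orbF subr_eq0 => /eqP.
have sa : s = a.
  have : (s - a) * (s + a) = 0 by move: h00; rewrite tb; lra.
  by move=> /eqP; rewrite mulf_eq0 [s + a == 0]gt_eqF ?addr_gt0// orbF subr_eq0 => /eqP.
have wc : w = c by move: tt; rewrite sa; lra.
by rewrite sa tb wc.
Qed.

End SymMatrix.

(** * The angle theta and the final form of the expansion *)

Section AngleForm.
Context {R : realType}.
Implicit Types (x y : 'cV[R]_2).

Lemma exists_angle (Q : 'M[R]_2) (s00 s01 s11 : R) : 0 < s00 -> s01 ^+ 2 < s00 * s11 ->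
  Q = sym2 s00 s01 s11 *m sym2 s00 s01 s11 -> exists theta : 'cV[R]_2 -> R, is_angle Q theta /\
   forall x, x != 0 -> [/\ 0 < nsq (lin s00 s01 s11 x), qform Q x = nsq (lin s00 s01 s11 x),
     cos (theta x) = (Num.sqrt (qform Q x))^-1 * lin s00 s01 s11 x 0 0 &
     sin (theta x) = (Num.sqrt (qform Q x))^-1 * lin s00 s01 s11 x 1 0].
Proof.
move=> s0 sd QE.
have SE : sqrtmx Q = sym2 s00 s01 s11 by rewrite QE; exact: sqrtmx_sym2.
have qE x : qform Q x = nsq (lin s00 s01 s11 x).
  by rewrite /qform QE -mulmxA !sym2_mulv dotE /lin /nsq !(vec0, vec1); ring.
have qp x : x != 0 -> 0 < nsq (lin s00 s01 s11 x).
  move=> x0; apply: enorm2_gt0; rewrite enorm_gt0.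
  apply/eqP => e; have [_ h] := (posdef_sym2 s00 s01 s11).2 (conj s0 sd).
  by have := h x x0; rewrite /qform sym2_mulv e dotE !mxE !mulr0 addr0 ltxx.
pose e x := (Num.sqrt (qform Q x))^-1 *: (sqrtmx Q *m x).
have /choice[theta ht] : forall x, exists t, x != 0 -> cos t = e x 0 0 /\ sin t = e x 1 0.
  move=> x; have [->|x0] := eqVneq x 0; first by exists 0 => /eqP.
  have [t _ et] := polar (e x); exists t => _.
  have e1 : enorm (e x) = 1.
    rewrite /e SE sym2_mulv enormZ ger0_norm ?invr_ge0 ?sqrtr_ge0// qE.
    have := qp x x0; set y := lin _ _ _ x => yp.
    rewrite /enorm dotE -/(nsq y) mulVf// gt_eqF// sqrtr_gt0//.
  by move: et; rewrite e1 => ->; rewrite vec0 vec1 /= !mul1r.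
exists theta; split=> [x x0|x x0]; first exact: ht.
have [-> ->] := ht x x0.
by split; [exact: qp|exact: qE|rewrite /e SE sym2_mulv mxE..].
Qed.

(** Here Q^(1/2) = sqrt(kappa) P, so x^T Q x = kappa |P x|^2. The constant d ln kappa is absorbed by
    gamma, and the dipole in P x becomes the cos theta, sin theta term with weights multiplied by
    sqrt(kappa). *)
Lemma angle_expansion (u : 'cV[R]_2 -> R) (A Q : 'M[R]_2) (kappa p00 p01 p11 b0 b1 g d w0 w1 : R) :
  0 < kappa -> 0 < p00 -> p01 ^+ 2 < p00 * p11 ->
  Q = kappa *: (sym2 p00 p01 p11 *m sym2 p00 p01 p11) ->
  (forall k, Sym k (- 2) (fun x => u x - (2^-1 * qform A x + (b0 * x 0 0 + b1 * x 1 0) + g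
     + log_dipole p00 p01 p11 d w0 w1 x))) ->
  exists (gamma d d1 d2 : R) (beta : 'cV[R]_2) (theta : 'cV[R]_2 -> R),
    is_angle Q theta /\ forall k : nat, bigO_k k (-2) 1 (fun x =>
      u x - (2^-1 * qform A x + dot beta x + gamma) - d * ln (qform Q x)
      - (Num.sqrt (qform Q x))^-1 * (d1 * cos (theta x) + d2 * sin (theta x))).
Proof.
move=> k0 p0 pd QE su; pose r := Num.sqrt kappa.
have r0 : 0 < r by rewrite sqrtr_gt0.
have rr : r * r = kappa by rewrite -expr2 sqr_sqrtr// ltW.
have [| | |theta [ta th]] := @exists_angle Q (r * p00) (r * p01) (r * p11).
- exact: mulr_gt0.
- have -> : (r * p01) ^+ 2 = r * r * p01 ^+ 2 by ring.
  have -> : r * p00 * (r * p11) = r * r * (p00 * p11) by ring.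
  by rewrite ltr_pM2l// mulr_gt0.
- rewrite QE -rr; have [e0 e1 e2 e3] := sym2E p00 p01 p11; have [f0 f1 f2 f3] := sym2E (r * p00) (r * p01) (r * p11).
  by apply: mx2P; rewrite [LHS]mxE !mul2E !(e0, e1, e2, e3, f0, f1, f2, f3); ring.
exists (g - d * ln kappa), d, (r * w0), (r * w1), (vec b0 b1), theta; split=> // k.
apply: Sym_bigO => j; apply: Sym_eq (su j); near=> x.
have xp : 0 < enorm x by near: x; exact: at_inf_gt.
have x0 : x != 0 by apply/eqP => e; move: xp; rewrite e enorm0 ltxx.
have [np qE -> ->] := th x x0.
have linE : lin (r * p00) (r * p01) (r * p11) x = r *: lin p00 p01 p11 x.
  by apply: cv2P; rewrite [RHS]mxE /lin !(vec0, vec1); ring.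
rewrite /log_dipole linE in np qE *; move: (lin p00 p01 p11 x) np qE => y np qE.
have yE i : (r *: y) i 0 = r * y i 0 by rewrite mxE.
have nE : nsq (r *: y) = kappa * nsq y by rewrite /nsq !yE -rr; ring.
rewrite nE in np qE; have np' : 0 < nsq y by rewrite pmulr_rgt0 in np.
have sE : (Num.sqrt (qform Q x))^-1 * (Num.sqrt (qform Q x))^-1 = (r * r * nsq y)^-1.
  by rewrite -invfM -expr2 sqr_sqrtr qE ?rr// ltW.
rewrite !yE dotE vec0 vec1 qE lnM ?posrE//; rewrite qE in sE; move: (Num.sqrt _) sE => s sE.
have -> : s^-1 * (r * w0 * (s^-1 * (r * y 0 0)) + r * w1 * (s^-1 * (r * y 1 0))) = (s^-1 * s^-1) * (r * r) * (w0 * y 0 0 + w1 * y 1 0) by ring.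
rewrite sE; move: (qform A x) (nsq y) np' (ln kappa) => qA n n0 lk.
by field; rewrite !gt_eqF.
Unshelve. all: by end_near. Qed.

Lemma qmx_unit (Q : 'M[R]_2) (kappa p00 p01 p11 : R) : 0 < kappa -> p01 ^+ 2 < p00 * p11 ->
  Q = kappa *: (sym2 p00 p01 p11 *m sym2 p00 p01 p11) -> Q \in unitmx.
Proof.
move=> k0 pd ->; rewrite unitmxE detZ det_mulmx det2 unitfE.
have [-> -> -> ->] := sym2E p00 p01 p11.
by rewrite !mulf_neq0 ?expf_neq0 ?gt_eqF// -expr2 subr_gt0.
Qed.

End AngleForm.

(** * Sums of two arctangents, and the gradient of F_tau *)

Section Angles.
Context {R : realType}.

(* For positive c, (1 - y1 y2, y1 + y2) is a positive multiple of the unit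
   vector of angle atan y1 + atan y2. *)
Lemma atan_add_polar (y1 y2 : R) : exists2 c : R, 0 < c &
  c * (1 - y1 * y2) = cos (atan y1 + atan y2) /\ c * (y1 + y2) = sin (atan y1 + atan y2).
Proof.
have cp (y : R) : 0 < cos (atan y) by rewrite cos_gt0_pihalf// atan_gtNpi2 atan_ltpi2.
have sE (y : R) : sin (atan y) = y * cos (atan y).
  by have := atanK y; rewrite /tan => {2}<-; rewrite divfK// gt_eqF.
exists (cos (atan y1) * cos (atan y2)); first exact: mulr_gt0.
by rewrite cosD sinD !sE; split; ring.
Qed.

Lemma atan_add_bound (y1 y2 : R) : - pi < atan y1 + atan y2 < pi.
Proof.
have := atan_gtNpi2 y1; have := atan_gtNpi2 y2; have := atan_ltpi2 y1; have := atan_ltpi2 y2.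
by move=> ? ? ? ?; apply/andP; split; lra.
Qed.

(** The argument of (X, Y) in (-pi, pi), by the half-angle formula; it has no singularity at X = 0,
    only on the half-line Y = 0, X <= 0. *)
Definition arg2 (X Y : R) : R := 2 * atan (Y / (X + Num.sqrt (X * X + Y * Y))).

Lemma arg2_pos (y1 y2 : R) (X := 1 - y1 * y2) (Y := y1 + y2) : 0 < X * X + Y * Y /\ 0 < X + Num.sqrt (X * X + Y * Y).
Proof.
have p : 0 < X * X + Y * Y.
  have -> : X * X + Y * Y = (1 + y1 ^+ 2) * (1 + y2 ^+ 2) by rewrite /X /Y; ring.
  by rewrite mulr_gt0// ltr_wpDr// sqr_ge0.
split=> //; have s0 : 0 < Num.sqrt (X * X + Y * Y) by rewrite sqrtr_gt0.
have sE : Num.sqrt (X * X + Y * Y) ^+ 2 = X * X + Y * Y by rewrite sqr_sqrtr// ltW.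
have [Xp|Xn] := ltP 0 X; first exact: addr_gt0.
have Y0 : Y != 0.
  apply/eqP => Y0; have y2E : y2 = - y1 by move: Y0; rewrite /Y; lra.
  by move: Xn; rewrite /X y2E mulrN opprK; have := sqr_ge0 y1; rewrite expr2; lra.
have Y2 : 0 < Y * Y by rewrite -expr2 exprn_even_gt0.
by move: s0 sE; set r := Num.sqrt _ => s0 sE; rewrite ltNge; apply/negP => h; nra.
Qed.

(** This writes the sum in the elementary symmetric functions of y1 and y2, so that it can be
    differentiated through trace and determinant even where two eigenvalues coincide. *)
Lemma atan_addE (y1 y2 : R) : atan y1 + atan y2 = arg2 (1 - y1 * y2) (y1 + y2).
Proof.
have [c c0 [cX cY]] := atan_add_polar y1 y2; have /andP[b1 b2] := atan_add_bound y1 y2.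
have [p q] := arg2_pos y1 y2; rewrite /arg2.
move: (atan y1 + atan y2) (1 - y1 * y2) (y1 + y2) cX cY b1 b2 p q => t X Y cX cY b1 b2 p q.
have hX : c * (c * (X * X + Y * Y)) = 1.
  by rewrite -(cos2Dsin2 t) -cX -cY; ring.
have sE : Num.sqrt (X * X + Y * Y) = c^-1.
  have -> : X * X + Y * Y = c^-1 ^+ 2 by rewrite -[RHS]mulr1 -hX; field; rewrite gt_eqF.
  by rewrite sqrtr_sqr gtr0_norm// invr_gt0.
have hc : 0 < cos (t / 2) by rewrite cos_gt0_pihalf//; apply/andP; split; lra.
have t2 : t = (t / 2) *+ 2 by rewrite mulr2n; field.
have -> : Y / (X + Num.sqrt (X * X + Y * Y)) = tan (t / 2).
  have n0 : c * X + 1 != 0 by rewrite gt_eqF//; move: q; rewrite sE -(pmulr_rgt0 _ c0) mulrDr mulfV ?gt_eqF.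
  have -> : Y / (X + Num.sqrt (X * X + Y * Y)) = (c * Y) / (c * X + 1).
    by rewrite sE; field; rewrite n0 gt_eqF.
  have s2 : sin t = cos (t / 2) * sin (t / 2) *+ 2 by rewrite -sin_mulr2n -t2.
  have c2 : cos t = cos (t / 2) ^+ 2 *+ 2 - 1 by rewrite -cos_mulr2n -t2.
  rewrite cX cY s2 c2 /tan subrK !mulr2n; move: (cos _) (sin _) hc => k s k0.
  by field; rewrite !gt_eqF// addr_gt0// exprn_gt0.
by rewrite tanK ?in_itv/=; [field|apply/andP; split; lra].
Qed.

Lemma is_derive_quadratic (a b c : R) : is_derive (0 : R) (1 : R) (fun h => a + h * b + h ^+ 2 * c) b.
Proof.
apply/is_deriveP => e e0.
have e1 : 0 < e / (1 + `|c|) by rewrite divr_gt0//; have := normr_ge0 c; lra.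
near=> h; have hh : `|h| < e / (1 + `|c|) by near: h; exact: near0_lt.
rewrite -[h *: 1]/(h * 1) mulr1 add0r.
have -> : a + h * b + h ^+ 2 * c - (a + 0 * b + 0 ^+ 2 * c) - h * b = h * c * h by ring.
rewrite !normrM ler_wpM2r//.
rewrite ltr_pdivlMr in hh; last by have := normr_ge0 c; lra.
by have := normr_ge0 h; have := normr_ge0 c; nra.
Unshelve. all: by end_near. Qed.

Lemma is_derive_ln_comp (U : R -> R) (u : R) : 0 < U 0 -> is_derive (0 : R) (1 : R) U u ->
  is_derive (0 : R) (1 : R) (fun h => ln (U h)) (u / U 0).
Proof.
move=> U0 dU; have := is_derive1_comp (is_derive1_ln U0) dU.
by rewrite mulrC.
Qed.

Lemma is_derive_div (U W : R -> R) (u w : R) : W 0 != 0 -> is_derive (0 : R) (1 : R) U u -> is_derive (0 : R) (1 : R) W w ->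
  is_derive (0 : R) (1 : R) (fun h => U h / W h) ((u * W 0 - U 0 * w) / W 0 ^+ 2).
Proof.
move=> W0 dU dW.
have -> : (u * W 0 - U 0 * w) / W 0 ^+ 2 = U 0 *: (- (W 0) ^- 2 *: w) + (W 0)^-1 *: u.
  by rewrite -![_ *: _]/(_ * _); field.
exact: (is_deriveM dU (is_deriveV W0 dW)).
Qed.

Lemma is_derive_arg2 (X Y : R -> R) (dx dy : R) :
  0 < X 0 * X 0 + Y 0 * Y 0 -> 0 < X 0 + Num.sqrt (X 0 * X 0 + Y 0 * Y 0) ->
  is_derive (0 : R) (1 : R) X dx -> is_derive (0 : R) (1 : R) Y dy ->
  is_derive (0 : R) (1 : R) (fun h => arg2 (X h) (Y h)) ((X 0 * dy - Y 0 * dx) / (X 0 * X 0 + Y 0 * Y 0)).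
Proof.
move=> p q dX dY; pose S h := X h * X h + Y h * Y h.
have dS : is_derive (0 : R) (1 : R) S (2 * (X 0 * dx + Y 0 * dy)).
  have := is_deriveD (is_deriveM dX dX) (is_deriveM dY dY).
  by congr is_derive; rewrite -![_ *: _]/(_ * _); ring.
have dr := is_derive1_comp (is_derive1_sqrt (p : 0 < S 0)) dS.
have dD := is_deriveD dX dr.
have dZ := is_derive_div (lt0r_neq0 q) dY dD.
have dA := is_derive1_comp (is_derive1_atan _) dZ.
have := is_derive_outer (is_derive_linear 2 _) dA.
congr is_derive.
have sE : Num.sqrt (S 0) ^+ 2 = X 0 * X 0 + Y 0 * Y 0 by rewrite sqr_sqrtr// ltW.
have s0 : 0 < Num.sqrt (S 0) by rewrite sqrtr_gt0.
have -> : (X + (Num.sqrt \o S)) 0 = X 0 + Num.sqrt (S 0) by [].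
rewrite -sE; move: q s0 sE; rewrite /S; clear; set r : R := Num.sqrt _; move: r (X 0) (Y 0) => r x y xr r0 rE.
have -> : 1 + (y / (x + r)) ^+ 2 = 2 * r / (x + r).
  have -> : 1 + (y / (x + r)) ^+ 2 = ((x + r) ^+ 2 + y ^+ 2) / (x + r) ^+ 2 by field; rewrite gt_eqF.
  have -> : (x + r) ^+ 2 + y ^+ 2 = 2 * r * (x + r) by rewrite -[LHS]addr0 -(subrr (r ^+ 2)) {2}rE; ring.
  by field; rewrite gt_eqF.
have -> : dy * (x + r) - y * (dx + (2 * r)^-1 * (2 * (x * dx + y * dy))) = (x * dy - y * dx) * (x + r) / r.
  have -> : dy * (x + r) - y * (dx + (2 * r)^-1 * (2 * (x * dx + y * dy))) =
    (r * dy * x + r ^+ 2 * dy - r * y * dx - x * y * dx - y * y * dy) / r by field; rewrite gt_eqF.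
  by rewrite rE; congr (_ / _); ring.
by field; rewrite !gt_eqF.
Qed.

(* By Cayley-Hamilton, with t = a + c and D = a c - b^2. *)
Lemma Qmx_sym2 tau (a b c : R) (q0 := sin tau * (1 - (a * c - b ^+ 2))) (q1 := sin tau * (a + c) + 2 * cos tau) :
  Qmx tau (sym2 a b c) = sym2 (q1 * a + q0) (q1 * b) (q1 * c + q0).
Proof.
have [e0 e1 e2 e3] := sym2E a b c; have [f0 f1 f2 f3] := sym2E (q1 * a + q0) (q1 * b) (q1 * c + q0).
by apply: mx2P; rewrite !(f0, f1, f2, f3) !mxE !big_ord_recl !big_ord0 !mxE /= /q1 /q0; ring.
Qed.

(** Along A + h N the trace is affine and the determinant quadratic in h, so only [Phi] has to be
    differentiated. As Q = q1 A + q0 I has determinant [dQ] and adjugate q0 I + q1 adj A, the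
    derivative (q0 t1 + q1 d1)/dQ is the pairing of Q^-1 with N. *)
Lemma Ftau_gradient tau (a b c : R) (Phi : R -> R -> R) (eps : R)
    (t0 := a + c) (d0 := a * c - b ^+ 2) (q0 := sin tau * (1 - d0)) (q1 := sin tau * t0 + 2 * cos tau)
    (dQ := q0 ^+ 2 + q0 * q1 * t0 + q1 ^+ 2 * d0) :
  0 < eps -> dQ != 0 ->
  (forall l : 'rV[R]_2, let t := l 0 0 + l 0 1 in let d := l 0 0 * l 0 1 in
     `|t - t0| < eps -> `|d - d0| < eps -> Ftau tau l = Phi t d) ->
  (forall t1 d1 d2, is_derive (0 : R) (1 : R) (fun h => Phi (t0 + h * t1 + h ^+ 2 * 0) (d0 + h * d1 + h ^+ 2 * d2))
     ((q0 * t1 + q1 * d1) / dQ)) ->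
  is_Ftau_gradient tau (sym2 a b c) (invmx (Qmx tau (sym2 a b c))).
Proof.
move=> eps0 dQ0 FPhi dPhi.
pose G := sym2 ((q0 + q1 * c) / dQ) (- (q1 * b) / dQ) ((q0 + q1 * a) / dQ).
have QG : Qmx tau (sym2 a b c) *m G = 1%:M.
  have [e0 e1 e2 e3] := sym2E ((q0 + q1 * c) / dQ) (- (q1 * b) / dQ) ((q0 + q1 * a) / dQ).
  have [f0 f1 f2 f3] := sym2E (q1 * a + q0) (q1 * b) (q1 * c + q0).
  rewrite Qmx_sym2; apply: mx2P; rewrite mul2E !(e0, e1, e2, e3, f0, f1, f2, f3) mxE /=; move: dQ0; rewrite /dQ /t0 /d0 => dQ0; field; exact: dQ0.
have -> : invmx (Qmx tau (sym2 a b c)) = G.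
  have [uQ _] := mulmx1_unit QG.
  by rewrite -[LHS]mulmx1 -QG mulmxA mulVmx// mul1mx.
split=> [|N NT]; first exact: sym2_tr.
rewrite (sym2_of NT); move: (N 0 0) (N 0 1) (N 1 1) => n00 n01 n11.
have -> : \sum_(i < 2) \sum_(j < 2) G i j * sym2 n00 n01 n11 i j
   = (q0 * (n00 + n11) + q1 * (a * n11 + c * n00 - 2 * b * n01)) / dQ.
  by rewrite !big_ord_recl !big_ord0 !mxE /=; field.
have := dPhi (n00 + n11) (a * n11 + c * n00 - 2 * b * n01) (n00 * n11 - n01 ^+ 2).
move=> /is_deriveP h; apply/is_deriveP => e e0.
have symh k : sym2 a b c + k *: sym2 n00 n01 n11 = sym2 (a + k * n00) (b + k * n01) (c + k * n11).
  by apply: mx2P; rewrite !mxE.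
pose t1 := n00 + n11; pose d1 := a * n11 + c * n00 - 2 * b * n01; pose d2 := n00 * n11 - n01 ^+ 2.
have FE k : `|k| * (`|t1| + `|d1| + `|d2| + 1) < eps -> `|k| < 1 ->
    Ftau tau (eigenvalues (sym2 a b c + k *: sym2 n00 n01 n11)) = Phi (t0 + k * t1 + k ^+ 2 * 0) (d0 + k * d1 + k ^+ 2 * d2).
  move=> k1 k2; rewrite symh.
  have := eigenvalues_tr_det (sym2_tr (a + k * n00) (b + k * n01) (c + k * n11)).
  have [-> -> _ ->] := sym2E (a + k * n00) (b + k * n01) (c + k * n11) => -[eT eD].
  have eT' : t0 + k * t1 + k ^+ 2 * 0 = a + k * n00 + (c + k * n11) by rewrite /t0 /t1; ring.
  have eD' : d0 + k * d1 + k ^+ 2 * d2 = (a + k * n00) * (c + k * n11) - (b + k * n01) ^+ 2 by rewrite /d0 /d1 /d2; ring.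
  have n0 := normr_ge0 t1; have n1 := normr_ge0 d1; have n2 := normr_ge0 d2; have n3 := normr_ge0 k.
  have -> := FPhi (eigenvalues (sym2 (a + k * n00) (b + k * n01) (c + k * n11))).
  - by rewrite eT eD eT' eD'.
  - rewrite eT -eT' (_ : _ - _ = k * t1); last by ring.
    by rewrite normrM; nra.
  - rewrite eD -eD' (_ : _ - _ = k * (d1 + k * d2)); last by ring.
    rewrite normrM; have h1 := ler_normD d1 (k * d2); rewrite normrM in h1.
    have h2 : `|k| * `|d2| <= `|d2| by rewrite ler_piMl// ltW.
    apply: le_lt_trans k1; apply: ler_wpM2l => //; lra.
have L0 : 0 < `|t1| + `|d1| + `|d2| + 1.
  by have := normr_ge0 t1; have := normr_ge0 d1; have := normr_ge0 d2; lra.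
pose phi k := Phi (t0 + k * t1 + k ^+ 2 * 0) (d0 + k * d1 + k ^+ 2 * d2).
have E0 : Ftau tau (eigenvalues (sym2 a b c)) = phi 0.
  have := FE 0; rewrite normr0 scale0r addr0 mul0r; apply => //.
near=> k.
have hk : `|phi (0 + k *: 1) - phi 0 - k * ((q0 * t1 + q1 * d1) / dQ)| <= e * `|k| by near: k; exact: h.
rewrite (_ : 0 + k *: (1 : R) = k) in hk; last by rewrite add0r -[k *: 1]/(k * 1) mulr1.
rewrite E0 FE; first exact: hk.
  by rewrite -ltr_pdivlMr//; near: k; apply: near0_lt; exact: divr_gt0.
by near: k; exact: near0_lt.
Unshelve. all: by end_near. Qed.

End Angles.

(** * The exterior of a bounded set, and the Hessian of a C^2 function *)

Section Exterior.
Context {R : realType}.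
Implicit Types (x y : 'cV[R]_2) (u : 'cV[R]_2 -> R).

Lemma bounded_exterior (Omega : set 'cV[R]_2) : bounded_set Omega ->
  exists2 R0 : R, 0 < R0 & forall x, R0 < enorm x -> (~` closure Omega) x.
Proof.
move=> [M [_ hM]]; have M1 : M < `|M| + 1 by have := ler_norm M; lra.
have n0 := normr_ge0 M.
exists (2 * (`|M| + 1) + 2); first by lra.
move=> x hx /(_ [set y | enorm (y - x) < 1]) [].
  exact: enorm_near.
move=> y [/= oy yx].
have yb : `|y| <= `|M| + 1 := hM _ M1 _ oy.
have cy i : `|y i 0| <= `|M| + 1 by apply: le_trans yb; rewrite [`|y|]mx_normrE; exact: (le_bigmax _ _ (i, 0)).
have := enorm_le_sum y; have := enorm_sub x y; rewrite enormBC.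
have := cy 0; have := cy 1; lra.
Qed.

Lemma hessian_regular (U : set 'cV[R]_2) u : open U -> Ck 2 U u -> forall x, U x ->
  [/\ fd u x (partial 0 u x) (partial 1 u x),
    fd (partial 0 u) x (hessian u x 0 0) (hessian u x 0 1),
    fd (partial 1 u) x (hessian u x 0 1) (hessian u x 1 1),
    hessian u x 1 0 = hessian u x 0 1 &
    [/\ {for x, continuous (fun y => hessian u y 0 0)}, {for x, continuous (fun y => hessian u y 0 1)} &
       {for x, continuous (fun y => hessian u y 1 1)}]].
Proof.
move=> oU [cu du] x Ux.
have nU : \forall y \near x, U y by exact: open_nbhs_nbhs.
have dd i : forall y, U y -> is_derive y (delta_mx i 0 : 'cV[R]_2) u (partial i u y).
  by move=> y Uy; have [h _] := du i; apply: derivableP; exact: h.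
have ddd i j : forall y, U y -> is_derive y (delta_mx i 0 : 'cV[R]_2) (partial j u) (hessian u y i j).
  by move=> y Uy; have [_ [_ /(_ i)[h _]]] := du j; rewrite mxE; apply: derivableP; exact: h.
have c1 j y : U y -> {for y, continuous (partial j u)}.
  by have [_ [h _]] := du j; exact: h.
have c2 i j y : U y -> {for y, continuous (fun y => hessian u y i j)}.
  move=> Uy; have [_ [_ /(_ i)[_ [h _]]]] := du j.
  rewrite (_ : (fun y => hessian u y i j) = partial i (partial j u)); first exact: h.
  by apply/funext => z; rewrite mxE.
have f0 y : U y -> fd u y (partial 0 u y) (partial 1 u y).
  move=> Uy; have nUy : \forall z \near y, U z by exact: open_nbhs_nbhs.
  apply: C1_fd (c1 0 y Uy) (c1 1 y Uy); near=> z; apply: dd; near: z; exact: nUy.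
have f1 j y : U y -> fd (partial j u) y (hessian u y 0 j) (hessian u y 1 j).
  move=> Uy; have nUy : \forall z \near y, U z by exact: open_nbhs_nbhs.
  apply: (C1_fd (p0 := fun z => hessian u z 0 j) (p1 := fun z => hessian u z 1 j)) (c2 0 j y Uy) (c2 1 j y Uy);
    near=> z; apply: ddd; near: z; exact: nUy.
have sy : hessian u x 1 0 = hessian u x 0 1.
  apply: (Young (f := u) (p0 := partial 0 u) (p1 := partial 1 u) (x := x)).
  - near=> z; apply: dd; near: z; exact: nU.
  - near=> z; apply: dd; near: z; exact: nU.
  - exact: f1.
  - exact: f1.
split; [exact: f0|by rewrite -sy; exact: f1|exact: f1|exact: sy|by split; exact: c2].
Unshelve. all: by end_near. Qed.

End Exterior.

(** * Reduction to det D^2 v = 1 *)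

Section Reduction.
Context {R : realType}.
Implicit Types (x y : 'cV[R]_2) (u : 'cV[R]_2 -> R) (l : 'rV[R]_2).

(* Near a matrix of trace t0 and determinant d0, F is the function Phi of the
   trace and the determinant, with the derivative that makes
   Q^-1 the gradient. *)
Definition trdet_rep (tau t0 d0 : R) : Prop :=
  let q0 := sin tau * (1 - d0) in let q1 := sin tau * t0 + 2 * cos tau in
  exists (Phi : R -> R -> R) (eps : R), [/\ 0 < eps,
    (forall l, let t := l 0 0 + l 0 1 in let d := l 0 0 * l 0 1 in
       `|t - t0| < eps -> `|d - d0| < eps -> Ftau tau l = Phi t d) &
    forall t1 d1 d2, is_derive (0 : R) (1 : R) (fun h => Phi (t0 + h * t1 + h ^+ 2 * 0) (d0 + h * d1 + h ^+ 2 * d2))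
      ((q0 * t1 + q1 * d1) / (q0 ^+ 2 + q0 * q1 * t0 + q1 ^+ 2 * d0))].

Lemma trdet_rep_gradient (tau a b c : R) : Qmx tau (sym2 a b c) \in unitmx ->
  trdet_rep tau (a + c) (a * c - b ^+ 2) -> is_Ftau_gradient tau (sym2 a b c) (invmx (Qmx tau (sym2 a b c))).
Proof.
move=> uQ [Phi [eps [e0 h1 h2]]]; apply: (@Ftau_gradient R tau a b c Phi eps) => //.
move: uQ; rewrite unitmxE unitfE Qmx_sym2 det2.
set q0 := sin tau * (1 - _); set q1 := sin tau * (a + c) + _.
have [-> -> -> ->] := sym2E (q1 * a + q0) (q1 * b) (q1 * c + q0).
by congr (_ != 0); ring.
Qed.

(** The conclusion of the theorem, named so that each range of tau can be settled separately. *)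
Definition quadratic_asymptotics (tau C0 : R) u : Prop :=
  exists (gamma d d1 d2 : R) (beta : 'cV[R]_2) (A : 'M[R]_2),
    [/\ A^T = A, Ftau_eq tau A C0 &
        let Q := Qmx tau A in
        [/\ Q \in unitmx, is_Ftau_gradient tau A (invmx Q) &
            exists theta : 'cV[R]_2 -> R, is_angle Q theta /\
              forall k : nat, bigO_k k (-2) 1 (fun x =>
                  u x - (2^-1 * qform A x + dot beta x + gamma) - d * ln (qform Q x)
                  - (Num.sqrt (qform Q x))^-1 * (d1 * cos (theta x) + d2 * sin (theta x)))]].

Lemma quadratic_asymptotics_intro (tau C0 : R) u (a b c kappa p00 p01 p11 b0 b1 g d w0 w1 : R) (l := eigenvalues (sym2 a b c)) :
  0 < kappa -> 0 < p00 -> p01 ^+ 2 < p00 * p11 ->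
  Qmx tau (sym2 a b c) = kappa *: (sym2 p00 p01 p11 *m sym2 p00 p01 p11) ->
  (forall k, Sym k (- 2) (fun x => u x - (2^-1 * quad a b c x + (b0 * x 0 0 + b1 * x 1 0) + g
     + log_dipole p00 p01 p11 d w0 w1 x))) ->
  Ftau_dom tau l -> Ftau tau l = C0 -> trdet_rep tau (l 0 0 + l 0 1) (l 0 0 * l 0 1) ->
  quadratic_asymptotics tau C0 u.
Proof.
move=> k0 p0 pd QE su dom eqF rep.
have [eT eD] := eigenvalues_tr_det (sym2_tr a b c).
have [a0 a1 a2 a3] := sym2E a b c.
rewrite /l eT eD a0 a1 a3 in rep.
have uQ := qmx_unit k0 pd QE.
have [|gamma [d' [d1 [d2 [beta [theta [ta bO]]]]]]] := @angle_expansion R u (sym2 a b c) _ kappa p00 p01 p11 b0 b1 g d w0 w1 k0 p0 pd QE.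
  by move=> k; apply: Sym_eq (su k); near=> x; rewrite qform_sym2.
exists gamma, d', d1, d2, beta, (sym2 a b c); split; [exact: sym2_tr|by []|].
split=> //; [exact: trdet_rep_gradient|by exists theta].
Unshelve. all: by end_near. Qed.

Lemma fd_nsq x : fd nsq x (2 * x 0 0) (2 * x 1 0).
Proof.
move=> e e0; near=> y.
have h : enorm (y - x) < e by near: y; exact: enorm_near.
have -> : nsq y - nsq x - (2 * x 0 0 * (y 0 0 - x 0 0) + 2 * x 1 0 * (y 1 0 - x 1 0)) = enorm (y - x) ^+ 2.
  by rewrite enorm_sqr !mxE /nsq; ring.
rewrite ger0_norm ?exprn_ge0// expr2; apply: ler_wpM2r => //; exact: ltW.
Unshelve. all: by end_near. Qed.

Lemma fd_comb (f g : 'cV[R]_2 -> R) x (a b a' b' k m : R) : fd f x a b -> fd g x a' b' ->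
  fd (fun y => k * f y + m * g y) x (k * a + m * a') (k * b + m * b').
Proof.
move=> fx gx e e0.
have e1 : 0 < e / (`|k| + `|m| + 1) by rewrite divr_gt0//; have := normr_ge0 k; have := normr_ge0 m; lra.
near=> y.
have h1 : `|f y - f x - (a * (y 0 0 - x 0 0) + b * (y 1 0 - x 1 0))| <= e / (`|k| + `|m| + 1) * enorm (y - x) by near: y; exact: fx.
have h2 : `|g y - g x - (a' * (y 0 0 - x 0 0) + b' * (y 1 0 - x 1 0))| <= e / (`|k| + `|m| + 1) * enorm (y - x) by near: y; exact: gx.
have -> : k * f y + m * g y - (k * f x + m * g x) - ((k * a + m * a') * (y 0 0 - x 0 0) + (k * b + m * b') * (y 1 0 - x 1 0))
  = k * (f y - f x - (a * (y 0 0 - x 0 0) + b * (y 1 0 - x 1 0))) + m * (g y - g x - (a' * (y 0 0 - x 0 0) + b' * (y 1 0 - x 1 0))) by ring.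
apply: le_trans (ler_normD _ _) _; rewrite !normrM.
have k0 := normr_ge0 k; have m0 := normr_ge0 m.
apply: le_trans (lerD (ler_wpM2l k0 h1) (ler_wpM2l m0 h2)) _.
rewrite -mulrDl mulrA; apply: ler_wpM2r => //.
rewrite mulrA ler_pdivrMr; last by lra.
by nra.
Unshelve. all: by end_near. Qed.

(** The function v = (sg/s)(u + c|x|^2/2) is convex with det D^2 v = 1. The relation between s, c
    and tau makes Q a multiple of A + c I. The last premise leads from the algebraic equation at the
    limit eigenvalues back to F_tau, with every strict trace bound valid for D^2 u at its
    disposal. *)
Theorem monge_ampere_case (tau C0 : R) (Omega : set 'cV[R]_2) u (sg s c : R) :
  sg * sg = 1 -> 0 < s -> sin tau * (1 - s ^+ 2 + c ^+ 2) = 2 * cos tau * c ->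
  bounded_domain Omega -> Ck 2 (~` closure Omega) u ->
  (forall x, (~` closure Omega) x -> let l := eigenvalues (hessian u x) in
     [/\ (l 0 0 + c) * (l 0 1 + c) = s ^+ 2, 0 < sg * (l 0 0 + c) & 0 < sg * (l 0 1 + c)]) ->
  (forall l, (l 0 0 + c) * (l 0 1 + c) = s ^+ 2 -> 0 < sg * (l 0 0 + c) -> 0 < sg * (l 0 1 + c) ->
     (forall B, (forall x, (~` closure Omega) x -> let m := eigenvalues (hessian u x) in sg * (m 0 0 + m 0 1) < B) ->
        sg * (l 0 0 + l 0 1) < B) ->
     [/\ Ftau_dom tau l, Ftau tau l = C0, 0 < sg * (sin tau * (l 0 0 + l 0 1) + 2 * cos tau) &
       trdet_rep tau (l 0 0 + l 0 1) (l 0 0 * l 0 1)]) ->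
  quadratic_asymptotics tau C0 u.
Proof.
move=> sg1 s0 rel [_ _ _ bO] hu fwd bwd.
have [R0 R0p ext] := bounded_exterior bO.
have oU : open (~` closure Omega) by apply: closed_openC; exact: closed_closure.
have reg x : R0 < enorm x -> _ := fun hx => hessian_regular oU hu (ext x hx).
have sn : s != 0 by rewrite gt_eqF.
pose k := sg / s.
pose v x := k * u x + k * c / 2 * nsq x.
pose q0 x := k * partial 0 u x + k * c * x 0 0; pose q1 x := k * partial 1 u x + k * c * x 1 0.
pose a00 x := k * hessian u x 0 0 + k * c; pose a01 x := k * hessian u x 0 1.
pose a11 x := k * hessian u x 1 1 + k * c.
have coord0 x : fd (fun y => y 0 0) x 1 0.
  by have := fd_lin_form 1 0 x; congr fd; apply/funext => y; ring.
have coord1 x : fd (fun y => y 1 0) x 0 1.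
  by have := fd_lin_form 0 1 x; congr fd; apply/funext => y; ring.
have dv x : R0 < enorm x -> [/\ fd v x (q0 x) (q1 x), fd q0 x (a00 x) (a01 x) & fd q1 x (a01 x) (a11 x)].
  move=> /reg[f0 f1 f2 _ _]; split.
  - have := fd_comb k (k * c / 2) f0 (fd_nsq x).
    by rewrite /q0 /q1; congr fd; field.
  - by have := fd_comb k (k * c) f1 (coord0 x); rewrite mulr1 mulr0 addr0.
  - by have := fd_comb k (k * c) f2 (coord1 x); rewrite mulr1 mulr0 addr0.
have ca x : R0 < enorm x -> [/\ {for x, continuous a00}, {for x, continuous a01} & {for x, continuous a11}].
  move=> /reg[_ _ _ _ [c0 c1 c2]].
  have cZ (f : 'cV[R]_2 -> R) : {for x, continuous f} -> {for x, continuous (fun y => k * f y)}.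
    by move=> cf; apply: continuousM => //; exact: cst_continuous.
  split; [|exact: cZ|]; by apply: continuousD; [exact: cZ|exact: cst_continuous].
have trdet x : R0 < enorm x -> let l := eigenvalues (hessian u x) in
    l 0 0 + l 0 1 = hessian u x 0 0 + hessian u x 1 1 /\ l 0 0 * l 0 1 = hessian u x 0 0 * hessian u x 1 1 - hessian u x 0 1 ^+ 2.
  move=> hx; have [_ _ _ sy _] := reg x hx.
  have ST : (hessian u x)^T = hessian u x by apply: mx2P; rewrite [LHS]mxE.
  exact: eigenvalues_tr_det ST.
have MA x : R0 < enorm x -> 0 < a00 x /\ a00 x * a11 x - a01 x ^+ 2 = 1.
  move=> hx; have [] := fwd x (ext x hx); have [] := trdet x hx.
  set l := eigenvalues _; set h00 := hessian u x 0 0; set h01 := hessian u x 0 1; set h11 := hessian u x 1 1.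
  move=> eT eD pr p0 p1.
  have det : (h00 + c) * (h11 + c) - h01 ^+ 2 = s ^+ 2.
    by rewrite -pr; rewrite -/h00 -/h11 -/h01 in eT eD; have := congr1 ( *%R c) eT; lra.
  have det1 : a00 x * a11 x - a01 x ^+ 2 = 1.
    rewrite /a00 /a11 /a01 -/h00 -/h11 -/h01.
    have -> : (k * h00 + k * c) * (k * h11 + k * c) - (k * h01) ^+ 2 = k * k * ((h00 + c) * (h11 + c) - h01 ^+ 2) by ring.
    rewrite det /k; have -> : sg / s * (sg / s) * s ^+ 2 = sg * sg by field.
    by [].
  split=> //.
  have tr : 0 < a00 x + a11 x.
    have -> : a00 x + a11 x = (sg * (l 0 0 + c) + sg * (l 0 1 + c)) / s.
      have -> : sg * (l 0 0 + c) + sg * (l 0 1 + c) = sg * (l 0 0 + l 0 1 + 2 * c) by ring.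
      by rewrite eT /a00 /a11 -/h00 -/h11 /k; field.
    by rewrite divr_gt0// addr_gt0.
  have := sqr_ge0 (a01 x); move: det1 tr; clear; move: (a00 x) (a11 x) (a01 x ^+ 2) => a b e h1 h2 h3; nra.
have [m00 [m01 [m11 [b0 [b1 [g [d [w0 [w1 [m0 mdet mtr sv]]]]]]]]]] := monge_ampere_expansion R0p dv ca MA.
have m1 : 0 < m11 by rewrite -(pmulr_rgt0 _ m0); have := sqr_ge0 m01; lra.
pose a := sg * s * m00 - c; pose b := sg * s * m01; pose e := sg * s * m11 - c.
have [eT eD] := eigenvalues_tr_det (sym2_tr a b e).
have [a0 a1 a2 a3] := sym2E a b e; rewrite a0 a1 a3 in eT eD.
set l := eigenvalues (sym2 a b e) in eT eD.
have lpr : (l 0 0 + c) * (l 0 1 + c) = s ^+ 2.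
  have -> : (l 0 0 + c) * (l 0 1 + c) = l 0 0 * l 0 1 + c * (l 0 0 + l 0 1) + c ^+ 2 by ring.
  rewrite eT eD /a /b /e.
  have -> : (sg * s * m00 - c) * (sg * s * m11 - c) - (sg * s * m01) ^+ 2 + c * (sg * s * m00 - c + (sg * s * m11 - c)) + c ^+ 2
    = (sg * sg) * s ^+ 2 * (m00 * m11 - m01 ^+ 2) by ring.
  by rewrite sg1 mdet mulr1 mul1r.
have lsum : sg * (l 0 0 + c) + sg * (l 0 1 + c) = s * (m00 + m11).
  have -> : sg * (l 0 0 + c) + sg * (l 0 1 + c) = sg * (l 0 0 + l 0 1 + 2 * c) by ring.
  rewrite eT /a /e; have -> : sg * (sg * s * m00 - c + (sg * s * m11 - c) + 2 * c) = sg * sg * s * (m00 + m11) by ring.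
  by rewrite sg1 mul1r.
have [lp0 lp1] : 0 < sg * (l 0 0 + c) /\ 0 < sg * (l 0 1 + c).
  have hs : 0 < sg * (l 0 0 + c) + sg * (l 0 1 + c) by rewrite lsum mulr_gt0// addr_gt0.
  have hp : sg * (l 0 0 + c) * (sg * (l 0 1 + c)) = s ^+ 2.
    by rewrite mulrACA sg1 mul1r.
  have s2 : 0 < s ^+ 2 by rewrite exprn_gt0.
  move: hs hp s2; clear; move: (sg * _) (sg * _) (s ^+ 2) => y z w h1 h2 h3; split; nra.
have [|dom Feq qpos rep] := bwd l lpr lp0 lp1.
  move=> B hB.
  have h : m00 + m11 < (B + 2 * (sg * c)) / s.
    apply: mtr => x hx; have := hB x (ext x hx); have [] := trdet x hx.
    set m := eigenvalues _ => mT _ /=; rewrite mT => hB'.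
    have -> : a00 x + a11 x = (sg * (hessian u x 0 0 + hessian u x 1 1) + 2 * (sg * c)) / s by rewrite /a00 /a11 /k; field.
    by rewrite ltr_pM2r ?invr_gt0//; lra.
  rewrite ltr_pdivlMr// in h.
  by have := lsum; lra.
pose Q1 := sin tau * (l 0 0 + l 0 1) + 2 * cos tau.
have T0 : 0 < m00 + m11 + 2 by lra.
(* Let M = (m_ij) be the limit of D^2 v, so A + c I = sg s M and Q = Q1 (A + c I) = sg s Q1 M. Since
   det M = 1, Cayley-Hamilton gives (I + M)^2 = (tr M + 2) M. Hence Q = kappa (I + M)^2 with the
   first witness as kappa. *)
apply: (@quadratic_asymptotics_intro tau C0 u a b e (sg * s * Q1 / (m00 + m11 + 2)) (1 + m00) m01 (1 + m11)
  (sg * s * b0) (sg * s * b1) (sg * s * g) (sg * s * d) (sg * s * w0) (sg * s * w1)) => //.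
- by rewrite divr_gt0// mulrAC mulr_gt0.
- lra.
- have -> : (1 + m00) * (1 + m11) = 1 + m00 + m11 + m00 * m11 by ring.
  lra.
- rewrite Qmx_sym2 -eT -eD -/Q1.
  have relq : sin tau * (1 - l 0 0 * l 0 1) = Q1 * c.
    rewrite /Q1; have : l 0 0 * l 0 1 = s ^+ 2 - c * (l 0 0 + l 0 1) - c ^+ 2 by rewrite -lpr; ring.
    by move=> ->; move: rel; lra.
  rewrite relq; have [f0 f1 f2 f3] := sym2E (1 + m00) m01 (1 + m11).
  have [g0 g1 g2 g3] := sym2E (Q1 * a + Q1 * c) (Q1 * b) (Q1 * e + Q1 * c).
  have P0 : (1 + m00) * (1 + m00) + m01 * m01 = m00 * (m00 + m11 + 2).
    have -> : m01 * m01 = m00 * m11 - 1 by rewrite -expr2 -mdet opprB addrC subrK.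
    by ring.
  have P1 : m01 * m01 + (1 + m11) * (1 + m11) = m11 * (m00 + m11 + 2).
    have -> : m01 * m01 = m00 * m11 - 1 by rewrite -expr2 -mdet opprB addrC subrK.
    by ring.
  apply: mx2P; rewrite [RHS]mxE mul2E !(f0, f1, f2, f3, g0, g1, g2, g3) ?P0 ?P1 /a /b /e; field; apply: lt0r_neq0; exact: T0.
- move=> j; apply: Sym_eq (SymZ (sg * s) (sv j)); near=> x.
  have uE : u x = sg * s * v x - c / 2 * nsq x.
    rewrite /v /k; have -> : sg * s * (sg / s * u x + sg / s * c / 2 * nsq x) = (sg * sg) * (u x + c / 2 * nsq x) by field.
    by rewrite sg1 mul1r addrK.
  rewrite uE /log_dipole /quad /a /b /e /nsq; ring.
Unshelve. all: by end_near. Qed.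

End Reduction.

(** * Reduction to Laplace's equation *)

Section HarmonicReduction.
Context {R : realType}.
Implicit Types (x y : 'cV[R]_2) (u : 'cV[R]_2 -> R) (l : 'rV[R]_2).

(** The function h = u + a|x|^2/2 is harmonic, and the lower bound on the product says that the
    squares of its second derivatives h_xx and h_xy sum to less than b^2. As the trace of A is -2a,
    the coefficient of A in Q vanishes and Q is a positive multiple of I, so [expansion] already has
    the required form. *)
Theorem harmonic_case (tau C0 : R) (Omega : set 'cV[R]_2) u (a b : R) :
  0 < b -> 0 < sin tau -> cos tau = a * sin tau -> a ^+ 2 + b ^+ 2 = 1 ->
  bounded_domain Omega -> Ck 2 (~` closure Omega) u ->
  (forall x, (~` closure Omega) x -> let l := eigenvalues (hessian u x) in
     l 0 0 + l 0 1 = - (2 * a) /\ - b ^+ 2 < (l 0 0 + a) * (l 0 1 + a)) ->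
  (forall l, l 0 0 + l 0 1 = - (2 * a) -> - b ^+ 2 < (l 0 0 + a) * (l 0 1 + a) ->
     [/\ Ftau_dom tau l, Ftau tau l = C0 & trdet_rep tau (l 0 0 + l 0 1) (l 0 0 * l 0 1)]) ->
  quadratic_asymptotics tau C0 u.
Proof.
move=> b0 s0 cE ab [_ _ _ bO] hu fwd bwd.
have [R0 R0p ext] := bounded_exterior bO.
have oU : open (~` closure Omega) by apply: closed_openC; exact: closed_closure.
have reg x : R0 < enorm x -> _ := fun hx => hessian_regular oU hu (ext x hx).
pose h x := 1 * u x + a / 2 * nsq x.
pose p0 x := 1 * partial 0 u x + a * x 0 0; pose p1 x := 1 * partial 1 u x + a * x 1 0.
pose h00 x := hessian u x 0 0 + a; pose h01 x := hessian u x 0 1.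
have tr x : R0 < enorm x -> hessian u x 0 0 + hessian u x 1 1 = - (2 * a) /\ h00 x ^+ 2 + h01 x ^+ 2 < b ^+ 2.
  move=> hx; have [_ _ _ sy _] := reg x hx.
  have ST : (hessian u x)^T = hessian u x by apply: mx2P; rewrite [LHS]mxE.
  have [eT eD] := eigenvalues_tr_det ST; have [] := fwd x (ext x hx).
  rewrite eT => t; split => //; rewrite /h00 /h01.
  move: (eigenvalues _) eT eD b1 => l eT eD b1.
  have lE : (l 0 0 + a) * (l 0 1 + a) = l 0 0 * l 0 1 + a * (l 0 0 + l 0 1) + a ^+ 2 by ring.
  rewrite lE eT eD t in b1.
  have t1 : hessian u x 1 1 = - (2 * a) - hessian u x 0 0 by rewrite -t; ring.
  rewrite t1 in b1; move: (hessian u x 0 0) (hessian u x 0 1) b1 => y z; lra.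
have coord0 x : fd (fun y => y 0 0) x 1 0.
  by have := fd_lin_form 1 0 x; congr fd; apply/funext => y; ring.
have coord1 x : fd (fun y => y 1 0) x 0 1.
  by have := fd_lin_form 0 1 x; congr fd; apply/funext => y; ring.
have dh x : R0 < enorm x -> [/\ fd h x (p0 x) (p1 x), fd p0 x (h00 x) (h01 x) & fd p1 x (h01 x) (- h00 x)].
  move=> hx; have [f0 f1 f2 _ _] := reg x hx; have [t _] := tr x hx; split.
  - have := fd_comb 1 (a / 2) f0 (fd_nsq x).
    by rewrite /p0 /p1; congr fd; field.
  - by have := fd_comb 1 a f1 (coord0 x); rewrite /h00 !mul1r mulr1 mulr0 addr0.
  - have := fd_comb 1 a f2 (coord1 x); rewrite /h01 !mul1r mulr1 mulr0 addr0.
    by congr fd; rewrite /h00; lra.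
have ca x : R0 < enorm x -> {for x, continuous h00} /\ {for x, continuous h01}.
  move=> /reg[_ _ _ _ [c0 c1 c2]]; split => //.
  by apply: continuousD; [exact: c0|exact: cst_continuous].
have bh x : R0 < enorm x -> `|h00 x| <= b /\ `|h01 x| <= b.
  move=> /tr[_]; move: (h00 x) (h01 x) => y z yz.
  have s0' := sqr_ge0 y; have s1 := sqr_ge0 z.
  by rewrite !ler_norml; split; apply/andP; split; nra.
have [k0 [k1 [l0 [l1 [c [d [w0 [w1 [hE hK]]]]]]]]] := harmonic_expansion R0p dh ca bh.
have {}hK : k0 ^+ 2 + k1 ^+ 2 < b ^+ 2 by apply: hK => [|x /tr[]//]; exact: ltW.
have [eT eD] := eigenvalues_tr_det (sym2_tr (k0 - a) k1 (- k0 - a)).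
have [e0 e1 e2 e3] := sym2E (k0 - a) k1 (- k0 - a); rewrite e0 e1 e3 in eT eD.
set l := eigenvalues _ in eT eD.
have lT : l 0 0 + l 0 1 = - (2 * a) by rewrite eT; ring.
have lD : l 0 0 * l 0 1 = a ^+ 2 - k0 ^+ 2 - k1 ^+ 2 by rewrite eD; ring.
have [|dom Feq rep] := bwd l lT.
  have -> : (l 0 0 + a) * (l 0 1 + a) = l 0 0 * l 0 1 + a * (l 0 0 + l 0 1) + a ^+ 2 by ring.
  by rewrite lD lT; lra.
apply: (@quadratic_asymptotics_intro R tau C0 u (k0 - a) k1 (- k0 - a) (sin tau * (1 - l 0 0 * l 0 1)) 1 0 1
  l0 l1 c d w0 w1) => //.
- rewrite mulr_gt0// lD; have := sqr_ge0 k0; have := sqr_ge0 k1; have := exprn_gt0 2 b0; lra.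
- by rewrite expr0n /= mulr1.
- rewrite Qmx_sym2 -eT -eD lT cE.
  have -> : sin tau * - (2 * a) + 2 * (a * sin tau) = 0 by ring.
  rewrite !mul0r !add0r; have [f0 f1 f2 f3] := @sym2E R 1 0 1.
  set q := _ * _; have [g0 g1 g2 g3] := sym2E q 0 q.
  by apply: mx2P; rewrite [RHS]mxE mul2E !(f0, f1, f2, f3, g0, g1, g2, g3); ring.
- move=> j; apply: Sym_eq (hE j); near=> x.
  rewrite /log_dipole /expansion /quad /h /lin /nsq !(vec0, vec1) !mul1r !mul0r !addr0 !add0r.
  move: (ln _) ((x 0 0 * x 0 0 + x 1 0 * x 1 0)^-1) => L I; field.
Unshelve. all: by end_near. Qed.

End HarmonicReduction.

(** * The coefficients a and b, and explicit formulas for F_tau *)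

Section Coefficients.
Context {R : realType}.
Implicit Types (tau : R) (l : 'rV[R]_2).

Lemma sin_tau_gt0 tau : 0 < tau <= pi / 2 -> 0 < sin tau.
Proof.
move=> /andP[t0 t1]; apply: sin_gt0_pi; rewrite t0 /=; apply: le_lt_trans t1 _.
by have := pi_gt0 R; lra.
Qed.

Lemma cos_acoef tau : sin tau != 0 -> cos tau = acoef tau * sin tau.
Proof. by move=> s0; rewrite /acoef divfK. Qed.

Lemma sqrt_acoef tau : 0 < sin tau -> Num.sqrt (acoef tau ^+ 2 + 1) = (sin tau)^-1.
Proof.
move=> s0; have -> : acoef tau ^+ 2 + 1 = (sin tau)^-1 ^+ 2.
  have -> : acoef tau ^+ 2 + 1 = (cos tau ^+ 2 + sin tau ^+ 2) / sin tau ^+ 2.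
    by rewrite /acoef; field; rewrite gt_eqF.
  by rewrite cos2Dsin2 div1r exprVn.
by rewrite sqrtr_sqr gtr0_norm// invr_gt0.
Qed.

Lemma acoef_sqr tau : 0 < sin tau -> acoef tau ^+ 2 - 1 = cos (2 * tau) / sin tau ^+ 2.
Proof.
move=> s0; rewrite mulr_natl cos_mulr2n.
have -> : cos tau ^+ 2 *+ 2 - 1 = cos tau ^+ 2 - sin tau ^+ 2 by rewrite -(cos2Dsin2 tau) mulr2n; ring.
by rewrite /acoef; field; rewrite gt_eqF.
Qed.

Lemma acoef_ge0 tau : 0 < tau <= pi / 2 -> 0 <= acoef tau.
Proof.
move=> /[dup] /sin_tau_gt0 s0 /andP[t0 t1]; rewrite divr_ge0 ?(ltW s0)//.
by apply: cos_ge0_pihalf; rewrite t1 andbT; have := pi_gt0 R; lra.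
Qed.

Lemma coef_lt tau : 0 < tau < pi / 4 -> 1 < acoef tau /\ bcoef tau ^+ 2 = acoef tau ^+ 2 - 1.
Proof.
move=> /andP[t0 t1]; have pp := pi_gt0 R.
have t2 : 0 < tau <= pi / 2 by rewrite t0 /=; lra.
have s0 := sin_tau_gt0 t2; have a0 := acoef_ge0 t2.
have p : 0 < acoef tau ^+ 2 - 1.
  by rewrite acoef_sqr// divr_gt0 ?exprn_gt0// cos_gt0_pihalf//; apply/andP; split; lra.
split; last by rewrite sqr_sqrtr// gtr0_norm.
by move: p a0; move: (acoef tau) => a; rewrite expr2 => ? ?; nra.
Qed.

Lemma coef_eq tau : tau = pi / 4 -> acoef tau = 1.
Proof.
move=> tE; have pp := pi_gt0 R.
have t2 : 0 < tau <= pi / 2 by rewrite tE; apply/andP; split; lra.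
have s0 := sin_tau_gt0 t2; have a0 := acoef_ge0 t2.
have := acoef_sqr s0; have -> : 2 * tau = pi / 2 by rewrite tE; field.
rewrite cos_pihalf mul0r; move: (acoef tau) a0 => a a0 e.
have /eqP : (a - 1) * (a + 1) = 0 by rewrite -[RHS]e; ring.
by rewrite mulf_eq0 [a + 1 == 0]gt_eqF ?ltr_wpDl// orbF subr_eq0 => /eqP.
Qed.

Lemma coef_gt tau : pi / 4 < tau <= pi / 2 -> 0 < bcoef tau /\ acoef tau ^+ 2 + bcoef tau ^+ 2 = 1.
Proof.
move=> /andP[t0 t1]; have pp := pi_gt0 R.
have t2 : 0 < tau <= pi / 2 by apply/andP; split; lra.
have s0 := sin_tau_gt0 t2.
have p : acoef tau ^+ 2 - 1 < 0.
  rewrite acoef_sqr// -oppr_gt0 -mulNr -sinBpihalf divr_gt0 ?exprn_gt0// sin_gt0_pi//.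
  by apply/andP; split; lra.
rewrite /bcoef ltr0_norm// sqr_sqrtr; last by rewrite oppr_ge0 ltW.
by rewrite sqrtr_gt0 oppr_gt0; split=> //; ring.
Qed.

Lemma coef_pihalf : acoef (pi / 2 : R) = 0 /\ bcoef (pi / 2 : R) = 1.
Proof.
have -> : acoef (pi / 2 : R) = 0 by rewrite /acoef cos_pihalf mul0r.
by rewrite /bcoef {1}/acoef cos_pihalf mul0r expr0n /= sub0r normrN1 sqrtr1.
Qed.

Lemma sum2 (f : 'I_2 -> R) : \sum_(i < 2) f i = f 0 + f 1.
Proof. by rewrite big_ord_recl big_ord1; congr (_ + f _); exact: val_inj. Qed.

Lemma ord2_ind (P : 'I_2 -> Prop) : P 0 -> P 1 -> forall i, P i.
Proof.
move=> p0 p1 i; have [->//|->//] : i = 0 \/ i = 1.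
by case: i => -[|[|//]] lt; [left|right]; exact: val_inj.
Qed.

Lemma Ftau_0 l : Ftau 0 l = 2^-1 * (ln (l 0 0) + ln (l 0 1)).
Proof. by rewrite /Ftau eqxx sum2. Qed.

Lemma Ftau_lt tau l : 0 < tau < pi / 4 ->
  Ftau tau l = Num.sqrt (acoef tau ^+ 2 + 1) / (2 * bcoef tau) *
    (ln ((l 0 0 + acoef tau - bcoef tau) / (l 0 0 + acoef tau + bcoef tau)) +
     ln ((l 0 1 + acoef tau - bcoef tau) / (l 0 1 + acoef tau + bcoef tau))).
Proof. by move=> /andP[t0 t1]; rewrite /Ftau gt_eqF// t1 sum2. Qed.

Lemma Ftau_pi4 l : Ftau (pi / 4) l = - Num.sqrt 2 * ((1 + l 0 0)^-1 + (1 + l 0 1)^-1).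
Proof. by rewrite /Ftau gt_eqF ?divr_gt0 ?pi_gt0// ltxx eqxx sum2. Qed.

(* Both atan ((y - 1) / (y + 1)) = atan y - pi/4, for y = (l_i + a) / b > -1, and the
   case tau = pi/2 are covered. *)
Definition atan_range tau l : Prop :=
  tau = pi / 2 \/ (0 < l 0 0 + acoef tau + bcoef tau /\ 0 < l 0 1 + acoef tau + bcoef tau).

(** The addition formula for tan, with -1 = tan(-pi/4). The condition y > -1 keeps atan y - pi/4
    above -pi/2. *)
Lemma atan_mobius (y : R) : 0 < y + 1 -> atan ((y - 1) / (y + 1)) = atan y - pi / 4.
Proof.
move=> y1; have [c c0 [cX cY]] := atan_add_polar y (- 1); rewrite atanN atan1 in cX cY.
have : atan (- 1) < atan y by apply: lt_atan; lra.
rewrite atanN atan1 => lo; have hi := atan_ltpi2 y; have pp := pi_gt0 R.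
rewrite -[RHS]tanK; last by rewrite in_itv /=; apply/andP; split; lra.
congr atan; rewrite /tan -cX -cY mulrN1 opprK [1 + y]addrC; field.
by rewrite !gt_eqF.
Qed.

(** The two shifts by pi/4 coming from [atan_mobius]; at tau = pi/2 the formula for F_tau is already
    a plain sum of arctangents. *)
Definition atan_offset tau : R := if tau < pi / 2 then pi / 2 else 0.

Lemma Ftau_atan tau l (a := acoef tau) (b := bcoef tau) : pi / 4 < tau <= pi / 2 -> atan_range tau l ->
  Ftau_dom tau l /\
  Ftau tau l = (b * sin tau)^-1 * (atan ((l 0 0 + a) / b) + atan ((l 0 1 + a) / b) - atan_offset tau).
Proof.
move=> ht; have [b0 _] := coef_gt ht; have /andP[t0 t1] := ht; have pp := pi_gt0 R.
have n0 : (tau == 0) = false by rewrite gt_eqF//; lra.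
have n1 : (tau < pi / 4) = false by apply/negbTE; rewrite -leNgt ltW.
have n2 : (tau == pi / 4) = false by rewrite gt_eqF.
rewrite /Ftau /Ftau_dom /atan_offset n0 n1 n2 -/a -/b.
have [t2 r|t2 _] := ltP tau (pi / 2); last first.
  have tE : tau = pi / 2 by apply/eqP; rewrite eq_le t1 t2.
  have [aE bE] := coef_pihalf; rewrite /a /b tE aE bE sin_pihalf sum2 !addr0 !divr1 mulr1 invr1 mul1r subr0.
  by split.
have s0 : 0 < sin tau by apply: sin_tau_gt0; apply/andP; split; lra.
case: r => [E|[p0 p1]]; first by rewrite E ltxx in t2.
split; first by apply: ord2_ind; rewrite gt_eqF.
have mob i : 0 < l 0 i + a + b -> atan ((l 0 i + a - b) / (l 0 i + a + b)) = atan ((l 0 i + a) / b) - pi / 4.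
  move=> p; have p' : 0 < (l 0 i + a) / b + 1 by rewrite -(pmulr_rgt0 _ b0) mulrDr mulrC divfK ?gt_eqF// mulr1.
  rewrite -atan_mobius//; congr atan; field.
  by rewrite !gt_eqF.
rewrite sum2 !mob// sqrt_acoef//; field.
by rewrite !gt_eqF.
Qed.

End Coefficients.

(** * F_tau as a function of trace and determinant *)

Section TraceDetRepresentations.
Context {R : realType}.
Implicit Types (tau : R) (l : 'rV[R]_2).

Lemma sum_prod_gt0 (y z : R) : 0 < y + z -> 0 < y * z -> 0 < y /\ 0 < z.
Proof. by move=> h1 h2; split; nra. Qed.

(** Both lambda_i + m are positive as soon as their sum and product are, and this is an open
    condition on trace and determinant. *)
Lemma lower_bound_open (m : R) l0 : 0 < l0 0 0 + m -> 0 < l0 0 1 + m ->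
  exists2 eps : R, 0 < eps & forall l : 'rV[R]_2,
    `|l 0 0 + l 0 1 - (l0 0 0 + l0 0 1)| < eps -> `|l 0 0 * l 0 1 - l0 0 0 * l0 0 1| < eps ->
    0 < l 0 0 + m /\ 0 < l 0 1 + m.
Proof.
move=> p0 p1; have n0 := normr_ge0 m.
pose e0 := l0 0 0 + l0 0 1 + 2 * m; pose e1 := (l0 0 0 + m) * (l0 0 1 + m).
have e00 : 0 < e0 by rewrite /e0; lra.
have e10 : 0 < e1 by rewrite mulr_gt0.
exists (Num.min e0 (e1 / (1 + `|m|))); first by rewrite lt_min e00 divr_gt0//; lra.
move=> l; rewrite !lt_min => /andP[h0 h1] /andP[_ h2].
rewrite !ltr_pdivlMr in h1 h2; try lra.
apply: sum_prod_gt0; first by move: h0; rewrite ltr_norml /e0 => /andP[? ?]; lra.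
have : e1 - (l 0 0 + m) * (l 0 1 + m) = - (l 0 0 * l 0 1 - l0 0 0 * l0 0 1) - m * (l 0 0 + l 0 1 - (l0 0 0 + l0 0 1)) by rewrite /e1; ring.
move: (l 0 0 * l 0 1 - l0 0 0 * l0 0 1) (l 0 0 + l 0 1 - (l0 0 0 + l0 0 1)) h0 h1 h2 => d t h0 h1 h2 E.
have : - d - m * t <= `|d| + `|m| * `|t|.
  by apply: le_trans (ler_norm _) _; apply: le_trans (ler_normB _ _) _; rewrite normrN normrM.
have : `|d| + `|m| * `|t| < e1.
  have M0 : 0 < 1 + `|m| by lra.
  pose e2 := e1 / (1 + `|m|); have e2E : e1 = e2 + `|m| * e2 by rewrite /e2; field; rewrite gt_eqF.
  have t2 : `|t| < e2 by rewrite ltr_pdivlMr.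
  have d2 : `|d| < e2 by rewrite ltr_pdivlMr.
  by rewrite e2E; apply: ltr_leD => //; rewrite ler_wpM2l// ltW.
by move: E; move: (_ * (l 0 1 + m)) => U E h3 h4; lra.
Qed.

Lemma is_derive_affine (t0 t1 d0 d1 d2 m n : R) (U := fun h => n * (d0 + h * d1 + h ^+ 2 * d2) + m * (t0 + h * t1 + h ^+ 2 * 0)) (k : R) :
  is_derive (0 : R) (1 : R) (fun h => U h + k) (n * d1 + m * t1) /\ U 0 + k = n * d0 + m * t0 + k.
Proof.
split; last by rewrite /U; ring.
have := is_derive_quadratic (n * d0 + m * t0 + k) (n * d1 + m * t1) (n * d2).
by congr is_derive; apply/funext => h; rewrite /U; ring.
Qed.

Lemma trdet_rep_0 l : 0 < l 0 0 -> 0 < l 0 1 -> trdet_rep 0 (l 0 0 + l 0 1) (l 0 0 * l 0 1).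
Proof.
move=> p0 p1; have [||eps e0 he] := @lower_bound_open 0 l; rewrite ?addr0//.
exists (fun t d => 2^-1 * ln (1 * d + 0 * t + 0)), eps; split; first exact: e0.
  move=> l' t d ht hd; have [q0 q1] := he l' ht hd; rewrite !addr0 in q0 q1.
  by rewrite Ftau_0 -lnM ?posrE// mul1r mul0r !addr0.
move=> t1 d1 d2; have [dU U0] := is_derive_affine (l 0 0 + l 0 1) t1 (l 0 0 * l 0 1) d1 d2 0 1 0.
have dpos : 0 < l 0 0 * l 0 1 by rewrite mulr_gt0.
have := is_derive_outer (is_derive_linear 2^-1 _) (is_derive_ln_comp _ dU).
rewrite U0 sin0 cos0 => /(_ _) h.
have : 0 < 1 * (l 0 0 * l 0 1) + 0 * (l 0 0 + l 0 1) + 0 by lra.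
move=> /h; congr is_derive.
rewrite !(mul0r, add0r, addr0, mul1r, mulr1, expr0n) /=; field.
by rewrite !gt_eqF.
Qed.

(** The products of the lambda_i + m and of the lambda_i + M, for m = a - b and M = a + b, are
    affine in trace and determinant. From m M = 1 one gets (x + m)(x + M) = x^2 + 2 a x + 1, so det
    Q is sin^2 tau times both products. *)
Lemma trdet_rep_lt tau l : 0 < tau < pi / 4 ->
  0 < l 0 0 + (acoef tau - bcoef tau) -> 0 < l 0 1 + (acoef tau - bcoef tau) ->
  trdet_rep tau (l 0 0 + l 0 1) (l 0 0 * l 0 1).
Proof.
move=> ht p0 p1; have [a1 b2] := coef_lt ht.
have s0 : 0 < sin tau by apply: sin_tau_gt0; have pp := pi_gt0 R; move: ht => /andP[? ?]; apply/andP; split; lra.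
have cE := cos_acoef (lt0r_neq0 s0); have sE := sqrt_acoef s0.
have bp : 0 < bcoef tau.
  by rewrite lt0r sqrtr_ge0 andbT; apply/eqP => b0; move: b2; rewrite b0 expr0n /= => /eqP; rewrite eq_sym subr_eq0 => /eqP; nra.
have [eps e0 he] := lower_bound_open p0 p1.
pose K := Num.sqrt (acoef tau ^+ 2 + 1) / (2 * bcoef tau).
move: sE cE b2 bp p0 p1 he; set s := sin tau; set a := acoef tau; set b := bcoef tau => sE cE b2 bp p0 p1 he.
pose m := a - b; pose M := a + b.
exists (fun t d => K * (ln (1 * d + m * t + m ^+ 2) - ln (1 * d + M * t + M ^+ 2))), eps; split; first exact: e0.
  move=> l' t d htt hd; have [q0 q1] := he l' htt hd.
  have [r0 r1] : 0 < l' 0 0 + M /\ 0 < l' 0 1 + M by rewrite /M; split; lra.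
  have -> : 1 * d + m * t + m ^+ 2 = (l' 0 0 + m) * (l' 0 1 + m) by rewrite /d /t; ring.
  have -> : 1 * d + M * t + M ^+ 2 = (l' 0 0 + M) * (l' 0 1 + M) by rewrite /d /t; ring.
  rewrite Ftau_lt// -/a -/b -/K -!addrA -/m -/M !ln_div ?posrE// !lnM ?posrE//.
  by congr (_ * _); ring.
move=> t1 d1 d2; have [dU U0] := is_derive_affine (l 0 0 + l 0 1) t1 (l 0 0 * l 0 1) d1 d2 m 1 (m ^+ 2).
have [dW W0] := is_derive_affine (l 0 0 + l 0 1) t1 (l 0 0 * l 0 1) d1 d2 M 1 (M ^+ 2).
have UE : 1 * (l 0 0 * l 0 1) + m * (l 0 0 + l 0 1) + m ^+ 2 = (l 0 0 + m) * (l 0 1 + m) by ring.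
have WE : 1 * (l 0 0 * l 0 1) + M * (l 0 0 + l 0 1) + M ^+ 2 = (l 0 0 + M) * (l 0 1 + M) by ring.
have [r0 r1] : 0 < l 0 0 + M /\ 0 < l 0 1 + M by rewrite /M; split; lra.
have U1 : 0 < (l 0 0 + m) * (l 0 1 + m) by exact: mulr_gt0.
have W1 : 0 < (l 0 0 + M) * (l 0 1 + M) by exact: mulr_gt0.
rewrite UE in U0; rewrite WE in W0.
have := is_derive_outer (is_derive_linear K _) (is_deriveB (is_derive_ln_comp _ dU) (is_derive_ln_comp _ dW)).
rewrite U0 W0 => /(_ U1 W1); congr is_derive.
rewrite cE /K -/a -/b sE -/s !mul1r.
have ab : a ^+ 2 = 1 + b ^+ 2 by rewrite b2 addrC subrK.
have q : (s * (1 - l 0 0 * l 0 1)) ^+ 2 + s * (1 - l 0 0 * l 0 1) * (s * (l 0 0 + l 0 1) + 2 * (a * s)) * (l 0 0 + l 0 1)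
   + (s * (l 0 0 + l 0 1) + 2 * (a * s)) ^+ 2 * (l 0 0 * l 0 1) = s ^+ 2 * ((l 0 0 + m) * (l 0 1 + m)) * ((l 0 0 + M) * (l 0 1 + M)).
  have mM (x : R) : (x + m) * (x + M) = x ^+ 2 + 2 * a * x + 1.
    have -> : (x + m) * (x + M) = x ^+ 2 + 2 * a * x + (a ^+ 2 - b ^+ 2) by rewrite /m /M; ring.
    by rewrite ab addrK.
  have -> : s ^+ 2 * ((l 0 0 + m) * (l 0 1 + m)) * ((l 0 0 + M) * (l 0 1 + M)) = s ^+ 2 * (((l 0 0 + m) * (l 0 0 + M)) * ((l 0 1 + m) * (l 0 1 + M))) by ring.
  by rewrite !mM; ring.
rewrite q.
have num : (d1 + m * t1) * ((l 0 0 + M) * (l 0 1 + M)) - (d1 + M * t1) * ((l 0 0 + m) * (l 0 1 + m))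
   = 2 * b * ((1 - l 0 0 * l 0 1) * t1 + (l 0 0 + l 0 1 + 2 * a) * d1).
  have mM : m * M = 1 by rewrite /m /M -(addrK (b ^+ 2) 1) -ab; ring.
  have -> : (d1 + m * t1) * ((l 0 0 + M) * (l 0 1 + M)) - (d1 + M * t1) * ((l 0 0 + m) * (l 0 1 + m)) =
    (M - m) * ((m * M - l 0 0 * l 0 1) * t1 + (l 0 0 + l 0 1 + (M + m)) * d1) by ring.
  by rewrite mM /m /M; ring.
have -> : (d1 + m * t1) / ((l 0 0 + m) * (l 0 1 + m)) - (d1 + M * t1) / ((l 0 0 + M) * (l 0 1 + M))
  = 2 * b * ((1 - l 0 0 * l 0 1) * t1 + (l 0 0 + l 0 1 + 2 * a) * d1) / (((l 0 0 + m) * (l 0 1 + m)) * ((l 0 0 + M) * (l 0 1 + M))).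
  by rewrite -num; field; rewrite !gt_eqF.
by field; rewrite !gt_eqF.
Qed.

Lemma trdet_rep_pi4 l : 0 < l 0 0 + 1 -> 0 < l 0 1 + 1 -> trdet_rep (pi / 4) (l 0 0 + l 0 1) (l 0 0 * l 0 1).
Proof.
move=> p0 p1; have pp := pi_gt0 R.
have s0 : 0 < sin (pi / 4 : R) by apply: sin_tau_gt0; apply/andP; split; lra.
have cE := cos_acoef (lt0r_neq0 s0); rewrite (coef_eq erefl) mul1r in cE.
have [eps e0 he] := lower_bound_open p0 p1.
exists (fun t d => - Num.sqrt 2 * ((0 * d + 1 * t + 2) / (1 * d + 1 * t + 1))), eps; split; first exact: e0.
  move=> l' t d ht hd; have [q0 q1] := he l' ht hd.
  rewrite Ftau_pi4; congr (_ * _).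
  have -> : 1 * d + 1 * t + 1 = (l' 0 0 + 1) * (l' 0 1 + 1) by rewrite /d /t; ring.
  by rewrite /t; field; rewrite !gt_eqF// addrC.
move=> t1 d1 d2; have [dU U0] := is_derive_affine (l 0 0 + l 0 1) t1 (l 0 0 * l 0 1) d1 d2 1 0 2.
have [dW W0] := is_derive_affine (l 0 0 + l 0 1) t1 (l 0 0 * l 0 1) d1 d2 1 1 1.
have WE : 1 * (l 0 0 * l 0 1) + 1 * (l 0 0 + l 0 1) + 1 = (l 0 0 + 1) * (l 0 1 + 1) by ring.
have W1 : 0 < (l 0 0 + 1) * (l 0 1 + 1) by exact: mulr_gt0.
rewrite WE in W0.
have := is_derive_outer (is_derive_linear (- Num.sqrt 2) _) (is_derive_div _ dU dW).
rewrite U0 W0 => /(_ (lt0r_neq0 W1)); congr is_derive.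
have ss : sin (pi / 4 : R) = (Num.sqrt 2)^-1.
  have e := sqrt_acoef s0; rewrite (coef_eq erefl) expr1n (_ : 1 + 1 = 2 :> R) // in e.
  by rewrite e invrK.
rewrite cE ss; have r0 : 0 < Num.sqrt (2 : R) by rewrite sqrtr_gt0.
have rr : Num.sqrt (2 : R) ^+ 2 = 2 by rewrite sqr_sqrtr.
move: (Num.sqrt (2 : R)) r0 rr => r r0 rr.
have -> : (r^-1 * (1 - l 0 0 * l 0 1)) ^+ 2 + r^-1 * (1 - l 0 0 * l 0 1) * (r^-1 * (l 0 0 + l 0 1) + 2 * r^-1) * (l 0 0 + l 0 1)
   + (r^-1 * (l 0 0 + l 0 1) + 2 * r^-1) ^+ 2 * (l 0 0 * l 0 1) = r ^- 2 * ((l 0 0 + 1) * (l 0 1 + 1)) ^+ 2.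
  by field; rewrite gt_eqF.
by field; rewrite !gt_eqF.
Qed.

(** With y_i = (lambda_i + a)/b, both 1 - y_1 y_2 and y_1 + y_2 are affine in trace and determinant.
    From a^2 + b^2 = 1 one gets (x + a)^2 + b^2 = x^2 + 2 a x + 1, which identifies the denominator
    in the derivative of [arg2] with det Q up to a factor. *)
Lemma trdet_rep_gt tau l : pi / 4 < tau <= pi / 2 -> atan_range tau l -> trdet_rep tau (l 0 0 + l 0 1) (l 0 0 * l 0 1).
Proof.
move=> ht r; have [b0 ab] := coef_gt ht.
have s0 : 0 < sin tau by apply: sin_tau_gt0; have pp := pi_gt0 R; move: ht => /andP[? ?]; apply/andP; split; lra.
have cE := cos_acoef (lt0r_neq0 s0).
have [eps e0 he] : exists2 eps : R, 0 < eps & forall l' : 'rV[R]_2, `|l' 0 0 + l' 0 1 - (l 0 0 + l 0 1)| < eps ->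
    `|l' 0 0 * l' 0 1 - l 0 0 * l 0 1| < eps -> atan_range tau l'.
  case: r => [tE|[p0 p1]]; first by exists 1 => // l' _ _; left.
  rewrite -!addrA in p0 p1; have [eps e0 he] := lower_bound_open p0 p1.
  by exists eps => // l' h1 h2; right; rewrite -!addrA; exact: he.
have FE := fun l' r' => (@Ftau_atan R tau l' ht r').2.
move: (acoef tau) (bcoef tau) b0 ab cE FE => a b b0 ab cE FE.
pose X t d := (- b ^- 2) * d + (- a * b ^- 2) * t + (1 - (a / b) ^+ 2).
pose Y t d := 0 * d + b^-1 * t + 2 * (a / b).
have XE (l' : 'rV[R]_2) : X (l' 0 0 + l' 0 1) (l' 0 0 * l' 0 1) = 1 - (l' 0 0 + a) / b * ((l' 0 1 + a) / b) by rewrite /X; field; rewrite gt_eqF.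
have YE (l' : 'rV[R]_2) : Y (l' 0 0 + l' 0 1) (l' 0 0 * l' 0 1) = (l' 0 0 + a) / b + (l' 0 1 + a) / b by rewrite /Y; field; rewrite gt_eqF.
exists (fun t d => (b * sin tau)^-1 * (arg2 (X t d) (Y t d) - atan_offset tau)), eps; split; first exact: e0.
  move=> l' t d h1 h2; rewrite (FE l' (he l' h1 h2)) atan_addE /t /d XE YE.
  by [].
move=> t1 d1 d2.
have [dX X0] := is_derive_affine (l 0 0 + l 0 1) t1 (l 0 0 * l 0 1) d1 d2 (- a * b ^- 2) (- b ^- 2) (1 - (a / b) ^+ 2).
have [dY Y0] := is_derive_affine (l 0 0 + l 0 1) t1 (l 0 0 * l 0 1) d1 d2 b^-1 0 (2 * (a / b)).
have [h1 h2] := arg2_pos ((l 0 0 + a) / b) ((l 0 1 + a) / b).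
rewrite -/(X (l 0 0 + l 0 1) _) XE in X0; rewrite -/(Y (l 0 0 + l 0 1) _) YE in Y0.
have dA := is_derive_arg2 _ _ dX dY.
rewrite X0 Y0 in dA.
have := is_derive_outer (is_derive_linear (b * sin tau)^-1 _) (is_deriveB (dA h1 h2) (is_derive_cst (atan_offset tau) _ _)).
congr is_derive.
have -> : (1 - (l 0 0 + a) / b * ((l 0 1 + a) / b)) * (1 - (l 0 0 + a) / b * ((l 0 1 + a) / b)) +
   ((l 0 0 + a) / b + (l 0 1 + a) / b) * ((l 0 0 + a) / b + (l 0 1 + a) / b) =
   ((l 0 0 + a) ^+ 2 + b ^+ 2) * ((l 0 1 + a) ^+ 2 + b ^+ 2) / b ^+ 4 by field; rewrite gt_eqF.
have bE (x : R) : (x + a) ^+ 2 + b ^+ 2 = x ^+ 2 + 2 * a * x + 1.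
  have -> : (x + a) ^+ 2 + b ^+ 2 = x ^+ 2 + 2 * a * x + (a ^+ 2 + b ^+ 2) by ring.
  by rewrite ab.
rewrite cE.
have -> : (sin tau * (1 - l 0 0 * l 0 1)) ^+ 2 + sin tau * (1 - l 0 0 * l 0 1) * (sin tau * (l 0 0 + l 0 1) + 2 * (a * sin tau)) * (l 0 0 + l 0 1)
   + (sin tau * (l 0 0 + l 0 1) + 2 * (a * sin tau)) ^+ 2 * (l 0 0 * l 0 1) =
   sin tau ^+ 2 * (((l 0 0 + a) ^+ 2 + b ^+ 2) * ((l 0 1 + a) ^+ 2 + b ^+ 2)).
  by rewrite !bE; ring.
have pos (x : R) : 0 < (x + a) ^+ 2 + b ^+ 2 by rewrite ltr_wpDl ?sqr_ge0// exprn_gt0.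
have := pos (l 0 0); have := pos (l 0 1).
set u0 := _ ^+ 2 + _; set u1 := _ ^+ 2 + _ => u00 u10.
have num : (1 - (l 0 0 + a) / b * ((l 0 1 + a) / b)) * (0 * d1 + b^-1 * t1) -
    ((l 0 0 + a) / b + (l 0 1 + a) / b) * (- b ^- 2 * d1 + - a * b ^- 2 * t1) =
    ((1 - l 0 0 * l 0 1) * t1 + (l 0 0 + l 0 1 + 2 * a) * d1) / b ^+ 3.
  have -> : 1 - l 0 0 * l 0 1 = b ^+ 2 + a ^+ 2 - l 0 0 * l 0 1 by rewrite (addrC (b ^+ 2)) ab.
  by field; rewrite gt_eqF.
rewrite num; field.
by rewrite !gt_eqF.
Qed.

End TraceDetRepresentations.

(** * The cases tau <= pi/4 *)

Section Cases.
Context {R : realType}.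
Implicit Types (tau : R) (l : 'rV[R]_2) (u : 'cV[R]_2 -> R).

Lemma mxgt_eigenvalues (M : 'M[R]_2) (m : R) : mxgt M m%:M -> m < eigenvalues M 0 0 /\ m < eigenvalues M 0 1.
Proof.
move=> pM; have DT : (M - m%:M)^T = M - m%:M := pM.1.
have MT : M^T = M by move: DT; rewrite linearB /= tr_scalar_mx => /addIr.
have [eT eD] := eigenvalues_tr_det MT.
move: pM; rewrite /mxgt (sym2_of DT) !mxE /= !mulr1n mulr0n !subr0 => /posdef_sym2[p0 p1].
set l := eigenvalues M in eT eD *.
have s0 : 0 < (l 0 0 - m) + (l 0 1 - m).
  have -> : (l 0 0 - m) + (l 0 1 - m) = (M 0 0 - m) + (M 1 1 - m) by rewrite addrACA eT addrACA.
  apply: addr_gt0 => //; rewrite -(pmulr_rgt0 _ p0); apply: le_lt_trans p1; exact: sqr_ge0.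
have s1 : 0 < (l 0 0 - m) * (l 0 1 - m).
  have -> : (l 0 0 - m) * (l 0 1 - m) = l 0 0 * l 0 1 - m * (l 0 0 + l 0 1) + m ^+ 2 by ring.
  by rewrite eT eD; lra.
by have := sum_prod_gt0 s0 s1; rewrite !subr_gt0.
Qed.

Lemma exterior_point (Omega : set 'cV[R]_2) : bounded_domain Omega -> exists x, (~` closure Omega) x.
Proof.
move=> [_ _ _ /bounded_exterior[R0 R0p h]]; exists (ofC (circ (R0 + 1) 0)); apply: h.
by rewrite enorm_circ; lra.
Qed.

Lemma case_0 C0 (Omega : set 'cV[R]_2) u : bounded_domain Omega -> Ck 2 (~` closure Omega) u ->
  (forall x, (~` closure Omega) x -> Ftau_eq 0 (hessian u x) C0) -> quadratic_asymptotics 0 C0 u.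
Proof.
move=> bO hu heq.
have lnE (y z : R) : 0 < y -> 0 < z -> 2^-1 * (ln y + ln z) = C0 <-> y * z = expR C0 ^+ 2.
  move=> y0 z0; rewrite -lnM ?posrE//; have yz : 0 < y * z by exact: mulr_gt0.
  rewrite -expRM_natl; split=> [<-|->]; last by rewrite expRK; field.
  by rewrite mulrA divff ?mul1r ?lnK ?posrE.
apply: (@monge_ampere_case R 0 C0 Omega u 1 (expR C0) 0) => //.
- by rewrite mulr1.
- exact: expR_gt0.
- by rewrite sin0 mul0r mulr0.
- move=> x /heq[dom]; rewrite Ftau_0; move: (eigenvalues _) dom => l dom.
  have p0 := dom 0; have p1 := dom 1; rewrite !eqxx in p0 p1.
  by move=> /(lnE _ _ p0 p1) pr /=; rewrite !addr0 !mul1r.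
- move=> l; rewrite !addr0 !mul1r => pr p0 p1 _; split.
  + by apply: ord2_ind; rewrite eqxx.
  + by rewrite Ftau_0; apply/lnE.
  + by rewrite sin0 cos0 mul0r add0r mulr1.
  + exact: trdet_rep_0.
Qed.

Lemma case_lt tau C0 (Omega : set 'cV[R]_2) u : 0 < tau < pi / 4 -> bounded_domain Omega -> Ck 2 (~` closure Omega) u ->
  (forall x, (~` closure Omega) x -> Ftau_eq tau (hessian u x) C0) ->
  (forall x, (~` closure Omega) x -> mxgt (hessian u x) (- acoef tau + bcoef tau)%:M) ->
  quadratic_asymptotics tau C0 u.
Proof.
move=> ht bO hu heq hgt; have [a1 b2] := coef_lt ht; have pp := pi_gt0 R.
have s0 : 0 < sin tau by apply: sin_tau_gt0; move: ht => /andP[? ?]; apply/andP; split; lra.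
have t0 : (tau == 0) = false by rewrite gt_eqF//; case/andP: ht.
have t1 : tau < pi / 4 by case/andP: ht.
have cE := cos_acoef (lt0r_neq0 s0); have sE := sqrt_acoef s0.
have bp : 0 < bcoef tau.
  by rewrite lt0r sqrtr_ge0 andbT; apply/eqP => b0; move: b2; rewrite b0 expr0n /= => /eqP; rewrite eq_sym subr_eq0 => /eqP; nra.
pose K := expR (2 * bcoef tau * sin tau * C0).
have K0 : 0 < K by exact: expR_gt0.
have FE l : 0 < l 0 0 + acoef tau - bcoef tau -> 0 < l 0 1 + acoef tau - bcoef tau ->
    Ftau tau l = C0 <-> (l 0 0 + acoef tau - bcoef tau) * (l 0 1 + acoef tau - bcoef tau) =
      K * ((l 0 0 + acoef tau + bcoef tau) * (l 0 1 + acoef tau + bcoef tau)).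
  move=> p0 p1; rewrite Ftau_lt// sE /K.
  have q0 : 0 < l 0 0 + acoef tau + bcoef tau by lra.
  have q1 : 0 < l 0 1 + acoef tau + bcoef tau by lra.
  move: (l 0 0 + acoef tau - bcoef tau) (l 0 1 + acoef tau - bcoef tau) (l 0 0 + acoef tau + bcoef tau) (l 0 1 + acoef tau + bcoef tau) p0 p1 q0 q1.
  move: (bcoef tau) bp (sin tau) s0 => b bp s s0 x0 x1 y0 y1 p0 p1 q0 q1.
  rewrite -lnM ?posrE ?divr_gt0//.
  have -> : x0 / y0 * (x1 / y1) = x0 * x1 / (y0 * y1) by rewrite invfM mulrACA.
  have r0 : 0 < x0 * x1 / (y0 * y1) by rewrite divr_gt0 ?mulr_gt0.
  have y01 : y0 * y1 != 0 by rewrite mulf_neq0// gt_eqF.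
  split=> [<-|->].
    have -> : 2 * b * s * (s^-1 / (2 * b) * ln (x0 * x1 / (y0 * y1))) = ln (x0 * x1 / (y0 * y1)) by field; rewrite !gt_eqF.
    by rewrite lnK ?posrE// divfK.
  by rewrite mulfK// expRK; field; rewrite !gt_eqF.
have lower x : (~` closure Omega) x -> 0 < eigenvalues (hessian u x) 0 0 + acoef tau - bcoef tau /\
    0 < eigenvalues (hessian u x) 0 1 + acoef tau - bcoef tau.
  by move=> /hgt /mxgt_eigenvalues[? ?]; split; lra.
have rep := @trdet_rep_lt R tau.
have domE l : 0 < l 0 0 + acoef tau - bcoef tau -> 0 < l 0 1 + acoef tau - bcoef tau -> Ftau_dom tau l.
  by move=> p0 p1; apply: ord2_ind; rewrite t0 t1 divr_gt0//; lra.
move: (acoef tau) (bcoef tau) a1 b2 cE bp @K K0 FE lower rep domE => a b a1 b2 cE bp K K0 FE lower rep domE.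
have K1 : K < 1.
  have [x hx] := exterior_point bO; have [p0 p1] := lower x hx; have [_ /FE e] := heq x hx.
  move: (eigenvalues _) p0 p1 e => l p0 p1 /(_ p0 p1) e.
  rewrite -(ltr_pM2r (_ : 0 < (l 0 0 + a + b) * (l 0 1 + a + b))); last by apply: mulr_gt0; lra.
  by rewrite -e mul1r; apply: ltr_pM => //; [exact: ltW|exact: ltW|lra|lra].
(* The equation says that the product of the lambda_i + a - b is K times that of the lambda_i + a +
   b, with K < 1. This m is the shift for which it becomes (lambda_1 + a - m)(lambda_2 + a - m) =
   m^2 - b^2. *)
pose m := b * (1 + K) / (1 - K).
have mK : m - b = K * (m + b) by rewrite /m; field; rewrite gt_eqF// subr_gt0.
have mb : b < m.
  have : 0 < K * (m + b).
    by rewrite mulr_gt0// addr_gt0// /m divr_gt0 ?subr_gt0// mulr_gt0// addr_gt0.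
  by rewrite -mK subr_gt0.
have s2 : 0 < m ^+ 2 - b ^+ 2 by rewrite !expr2; nra.
apply: (@monge_ampere_case R tau C0 Omega u 1 (Num.sqrt (m ^+ 2 - b ^+ 2)) (a - m)) => //.
- by rewrite mulr1.
- by rewrite sqrtr_gt0.
- rewrite (sqr_sqrtr (ltW s2)) cE b2; ring.
- move=> x hx; have [p0 p1] := lower x hx; have [_ /FE e] := heq x hx.
  move: (eigenvalues _) p0 p1 e => l p0 p1 /(_ p0 p1) e /=; rewrite (sqr_sqrtr (ltW s2)) !mul1r.
  have e1 : (l 0 0 + (a - m)) * (l 0 1 + (a - m)) = m ^+ 2 - b ^+ 2.
    have K1' : 1 - K != 0 by rewrite gt_eqF// subr_gt0.
    apply: (mulfI K1').
    have h1 : (1 - K) * m = b * (1 + K) by rewrite /m; field.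
    have -> : (1 - K) * ((l 0 0 + (a - m)) * (l 0 1 + (a - m))) =
      ((l 0 0 + a - b) * (l 0 1 + a - b) - K * ((l 0 0 + a + b) * (l 0 1 + a + b)))
      + (b * (1 + K) - (1 - K) * m) * (l 0 0 + l 0 1 + 2 * a) + (1 - K) * (m ^+ 2 - b ^+ 2) by ring.
    by rewrite e h1 !subrr mul0r !add0r.
  (* The product m^2 - b^2 exceeds (m - b)^2. Two negative factors would both lie in (-(m - b), 0)
     and have a smaller product, so both factors are positive. *)
  split=> //.
    move: e1 p0 p1 mb bp; clear.
    have -> : l 0 0 + (a - m) = (l 0 0 + a - b) - (m - b) by ring.
    have -> : l 0 1 + (a - m) = (l 0 1 + a - b) - (m - b) by ring.
    by move: (l 0 0 + a - b) (l 0 1 + a - b) => y z; rewrite !expr2 => ? ? ? ? ?; nra.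
  move: e1 p0 p1 mb bp; clear.
  have -> : l 0 0 + (a - m) = (l 0 0 + a - b) - (m - b) by ring.
  have -> : l 0 1 + (a - m) = (l 0 1 + a - b) - (m - b) by ring.
  by move: (l 0 0 + a - b) (l 0 1 + a - b) => y z; rewrite !expr2 => ? ? ? ? ?; nra.
- move=> l; rewrite (sqr_sqrtr (ltW s2)) !mul1r => e p0 p1 _.
  have q0 : 0 < l 0 0 + a - b by lra.
  have q1 : 0 < l 0 1 + a - b by lra.
  split.
  + exact: domE.
  + apply/(FE l q0 q1).
    have -> : (l 0 0 + a - b) * (l 0 1 + a - b) = (l 0 0 + (a - m)) * (l 0 1 + (a - m)) - (m ^+ 2 - b ^+ 2) + (m - b) * (l 0 0 + l 0 1 + 2 * a) by ring.
    have -> : (l 0 0 + a + b) * (l 0 1 + a + b) = (l 0 0 + (a - m)) * (l 0 1 + (a - m)) - (m ^+ 2 - b ^+ 2) + (m + b) * (l 0 0 + l 0 1 + 2 * a) by ring.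
    by rewrite e subrr !add0r mulrA mK.
  + have -> : sin tau * (l 0 0 + l 0 1) + 2 * cos tau = sin tau * (l 0 0 + l 0 1 + 2 * a) by rewrite cE; ring.
    have Y0 : 0 < l 0 0 + l 0 1 + 2 * a by move: p0 p1 mb bp; clear; lra.
    exact: mulr_gt0.
  + by apply: rep => //; lra.
Qed.

(** The sum of the 1/(1 + lambda_i) is a constant k > 0; completing the product gives (1 + lambda_1
    - 1/k)(1 + lambda_2 - 1/k) = 1/k^2. *)
Lemma case_pi4 C0 (Omega : set 'cV[R]_2) u : bounded_domain Omega -> Ck 2 (~` closure Omega) u ->
  (forall x, (~` closure Omega) x -> Ftau_eq (pi / 4) (hessian u x) C0) ->
  (forall x, (~` closure Omega) x -> mxgt (hessian u x) (- 1%:M)) ->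
  quadratic_asymptotics (pi / 4) C0 u.
Proof.
move=> bO hu heq hgt; have pp := pi_gt0 R.
have s0 : 0 < sin (pi / 4 : R) by apply: sin_tau_gt0; apply/andP; split; lra.
have cE := cos_acoef (lt0r_neq0 s0); rewrite (coef_eq erefl) mul1r in cE.
have r0 : 0 < Num.sqrt (2 : R) by rewrite sqrtr_gt0.
pose k := - C0 / Num.sqrt 2.
have FE l : 0 < 1 + l 0 0 -> 0 < 1 + l 0 1 -> Ftau (pi / 4) l = C0 <-> (1 + l 0 0) + (1 + l 0 1) = k * ((1 + l 0 0) * (1 + l 0 1)).
  rewrite Ftau_pi4 /k; move: (1 + l 0 0) (1 + l 0 1) => y z y0 z0; split=> [<-|e].
    by field; rewrite !gt_eqF.
  have -> : y^-1 + z^-1 = (y + z) / (y * z) by field; rewrite !gt_eqF.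
  by rewrite e; field; rewrite !gt_eqF.
have lower x : (~` closure Omega) x -> 0 < 1 + eigenvalues (hessian u x) 0 0 /\ 0 < 1 + eigenvalues (hessian u x) 0 1.
  move=> /hgt; rewrite (_ : - 1%:M = (- 1)%:M :> 'M[R]_2); last by rewrite raddfN.
  by move=> /mxgt_eigenvalues[? ?]; split; lra.
have k0 : 0 < k.
  have [x hx] := exterior_point bO; have [p0 p1] := lower x hx; have [_ /FE e] := heq x hx.
  move: (eigenvalues _) p0 p1 e => l p0 p1 /(_ p0 p1) e.
  have : 0 < k * ((1 + l 0 0) * (1 + l 0 1)) by rewrite -e addr_gt0.
  by rewrite pmulr_lgt0// mulr_gt0.
move: k k0 FE => k k0 FE.
have q0 : 0 < k^-1 by rewrite invr_gt0.
apply: (@monge_ampere_case R (pi / 4) C0 Omega u 1 k^-1 (1 - k^-1)) => //.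
- by rewrite mulr1.
- by rewrite cE; ring.
- move=> x hx; have [p0 p1] := lower x hx; have [_ /FE e] := heq x hx.
  move: (eigenvalues _) p0 p1 e => l p0 p1 /(_ p0 p1) e /=; rewrite !mul1r.
  rewrite !(addrA (l _ _)) ![l _ _ + 1]addrC; move: (1 + l 0 0) (1 + l 0 1) p0 p1 e => y z y0 z0 e.
  have e' : y * z = k^-1 * (y + z) by rewrite e mulrA mulVf ?mul1r// gt_eqF.
  have pr : (y - k^-1) * (z - k^-1) = k^-1 ^+ 2.
    have -> : (y - k^-1) * (z - k^-1) = y * z - k^-1 * (y + z) + k^-1 ^+ 2 by ring.
    by rewrite e' subrr add0r.
  by split=> //; move: (k^-1) q0 pr e' => q q0 pr e'; clear -y0 z0 e' q0; nra.
- move=> l; rewrite !mul1r !(addrA (l _ _)) ![l _ _ + 1]addrC => e p0 p1 _.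
  have y0 : 0 < 1 + l 0 0 by lra.
  have z0 : 0 < 1 + l 0 1 by lra.
  split.
  + have n0 : (pi / 4 == 0 :> R) = false by rewrite gt_eqF// divr_gt0.
    by apply: ord2_ind; rewrite n0 ltxx eqxx; apply/eqP => h; rewrite h in y0 z0; lra.
  + apply/(FE l y0 z0).
    have -> : (1 + l 0 0) * (1 + l 0 1) = (1 + l 0 0 - k^-1) * (1 + l 0 1 - k^-1) - k^-1 ^+ 2 + k^-1 * ((1 + l 0 0) + (1 + l 0 1)) by ring.
    by rewrite e subrr add0r mulrA mulfV ?mul1r// gt_eqF.
  + rewrite cE; have -> : sin (pi / 4) * (l 0 0 + l 0 1) + 2 * sin (pi / 4) = sin (pi / 4) * (l 0 0 + l 0 1 + 2) by ring.
    by apply: mulr_gt0 => //; lra.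
  + by apply: trdet_rep_pi4; lra.
Qed.

End Cases.

(** * The case tau > pi/4 *)

Section ArctanCase.
Context {R : realType}.
Implicit Types (tau : R) (l : 'rV[R]_2) (u : 'cV[R]_2 -> R).

Lemma angle_unique (t C : R) : - pi < t < pi -> - pi < C < pi -> cos t = cos C -> sin t = sin C -> t = C.
Proof.
move=> /andP[t0 t1] /andP[C0 C1] hc hs; pose h := (t - C) / 2.
have hE : t - C = h *+ 2 by rewrite mulr2n /h; field.
have h1 : cos (h *+ 2) = 1 by rewrite -hE cosD cosN sinN hc hs mulrN opprK -!expr2 cos2Dsin2.
have sh : sin h = 0.
  apply/eqP; rewrite -sqrf_eq0; apply/eqP; move: h1; rewrite cos_mulr2n mulr2n.
  by have := cos2Dsin2 h; lra.
have hb : - pi < h /\ h < pi by rewrite /h; split; lra.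
have [hp|hn|h0] := ltgtP h 0.
- have : 0 < sin (- h) by apply: sin_gt0_pi; apply/andP; split; lra.
  by rewrite sinN sh oppr0 ltxx.
- have : 0 < sin h by apply: sin_gt0_pi; apply/andP; split; lra.
  by rewrite sh ltxx.
by move: hE; rewrite h0 mul0rn; lra.
Qed.

(** Arithmetic-geometric mean: two positive numbers with product 1 + q^2 have sum at least 2 sqrt(1
    + q^2), more than 2q. *)
Lemma sum_gt_cot (sg k z1 z2 : R) : sg * sg = 1 -> z1 * z2 = 1 + k ^+ 2 -> 0 < sg * z1 -> 0 < sg * z2 ->
  0 < sg * (z1 + z2 - 2 * k).
Proof.
move=> sg1 e p1 p2.
have e' : (sg * z1) * (sg * z2) = 1 + (sg * k) ^+ 2.
  have -> : (sg * z1) * (sg * z2) = (sg * sg) * (z1 * z2) by ring.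
  have -> : (sg * k) ^+ 2 = (sg * sg) * k ^+ 2 by ring.
  by rewrite sg1 e !mul1r.
rewrite !(mulrDr, mulrN) mulrCA; move: (sg * z1) (sg * z2) (sg * k) p1 p2 e'; clear => w1 w2 q p1 p2; rewrite expr2 => e.
rewrite ltNge; apply/negP => h; have := sqr_ge0 (w1 - w2); rewrite expr2; nra.
Qed.

Lemma atan_add_eq (sg y1 y2 C : R) (k := cos C / sin C) : - pi < C < pi -> sg * sg = 1 -> 0 < sg * sin C ->
  atan y1 + atan y2 = C <-> [/\ (y1 + k) * (y2 + k) = 1 + k ^+ 2, 0 < sg * (y1 + k) & 0 < sg * (y2 + k)].
Proof.
move=> hC sg1 sp; have sC : sin C != 0 by apply/eqP => h; move: sp; rewrite h mulr0 ltxx.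
have s2 : 0 < sin C ^+ 2 by rewrite exprn_even_gt0.
have [c c0 [cX cY]] := atan_add_polar y1 y2; have tb := atan_add_bound y1 y2.
have kE : cos C = k * sin C by rewrite /k divfK.
split=> [e|[pr p1 p2]].
  rewrite e in cX cY.
  have E : 1 - y1 * y2 = k * (y1 + y2).
    by apply: (mulfI (lt0r_neq0 c0)); rewrite cX kE -cY; ring.
  have pr : (y1 + k) * (y2 + k) = 1 + k ^+ 2.
    have -> : (y1 + k) * (y2 + k) = 1 - (1 - y1 * y2) + k * (y1 + y2) + k ^+ 2 by ring.
    by rewrite E subrK.
  have pos y y' : c * (1 - y * y') = cos C -> c * (y + y') = sin C -> 0 < sg * (y + k).
    move=> e1 e2; rewrite -(pmulr_rgt0 _ s2).
    have -> : sin C ^+ 2 * (sg * (y + k)) = (sg * sin C) * (c * (1 + y ^+ 2)).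
      have -> : sin C ^+ 2 * (sg * (y + k)) = (sg * sin C) * (y * sin C + k * sin C) by ring.
      by rewrite -kE -e1 -e2; ring.
    by rewrite mulr_gt0// mulr_gt0// ltr_wpDr// sqr_ge0.
  split=> //; first exact: pos cX cY.
  by apply: (pos y2 y1); rewrite ?[y2 * y1]mulrC // [y2 + y1]addrC.
have E : 1 - y1 * y2 = k * (y1 + y2).
  have := pr; have -> : (y1 + k) * (y2 + k) = y1 * y2 + k * (y1 + y2) + k ^+ 2 by ring.
  by lra.
have Yp : 0 < sg * (y1 + y2).
  have -> : y1 + y2 = y1 + k + (y2 + k) - 2 * k by ring.
  exact: sum_gt_cot.
pose la := c * (y1 + y2) / sin C.
have e1 : sin (atan y1 + atan y2) = la * sin C by rewrite /la divfK// cY.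
have e2 : cos (atan y1 + atan y2) = la * cos C.
  by rewrite -cX E kE /la; field.
have la0 : 0 < la.
  rewrite -(pmulr_rgt0 _ s2).
  have -> : sin C ^+ 2 * la = c * ((sg * (y1 + y2)) * (sg * sin C)).
    have -> : (sg * (y1 + y2)) * (sg * sin C) = (sg * sg) * ((y1 + y2) * sin C) by ring.
    by rewrite sg1 /la; field.
  by rewrite mulr_gt0// mulr_gt0.
clearbody la.
have la1 : la = 1.
  have := cos2Dsin2 (atan y1 + atan y2); rewrite e1 e2 !exprMn -mulrDr cos2Dsin2 mulr1 => h.
  have /eqP : (la - 1) * (la + 1) = 0.
    have -> : (la - 1) * (la + 1) = la ^+ 2 - 1 by ring.
    by rewrite h subrr.
  by rewrite mulf_eq0 [la + 1 == 0]gt_eqF ?addr_gt0// orbF subr_eq0 => /eqP.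
by apply: angle_unique; rewrite ?e1 ?e2 ?la1 ?mul1r.
Qed.

(* Only tau < pi/2 uses the bound on the trace: there (y1 + 1) (y2 + 1) =
   2 + (1 - k) (y1 + y2) has to stay positive in the limit. *)
Lemma limit_range (sg k y1 y2 z1 z2 : R) : sg * sg = 1 ->
  (y1 + k) * (y2 + k) = 1 + k ^+ 2 -> 0 < sg * (y1 + k) -> 0 < sg * (y2 + k) ->
  (z1 + k) * (z2 + k) = 1 + k ^+ 2 -> 0 < sg * (z1 + k) -> 0 < sg * (z2 + k) -> 0 < z1 + 1 -> 0 < z2 + 1 ->
  (sg * (1 - k) < 0 -> sg * (y1 + y2) < 2 / - (sg * (1 - k))) ->
  0 < y1 + 1 /\ 0 < y2 + 1.
Proof.
move=> sg1 ey py1 py2 ez pz1 pz2 z1p z2p trb.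
have Yp : 0 < sg * (y1 + y2).
  have -> : y1 + y2 = y1 + k + (y2 + k) - 2 * k by ring.
  exact: sum_gt_cot.
have prod : 0 < (y1 + 1) * (y2 + 1).
  have -> : (y1 + 1) * (y2 + 1) = 2 + (sg * sg) * ((1 - k) * (y1 + y2)).
    have -> : (y1 + 1) * (y2 + 1) = (y1 + k) * (y2 + k) - k ^+ 2 + 1 + (1 - k) * (y1 + y2) by ring.
    by rewrite ey sg1; ring.
  have -> : (sg * sg) * ((1 - k) * (y1 + y2)) = (sg * (1 - k)) * (sg * (y1 + y2)) by ring.
  have [h|h] := leP 0 (sg * (1 - k)).
    by have := mulr_ge0 h (ltW Yp); lra.
  have h' : 0 < - (sg * (1 - k)) by rewrite oppr_gt0.
  have := trb h; rewrite ltr_pdivlMr// => h2.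
  by move: h2; rewrite mulrN mulrC; lra.
apply: sum_prod_gt0 => //.
rewrite ltNge; apply/negP => sneg.
have [n1 n2] : y1 + 1 < 0 /\ y2 + 1 < 0 by move: prod sneg; clear; move: (y1 + 1) (y2 + 1) => a b ? ?; split; nra.
have : sg = 1 \/ sg = -1.
  have /eqP : (sg - 1) * (sg + 1) = 0.
    have -> : (sg - 1) * (sg + 1) = sg * sg - 1 by ring.
    by rewrite sg1 subrr.
  by rewrite mulf_eq0 subr_eq0 addr_eq0 => /orP[] /eqP; [left|right].
move=> [] sgE; rewrite sgE in py1 py2 pz1 pz2.
  rewrite !mul1r in py1 py2 pz1 pz2; move: ey py1 py2 n1 n2; clear; rewrite expr2 => *; nra.
rewrite !mulN1r in py1 py2 pz1 pz2.
have k0 : k < 0 by move: ez pz1 pz2 z1p z2p; clear; rewrite expr2 => *; nra.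
move: ey n1 n2 k0; clear.
have -> : (y1 + k) * (y2 + k) = (1 - k - (y1 + 1)) * (1 - k - (y2 + 1)) by ring.
move: (y1 + 1) (y2 + 1) => a b; rewrite expr2 => *; nra.
Qed.

(** In the variables y_i = (lambda_i + a)/b the equation is atan y_1 + atan y_2 = C. If C = 0 then
    y_1 = -y_2, the harmonic case; otherwise [atan_add_eq] gives the determinant form with c = a + b
    k and s = b sqrt(1 + k^2). *)
Lemma case_gt tau C0 (Omega : set 'cV[R]_2) u : pi / 4 < tau <= pi / 2 -> bounded_domain Omega -> Ck 2 (~` closure Omega) u ->
  (forall x, (~` closure Omega) x -> Ftau_eq tau (hessian u x) C0) ->
  (forall x, (~` closure Omega) x -> atan_range tau (eigenvalues (hessian u x))) ->
  (tau = pi / 2 -> C0 != 0) ->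
  quadratic_asymptotics tau C0 u.
Proof.
move=> ht bO hu heq rng hC; have [b0 ab] := coef_gt ht; have pp := pi_gt0 R.
have s0 : 0 < sin tau by apply: sin_tau_gt0; move: ht => /andP[? ?]; apply/andP; split; lra.
have cE := cos_acoef (lt0r_neq0 s0).
pose C := bcoef tau * sin tau * C0 + atan_offset tau.
have FE l : atan_range tau l -> Ftau tau l = C0 <-> atan ((l 0 0 + acoef tau) / bcoef tau) + atan ((l 0 1 + acoef tau) / bcoef tau) = C.
  move=> r; have [_ ->] := Ftau_atan ht r; rewrite /C.
  move: (atan _ + atan _) (atan_offset tau) => A o; have bs : bcoef tau * sin tau != 0 by rewrite mulf_neq0// gt_eqF.
  split=> [<-|->]; first by rewrite mulrA divff// mul1r subrK.
  by rewrite addrK mulrA mulVf// mul1r.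
have dom l (r : atan_range tau l) := (Ftau_atan ht r).1.
have rep l := @trdet_rep_gt R tau l ht.
have C00 : C = 0 -> tau < pi / 2.
  move=> Cz; case/andP: (ht) => _; rewrite le_eqVlt => /predU1P[tE|//]; exfalso.
  have [_ bE] := coef_pihalf (R := R).
  by have := hC tE; move: Cz; rewrite /C /atan_offset tE ltxx bE sin_pihalf !mul1r addr0 => ->; rewrite eqxx.
have rngE l : atan_range tau l <-> (tau = pi / 2 \/ (0 < (l 0 0 + acoef tau) / bcoef tau + 1 /\ 0 < (l 0 1 + acoef tau) / bcoef tau + 1)).
  rewrite /atan_range.
  have e (y : R) : (0 < y / bcoef tau + 1) = (0 < y + bcoef tau).
    by rewrite -(pmulr_rgt0 (y / bcoef tau + 1) b0) mulrDr mulr1 mulrC divfK// gt_eqF.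
  by rewrite !e.
clear hC; move: C C00 FE => C C00 FE.
have Cb : - pi < C < pi.
  have [x hx] := exterior_point bO; have [_ /(FE _ (rng x hx)) <-] := heq x hx; exact: atan_add_bound.
move: (acoef tau) (bcoef tau) b0 ab cE FE rngE => a b b0 ab cE FE rngE.
have bn : b != 0 by rewrite gt_eqF.
have [Cz|Cn] := eqVneq C 0.
  have t2 := C00 Cz.
  apply: (@harmonic_case R tau C0 Omega u a b) => //.
    move=> x hx; have [_ /(FE _ (rng x hx)) e] := heq x hx; have /rngE := rng x hx.
    move: (eigenvalues _) e => l e [tE|[p0 p1]] /=; first by rewrite tE ltxx in t2.
    have yE : (l 0 0 + a) / b = - ((l 0 1 + a) / b).
      by rewrite -[LHS]atanK -[RHS]atanK atanN; congr tan; apply/eqP; rewrite -addr_eq0 e Cz.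
    have E0 : l 0 0 + a = - (l 0 1 + a) by rewrite -[LHS](divfK bn) yE -{2}[l 0 1 + a](divfK bn) mulNr.
    split; first by move: E0; lra.
    rewrite E0; rewrite yE in p0; move: p0 p1.
    rewrite -{3 4}[l 0 1 + a](divfK bn); move: ((l 0 1 + a) / b) => y p0 p1.
    have b2 : 0 < b * b by exact: mulr_gt0.
    have : y ^+ 2 < 1 by rewrite expr2; nra.
    rewrite -subr_gt0 -(pmulr_rgt0 _ b2) => h; rewrite -subr_gt0.
    by have -> : - (y * b) * (y * b) - - b ^+ 2 = b * b * (1 - y ^+ 2) by ring.
  move=> l lT h.
  have yE : (l 0 1 + a) / b = - ((l 0 0 + a) / b).
    by rewrite -mulNr; congr (_ / _); lra.
  have r : atan_range tau l.
    apply/rngE; right; rewrite yE.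
    have E1 : l 0 1 + a = - (l 0 0 + a) by lra.
    rewrite E1 in h; move: h; rewrite -{1 2}[l 0 0 + a](divfK bn).
    move: ((l 0 0 + a) / b) => y h.
    have b2 : 0 < b * b by exact: mulr_gt0.
    have : y ^+ 2 < 1.
      rewrite -subr_gt0 -(pmulr_rgt0 _ b2).
      have -> : b * b * (1 - y ^+ 2) = y * b * - (y * b) - - b ^+ 2 by ring.
      by rewrite subr_gt0.
    by rewrite expr2 => y2; split; nra.
  by split; [exact: dom|apply/(FE l r); rewrite yE atanN subrr Cz|exact: rep].
pose sg : R := if 0 < C then 1 else -1.
have sg1 : sg * sg = 1 by rewrite /sg; case: ifP; rewrite ?mulrNN mulr1.
have sp : 0 < sg * sin C.
  rewrite /sg; have [Cs|Cs] := ltP 0 C; first by rewrite mul1r sin_gt0_pi// Cs; case/andP: Cb.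
  rewrite mulN1r -sinN sin_gt0_pi// oppr_gt0 lt_neqAle Cn Cs /=; case/andP: Cb => *; lra.
have sumE y1 y2 := @atan_add_eq sg y1 y2 C Cb sg1 sp.
move: (cos C / sin C) sumE => k sumE.
have k2 : 0 < 1 + k ^+ 2 by rewrite ltr_wpDr// sqr_ge0.
have yk (y : R) : y + (a + b * k) = b * ((y + a) / b + k) by field.
have sgb (y : R) : (0 < sg * (y + (a + b * k))) = (0 < sg * ((y + a) / b + k)).
  by rewrite yk mulrCA pmulr_rgt0.
have prE (l : 'rV[R]_2) : (l 0 0 + (a + b * k)) * (l 0 1 + (a + b * k)) = (b * Num.sqrt (1 + k ^+ 2)) ^+ 2 <->
    ((l 0 0 + a) / b + k) * ((l 0 1 + a) / b + k) = 1 + k ^+ 2.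
  rewrite !yk mulrACA -expr2 exprMn (sqr_sqrtr (ltW k2)).
  by split=> [/(mulfI (expf_neq0 2 bn))//|->].
apply: (@monge_ampere_case R tau C0 Omega u sg (b * Num.sqrt (1 + k ^+ 2)) (a + b * k)) => //.
- by rewrite mulr_gt0// sqrtr_gt0.
- rewrite exprMn (sqr_sqrtr (ltW k2)) cE.
  have -> : 1 - b ^+ 2 * (1 + k ^+ 2) + (a + b * k) ^+ 2 = (1 - (a ^+ 2 + b ^+ 2)) + 2 * a * (a + b * k) by ring.
  by rewrite ab; ring.
- move=> x hx; have [_ /(FE _ (rng x hx)) /sumE[e p0 p1]] := heq x hx.
  move: (eigenvalues _) e p0 p1 => l e p0 p1 /=.
  by rewrite !sgb; split=> //; apply/prE.
- move=> l /prE e; rewrite !sgb => p0 p1 trb.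
  have Yp : 0 < sg * ((l 0 0 + a) / b + (l 0 1 + a) / b).
    have -> : (l 0 0 + a) / b + (l 0 1 + a) / b = (l 0 0 + a) / b + k + ((l 0 1 + a) / b + k) - 2 * k by ring.
    exact: sum_gt_cot.
  have r : atan_range tau l.
    have [tE|tn] := eqVneq tau (pi / 2); first by left.
    apply/rngE; right.
    have zr x : (~` closure Omega) x -> let z := eigenvalues (hessian u x) in
      [/\ ((z 0 0 + a) / b + k) * ((z 0 1 + a) / b + k) = 1 + k ^+ 2, 0 < sg * ((z 0 0 + a) / b + k), 0 < sg * ((z 0 1 + a) / b + k),
        0 < (z 0 0 + a) / b + 1 & 0 < (z 0 1 + a) / b + 1].
      move=> hx; have [_ /(FE _ (rng x hx)) /sumE[e' q0 q1]] := heq x hx.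
      by have /rngE[tE|[? ?]] := rng x hx; [rewrite tE eqxx in tn|split].
    have [x0 hx0] := exterior_point bO; have [ez pz1 pz2 z1 z2] := zr x0 hx0.
    apply: (limit_range sg1 e p0 p1 ez pz1 pz2 z1 z2) => kn.
    (* Positivity of (y_1 + 1)(y_2 + 1) = 2 + (1 - k)(y_1 + y_2) at each exterior point, when sg (1
       - k) < 0, is a strict upper bound on sg (y_1 + y_2). [B] is that bound rewritten for sg
       (lambda_1 + lambda_2), so that it passes to the limit. *)
    pose B := b * (2 / - (sg * (1 - k))) - 2 * (sg * a).
    have : sg * (l 0 0 + l 0 1) < B.
      apply: trb => x hx; have [ey py1 py2 y1 y2] := zr x hx.
      move: (eigenvalues _) ey py1 py2 y1 y2 => z ey py1 py2 y1 y2 /=.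
      rewrite /B ltrBrDr.
      have -> : sg * (z 0 0 + z 0 1) + 2 * (sg * a) = b * (sg * ((z 0 0 + a) / b + (z 0 1 + a) / b)) by field.
      rewrite ltr_pM2l// ltr_pdivlMr ?oppr_gt0//.
      have := mulr_gt0 y1 y2.
      move: ((z 0 0 + a) / b) ((z 0 1 + a) / b) ey => y y' ey.
      have -> : (y + 1) * (y' + 1) = (y + k) * (y' + k) - k ^+ 2 + 1 + (1 - k) * (y + y') by ring.
      rewrite ey; have -> : sg * (y + y') * - (sg * (1 - k)) = - ((sg * sg) * ((1 - k) * (y + y'))) by ring.
      by rewrite sg1 mul1r; lra.
    rewrite /B ltrBrDr.
    have -> : sg * (l 0 0 + l 0 1) + 2 * (sg * a) = b * (sg * ((l 0 0 + a) / b + (l 0 1 + a) / b)) by field.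
    by rewrite ltr_pM2l.
  split.
  + exact: dom.
  + by apply/(FE l r); apply/sumE.
  + have -> : sg * (sin tau * (l 0 0 + l 0 1) + 2 * cos tau) = sin tau * b * (sg * ((l 0 0 + a) / b + (l 0 1 + a) / b)).
      by rewrite cE; field.
    by rewrite mulr_gt0// mulr_gt0.
  + exact: rep.
Qed.

End ArctanCase.

(** * The theorem, by ranges of tau *)

Unset Implicit Arguments.
Theorem theorem1p1 (R : realType) (tau C0 : R) (Omega : set 'cV[R]_2)
    (u : 'cV[R]_2 -> R)
    (htau : 0 <= tau <= pi / 2)
    (hOmega : bounded_domain Omega)
    (hu : Ck 2 (~` closure Omega) u)
    (heq : forall x, (~` closure Omega) x -> Ftau_eq tau (hessian u x) C0)
    (h0 : tau = 0 ->
      forall x, (~` closure Omega) x -> mxgt (hessian u x) 0)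
    (h1 : 0 < tau < pi / 4 ->
      forall x, (~` closure Omega) x ->
        mxgt (hessian u x) (- acoef tau + bcoef tau)%:M)
    (h2 : tau = pi / 4 ->
      forall x, (~` closure Omega) x -> mxgt (hessian u x) (- 1%:M))
    (h3 : pi / 4 < tau < pi / 2 ->
      forall x, (~` closure Omega) x ->
        mxgt (hessian u x) (- (acoef tau + bcoef tau))%:M)
    (h4 : tau = pi / 2 -> C0 != 0) :
  exists (gamma d d1 d2 : R) (beta : 'cV[R]_2) (A : 'M[R]_2),
    [/\ A^T = A,
        Ftau_eq tau A C0 &
        let Q := Qmx tau A in
        [/\ Q \in unitmx,
            is_Ftau_gradient tau A (invmx Q) &
            exists theta : 'cV[R]_2 -> R,
              is_angle Q theta /\
              forall k : nat,
                bigO_k k (-2) 1 (fun x =>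
                  u x - (2^-1 * qform A x + dot beta x + gamma)
                  - d * ln (qform Q x)
                  - (Num.sqrt (qform Q x))^-1 *
                    (d1 * cos (theta x) + d2 * sin (theta x)))]].
Proof.
rewrite -/(quadratic_asymptotics tau C0 u).
have pp := pi_gt0 R; have /andP[t0 t1] := htau.
have [tz|tn] := eqVneq tau 0; first by rewrite tz in heq *; exact: case_0 hOmega hu heq.
have tp : 0 < tau by rewrite lt0r tn.
have [tl|tg|tE] := ltgtP tau (pi / 4).
- have ht : 0 < tau < pi / 4 by rewrite tp tl.
  exact: case_lt ht hOmega hu heq (h1 ht).
- have ht : pi / 4 < tau <= pi / 2 by rewrite tg t1.
  apply: (case_gt ht hOmega hu heq) h4 => x hx.
  have [tE|tn2] := eqVneq tau (pi / 2); first by left.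
  have lt : pi / 4 < tau < pi / 2 by rewrite tg lt_neqAle tn2 t1.
  by right; have [p0 p1] := mxgt_eigenvalues (h3 lt x hx); split; lra.
- by have h := h2 tE; rewrite tE in heq *; exact: case_pi4 hOmega hu heq h.
Qed.
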